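(* Assume the Riemann Hypothesis. Then for every complex number $s$ with $\Re(s)>\tfrac12$ and $s\neq 1$, $$\zeta(s)=\lim_{x\to\infty} e^{\operatorname{E}_1[(s-1)\log x]}\prod_{p\le x}\left(1-\frac{1}{p^s}\right)^{-1},$$ where $x$ is a real variable, the product runs over all primes $p\le x$, $\zeta$ is the (analytically continued) Riemann zeta function, and $\operatorname{E}_1$ is the exponential integral.
   Context: The Riemann Hypothesis (RH) is the assertion that every zero of $\zeta$ in the strip $0<\Re(s)<1$ satisfies $\Re(s)=\tfrac12$. The exponential integral is defined by $$\operatorname{E}_1(z)=\int_z^\infty \frac{e^{-t}}{t}\,dt,\qquad |\arg(z)|<\pi,$$ for complex $z$, with a branch cut on $(-\infty,0]$ (the path of integration avoids the cut and tends to $+\infty$). It has the expansion $$\operatorname{E}_1(z)=-\gamma-\log z-\sum_{k=1}^\infty \frac{(-z)^k}{k\cdot k!},$$ with $\log$ the principal branch and $\gamma$ Euler's constant. For real $s\in(\tfrac12,1)$ the argument $(s-1)\log x$ (with $x>1$) is a negative real number, lying on the cut. The boundary values of $\operatorname{E}_1$ from the two sides of the cut differ by $2\pi i$, so $e^{\operatorname{E}_1(z)}$ is unambiguous there; it is understood as the common boundary value, i.e. for all $z\neq 0$, $$e^{\operatorname{E}_1(z)}=\frac{e^{-\gamma}}{z}\exp\left(-\sum_{k=1}^\infty \frac{(-z)^k}{k\cdot k!}\right).$$ *)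

(* Defs.v *)
(* Concrete classical reals of the standard library, with Coquelicot. *)
From Stdlib Require Import Reals ZArith Znumtheory List.
From Coquelicot Require Import Coquelicot.

Open Scope R_scope.

Definition Cexp (z : C) : C := (exp (Re z) * cos (Im z), exp (Re z) * sin (Im z)).

Definition nat_cpow (n : nat) (s : C) : C := Cexp (s * RtoC (ln (INR n)))%C.

(* The defining properties of the analytically continued zeta function; by the
   identity theorem they determine [zeta] away from the pole s = 1, where its
   value is unconstrained. *)
Definition is_riemann_zeta (zeta : C -> C) : Prop :=
  (forall s : C, 1 < Re s ->
     is_series (V := C_NormedModule)
       (fun n : nat => / nat_cpow (S n) s)%C (zeta s)) /\
  (forall s : C, s <> RtoC 1 ->
     ex_derive (K := C_AbsRing) (V := C_NormedModule) zeta s).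

Definition riemann_hypothesis (zeta : C -> C) : Prop :=
  forall s : C, 0 < Re s < 1 -> zeta s = RtoC 0 -> Re s = 1 / 2.

Definition E1_cut (z : C) : Prop := Im z = 0 /\ Re z <= 0.

Lemma E1_cut_dec (z : C) : {E1_cut z} + {~ E1_cut z}.
Proof.
unfold E1_cut.
destruct (Req_dec_T (Im z) 0) as [Hi | Hi].
- destruct (Rle_dec (Re z) 0) as [Hr | Hr].
  + left; split; assumption.
  + right; intros [_ H]; exact (Hr H).
- right; intros [H _]; exact (Hi H).
Defined.

(* The integral of exp(-t)/t from z to infinity along the horizontal ray
   t = z + u, u >= 0, which avoids the cut exactly when z does. Meaningful only
   for z off the cut. *)
Definition E1 (z : C) : C :=
  RInt_gen (V := C_R_CompleteNormedModule)
    (fun u : R => Cexp (- (z + RtoC u)) / (z + RtoC u))%C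
    (at_point 0) (Rbar_locally p_infty).

(* exp(E1 z), extended to the negative real axis by the common boundary value
   of exp(E1 w) as w tends to z from off the cut. The value at z = 0 is
   meaningless. *)
Definition exp_E1 (z : C) : C :=
  if E1_cut_dec z then
    iota (T := C_CompleteNormedModule) (fun v : C =>
      filterlim (fun w : C => Cexp (E1 w))
        (within (fun w : C => ~ E1_cut w) (locally (T := C_UniformSpace) z))
        (locally (T := C_UniformSpace) v))
  else Cexp (E1 z).

(* For x < 0 the integer part is negative, [Z.to_nat] sends it to 0, and the
   list is empty, as it should be. *)
Definition primes_upto (x : R) : list nat :=
  filter (fun p : nat => if prime_dec (Z.of_nat p) then true else false)
    (seq 0 (S (Z.to_nat (Int_part x)))).

Definition euler_product (s : C) (x : R) : C :=
  fold_right Cmult (RtoC 1)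
    (map (fun p : nat => / (1 - / nat_cpow p s))%C (primes_upto x)).

(* Main.v *)
Require Import Defs.
From Stdlib Require Import Reals ZArith Znumtheory List Lra Lia Psatz Classical ClassicalEpsilon.
From Coquelicot Require Import Coquelicot.

(** Write [H s = (s - 1) zeta s], which is holomorphic for [Re s > 0] with [H 1 = 1]. The
    factor [(s - 1) e^(E1((s - 1) log x))] is, up to a nonzero constant,
    [exp (- J_x s)], where [J_x s] is an entire function of [s] that is a primitive in [x] of
    [x^(-s) / log x] ([regularised_factor], [rder_Jint]): it is the factor that compensates
    the sum of [p^(-s)] over [p <= x] if the primes have density [1 / log x]. The theorem
    therefore says that this compensated sum converges as soon as [Re s > 1/2], together
    with the determination of its limit.

    Convergence is a matter of prime counting. Summation by parts ([Ysum]) turns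
    [sum of p^(-s), minus J_x s] into a boundary term and a series whose terms contain
    [theta N - N], the error in the prime number theorem. Under the Riemann hypothesis this
    error is [O(N^b)] for every [b > 1/2] ([theta_bound]), so that the series converges
    locally uniformly for [Re s > 1/2] and the boundary term tends to [0]. The Euler factors
    differ from [exp (p^(-s))] by [O(p^(-2s))], and the corresponding product [Gprod] converges
    in the same half-plane unconditionally. So [(s - 1) e^(E1((s - 1) log N))] times the
    product over the primes up to [N] has a limit [Llim] holomorphic for [Re s > 1/2]. For
    [Re s > 1] the exponential integral tends to [0] and the Euler product converges to [zeta],
    so that [Llim = H] there ([Llim_right]); by the identity theorem [Llim = H] for
    [Re s > 1/2] ([Llim_eq]). Passing from integers to real [x] moves [J_x s] by only
    [O(x^(- Re s))] ([Jint_floor]).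

    For [theta_bound], [H] has no zero with [Re s > 1/2]: to the left of the line [Re s = 1]
    by the Riemann hypothesis, on it by the inequality [3 + 4 cos x + cos 2x >= 0]
    ([Hzeta_neq_0_line]), to the right of it by the Euler product. So [log |H|] is harmonic
    there. It is bounded above by [O(log T)] up to height [T] ([Hzeta_bound]) and bounded
    below on the line [Re s = 2]; the gradient estimate for nonnegative harmonic functions
    propagates the lower bound to the left and gives [H' / H = O(log T)] on [Re s >= a] for
    every [a > 1/2] ([Efun_bound]). Perron's formula represents [theta N] by an integral of
    [- zeta' / zeta], freed of the contribution of prime powers, along [Re s = 2] up to a
    height of order [N^3] ([perron_theta]); the pole at [1] contributes [N], and the rest of
    the integral, moved to [Re s = a], is [O(N^a (log N)^2)].

    The complex analysis that this needs lives on rectangles: Goursat's theorem gives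
    primitives ([primitive_exists]), primitives give the mean value property over circles
    ([mean_value_primitive]), and this gives Cauchy's formula for the derivative,
    holomorphy of the derivative ([hol_cder]), Morera's criterion, holomorphy of uniform
    limits and the identity theorem. *)

Open Scope R_scope.

(** * Calculus of complex-valued functions *)

Ltac Ceq := apply injective_projections; simpl.

Lemma Cmod_le_Re_Im (z : C) : Cmod z <= Rabs (Re z) + Rabs (Im z).
Proof.
assert (E : z = (RtoC (Re z) + Ci * RtoC (Im z))%C) by (destruct z; Ceq; ring).
rewrite E at 1.
eapply Rle_trans; [apply Cmod_triangle|].
rewrite Cmod_mult, Cmod_Ci, !Cmod_R; lra.
Qed.

Lemma im_le_Cmod (z : C) : Rabs (Im z) <= Cmod z.
Proof.
eapply Rle_trans; [|apply Rmax_Cmod]; apply Rmax_r.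
Qed.

Lemma Cmod_minus_sym (z w : C) : Cmod (z - w) = Cmod (w - z).
Proof. rewrite <- Cmod_opp; f_equal; ring. Qed.

Lemma Cmod_triangle_minus (z w : C) : Cmod (z - w) <= Cmod z + Cmod w.
Proof. eapply Rle_trans; [apply Cmod_triangle|]; rewrite Cmod_opp; lra. Qed.

Lemma Cmod_triangle_rev (z w : C) : Cmod z - Cmod w <= Cmod (z - w).
Proof.
pose proof (Cmod_triangle (z - w) w) as H.
replace (z - w + w)%C with z in H by ring; lra.
Qed.

Definition ccont (f : R -> C) (t : R) : Prop :=
  continuous (fun u => Re (f u)) t /\ continuous (fun u => Im (f u)) t.

Definition rder (f : R -> C) (t : R) (l : C) : Prop :=
  is_derive (fun u => Re (f u)) t (Re l) /\ is_derive (fun u => Im (f u)) t (Im l).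

Lemma rder_ccont (f : R -> C) (t : R) (l : C) : rder f t l -> ccont f t.
Proof.
intros [H1 H2]; split; apply (ex_derive_continuous (V := R_NormedModule)); eexists; eassumption.
Qed.

Lemma ccont_const (c : C) (t : R) : ccont (fun _ => c) t.
Proof. split; apply continuous_const. Qed.

Lemma ccont_plus (f g : R -> C) (t : R) :
  ccont f t -> ccont g t -> ccont (fun u => f u + g u)%C t.
Proof.
intros [F1 F2] [G1 G2]; split; simpl.
- apply (continuous_plus (fun u => Re (f u)) (fun u => Re (g u))); assumption.
- apply (continuous_plus (fun u => Im (f u)) (fun u => Im (g u))); assumption.
Qed.

Lemma ccont_opp (f : R -> C) (t : R) : ccont f t -> ccont (fun u => - f u)%C t.
Proof.
intros [F1 F2]; split; simpl.
- apply (continuous_opp (fun u => Re (f u))); assumption.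
- apply (continuous_opp (fun u => Im (f u))); assumption.
Qed.

Lemma ccont_minus (f g : R -> C) (t : R) :
  ccont f t -> ccont g t -> ccont (fun u => f u - g u)%C t.
Proof. intros F G; apply ccont_plus; [|apply ccont_opp]; assumption. Qed.

Lemma ccont_mult (f g : R -> C) (t : R) :
  ccont f t -> ccont g t -> ccont (fun u => f u * g u)%C t.
Proof.
intros [F1 F2] [G1 G2]; split; simpl.
- apply (continuous_minus (fun u => Re (f u) * Re (g u)) (fun u => Im (f u) * Im (g u)));
  apply (continuous_mult (K := R_AbsRing)); assumption.
- apply (continuous_plus (fun u => Re (f u) * Im (g u)) (fun u => Im (f u) * Re (g u)));
  apply (continuous_mult (K := R_AbsRing)); assumption.
Qed.

Lemma ccont_RtoC (f : R -> R) (t : R) : continuous f t -> ccont (fun u => RtoC (f u)) t.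
Proof. intros F; split; simpl; [assumption | apply continuous_const]. Qed.

Lemma ccont_Cmod (f : R -> C) (t : R) : ccont f t -> continuous (fun u => Cmod (f u)) t.
Proof.
intros [F1 F2]; unfold Cmod.
apply continuous_comp.
2: apply continuous_sqrt.
apply (continuous_plus (fun u => Re (f u) ^ 2) (fun u => Im (f u) ^ 2)); simpl;
repeat (apply (continuous_mult (K := R_AbsRing)); try assumption; try apply continuous_const).
Qed.

Lemma rder_const (c : C) (t : R) : rder (fun _ => c) t 0.
Proof. split; simpl; apply (is_derive_const (V := R_NormedModule)). Qed.

Lemma rder_plus (f g : R -> C) (t : R) (a b : C) :
  rder f t a -> rder g t b -> rder (fun u => f u + g u)%C t (a + b)%C.
Proof.
intros [F1 F2] [G1 G2]; split; simpl.
- apply (is_derive_plus (fun u => Re (f u)) (fun u => Re (g u))); assumption.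
- apply (is_derive_plus (fun u => Im (f u)) (fun u => Im (g u))); assumption.
Qed.

Lemma rder_mult (f g : R -> C) (t : R) (a b : C) :
  rder f t a -> rder g t b -> rder (fun u => f u * g u)%C t (a * g t + f t * b)%C.
Proof.
intros [F1 F2] [G1 G2]; split; simpl.
- evar_last.
  + apply (is_derive_minus (fun u => Re (f u) * Re (g u)) (fun u => Im (f u) * Im (g u)));
    apply (is_derive_mult (K := R_AbsRing)); try eassumption; intros; apply Rmult_comm.
  + unfold minus, plus, opp, mult, Re, Im; simpl; ring.
- evar_last.
  + apply (is_derive_plus (fun u => Re (f u) * Im (g u)) (fun u => Im (f u) * Re (g u)));
    apply (is_derive_mult (K := R_AbsRing)); try eassumption; intros; apply Rmult_comm.
  + unfold minus, plus, opp, mult, Re, Im; simpl; ring.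
Qed.

Lemma rder_RtoC (f : R -> R) (t : R) (l : R) :
  is_derive f t l -> rder (fun u => RtoC (f u)) t l.
Proof. intros F; split; simpl; [assumption | apply (is_derive_const (V := R_NormedModule))]. Qed.

Lemma rder_ext (f g : R -> C) (t : R) (l : C) :
  (forall u, f u = g u) -> rder f t l -> rder g t l.
Proof.
intros E [H1 H2]; split.
- eapply is_derive_ext; [|exact H1]; intros u; simpl; now rewrite E.
- eapply is_derive_ext; [|exact H2]; intros u; simpl; now rewrite E.
Qed.

(** ** Integrals over a real interval *)

Definition cint (f : R -> C) (a b : R) : C :=
  (RInt (fun t => Re (f t)) a b, RInt (fun t => Im (f t)) a b).

Definition cex (f : R -> C) (a b : R) : Prop :=
  ex_RInt (fun t => Re (f t)) a b /\ ex_RInt (fun t => Im (f t)) a b.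

Lemma cex_cont (f : R -> C) (a b : R) :
  (forall t, Rmin a b <= t <= Rmax a b -> ccont f t) -> cex f a b.
Proof.
intros H; split; apply (ex_RInt_continuous (V := R_CompleteNormedModule));
intros z Hz; apply H; assumption.
Qed.

Lemma cex_cont_le (f : R -> C) (a b : R) : a <= b ->
  (forall t, a <= t <= b -> ccont f t) -> cex f a b.
Proof.
intros Hab H; apply cex_cont; rewrite Rmin_left, Rmax_right by assumption; assumption.
Qed.

Lemma cint_ext (f g : R -> C) (a b : R) :
  (forall t, Rmin a b < t < Rmax a b -> f t = g t) -> cint f a b = cint g a b.
Proof.
intros H; unfold cint; f_equal; apply RInt_ext; intros t Ht; now rewrite H.
Qed.

Lemma cex_plus (f g : R -> C) (a b : R) :
  cex f a b -> cex g a b -> cex (fun t => f t + g t)%C a b.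
Proof.
intros [F1 F2] [G1 G2]; split; simpl.
- apply (ex_RInt_plus (fun u => Re (f u)) (fun u => Re (g u))); assumption.
- apply (ex_RInt_plus (fun u => Im (f u)) (fun u => Im (g u))); assumption.
Qed.

Lemma cint_plus (f g : R -> C) (a b : R) :
  cex f a b -> cex g a b -> cint (fun t => f t + g t)%C a b = (cint f a b + cint g a b)%C.
Proof.
intros [F1 F2] [G1 G2]; Ceq.
- apply (RInt_plus (fun u => Re (f u)) (fun u => Re (g u))); assumption.
- apply (RInt_plus (fun u => Im (f u)) (fun u => Im (g u))); assumption.
Qed.

Lemma cex_scal (c : C) (f : R -> C) (a b : R) :
  cex f a b -> cex (fun t => c * f t)%C a b.
Proof.
intros [F1 F2]; split; simpl.
- apply (ex_RInt_minus (fun u => Re c * Re (f u)) (fun u => Im c * Im (f u)));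
  apply (ex_RInt_scal (V := R_NormedModule)); assumption.
- apply (ex_RInt_plus (fun u => Re c * Im (f u)) (fun u => Im c * Re (f u)));
  apply (ex_RInt_scal (V := R_NormedModule)); assumption.
Qed.

Lemma cint_scal (c : C) (f : R -> C) (a b : R) :
  cex f a b -> cint (fun t => c * f t)%C a b = (c * cint f a b)%C.
Proof.
intros [F1 F2]; Ceq.
- rewrite (RInt_minus (fun u => Re c * Re (f u)) (fun u => Im c * Im (f u)));
  try (apply (ex_RInt_scal (V := R_NormedModule)); assumption).
  rewrite !(RInt_scal (V := R_CompleteNormedModule)) by assumption; reflexivity.
- rewrite (RInt_plus (fun u => Re c * Im (f u)) (fun u => Im c * Re (f u)));
  try (apply (ex_RInt_scal (V := R_NormedModule)); assumption).
  rewrite !(RInt_scal (V := R_CompleteNormedModule)) by assumption; reflexivity.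
Qed.

Lemma cex_opp (f : R -> C) (a b : R) : cex f a b -> cex (fun t => - f t)%C a b.
Proof.
intros [F1 F2]; split; simpl.
- apply (ex_RInt_opp (fun u => Re (f u))); assumption.
- apply (ex_RInt_opp (fun u => Im (f u))); assumption.
Qed.

Lemma cint_opp (f : R -> C) (a b : R) :
  cex f a b -> cint (fun t => - f t)%C a b = (- cint f a b)%C.
Proof.
intros [F1 F2]; Ceq.
- apply (RInt_opp (fun u => Re (f u))); assumption.
- apply (RInt_opp (fun u => Im (f u))); assumption.
Qed.

Lemma cex_minus (f g : R -> C) (a b : R) :
  cex f a b -> cex g a b -> cex (fun t => f t - g t)%C a b.
Proof. intros F G; apply cex_plus; [|apply cex_opp]; assumption. Qed.

Lemma cint_minus (f g : R -> C) (a b : R) :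
  cex f a b -> cex g a b -> cint (fun t => f t - g t)%C a b = (cint f a b - cint g a b)%C.
Proof.
intros F G; unfold Cminus; rewrite cint_plus, cint_opp; auto using cex_opp.
Qed.

Lemma cint_Chasles (f : R -> C) (a b c : R) :
  cex f a b -> cex f b c -> (cint f a b + cint f b c)%C = cint f a c.
Proof.
intros [F1 F2] [G1 G2]; Ceq.
- apply (RInt_Chasles (fun u => Re (f u))); assumption.
- apply (RInt_Chasles (fun u => Im (f u))); assumption.
Qed.

Lemma cint_point (f : R -> C) (a : R) : cint f a a = 0.
Proof. unfold cint; rewrite !RInt_point; reflexivity. Qed.

Lemma cint_swap (f : R -> C) (a b : R) : cex f a b -> cint f b a = (- cint f a b)%C.
Proof.
intros [F1 F2]; Ceq.
- rewrite <- (opp_RInt_swap (fun u => Re (f u))) by assumption; reflexivity.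
- rewrite <- (opp_RInt_swap (fun u => Im (f u))) by assumption; reflexivity.
Qed.

Lemma cint_const (c : C) (a b : R) : cint (fun _ => c) a b = (RtoC (b - a) * c)%C.
Proof.
unfold cint; rewrite !RInt_const; Ceq; unfold scal, Re, Im; simpl; unfold mult; simpl; ring.
Qed.

Lemma cint_FTC (F f : R -> C) (a b : R) :
  (forall t, Rmin a b <= t <= Rmax a b -> rder F t (f t)) ->
  (forall t, Rmin a b <= t <= Rmax a b -> ccont f t) ->
  cint f a b = (F b - F a)%C.
Proof.
intros H1 H2; Ceq; apply is_RInt_unique.
- apply (is_RInt_derive (fun u => Re (F u)) (fun u => Re (f u)));
  intros t Ht; [apply H1 | apply H2]; assumption.
- apply (is_RInt_derive (fun u => Im (F u)) (fun u => Im (f u)));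
  intros t Ht; [apply H1 | apply H2]; assumption.
Qed.

(** Testing against the conjugate of the integral itself reduces the bound to real
    integrals. *)
Lemma cint_bound (f : R -> C) (g : R -> R) (a b : R) : a <= b ->
  cex f a b -> ex_RInt g a b -> (forall t, a <= t <= b -> Cmod (f t) <= g t) ->
  Cmod (cint f a b) <= RInt g a b.
Proof.
intros Hab Hf Hg H.
set (I := cint f a b).
destruct (Req_dec (Cmod I) 0) as [E | E].
- rewrite E; rewrite <- (Rmult_0_r (b - a)).
  replace ((b - a) * 0) with (RInt (fun _ => 0) a b) by (rewrite RInt_const; reflexivity).
  apply RInt_le; try assumption; [apply ex_RInt_const|].
  intros t Ht; eapply Rle_trans; [apply Cmod_ge_0 | apply H; lra].
- assert (P : 0 < Cmod I) by (pose proof (Cmod_ge_0 I); lra).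
  apply Rmult_le_reg_l with (Cmod I); [assumption|].
  replace (Cmod I * Cmod I) with (Re (Cconj I * I)%C)
    by (rewrite <- (Rmult_1_r (Cmod I * _)); replace (Cmod I * Cmod I * 1) with (Cmod I ^ 2) by ring;
        rewrite Cmod2_alt; simpl; unfold Re, Im; ring).
  unfold I at 2; rewrite <- cint_scal by assumption.
  unfold cint, Re at 1, fst.
  change (Cmod I * RInt g a b) with (scal (V := R_NormedModule) (Cmod I) (RInt g a b)).
  rewrite <- (RInt_scal (V := R_CompleteNormedModule)) by assumption.
  apply RInt_le; try assumption.
  + apply (cex_scal (Cconj I) f a b Hf).
  + apply (ex_RInt_scal (V := R_NormedModule)); assumption.
  + intros t Ht.
    eapply Rle_trans; [apply Rle_abs|].
    eapply Rle_trans; [apply re_le_Cmod|].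
    rewrite Cmod_mult, Cmod_conj.
    apply Rmult_le_compat_l; [lra | apply H; lra].
Qed.

Lemma cint_bound_const (f : R -> C) (M a b : R) : a <= b ->
  cex f a b -> (forall t, a <= t <= b -> Cmod (f t) <= M) ->
  Cmod (cint f a b) <= M * (b - a).
Proof.
intros Hab Hf H.
replace (M * (b - a)) with (RInt (fun _ => M) a b).
- apply cint_bound; try assumption; apply ex_RInt_const.
- rewrite RInt_const; unfold scal; simpl; unfold mult; simpl; ring.
Qed.

Lemma cint_bound_abs (f : R -> C) (M a b : R) :
  (forall t, Rmin a b <= t <= Rmax a b -> ccont f t) ->
  (forall t, Rmin a b <= t <= Rmax a b -> Cmod (f t) <= M) ->
  Cmod (cint f a b) <= M * Rabs (b - a).
Proof.
intros Hc H; destruct (Rle_dec a b) as [h | h].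
- rewrite Rmin_left, Rmax_right in Hc, H by lra; rewrite Rabs_right by lra.
  apply cint_bound_const; try assumption; apply cex_cont_le; assumption.
- rewrite Rmin_right, Rmax_left in Hc, H by lra; rewrite Rabs_left by lra.
  assert (E : cex f b a) by (apply cex_cont_le; [lra | assumption]).
  rewrite (cint_swap f b a) by assumption; rewrite Cmod_opp; replace (- (b - a)) with (a - b) by ring.
  apply cint_bound_const; try lra; try assumption; apply cex_cont_le; try lra; assumption.
Qed.

(** ** Complex derivatives *)

Definition is_cderiv (f : C -> C) (z l : C) : Prop :=
  forall eps, 0 < eps -> exists d, 0 < d /\
    forall w, Cmod (w - z) < d -> Cmod (f w - f z - l * (w - z)) <= eps * Cmod (w - z).

Definition ccontz (f : C -> C) (z : C) : Prop :=
  forall eps, 0 < eps -> exists d, 0 < d /\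
    forall w, Cmod (w - z) < d -> Cmod (f w - f z) < eps.

Definition hol (f : C -> C) (z : C) : Prop := exists l, is_cderiv f z l.

(** A total derivative: it is the derivative wherever there is one, which spares
    later statements a differentiability proof as an argument. *)
Definition cder (f : C -> C) (z : C) : C := epsilon (inhabits (RtoC 0)) (is_cderiv f z).

Lemma cder_correct (f : C -> C) (z : C) : hol f z -> is_cderiv f z (cder f z).
Proof. intros H; apply (epsilon_spec (inhabits (RtoC 0)) (is_cderiv f z) H). Qed.

Lemma is_cderiv_unique (f : C -> C) (z a b : C) : is_cderiv f z a -> is_cderiv f z b -> a = b.
Proof.
intros Ha Hb.
destruct (Req_dec (Cmod (a - b)) 0) as [E | E].
- apply Cmod_eq_0 in E; rewrite <- (Cplus_0_l b), <- E; ring.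
- exfalso.
  set (e := Cmod (a - b)) in *.
  assert (P : 0 < e) by (pose proof (Cmod_ge_0 (a - b)); fold e in H; lra).
  destruct (Ha (e / 4)) as [d1 [D1 H1]]; [lra|].
  destruct (Hb (e / 4)) as [d2 [D2 H2]]; [lra|].
  set (h := Rmin d1 d2 / 2).
  assert (hp : 0 < h) by (unfold h; pose proof (Rmin_pos d1 d2 D1 D2); lra).
  assert (E1 : (z + RtoC h - z = RtoC h)%C) by ring.
  specialize (H1 (z + RtoC h)%C); specialize (H2 (z + RtoC h)%C).
  rewrite E1, Cmod_R, (Rabs_right h) in H1, H2 by lra.
  specialize (H1 ltac:(unfold h in *; pose proof (Rmin_l d1 d2); lra)).
  specialize (H2 ltac:(unfold h in *; pose proof (Rmin_r d1 d2); lra)).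
  assert (T := Cmod_triangle_minus (f (z + RtoC h)%C - f z - b * RtoC h)
                (f (z + RtoC h)%C - f z - a * RtoC h)).
  match type of T with Cmod ?x <= _ => replace x with ((a - b) * RtoC h)%C in T by ring end.
  rewrite Cmod_mult, Cmod_R, (Rabs_right h) in T by lra; fold e in T.
  nra.
Qed.

Lemma cder_eq (f : C -> C) (z l : C) : is_cderiv f z l -> cder f z = l.
Proof.
intros H; apply (is_cderiv_unique f z); [apply cder_correct; exists l|]; assumption.
Qed.

Lemma is_cderiv_ccontz (f : C -> C) (z l : C) : is_cderiv f z l -> ccontz f z.
Proof.
intros H eps He.
destruct (H 1) as [d [D Hd]]; [lra|].
pose proof (Cmod_ge_0 l) as Hl.
exists (Rmin d (eps / (2 + Cmod l))); split.
- apply Rmin_pos; [assumption | apply Rdiv_lt_0_compat; lra].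
- intros w Hw.
  pose proof (Rmin_l d (eps / (2 + Cmod l))); pose proof (Rmin_r d (eps / (2 + Cmod l))).
  specialize (Hd w ltac:(lra)).
  assert (T := Cmod_triangle (f w - f z - l * (w - z)) (l * (w - z))).
  replace (f w - f z - l * (w - z) + l * (w - z))%C with (f w - f z)%C in T by ring.
  rewrite Cmod_mult in T.
  assert (Cmod (w - z) * (2 + Cmod l) < eps).
  { apply Rlt_le_trans with (eps / (2 + Cmod l) * (2 + Cmod l)).
    - apply Rmult_lt_compat_r; lra.
    - right; field; lra. }
  pose proof (Cmod_ge_0 (w - z)); nra.
Qed.

Lemma hol_ccontz (f : C -> C) (z : C) : hol f z -> ccontz f z.
Proof. intros [l H]; eapply is_cderiv_ccontz; eassumption. Qed.

Lemma ccontz_ext (f g : C -> C) (z : C) : (forall w, f w = g w) -> ccontz f z -> ccontz g z.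
Proof.
intros E H eps He; destruct (H eps He) as [d [D Hd]]; exists d; split; [assumption|].
intros w Hw; rewrite <- !E; apply Hd; assumption.
Qed.

Lemma ccontz_const (c z : C) : ccontz (fun _ => c) z.
Proof.
intros eps He; exists 1; split; [lra|]; intros w _.
replace (c - c)%C with (RtoC 0) by ring; rewrite Cmod_0; assumption.
Qed.

Lemma ccontz_id (z : C) : ccontz (fun w => w) z.
Proof. intros eps He; exists eps; split; auto. Qed.

Lemma ccontz_plus (f g : C -> C) (z : C) :
  ccontz f z -> ccontz g z -> ccontz (fun w => f w + g w)%C z.
Proof.
intros F G eps He.
destruct (F (eps / 2)) as [d1 [D1 H1]]; [lra|].
destruct (G (eps / 2)) as [d2 [D2 H2]]; [lra|].
exists (Rmin d1 d2); split; [apply Rmin_pos; assumption|].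
intros w Hw; pose proof (Rmin_l d1 d2); pose proof (Rmin_r d1 d2).
specialize (H1 w ltac:(lra)); specialize (H2 w ltac:(lra)).
replace (f w + g w - (f z + g z))%C with ((f w - f z) + (g w - g z))%C by ring.
eapply Rle_lt_trans; [apply Cmod_triangle|]; lra.
Qed.

Lemma ccontz_mult (f g : C -> C) (z : C) :
  ccontz f z -> ccontz g z -> ccontz (fun w => f w * g w)%C z.
Proof.
intros F G eps He.
pose proof (Cmod_ge_0 (f z)) as Hf; pose proof (Cmod_ge_0 (g z)) as Hg.
destruct (F (Rmin 1 (eps / (2 * (1 + Cmod (g z)))))) as [d1 [D1 H1]].
{ apply Rmin_pos; [lra | apply Rdiv_lt_0_compat; lra]. }
destruct (G (eps / (2 * (1 + Cmod (f z))))) as [d2 [D2 H2]].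
{ apply Rdiv_lt_0_compat; lra. }
exists (Rmin d1 d2); split; [apply Rmin_pos; assumption|].
intros w Hw; pose proof (Rmin_l d1 d2); pose proof (Rmin_r d1 d2).
specialize (H1 w ltac:(lra)); specialize (H2 w ltac:(lra)).
pose proof (Rmin_l 1 (eps / (2 * (1 + Cmod (g z))))) as M1.
pose proof (Rmin_r 1 (eps / (2 * (1 + Cmod (g z))))) as M2.
replace (f w * g w - f z * g z)%C with
  ((f w - f z) * (g w - g z) + (f z * (g w - g z) + (f w - f z) * g z))%C by ring.
eapply Rle_lt_trans; [apply Cmod_triangle|].
eapply Rle_lt_trans; [apply Rplus_le_compat_l, Cmod_triangle|].
rewrite !Cmod_mult.
set (u := Cmod (f w - f z)) in *; set (v := Cmod (g w - g z)) in *.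
assert (U : 0 <= u) by apply Cmod_ge_0; assert (V : 0 <= v) by apply Cmod_ge_0.
assert (A : u * (1 + Cmod (g z)) < eps / 2).
{ apply Rlt_le_trans with (eps / (2 * (1 + Cmod (g z))) * (1 + Cmod (g z))).
  - apply Rmult_lt_compat_r; lra.
  - right; field; lra. }
assert (B : v * (1 + Cmod (f z)) < eps / 2).
{ apply Rlt_le_trans with (eps / (2 * (1 + Cmod (f z))) * (1 + Cmod (f z))).
  - apply Rmult_lt_compat_r; lra.
  - right; field; lra. }
assert (u <= 1) by lra.
nra.
Qed.

Lemma ccontz_inv (f : C -> C) (z : C) : f z <> 0 -> ccontz f z -> ccontz (fun w => / f w)%C z.
Proof.
intros N F eps He.
assert (P : 0 < Cmod (f z)) by (apply Cmod_gt_0; assumption).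
set (m := Cmod (f z)) in *.
destruct (F (Rmin (m / 2) (eps * m * m / 2))) as [d [D H]].
{ apply Rmin_pos; [lra | repeat apply Rmult_lt_0_compat; lra]. }
exists d; split; [assumption|]; intros w Hw; specialize (H w Hw).
pose proof (Rmin_l (m / 2) (eps * m * m / 2)); pose proof (Rmin_r (m / 2) (eps * m * m / 2)).
assert (Q : m / 2 < Cmod (f w)).
{ pose proof (Cmod_triangle_rev (f z) (f w)) as T; rewrite Cmod_minus_sym in T.
  fold m in T; lra. }
assert (N' : f w <> 0) by (apply Cmod_gt_0; lra).
replace (/ f w - / f z)%C with (- ((f w - f z) / (f w * f z)))%C by (field; auto).
rewrite Cmod_opp, Cmod_div, Cmod_mult by (apply Cmult_neq_0; assumption); fold m.
apply Rmult_lt_reg_r with (Cmod (f w) * m); [apply Rmult_lt_0_compat; lra|].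
unfold Rdiv; rewrite Rmult_assoc, Rinv_l, Rmult_1_r by (apply Rgt_not_eq, Rmult_lt_0_compat; lra).
apply Rlt_le_trans with (eps * m * m / 2); [lra|].
assert (0 < eps * m) by (apply Rmult_lt_0_compat; lra).
nra.
Qed.

Lemma ccontz_comp (f g : C -> C) (z : C) :
  ccontz f z -> ccontz g (f z) -> ccontz (fun w => g (f w)) z.
Proof.
intros F G eps He; destruct (G eps He) as [d1 [D1 H1]]; destruct (F d1 D1) as [d [D H]].
exists d; split; [assumption|]; intros w Hw; apply H1, H, Hw.
Qed.

(** Carathéodory's form of differentiability: the difference quotient extends
    continuously; the rules below reduce to continuity rules. *)
Lemma is_cderiv_quot (f : C -> C) (z l : C) :
  is_cderiv f z l <->
  exists q, q z = l /\ ccontz q z /\ forall w, f w = (f z + q w * (w - z))%C.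
Proof.
split.
- intros H.
  exists (fun w => if excluded_middle_informative (w = z) then l else ((f w - f z) / (w - z))%C).
  repeat split.
  + destruct (excluded_middle_informative (z = z)); [reflexivity | contradiction].
  + intros eps He; destruct (H (eps / 2)) as [d [D Hd]]; [lra|].
    exists d; split; [assumption|]; intros w Hw.
    destruct (excluded_middle_informative (z = z)) as [_ |]; [| contradiction].
    destruct (excluded_middle_informative (w = z)) as [E | E].
    * replace (l - l)%C with (RtoC 0) by ring; rewrite Cmod_0; assumption.
    * assert (N : (w - z)%C <> 0).
      { intros E'; apply E; rewrite <- (Cplus_0_l z), <- E'; ring. }
      replace ((f w - f z) / (w - z) - l)%C with ((f w - f z - l * (w - z)) / (w - z))%C
        by (field; assumption).
      rewrite Cmod_div by assumption.
      assert (P : 0 < Cmod (w - z)) by (apply Cmod_gt_0; assumption).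
      specialize (Hd w Hw).
      apply Rle_lt_trans with (eps / 2); [|lra].
      apply Rmult_le_reg_r with (Cmod (w - z)); [assumption|].
      unfold Rdiv at 1; rewrite Rmult_assoc, Rinv_l, Rmult_1_r by lra; assumption.
  + intros w; destruct (excluded_middle_informative (w = z)) as [E | E].
    * subst; ring.
    * field; intros E'; apply E; rewrite <- (Cplus_0_l z), <- E'; ring.
- intros [q [E [Q H]]] eps He; destruct (Q eps He) as [d [D Hd]].
  exists d; split; [assumption|]; intros w Hw.
  rewrite (H w); replace (f z + q w * (w - z) - f z - l * (w - z))%C with ((q w - l) * (w - z))%C by ring.
  rewrite Cmod_mult; apply Rmult_le_compat_r; [apply Cmod_ge_0|].
  rewrite <- E; left; apply Hd; assumption.
Qed.

Lemma is_cderiv_ext (f g : C -> C) (z l : C) :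
  (forall w, f w = g w) -> is_cderiv f z l -> is_cderiv g z l.
Proof.
intros E H eps He; destruct (H eps He) as [d [D Hd]]; exists d; split; [assumption|].
intros w Hw; rewrite <- !E; apply Hd; assumption.
Qed.

Lemma is_cderiv_local (f g : C -> C) (z l : C) (d : R) : 0 < d ->
  (forall w, Cmod (w - z) < d -> f w = g w) -> is_cderiv f z l -> is_cderiv g z l.
Proof.
intros D E H eps He.
destruct (H eps He) as [d1 [D1 H1]].
exists (Rmin d d1); split; [apply Rmin_pos; assumption|].
intros w Hw; pose proof (Rmin_l d d1); pose proof (Rmin_r d d1).
rewrite <- !E; [apply H1; lra | | lra].
replace (z - z)%C with (RtoC 0) by ring; rewrite Cmod_0; assumption.
Qed.

Lemma is_cderiv_const (c z : C) : is_cderiv (fun _ => c) z 0.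
Proof.
apply is_cderiv_quot; exists (fun _ => RtoC 0); repeat split; [apply ccontz_const|].
intros; ring.
Qed.

Lemma is_cderiv_id (z : C) : is_cderiv (fun w => w) z 1.
Proof.
apply is_cderiv_quot; exists (fun _ => RtoC 1); repeat split; [apply ccontz_const|].
intros; ring.
Qed.

Lemma is_cderiv_plus (f g : C -> C) (z a b : C) :
  is_cderiv f z a -> is_cderiv g z b -> is_cderiv (fun w => f w + g w)%C z (a + b)%C.
Proof.
rewrite !is_cderiv_quot; intros [p [Ep [Cp Hp]]] [q [Eq [Cq Hq]]].
exists (fun w => p w + q w)%C; repeat split.
- congruence.
- apply ccontz_plus; assumption.
- intros w; rewrite (Hp w), (Hq w); ring.
Qed.

Lemma is_cderiv_mult (f g : C -> C) (z a b : C) :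
  is_cderiv f z a -> is_cderiv g z b -> is_cderiv (fun w => f w * g w)%C z (a * g z + f z * b)%C.
Proof.
intros F G; pose proof (is_cderiv_ccontz _ _ _ F) as CF.
revert F G; rewrite !is_cderiv_quot; intros [p [Ep [Cp Hp]]] [q [Eq [Cq Hq]]].
exists (fun w => p w * g z + f w * q w)%C; repeat split.
- congruence.
- apply ccontz_plus; apply ccontz_mult; auto using ccontz_const.
- intros w; rewrite (Hq w), (Hp w); ring.
Qed.

Lemma is_cderiv_scal (c : C) (f : C -> C) (z a : C) :
  is_cderiv f z a -> is_cderiv (fun w => c * f w)%C z (c * a)%C.
Proof.
intros F; replace (c * a)%C with (0 * f z + c * a)%C by ring.
apply (is_cderiv_mult (fun _ => c)); [apply is_cderiv_const | assumption].
Qed.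

Lemma is_cderiv_opp (f : C -> C) (z a : C) :
  is_cderiv f z a -> is_cderiv (fun w => - f w)%C z (- a)%C.
Proof.
intros F; apply is_cderiv_ext with (fun w => (- (1)) * f w)%C; [intros; ring|].
replace (- a)%C with ((- (1)) * a)%C by ring; apply is_cderiv_scal; assumption.
Qed.

Lemma is_cderiv_minus (f g : C -> C) (z a b : C) :
  is_cderiv f z a -> is_cderiv g z b -> is_cderiv (fun w => f w - g w)%C z (a - b)%C.
Proof. intros F G; apply is_cderiv_plus; [|apply is_cderiv_opp]; assumption. Qed.

Lemma is_cderiv_comp (f g : C -> C) (z a b : C) :
  is_cderiv f z a -> is_cderiv g (f z) b -> is_cderiv (fun w => g (f w)) z (b * a)%C.
Proof.
intros F G; pose proof (is_cderiv_ccontz _ _ _ F) as CF.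
revert F G; rewrite !is_cderiv_quot; intros [p [Ep [Cp Hp]]] [q [Eq [Cq Hq]]].
exists (fun w => q (f w) * p w)%C; repeat split.
- congruence.
- apply ccontz_mult; [apply (ccontz_comp f q) |]; assumption.
- intros w; rewrite (Hq (f w)); f_equal.
  replace (f w - f z)%C with (p w * (w - z))%C by (rewrite (Hp w); ring); ring.
Qed.

Lemma is_cderiv_inv (f : C -> C) (z a : C) : f z <> 0 ->
  is_cderiv f z a -> is_cderiv (fun w => / f w)%C z (- a / (f z * f z))%C.
Proof.
intros N F; pose proof (is_cderiv_ccontz _ _ _ F) as CF.
apply is_cderiv_quot in F; destruct F as [p [Ep [Cp Hp]]].
destruct (CF (Cmod (f z))) as [d [D Hd]]; [apply Cmod_gt_0; assumption|].
apply is_cderiv_local with (d := d)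
  (f := fun w => (/ f z + (- p w * / (f w * f z)) * (w - z))%C); [assumption | |].
- intros w Hw; specialize (Hd w Hw).
  assert (N' : f w <> 0).
  { intros E; rewrite E in Hd; replace (0 - f z)%C with (- f z)%C in Hd by ring.
    rewrite Cmod_opp in Hd; lra. }
  assert (E : (p w * (w - z) = f w - f z)%C) by (rewrite (Hp w); ring).
  replace (- p w * / (f w * f z) * (w - z))%C with (- (p w * (w - z)) * / (f w * f z))%C by ring.
  rewrite E; field; auto.
- apply is_cderiv_quot; exists (fun w => - p w * / (f w * f z))%C; repeat split.
  + rewrite Ep; reflexivity.
  + apply ccontz_mult.
    * apply ccontz_ext with (fun w => (- (1)) * p w)%C; [intros; ring|].
      apply ccontz_mult; [apply ccontz_const | assumption].
    * apply (ccontz_inv (fun w => f w * f z)%C); [apply Cmult_neq_0; assumption|].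
      apply ccontz_mult; [assumption | apply ccontz_const].
  + intros w; ring.
Qed.

Lemma hol_const (c z : C) : hol (fun _ => c) z.
Proof. eexists; apply is_cderiv_const. Qed.
Lemma hol_id (z : C) : hol (fun w => w) z.
Proof. eexists; apply is_cderiv_id. Qed.
Lemma hol_plus (f g : C -> C) (z : C) : hol f z -> hol g z -> hol (fun w => f w + g w)%C z.
Proof. intros [a F] [b G]; eexists; apply is_cderiv_plus; eassumption. Qed.
Lemma hol_minus (f g : C -> C) (z : C) : hol f z -> hol g z -> hol (fun w => f w - g w)%C z.
Proof. intros [a F] [b G]; eexists; apply is_cderiv_minus; eassumption. Qed.
Lemma hol_sub_const (a z : C) : hol (fun w => w - a)%C z.
Proof. apply hol_minus; [apply hol_id | apply hol_const]. Qed.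
Lemma hol_opp (f : C -> C) (z : C) : hol f z -> hol (fun w => - f w)%C z.
Proof. intros [a F]; eexists; apply is_cderiv_opp; eassumption. Qed.
Lemma hol_mult (f g : C -> C) (z : C) : hol f z -> hol g z -> hol (fun w => f w * g w)%C z.
Proof. intros [a F] [b G]; eexists; apply is_cderiv_mult; eassumption. Qed.
Lemma hol_comp (f g : C -> C) (z : C) : hol f z -> hol g (f z) -> hol (fun w => g (f w)) z.
Proof. intros [a F] [b G]; eexists; apply is_cderiv_comp; eassumption. Qed.
Lemma hol_inv (f : C -> C) (z : C) : f z <> 0 -> hol f z -> hol (fun w => / f w)%C z.
Proof. intros N [a F]; eexists; apply is_cderiv_inv; eassumption. Qed.
Lemma hol_div (f g : C -> C) (z : C) : g z <> 0 -> hol f z -> hol g z ->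
  hol (fun w => f w / g w)%C z.
Proof. intros N F G; apply (hol_mult f (fun w => / g w)%C); [|apply hol_inv]; assumption. Qed.

(** ** Complex functions along real paths *)

Lemma continuous_eps (g : R -> R) (t : R) :
  (forall eps, 0 < eps -> exists d, 0 < d /\ forall u, Rabs (u - t) < d -> Rabs (g u - g t) < eps) ->
  continuous g t.
Proof.
intros H; apply (proj2 (filterlim_locally g (g t))); intros eps.
destruct (H eps (cond_pos eps)) as [d [D Hd]].
exists (mkposreal d D); intros u Hu; apply Hd; exact Hu.
Qed.

Lemma continuous_eps_inv (g : R -> R) (t : R) : continuous g t ->
  forall eps, 0 < eps -> exists d, 0 < d /\ forall u, Rabs (u - t) < d -> Rabs (g u - g t) < eps.
Proof.
intros H eps He.
destruct (proj1 (filterlim_locally g (g t)) H (mkposreal eps He)) as [d Hd].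
exists d; split; [apply cond_pos|]; intros u Hu; apply (Hd u); exact Hu.
Qed.

Lemma ccont_eps (g : R -> C) (t : R) :
  (forall eps, 0 < eps -> exists d, 0 < d /\ forall u, Rabs (u - t) < d -> Cmod (g u - g t) < eps) ->
  ccont g t.
Proof.
intros H; split; apply continuous_eps; intros eps He; destruct (H eps He) as [d [D Hd]];
exists d; split; try assumption; intros u Hu;
(eapply Rle_lt_trans; [| apply (Hd u Hu)]).
- apply (re_le_Cmod (g u - g t)).
- apply (im_le_Cmod (g u - g t)).
Qed.

Lemma ccont_eps_inv (g : R -> C) (t : R) : ccont g t ->
  forall eps, 0 < eps -> exists d, 0 < d /\ forall u, Rabs (u - t) < d -> Cmod (g u - g t) < eps.
Proof.
intros [H1 H2] eps He.
destruct (continuous_eps_inv _ _ H1 (eps / 2)) as [d1 [D1 K1]]; [lra|].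
destruct (continuous_eps_inv _ _ H2 (eps / 2)) as [d2 [D2 K2]]; [lra|].
exists (Rmin d1 d2); split; [apply Rmin_pos; assumption|].
intros u Hu; pose proof (Rmin_l d1 d2); pose proof (Rmin_r d1 d2).
specialize (K1 u ltac:(lra)); specialize (K2 u ltac:(lra)).
eapply Rle_lt_trans; [apply Cmod_le_Re_Im|].
change (Rabs (Re (g u) - Re (g t)) + Rabs (Im (g u) - Im (g t)) < eps); lra.
Qed.

Lemma ccontz_path (f : C -> C) (g : R -> C) (t : R) :
  ccontz f (g t) -> ccont g t -> ccont (fun u => f (g u)) t.
Proof.
intros F G; apply ccont_eps; intros eps He.
destruct (F eps He) as [d1 [D1 H1]].
destruct (ccont_eps_inv _ _ G d1 D1) as [d [D H]].
exists d; split; [assumption|]; intros u Hu; apply H1, H, Hu.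
Qed.

Lemma continuous_quot_is_derive (f q : R -> R) (t : R) :
  continuous q t -> (forall u, f u = f t + q u * (u - t)) -> is_derive f t (q t).
Proof.
intros Q H; apply is_derive_Reals; intros eps He.
destruct (continuous_eps_inv _ _ Q eps He) as [d [D Hd]].
exists (mkposreal d D); intros h Nh Hh; simpl in Hh.
rewrite (H (t + h)); replace (t + h - t) with h by ring.
replace ((f t + q (t + h) * h - f t) / h - q t) with (q (t + h) - q t) by (field; assumption).
apply Hd; replace (t + h - t) with h by ring; assumption.
Qed.

(** The chain rule along a path, again through difference quotients. *)
Lemma rder_path (f : C -> C) (g : R -> C) (t : R) (l m : C) :
  is_cderiv f (g t) l -> rder g t m -> rder (fun u => f (g u)) t (l * m)%C.
Proof.
intros F G.
pose proof (rder_ccont _ _ _ G) as CG.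
destruct G as [G1 G2].
assert (Q : exists p, p t = m /\ ccont p t /\ forall u, g u = (g t + p u * RtoC (u - t))%C).
{ set (qr := fun (h : R -> R) (l : R) u =>
    if Req_EM_T u t then l else (h u - h t) / (u - t)).
  assert (A : forall h l, is_derive h t l -> continuous (qr h l) t).
  { intros h a Ha; apply is_derive_Reals in Ha; apply continuous_eps; intros eps He.
    destruct (Ha eps He) as [d Hd]; exists d; split; [apply cond_pos|].
    intros u Hu; unfold qr.
    destruct (Req_EM_T t t) as [_ |]; [|contradiction].
    destruct (Req_EM_T u t) as [E | E].
    - rewrite Rminus_diag, Rabs_R0; assumption.
    - specialize (Hd (u - t) ltac:(lra) Hu); replace (t + (u - t)) with u in Hd by ring; assumption. }
  assert (B : forall h l u, h u = h t + qr h l u * (u - t)).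
  { intros h a u; unfold qr; destruct (Req_EM_T u t) as [E | E]; [subst; ring | field; lra]. }
  exists (fun u => (qr (fun u => Re (g u)) (Re m) u, qr (fun u => Im (g u)) (Im m) u)).
  repeat split; simpl.
  - unfold qr; destruct (Req_EM_T t t) as [_ |]; [destruct m; reflexivity | contradiction].
  - apply A; assumption.
  - apply A; assumption.
  - intros u; Ceq.
    + rewrite (B (fun u => Re (g u)) (Re m) u) at 1; unfold Re; ring.
    + rewrite (B (fun u => Im (g u)) (Im m) u) at 1; unfold Im; ring. }
destruct Q as [p [Ep [Cp Hp]]].
apply is_cderiv_quot in F; destruct F as [q [Eq [Cq Hq]]].
set (r := fun u => (q (g u) * p u)%C).
assert (Cr : ccont r t) by (apply ccont_mult; [apply ccontz_path|]; assumption).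
assert (Hr : forall u, f (g u) = (f (g t) + r u * RtoC (u - t))%C).
{ intros u; rewrite (Hq (g u)); unfold r; f_equal.
  replace (g u - g t)%C with (p u * RtoC (u - t))%C by (rewrite (Hp u); ring); ring. }
replace (l * m)%C with (r t) by (unfold r; rewrite Ep, Eq; reflexivity).
destruct Cr as [C1 C2]; split.
- apply (continuous_quot_is_derive (fun u => Re (f (g u))) (fun u => Re (r u))); [assumption|].
  intros u; rewrite (Hr u); simpl; unfold Re; ring.
- apply (continuous_quot_is_derive (fun u => Im (f (g u))) (fun u => Im (r u))); [assumption|].
  intros u; rewrite (Hr u); simpl; unfold Im; ring.
Qed.

(** * Cauchy's theorem for rectangles *)

Definition hint (f : C -> C) (a b y : R) : C := cint (fun x => f (x, y)) a b.
Definition vint (f : C -> C) (x c d : R) : C := cint (fun y => f (x, y)) c d.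
Definition rect (f : C -> C) (a b c d : R) : C :=
  (hint f a b c - hint f a b d + Ci * (vint f b c d - vint f a c d))%C.

Definition rcont (f : C -> C) (a b c d : R) : Prop :=
  forall x y, a <= x <= b -> c <= y <= d -> ccontz f (x, y).

Lemma ccont_hline (f : C -> C) (x y : R) : ccontz f (x, y) -> ccont (fun t => f (t, y)) x.
Proof.
intros H; apply (ccontz_path f (fun t => (t, y))); [assumption|].
split; simpl; [apply continuous_id | apply continuous_const].
Qed.

Lemma ccont_vline (f : C -> C) (x y : R) : ccontz f (x, y) -> ccont (fun t => f (x, t)) y.
Proof.
intros H; apply (ccontz_path f (fun t => (x, t))); [assumption|].
split; simpl; [apply continuous_const | apply continuous_id].
Qed.

Lemma rder_hline (f : C -> C) (x y : R) (l : C) :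
  is_cderiv f (x, y) l -> rder (fun t => f (t, y)) x l.
Proof.
intros H; replace l with (l * 1)%C by ring.
apply (rder_path f (fun t => (t, y))); [assumption|].
split; simpl; [apply (is_derive_id (K := R_AbsRing)) | apply (is_derive_const (V := R_NormedModule))].
Qed.

Lemma rder_vline (f : C -> C) (x y : R) (l : C) :
  is_cderiv f (x, y) l -> rder (fun t => f (x, t)) y (l * Ci)%C.
Proof.
intros H; apply (rder_path f (fun t => (x, t))); [assumption|].
split; simpl; [apply (is_derive_const (V := R_NormedModule)) | apply (is_derive_id (K := R_AbsRing))].
Qed.

Lemma cex_hline (f : C -> C) (a b y : R) :
  (forall x, Rmin a b <= x <= Rmax a b -> ccontz f (x, y)) -> cex (fun x => f (x, y)) a b.
Proof. intros H; apply cex_cont; intros t Ht; apply ccont_hline, H, Ht. Qed.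

Lemma cex_vline (f : C -> C) (x c d : R) :
  (forall y, Rmin c d <= y <= Rmax c d -> ccontz f (x, y)) -> cex (fun y => f (x, y)) c d.
Proof. intros H; apply cex_cont; intros t Ht; apply ccont_vline, H, Ht. Qed.

Lemma rect_split_x (f : C -> C) (a m b c d : R) : a <= m <= b -> c <= d ->
  rcont f a b c d -> rect f a b c d = (rect f a m c d + rect f m b c d)%C.
Proof.
intros Hm Hcd H; unfold rect.
assert (E : forall y, c <= y <= d -> hint f a b y = (hint f a m y + hint f m b y)%C).
{ intros y Hy; unfold hint; symmetry; apply cint_Chasles; apply cex_hline; intros x Hx;
  rewrite Rmin_left, Rmax_right in Hx by lra; apply H; lra. }
rewrite !E by lra; ring.
Qed.

Lemma rect_split_y (f : C -> C) (a b c m d : R) : a <= b -> c <= m <= d ->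
  rcont f a b c d -> rect f a b c d = (rect f a b c m + rect f a b m d)%C.
Proof.
intros Hm Hcd H; unfold rect.
assert (E : forall x, a <= x <= b -> vint f x c d = (vint f x c m + vint f x m d)%C).
{ intros y Hy; unfold vint; symmetry; apply cint_Chasles; apply cex_vline; intros x Hx;
  rewrite Rmin_left, Rmax_right in Hx by lra; apply H; lra. }
rewrite !E by lra; ring.
Qed.

Lemma rect_bound (f : C -> C) (M a b c d : R) : a <= b -> c <= d ->
  rcont f a b c d -> (forall x y, a <= x <= b -> c <= y <= d -> Cmod (f (x, y)) <= M) ->
  Cmod (rect f a b c d) <= 2 * M * ((b - a) + (d - c)).
Proof.
intros Hab Hcd H HM.
assert (Hh : forall y, c <= y <= d -> Cmod (hint f a b y) <= M * (b - a)).
{ intros y Hy; apply cint_bound_const; [assumption | |intros; apply HM; lra].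
  apply cex_cont_le; [assumption|]; intros; apply ccont_hline, H; lra. }
assert (Hv : forall x, a <= x <= b -> Cmod (vint f x c d) <= M * (d - c)).
{ intros y Hy; apply cint_bound_const; [assumption | |intros; apply HM; lra].
  apply cex_cont_le; [assumption|]; intros; apply ccont_vline, H; lra. }
unfold rect; eapply Rle_trans; [apply Cmod_triangle|].
rewrite Cmod_mult, Cmod_Ci, Rmult_1_l.
pose proof (Cmod_triangle_minus (hint f a b c) (hint f a b d)).
pose proof (Cmod_triangle_minus (vint f b c d) (vint f a c d)).
pose proof (Hh c ltac:(lra)); pose proof (Hh d ltac:(lra)).
pose proof (Hv a ltac:(lra)); pose proof (Hv b ltac:(lra)).
lra.
Qed.

Lemma rect_minus (f g : C -> C) (a b c d : R) : a <= b -> c <= d ->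
  rcont f a b c d -> rcont g a b c d ->
  rect (fun z => f z - g z)%C a b c d = (rect f a b c d - rect g a b c d)%C.
Proof.
intros Hab Hcd F G; unfold rect, hint, vint.
rewrite !cint_minus;
 try (apply cex_cont_le; [assumption|]; intros; try apply ccont_hline; try apply ccont_vline;
      first [apply F; lra | apply G; lra | idtac]).
ring.
all: try (apply ccont_hline; first [apply F; lra | apply G; lra]).
Qed.

Lemma rect_primitive (F f : C -> C) (a b c d : R) : a <= b -> c <= d ->
  rcont f a b c d ->
  (forall x y, a <= x <= b -> c <= y <= d -> is_cderiv F (x, y) (f (x, y))) ->
  rect f a b c d = 0.
Proof.
intros Hab Hcd H HF.
assert (Hh : forall y, c <= y <= d -> hint f a b y = (F (b, y) - F (a, y))%C).
{ intros y Hy; apply (cint_FTC (fun x => F (x, y))); intros t Ht;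
  rewrite Rmin_left, Rmax_right in Ht by assumption.
  - apply rder_hline, HF; lra.
  - apply ccont_hline, H; lra. }
assert (Hv : forall x, a <= x <= b -> (Ci * vint f x c d)%C = (F (x, d) - F (x, c))%C).
{ intros x Hx; unfold vint; rewrite <- cint_scal.
  - apply (cint_FTC (fun y => F (x, y))); intros t Ht;
    rewrite Rmin_left, Rmax_right in Ht by assumption.
    + rewrite Cmult_comm; apply rder_vline, HF; lra.
    + apply ccont_mult; [apply ccont_const | apply ccont_vline, H; lra].
  - apply cex_cont_le; [assumption|]; intros; apply ccont_vline, H; lra. }
unfold rect.
replace (Ci * (vint f b c d - vint f a c d))%C with (Ci * vint f b c d - Ci * vint f a c d)%C by ring.
rewrite !Hh, !Hv by lra; ring.
Qed.

Lemma rcont_sub (f : C -> C) (a b c d a' b' c' d' : R) :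
  rcont f a b c d -> a <= a' -> b' <= b -> c <= c' -> d' <= d -> rcont f a' b' c' d'.
Proof. intros H ? ? ? ? x y Hx Hy; apply H; lra. Qed.

Lemma Cmod_ge_components (x y x0 y0 : R) :
  Cmod ((x, y) - (x0, y0)) <= Rabs (x - x0) + Rabs (y - y0).
Proof. apply (Cmod_le_Re_Im ((x, y) - (x0, y0))). Qed.

Record box4 := Box { xa : R; xb : R; yc : R; yd : R }.

Section Bisection.
Variable f : C -> C.

Let I (q : box4) : R := Cmod (rect f (xa q) (xb q) (yc q) (yd q)).

Definition quarters (q : box4) : list box4 :=
  let mx := (xa q + xb q) / 2 in let my := (yc q + yd q) / 2 in
  (Box (xa q) mx (yc q) my :: Box mx (xb q) (yc q) my ::
   Box (xa q) mx my (yd q) :: Box mx (xb q) my (yd q) :: nil)%list.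

(** The integrals over the four quarters add up to the integral over the rectangle, so
    that one of them is at least a quarter of it in modulus. *)
Lemma bisect_step (q : box4) : xa q <= xb q -> yc q <= yd q ->
  rcont f (xa q) (xb q) (yc q) (yd q) ->
  exists q', (xa q <= xa q' <= xb q' /\ xb q' <= xb q) /\ (yc q <= yc q' <= yd q' /\ yd q' <= yd q) /\
    xb q' - xa q' = (xb q - xa q) / 2 /\ yd q' - yc q' = (yd q - yc q) / 2 /\ I q <= 4 * I q'.
Proof.
intros Hx Hy H.
destruct (classic (exists q', In q' (quarters q) /\ I q <= 4 * I q')) as [[q' [Hin Hq']] | N].
- exists q'; simpl in Hin.
  destruct Hin as [E | [E | [E | [E | []]]]]; subst q'; simpl; repeat split; try lra; assumption.
- exfalso.
  assert (K : forall q', In q' (quarters q) -> 4 * I q' < I q).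
  { intros q' Hin; apply Rnot_le_lt; intros L; apply N; exists q'; split; assumption. }
  pose proof (K _ (or_introl eq_refl)) as K1.
  pose proof (K _ (or_intror (or_introl eq_refl))) as K2.
  pose proof (K _ (or_intror (or_intror (or_introl eq_refl)))) as K3.
  pose proof (K _ (or_intror (or_intror (or_intror (or_introl eq_refl))))) as K4.
  unfold I in *; simpl in *.
  set (mx := (xa q + xb q) / 2) in *; set (my := (yc q + yd q) / 2) in *.
  assert (xa q <= mx <= xb q /\ yc q <= my <= yd q) by (unfold mx, my; lra).
  rewrite (rect_split_x f (xa q) mx (xb q) (yc q) (yd q)) in K1, K2, K3, K4 by (tauto || lra).
  rewrite (rect_split_y f (xa q) mx (yc q) my (yd q)) in K1, K2, K3, K4
    by (try tauto; try lra; eapply rcont_sub; try eassumption; lra).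
  rewrite (rect_split_y f mx (xb q) (yc q) my (yd q)) in K1, K2, K3, K4
    by (try tauto; try lra; eapply rcont_sub; try eassumption; lra).
  set (r1 := rect f (xa q) mx (yc q) my) in *; set (r2 := rect f mx (xb q) (yc q) my) in *.
  set (r3 := rect f (xa q) mx my (yd q)) in *; set (r4 := rect f mx (xb q) my (yd q)) in *.
  pose proof (Cmod_triangle (r1 + r3) (r2 + r4)).
  pose proof (Cmod_triangle r1 r3); pose proof (Cmod_triangle r2 r4); lra.
Qed.

(** Bisection concentrates a nonzero integral near one point, where the
    differential approximation makes it too small. *)
Lemma goursat (a b c d : R) : a <= b -> c <= d ->
  (forall x y, a <= x <= b -> c <= y <= d -> hol f (x, y)) -> rect f a b c d = 0.
Proof.
intros Hab Hcd H.
assert (HC : rcont f a b c d) by (intros x y Hx Hy; apply hol_ccontz, H; assumption).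
set (inb := fun q => a <= xa q <= xb q /\ xb q <= b /\ c <= yc q <= yd q /\ yd q <= d).
assert (ST : forall q, exists q', inb q ->
  inb q' /\ xa q <= xa q' /\ xb q' <= xb q /\ yc q <= yc q' /\ yd q' <= yd q /\
  xb q' - xa q' = (xb q - xa q) / 2 /\ yd q' - yc q' = (yd q - yc q) / 2 /\ I q <= 4 * I q').
{ intros q; destruct (classic (inb q)) as [B | B].
  - destruct (bisect_step q) as [q' Hq']; unfold inb in B; try lra.
    + eapply rcont_sub; [exact HC | | | |]; lra.
    + exists q'; intros _; unfold inb; lra.
  - exists q; intros; contradiction. }
set (next := fun q => proj1_sig (constructive_indefinite_description _ (ST q))).
set (s := nat_rect (fun _ => box4) (Box a b c d) (fun _ q => next q)).
assert (SI : forall n, inb (s n)).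
{ induction n as [|n IH]; simpl.
  - unfold inb; simpl; lra.
  - unfold next; destruct (constructive_indefinite_description _ (ST (s n))) as [q' Hq']; simpl.
    apply Hq', IH. }
assert (SN : forall n, xa (s n) <= xa (s (S n)) /\ xb (s (S n)) <= xb (s n) /\
  yc (s n) <= yc (s (S n)) /\ yd (s (S n)) <= yd (s n) /\
  xb (s (S n)) - xa (s (S n)) = (xb (s n) - xa (s n)) / 2 /\
  yd (s (S n)) - yc (s (S n)) = (yd (s n) - yc (s n)) / 2 /\ I (s n) <= 4 * I (s (S n))).
{ intros n; simpl; unfold next at 1 2 3 4 5 6 7 8 9.
  destruct (constructive_indefinite_description _ (ST (s n))) as [q' Hq']; simpl.
  apply Hq', SI. }
assert (LIM : forall (u v : nat -> R), (forall n, u n <= u (S n)) -> (forall n, v (S n) <= v n) ->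
  (forall n, u n <= v n) -> exists l, forall n, u n <= l <= v n).
{ intros u v Hu Hv Huv.
  assert (M : forall n k, v (n + k)%nat <= v n).
  { intros n k; induction k; [rewrite Nat.add_0_r; lra|].
    rewrite Nat.add_succ_r; eapply Rle_trans; [apply Hv | assumption]. }
  assert (M' : forall n k, u n <= u (n + k)%nat).
  { intros n k; induction k; [rewrite Nat.add_0_r; lra|].
    rewrite Nat.add_succ_r; eapply Rle_trans; [eassumption | apply Hu]. }
  destruct (completeness (fun x => exists n, x = u n)) as [l [L1 L2]].
  - exists (v 0%nat); intros x [n ->]; eapply Rle_trans; [apply Huv | apply (M 0%nat n)].
  - exists (u 0%nat); exists 0%nat; reflexivity.
  - exists l; intros n; split; [apply L1; exists n; reflexivity|].
    apply L2; intros x [m ->].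
    eapply Rle_trans; [apply (M' m n)|]; rewrite Nat.add_comm.
    eapply Rle_trans; [apply Huv | apply M]. }
destruct (LIM (fun n => xa (s n)) (fun n => xb (s n))) as [x0 X0]; try (intros n; apply SN).
{ intros n; apply (SI n). }
destruct (LIM (fun n => yc (s n)) (fun n => yd (s n))) as [y0 Y0]; try (intros n; apply SN).
{ intros n; apply (SI n). }
assert (DX : forall n, xb (s n) - xa (s n) = (b - a) / 2 ^ n).
{ induction n as [|n IH]; [simpl; field|].
  destruct (SN n) as (_ & _ & _ & _ & E & _); rewrite E, IH; simpl; field; apply pow_nonzero; lra. }
assert (DY : forall n, yd (s n) - yc (s n) = (d - c) / 2 ^ n).
{ induction n as [|n IH]; [simpl; field|].
  destruct (SN n) as (_ & _ & _ & _ & _ & E & _); rewrite E, IH; simpl; field; apply pow_nonzero; lra. }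
assert (DI : forall n, Cmod (rect f a b c d) <= 4 ^ n * I (s n)).
{ induction n as [|n IH]; [simpl; unfold I; simpl; lra|].
  destruct (SN n) as (_ & _ & _ & _ & _ & _ & E).
  eapply Rle_trans; [exact IH|].
  replace (4 ^ S n * I (s (S n))) with (4 ^ n * (4 * I (s (S n)))) by (simpl; ring).
  apply Rmult_le_compat_l; [apply pow_le; lra | exact E]. }
set (L := (b - a) + (d - c)).
assert (HL : 0 <= L) by (unfold L; lra).
destruct (H x0 y0) as [l Hl].
{ specialize (X0 0%nat); simpl in X0; lra. }
{ specialize (Y0 0%nat); simpl in Y0; lra. }
apply Cmod_eq_0.
apply Rle_antisym; [|apply Cmod_ge_0].
apply Rle_plus_epsilon; intros e He; rewrite Rplus_0_l.
(* After [n] bisections the perimeter has shrunk by [2^n], while the integral has by at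
   most [4^n]: approximating [f] within [e' |z - (x0, y0)|] bounds it by [2 e' L^2]. *)
set (e' := e / (2 * L * L + 1)).
assert (He' : 0 < e') by (apply Rdiv_lt_0_compat; [assumption | nra]).
destruct (Hl e' He') as [dl [Dl Hdl]].
assert (EN : exists n, L / 2 ^ n < dl).
{ destruct (pow_lt_1_zero (/ 2) ltac:(rewrite Rabs_right; lra) (dl / (L + 1))) as [n Hn].
  - apply Rdiv_lt_0_compat; lra.
  - exists n; specialize (Hn n (le_n n)).
    rewrite Rabs_right in Hn by (apply Rle_ge, pow_le; lra).
    rewrite pow_inv in Hn.
    assert (P : 0 < / 2 ^ n) by (apply Rinv_0_lt_compat, pow_lt; lra).
    apply Rle_lt_trans with ((L + 1) * / 2 ^ n); [unfold Rdiv; nra|].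
    apply Rlt_le_trans with ((L + 1) * (dl / (L + 1))); [apply Rmult_lt_compat_l; lra|].
    right; field; lra. }
destruct EN as [n Hn].
specialize (X0 n); specialize (Y0 n); specialize (SI n); specialize (DX n); specialize (DY n).
specialize (DI n); unfold I in DI; clear SN.
set (q := s n) in *.
set (g := fun z => (f (x0, y0) + l * (z - (x0, y0)))%C).
assert (P2 : 0 < 2 ^ n) by (apply pow_lt; lra).
assert (RC : rcont f (xa q) (xb q) (yc q) (yd q)).
{ unfold inb in SI; eapply rcont_sub; [exact HC | | | |]; lra. }
assert (GD : forall z, is_cderiv g z l).
{ intros z.
  assert (K : is_cderiv g z (0 + l * (1 - 0))).
  { apply is_cderiv_plus; [apply is_cderiv_const|].
    apply is_cderiv_scal, is_cderiv_minus; [apply is_cderiv_id | apply is_cderiv_const]. }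
  replace (0 + l * (1 - 0))%C with l in K by ring; exact K. }
assert (RG : rect g (xa q) (xb q) (yc q) (yd q) = 0).
{ apply (rect_primitive (fun z => f (x0, y0) * z + l * ((z - (x0, y0)) * (z - (x0, y0)) * (RtoC (/ 2))))%C);
  try (unfold inb in SI; lra).
  - intros x y _ _; apply (is_cderiv_ccontz _ _ l), GD.
  - intros x y _ _; unfold g.
    replace (f (x0, y0) + l * ((x, y) - (x0, y0)))%C with
     (f (x0, y0) * 1 + l * (((1 - 0) * ((x, y) - (x0, y0)) + ((x, y) - (x0, y0)) * (1 - 0)) * RtoC (/ 2)
       + ((x, y) - (x0, y0)) * ((x, y) - (x0, y0)) * 0))%C.
    2:{ assert (E2 : (RtoC (/ 2) + RtoC (/ 2) = 1)%C) by (rewrite <- RtoC_plus; f_equal; field).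
        transitivity (f (x0, y0) + l * (((x, y) - (x0, y0)) * (RtoC (/ 2) + RtoC (/ 2))))%C;
        [ring | rewrite E2; ring]. }
    assert (ID : is_cderiv (fun z => z - (x0, y0))%C (x, y) (1 - 0)%C)
      by (apply is_cderiv_minus; [apply is_cderiv_id | apply is_cderiv_const]).
    apply is_cderiv_plus; apply is_cderiv_scal; [apply is_cderiv_id|].
    apply (is_cderiv_mult (fun z => (z - (x0, y0)) * (z - (x0, y0)))%C (fun _ => RtoC (/2))).
    + apply (is_cderiv_mult (fun z => (z - (x0, y0)))%C (fun z => (z - (x0, y0)))%C); assumption.
    + apply is_cderiv_const. }
assert (B : Cmod (rect (fun z => f z - g z)%C (xa q) (xb q) (yc q) (yd q)) <=
   2 * (e' * (L / 2 ^ n)) * ((xb q - xa q) + (yd q - yc q))).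
{ apply rect_bound; try (unfold inb in SI; lra).
  - intros x y Hx Hy; apply (ccontz_plus f (fun z => - g z)%C); [apply RC; assumption|].
    apply hol_ccontz, hol_opp; exists l; apply GD.
  - intros x y Hx Hy.
    assert (Q : Cmod ((x, y) - (x0, y0)) <= L / 2 ^ n).
    { eapply Rle_trans; [apply Cmod_ge_components|].
      replace (L / 2 ^ n) with ((b - a) / 2 ^ n + (d - c) / 2 ^ n) by (unfold L; field; lra).
      rewrite <- DX, <- DY; apply Rplus_le_compat; apply Rabs_le; lra. }
    unfold g; replace (f (x, y) - (f (x0, y0) + l * ((x, y) - (x0, y0))))%C with
      (f (x, y) - f (x0, y0) - l * ((x, y) - (x0, y0)))%C by ring.
    eapply Rle_trans; [apply Hdl; lra|].
    apply Rmult_le_compat_l; lra. }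
rewrite rect_minus in B; try (unfold inb in SI; lra); [| assumption |
   intros x y _ _; apply (is_cderiv_ccontz _ _ l), GD].
rewrite RG, DX, DY in B.
replace (rect f (xa q) (xb q) (yc q) (yd q) - 0)%C with (rect f (xa q) (xb q) (yc q) (yd q)) in B by ring.
eapply Rle_trans; [exact DI|].
eapply Rle_trans; [apply Rmult_le_compat_l; [apply pow_le; lra | exact B]|].
replace (4 ^ n) with (2 ^ n * 2 ^ n) by (rewrite <- Rpow_mult_distr; f_equal; ring).
replace (2 ^ n * 2 ^ n * (2 * (e' * (L / 2 ^ n)) * ((b - a) / 2 ^ n + (d - c) / 2 ^ n))) with
  (e' * (2 * L * L)) by (unfold L; field; lra).
apply Rle_trans with (e' * (2 * L * L + 1)); [nra|].
unfold e'; right; field; nra.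
Qed.

End Bisection.

Lemma rect_flat_x (f : C -> C) (a c d : R) : rect f a a c d = 0.
Proof. unfold rect, hint; rewrite !cint_point; ring. Qed.

Lemma rect_flat_y (f : C -> C) (a b c : R) : rect f a b c c = 0.
Proof. unfold rect, vint; rewrite !cint_point; ring. Qed.

(** A point where [f] is only continuous is enclosed in a small square, which
    contributes at most its perimeter. *)
Lemma goursat_except (f : C -> C) (p : C) (a b c d : R) : a <= b -> c <= d ->
  rcont f a b c d ->
  (forall x y, a <= x <= b -> c <= y <= d -> (x, y) <> p -> hol f (x, y)) ->
  rect f a b c d = 0.
Proof.
intros Hab Hcd HC H; destruct p as [px py].
destruct (classic (a <= px <= b /\ c <= py <= d)) as [[Hx Hy] | N].
2:{ apply goursat; try assumption; intros x y Hx Hy; apply H; try assumption.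
    intros E; injection E as -> ->; tauto. }
apply Cmod_eq_0, Rle_antisym; [|apply Cmod_ge_0].
apply Rle_plus_epsilon; intros e He; rewrite Rplus_0_l.
destruct (HC px py Hx Hy 1 ltac:(lra)) as [d0 [D0 B0]].
set (M := Cmod (f (px, py)) + 1).
assert (HM : 1 <= M) by (unfold M; pose proof (Cmod_ge_0 (f (px, py))); lra).
set (dl := Rmin (d0 / 4) (e / (8 * M))).
assert (Dl : 0 < dl) by (apply Rmin_pos; [lra | apply Rdiv_lt_0_compat; lra]).
pose proof (Rmin_l (d0 / 4) (e / (8 * M))) as L1; fold dl in L1.
pose proof (Rmin_r (d0 / 4) (e / (8 * M))) as L2; fold dl in L2.
set (a' := Rmax a (px - dl)); set (b' := Rmin b (px + dl)).
set (c' := Rmax c (py - dl)); set (d' := Rmin d (py + dl)).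
assert (A1 : a <= a' <= px) by (unfold a'; split; [apply Rmax_l | apply Rmax_lub; lra]).
assert (A2 : px - dl <= a') by (unfold a'; apply Rmax_r).
assert (B1 : px <= b' <= b) by (unfold b'; split; [apply Rmin_glb; lra | apply Rmin_l]).
assert (B2 : b' <= px + dl) by (unfold b'; apply Rmin_r).
assert (C1 : c <= c' <= py) by (unfold c'; split; [apply Rmax_l | apply Rmax_lub; lra]).
assert (C2 : py - dl <= c') by (unfold c'; apply Rmax_r).
assert (D1 : py <= d' <= d) by (unfold d'; split; [apply Rmin_glb; lra | apply Rmin_l]).
assert (D2 : d' <= py + dl) by (unfold d'; apply Rmin_r).
assert (Z1 : rect f a a' c d = 0).
{ destruct (Req_dec a a') as [E | E]; [rewrite <- E; apply rect_flat_x|].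
  apply goursat; try lra; intros x y ? ?; apply H; try lra; intros Q; injection Q as -> ->.
  unfold a', Rmax in *; destruct (Rle_dec a (px - dl)); lra. }
assert (Z2 : rect f b' b c d = 0).
{ destruct (Req_dec b' b) as [E | E]; [rewrite E; apply rect_flat_x|].
  apply goursat; try lra; intros x y ? ?; apply H; try lra; intros Q; injection Q as -> ->.
  unfold b', Rmin in *; destruct (Rle_dec b (px + dl)); lra. }
assert (Z3 : rect f a' b' c c' = 0).
{ destruct (Req_dec c c') as [E | E]; [rewrite <- E; apply rect_flat_y|].
  apply goursat; try lra; intros x y ? ?; apply H; try lra; intros Q; injection Q as -> ->.
  unfold c', Rmax in *; destruct (Rle_dec c (py - dl)); lra. }
assert (Z4 : rect f a' b' d' d = 0).
{ destruct (Req_dec d' d) as [E | E]; [rewrite E; apply rect_flat_y|].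
  apply goursat; try lra; intros x y ? ?; apply H; try lra; intros Q; injection Q as -> ->.
  unfold d', Rmin in *; destruct (Rle_dec d (py + dl)); lra. }
rewrite (rect_split_x f a a' b), (rect_split_x f a' b' b), (rect_split_y f a' b' c c' d),
 (rect_split_y f a' b' c' d' d), Z1, Z2, Z3, Z4;
 try lra; try (eapply rcont_sub; [exact HC | | | |]; lra).
replace (0 + (0 + (rect f a' b' c' d' + 0) + 0))%C with (rect f a' b' c' d') by ring.
eapply Rle_trans.
- apply (rect_bound f M); try lra; [eapply rcont_sub; [exact HC | | | |]; lra|].
  intros x y Qx Qy.
  assert (T := Cmod_triangle (f (x, y) - f (px, py)) (f (px, py))).
  replace (f (x, y) - f (px, py) + f (px, py))%C with (f (x, y)) in T by ring.
  assert (Cmod ((x, y) - (px, py)) < d0).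
  { eapply Rle_lt_trans; [apply Cmod_ge_components|].
    assert (Rabs (x - px) <= dl) by (apply Rabs_le; lra).
    assert (Rabs (y - py) <= dl) by (apply Rabs_le; lra). lra. }
  specialize (B0 _ H0); unfold M; lra.
- apply Rle_trans with (2 * M * (4 * dl)).
  + apply Rmult_le_compat_l; lra.
  + apply Rle_trans with (8 * M * (e / (8 * M))); [|right; field; lra].
    replace (2 * M * (4 * dl)) with (8 * M * dl) by ring.
    apply Rmult_le_compat_l; lra.
Qed.

(** * Primitives *)

(** An interval, open and possibly unbounded. Products of two such sets are squares,
    half-planes or the plane; they contain with any two points the rectangle that these
    span, so that primitives exist on them without any topology. *)
Definition oint (P : R -> Prop) : Prop :=
  (forall x, P x -> exists d, 0 < d /\ forall y, Rabs (y - x) < d -> P y) /\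
  (forall x y z, P x -> P z -> x <= y <= z -> P y).

Definition dom (P Q : R -> Prop) (z : C) : Prop := P (Re z) /\ Q (Im z).

Lemma oint_minmax (P : R -> Prop) (a b x : R) : oint P -> P a -> P b ->
  Rmin a b <= x <= Rmax a b -> P x.
Proof.
intros [_ H] Ha Hb Hx; destruct (Rle_dec a b).
- rewrite Rmin_left, Rmax_right in Hx by lra; apply (H a x b); assumption.
- rewrite Rmin_right, Rmax_left in Hx by lra; apply (H b x a); assumption.
Qed.

Definition rects_vanish (f : C -> C) (P Q : R -> Prop) : Prop :=
  forall a b c d, a <= b -> c <= d -> P a -> P b -> Q c -> Q d -> rect f a b c d = 0.

Lemma rect_any_order (f : C -> C) (P Q : R -> Prop) (a b c d : R) : oint P -> oint Q ->
  (forall z, dom P Q z -> ccontz f z) -> rects_vanish f P Q ->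
  P a -> P b -> Q c -> Q d -> rect f a b c d = 0.
Proof.
intros OP OQ HC HR Ha Hb Hc Hd.
assert (Xh : forall y, Q y -> cex (fun x => f (x, y)) a b).
{ intros y Hy; apply cex_hline; intros x Hx; apply HC; split; simpl; [|assumption].
  apply (oint_minmax P a b); assumption. }
assert (Xv : forall x, P x -> cex (fun y => f (x, y)) c d).
{ intros y Hy; apply cex_vline; intros x Hx; apply HC; split; simpl; [assumption|].
  apply (oint_minmax Q c d); assumption. }
assert (Sh : forall y, Q y -> hint f b a y = (- hint f a b y)%C).
{ intros y Hy; apply cint_swap, Xh, Hy. }
assert (Sv : forall x, P x -> vint f x d c = (- vint f x c d)%C).
{ intros y Hy; apply cint_swap, Xv, Hy. }
destruct (Rle_dec a b); destruct (Rle_dec c d).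
- apply HR; assumption.
- assert (E := HR a b d c ltac:(lra) ltac:(lra) Ha Hb Hd Hc); unfold rect in *.
  rewrite !Sv in E by assumption.
  replace (RtoC 0) with (- (0))%C by ring; rewrite <- E; ring.
- assert (E := HR b a c d ltac:(lra) ltac:(lra) Hb Ha Hc Hd); unfold rect in *.
  rewrite !Sh in E by assumption.
  replace (RtoC 0) with (- (0))%C by ring; rewrite <- E; ring.
- assert (E := HR b a d c ltac:(lra) ltac:(lra) Hb Ha Hd Hc); unfold rect in *.
  rewrite !Sh, !Sv in E by assumption.
  rewrite <- E; ring.
Qed.

(** The primitive integrates [f] along the horizontal and then the vertical side leading
    from a base point. Vanishing of the rectangle integrals allows the increment to be
    computed along the two sides that join the two points themselves, where [f] is close to
    its value at one of them. *)
Lemma primitive_exists (f : C -> C) (P Q : R -> Prop) : oint P -> oint Q ->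
  (forall z, dom P Q z -> ccontz f z) -> rects_vanish f P Q ->
  exists F, forall z, dom P Q z -> is_cderiv F z (f z).
Proof.
intros OP OQ HC HR.
destruct (classic (exists z0, dom P Q z0)) as [[[x0 y0] [Px0 Qy0]] | N].
2:{ exists (fun _ => RtoC 0); intros z Hz; exfalso; apply N; exists z; assumption. }
simpl in Px0, Qy0.
exists (fun z => hint f x0 (Re z) y0 + Ci * vint f (Re z) y0 (Im z))%C.
intros [x y] [Px Qy]; simpl in Px, Qy.
intros e He.
destruct (HC (x, y) (conj Px Qy) (e / 2) ltac:(lra)) as [d0 [D0 B0]].
destruct (proj1 OP x Px) as [d1 [D1 B1]]; destruct (proj1 OQ y Qy) as [d2 [D2 B2]].
exists (Rmin (d0 / 2) (Rmin d1 d2)); split; [repeat apply Rmin_pos; lra|].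
intros [x1 y1] Hw.
assert (M1 := Rmin_l (d0 / 2) (Rmin d1 d2)); assert (M2 := Rmin_r (d0 / 2) (Rmin d1 d2)).
assert (M3 := Rmin_l d1 d2); assert (M4 := Rmin_r d1 d2).
assert (Rx := re_le_Cmod ((x1, y1) - (x, y))); assert (Ry := im_le_Cmod ((x1, y1) - (x, y))).
change (Rabs (x1 - x) <= Cmod ((x1, y1) - (x, y))) in Rx.
change (Rabs (y1 - y) <= Cmod ((x1, y1) - (x, y))) in Ry.
assert (Px1 : P x1) by (apply B1; lra).
assert (Qy1 : Q y1) by (apply B2; lra).
assert (Xh : forall a b y, P a -> P b -> Q y -> cex (fun x => f (x, y)) a b).
{ intros a b v Ha Hb Hy; apply cex_hline; intros u Hu; apply HC; split; simpl; [|assumption].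
  apply (oint_minmax P a b); assumption. }
assert (Xv : forall x c d, P x -> Q c -> Q d -> cex (fun y => f (x, y)) c d).
{ intros u c d Hu Hc Hd; apply cex_vline; intros v Hv; apply HC; split; simpl; [assumption|].
  apply (oint_minmax Q c d); assumption. }
simpl.
assert (R0 := rect_any_order f P Q x x1 y0 y OP OQ HC HR Px Px1 Qy0 Qy).
unfold rect in R0.
assert (E1 : hint f x0 x1 y0 = (hint f x0 x y0 + hint f x x1 y0)%C).
{ symmetry; apply cint_Chasles; apply Xh; assumption. }
assert (E2 : vint f x1 y0 y1 = (vint f x1 y0 y + vint f x1 y y1)%C).
{ symmetry; apply cint_Chasles; apply Xv; assumption. }
assert (E3 : (cint (fun t => f (t, y) - f (x, y)) x x1 = hint f x x1 y - RtoC (x1 - x) * f (x, y))%C).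
{ rewrite cint_minus, cint_const; [reflexivity | apply Xh; assumption|].
  apply cex_cont; intros; apply ccont_const. }
assert (E4 : (cint (fun t => f (x1, t) - f (x, y)) y y1 = vint f x1 y y1 - RtoC (y1 - y) * f (x, y))%C).
{ rewrite cint_minus, cint_const; [reflexivity | apply Xv; assumption|].
  apply cex_cont; intros; apply ccont_const. }
match goal with |- Cmod ?u <= _ =>
 replace u with (cint (fun t => f (t, y) - f (x, y))%C x x1 + Ci * cint (fun t => f (x1, t) - f (x, y))%C y y1)%C end.
2:{ rewrite E3, E4, E1, E2.
    assert (K : ((x1, y1) - (x, y) = RtoC (x1 - x) + Ci * RtoC (y1 - y))%C) by (Ceq; ring).
    rewrite K.
    set (h1 := hint f x x1 y) in *; set (h0 := hint f x x1 y0) in *.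
    set (v1 := vint f x1 y0 y) in *; set (v0 := vint f x y0 y) in *.
    assert (K2 : (h1 = h0 + Ci * (v1 - v0))%C).
    { transitivity (h1 + 0)%C; [ring | rewrite <- R0; ring]. }
    rewrite K2; ring. }
eapply Rle_trans; [apply Cmod_triangle|].
rewrite Cmod_mult, Cmod_Ci, Rmult_1_l.
assert (N1 : Cmod (cint (fun t => f (t, y) - f (x, y))%C x x1) <= e / 2 * Rabs (x1 - x)).
{ apply cint_bound_abs; intros t Ht.
  - apply ccont_minus; [|apply ccont_const]; apply ccont_hline, HC; split; simpl; [|assumption].
    apply (oint_minmax P x x1); assumption.
  - left; apply B0.
    eapply Rle_lt_trans; [apply Cmod_ge_components|].
    replace (y - y) with 0 by ring; rewrite Rabs_R0.
    assert (Rabs (t - x) <= Rabs (x1 - x)).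
    { revert Ht; unfold Rmin, Rmax; destruct (Rle_dec x x1); unfold Rabs;
      repeat destruct Rcase_abs; lra. }
    lra. }
assert (N2 : Cmod (cint (fun t => f (x1, t) - f (x, y))%C y y1) <= e / 2 * Rabs (y1 - y)).
{ apply cint_bound_abs; intros t Ht.
  - apply ccont_minus; [|apply ccont_const]; apply ccont_vline, HC; split; simpl; [assumption|].
    apply (oint_minmax Q y y1); assumption.
  - left; apply B0.
    eapply Rle_lt_trans; [apply Cmod_ge_components|].
    assert (Rabs (t - y) <= Rabs (y1 - y)).
    { revert Ht; unfold Rmin, Rmax; destruct (Rle_dec y y1); unfold Rabs;
      repeat destruct Rcase_abs; lra. }
    lra. }
assert (e / 2 * Rabs (x1 - x) <= e / 2 * Cmod ((x1, y1) - (x, y))) by (apply Rmult_le_compat_l; lra).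
assert (e / 2 * Rabs (y1 - y) <= e / 2 * Cmod ((x1, y1) - (x, y))) by (apply Rmult_le_compat_l; lra).
lra.
Qed.

(** * The mean value property *)

Definition cis (t : R) : C := (cos t, sin t).

Lemma rder_cis (t : R) : rder cis t (Ci * cis t)%C.
Proof.
split; simpl.
- replace (0 * cos t - 1 * sin t) with (- sin t) by ring; apply is_derive_cos.
- replace (0 * sin t + 1 * cos t) with (cos t) by ring; apply is_derive_sin.
Qed.

Lemma Cmod_cis (t : R) : Cmod (cis t) = 1.
Proof.
unfold Cmod, cis; simpl; rewrite !Rmult_1_r, <- sqrt_1 at 1; f_equal.
pose proof (sin2_cos2 t) as H; unfold Rsqr in H; lra.
Qed.

Lemma cis_neq_0 (t : R) : cis t <> 0.
Proof. apply Cmod_gt_0; rewrite Cmod_cis; lra. Qed.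

Lemma cis_opp (t : R) : (cis t * cis (- t))%C = 1.
Proof.
unfold cis; rewrite cos_neg, sin_neg; Ceq; pose proof (sin2_cos2 t) as H; unfold Rsqr in H; lra.
Qed.

Lemma rder_cis_opp (t : R) : rder (fun u => cis (- u)) t (- (Ci * cis (- t)))%C.
Proof.
apply rder_ext with (fun u => (cos u, - sin u)).
{ intros u; unfold cis; rewrite cos_neg, sin_neg; reflexivity. }
unfold cis; rewrite cos_neg, sin_neg; split; simpl.
- replace (- (0 * cos t - 1 * - sin t)) with (- sin t) by ring; apply is_derive_cos.
- replace (- (0 * - sin t + 1 * cos t)) with (- cos t) by ring.
  apply (is_derive_opp sin); apply is_derive_sin.
Qed.

Lemma ccont_cis (t : R) : ccont cis t.
Proof. eapply rder_ccont, rder_cis. Qed.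

Lemma Cmod_circle (z0 : C) (r t : R) : Cmod (z0 + RtoC r * cis t - z0) = Rabs r.
Proof.
replace (z0 + RtoC r * cis t - z0)%C with (RtoC r * cis t)%C by ring.
rewrite Cmod_mult, Cmod_cis, Cmod_R; ring.
Qed.

Lemma rder_circle_t (z0 : C) (r t : R) :
  rder (fun u => z0 + RtoC r * cis u)%C t (RtoC r * (Ci * cis t))%C.
Proof.
replace (RtoC r * (Ci * cis t))%C with (0 + (0 * cis t + RtoC r * (Ci * cis t)))%C by ring.
apply (rder_plus (fun _ => z0)); [apply rder_const|].
apply (rder_mult (fun _ => RtoC r)); [apply rder_const | apply rder_cis].
Qed.

Lemma rder_circle_r (z0 : C) (r t : R) :
  rder (fun u => z0 + RtoC u * cis t)%C r (cis t).
Proof.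
assert (K : rder (fun u => z0 + RtoC u * cis t)%C r (0 + (1 * cis t + RtoC r * 0))).
{ apply (rder_plus (fun _ => z0)); [apply rder_const|].
  apply (rder_mult (fun u => RtoC u) (fun _ => cis t)); [| apply rder_const].
  apply (rder_RtoC (fun u => u)), (is_derive_id (K := R_AbsRing)). }
replace (0 + (1 * cis t + RtoC r * 0))%C with (cis t) in K by ring; exact K.
Qed.

Lemma ccont_circle_t (z0 : C) (r t : R) : ccont (fun u => z0 + RtoC r * cis u)%C t.
Proof. eapply rder_ccont, rder_circle_t. Qed.

Lemma cont2_circle (f : C -> C) (z0 : C) (r t : R) : ccontz f (z0 + RtoC r * cis t)%C ->
  forall eps, 0 < eps -> exists d, 0 < d /\ forall u v, Rabs (u - r) < d -> Rabs (v - t) < d ->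
   Cmod (f (z0 + RtoC u * cis v) - f (z0 + RtoC r * cis t))%C < eps.
Proof.
intros H e He; destruct (H e He) as [d0 [D0 B0]].
destruct (ccont_eps_inv _ _ (ccont_cis t) (d0 / (2 * (1 + Rabs r)))) as [d1 [D1 B1]].
{ pose proof (Rabs_pos r); apply Rdiv_lt_0_compat; lra. }
exists (Rmin (d0 / 2) d1); split; [apply Rmin_pos; lra|].
intros u v Hu Hv; pose proof (Rmin_l (d0 / 2) d1); pose proof (Rmin_r (d0 / 2) d1).
apply B0.
replace (z0 + RtoC u * cis v - (z0 + RtoC r * cis t))%C with
  (RtoC (u - r) * cis v + RtoC r * (cis v - cis t))%C by (rewrite RtoC_minus; ring).
eapply Rle_lt_trans; [apply Cmod_triangle|].
rewrite !Cmod_mult, !Cmod_R, Cmod_cis, Rmult_1_r.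
specialize (B1 v ltac:(lra)).
pose proof (Rabs_pos r) as Pr; pose proof (Cmod_ge_0 (cis v - cis t)).
assert (Rabs r * Cmod (cis v - cis t) <= (1 + Rabs r) * (d0 / (2 * (1 + Rabs r)))).
{ apply Rmult_le_compat; lra. }
replace ((1 + Rabs r) * (d0 / (2 * (1 + Rabs r)))) with (d0 / 2) in H3 by (field; lra).
lra.
Qed.

(** The quotient [k u / u] has derivative [0] for [u > 0] and tends to [k' 0 = j 0]. *)
Lemma radial_constant (k j : R -> R) (R' r : R) : 0 < r < R' ->
  (forall u, Rabs u < R' -> is_derive k u (j u)) -> (forall u, Rabs u < R' -> k u = u * j u) ->
  j r = j 0.
Proof.
intros Hr Hk Hj.
assert (Cst : forall u, 0 < u < r -> k u / u = k r / r).
{ intros u Hu.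
  destruct (MVT_gen (fun x => k x / x) u r (fun _ => 0)) as [c [_ E]].
  - rewrite Rmin_left, Rmax_right by lra; intros x Hx.
    evar_last.
    + apply (is_derive_div k (fun x => x)); [apply Hk; rewrite Rabs_right; lra | apply (is_derive_id (K := R_AbsRing)) | lra].
    + rewrite (Hj x) by (rewrite Rabs_right; lra); unfold one; simpl; field; lra.
  - rewrite Rmin_left, Rmax_right by lra; intros x Hx.
    apply derivable_continuous_pt, ex_derive_Reals_0; exists ((j x * x - k x * 1) / x ^ 2).
    apply (is_derive_div k (fun x => x)); [apply Hk; rewrite Rabs_right; lra | apply (is_derive_id (K := R_AbsRing)) | lra].
  - lra. }
assert (K0 : k 0 = 0) by (rewrite Hj; [ring | rewrite Rabs_R0; lra]).
assert (E : forall e, 0 < e -> Rabs (j r - j 0) <= e).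
{ intros e He.
  assert (D := Hk 0 ltac:(rewrite Rabs_R0; lra)).
  apply is_derive_Reals in D; destruct (D e He) as [d Hd].
  pose proof (cond_pos d) as Pd.
  set (h := Rmin d r / 2).
  pose proof (Rmin_l d r); pose proof (Rmin_r d r); pose proof (Rmin_pos d r Pd ltac:(lra)).
  specialize (Hd h ltac:(unfold h; lra) ltac:(unfold h; rewrite Rabs_right; lra)).
  rewrite Rplus_0_l, K0, Rminus_0_r, (Cst h) in Hd by (unfold h; lra).
  rewrite (Hj r) in Hd by (rewrite Rabs_right; lra).
  replace (r * j r / r) with (j r) in Hd by (field; lra); lra. }
apply Rminus_diag_uniq.
destruct (Req_dec (j r - j 0) 0) as [Z | Z]; [assumption|].
specialize (E (Rabs (j r - j 0) / 2)); pose proof (Rabs_pos_lt _ Z); lra.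
Qed.

Section MeanValue.
Variables (F f : C -> C) (z0 : C) (R' : R).
Hypothesis HF : forall z, Cmod (z - z0) < R' -> is_cderiv F z (f z).
Hypothesis Hf : forall z, Cmod (z - z0) < R' -> ccontz f z.

Let J (r : R) : C := cint (fun t => f (z0 + RtoC r * cis t)%C) 0 (2 * PI).
Let K (r : R) : C := cint (fun t => F (z0 + RtoC r * cis t) * cis (- t))%C 0 (2 * PI).

Lemma ccont_circle_comp (g : C -> C) (r t : R) :
  (forall z, Cmod (z - z0) < R' -> ccontz g z) -> Rabs r < R' ->
  ccont (fun t => g (z0 + RtoC r * cis t)%C) t.
Proof.
intros H Hr; apply (ccontz_path g (fun t => z0 + RtoC r * cis t)%C); [|apply ccont_circle_t].
apply H; rewrite Cmod_circle; assumption.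
Qed.

Lemma HFc : forall z, Cmod (z - z0) < R' -> ccontz F z.
Proof. intros z Hz; eapply is_cderiv_ccontz, HF, Hz. Qed.

Lemma circle_by_parts (r : R) : Rabs r < R' -> K r = (RtoC r * J r)%C.
Proof.
intros Hr.
assert (CJ : forall t, ccont (fun t => f (z0 + RtoC r * cis t)%C) t).
{ intros t; apply ccont_circle_comp; assumption. }
assert (CK : forall t, ccont (fun t => F (z0 + RtoC r * cis t) * cis (- t))%C t).
{ intros t; apply ccont_mult; [apply ccont_circle_comp; [apply HFc | assumption]|].
  eapply rder_ccont, rder_cis_opp. }
assert (E : cint (fun t => Ci * (RtoC r * f (z0 + RtoC r * cis t) - F (z0 + RtoC r * cis t) * cis (- t)))%C
  0 (2 * PI) = 0).
{ erewrite (cint_FTC (fun t => F (z0 + RtoC r * cis t) * cis (- t))%C).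
  - unfold cis; rewrite cos_neg, sin_neg, cos_2PI, sin_2PI, Ropp_0, sin_0, cos_0; ring.
  - intros t _.
    match goal with |- rder _ _ ?u => replace u with
      ((f (z0 + RtoC r * cis t) * (RtoC r * (Ci * cis t))) * cis (- t) +
        F (z0 + RtoC r * cis t) * (- (Ci * cis (- t))))%C end.
    + apply (rder_mult (fun t => F (z0 + RtoC r * cis t))%C (fun t => cis (- t))); [|apply rder_cis_opp].
      apply (rder_path F (fun t => z0 + RtoC r * cis t)%C); [|apply rder_circle_t].
      apply HF; rewrite Cmod_circle; assumption.
    + transitivity (Ci * (RtoC r * f (z0 + RtoC r * cis t) * (cis t * cis (- t))
        - F (z0 + RtoC r * cis t) * cis (- t)))%C; [ring | rewrite cis_opp; ring].
  - intros t _; apply ccont_mult; [apply ccont_const|].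
    apply ccont_minus; [apply ccont_mult; [apply ccont_const | apply CJ] | apply CK]. }
rewrite cint_scal, cint_minus, cint_scal in E.
- fold (J r) in E; fold (K r) in E.
  assert (E' : (RtoC r * J r - K r)%C = 0).
  { replace (RtoC r * J r - K r)%C with ((- Ci) * (Ci * (RtoC r * J r - K r)))%C.
    - rewrite E; ring.
    - transitivity ((- (Ci * Ci)) * (RtoC r * J r - K r))%C; [ring|].
      replace (- (Ci * Ci))%C with (RtoC 1) by (Ceq; ring); ring. }
  transitivity (K r + (RtoC r * J r - K r))%C; [rewrite E'; ring | ring].
- apply cex_cont; intros; apply CJ.
- apply cex_scal, cex_cont; intros; apply CJ.
- apply cex_cont; intros; apply CK.
- apply cex_minus; [apply cex_scal|]; apply cex_cont; intros; [apply CJ | apply CK].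
Qed.

Lemma rder_radial (r t : R) : Rabs r < R' ->
  rder (fun r => F (z0 + RtoC r * cis t) * cis (- t))%C r (f (z0 + RtoC r * cis t)%C).
Proof.
intros Hr.
replace (f (z0 + RtoC r * cis t)%C) with ((f (z0 + RtoC r * cis t) * cis t) * cis (- t)
   + F (z0 + RtoC r * cis t) * 0)%C
 by (rewrite <- Cmult_assoc, cis_opp; ring).
apply (rder_mult (fun r => F (z0 + RtoC r * cis t))%C (fun _ => cis (- t))); [|apply rder_const].
apply (rder_path F (fun r => z0 + RtoC r * cis t)%C); [|apply rder_circle_r].
apply HF; rewrite Cmod_circle; assumption.
Qed.

Lemma near_lt_abs (r : R) : Rabs r < R' -> locally r (fun u => Rabs u < R').
Proof.
intros Hr; exists (mkposreal (R' - Rabs r) ltac:(lra)); intros u Hu.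
change (Rabs (u - r) < R' - Rabs r) in Hu.
replace u with (r + (u - r)) by ring; eapply Rle_lt_trans; [apply Rabs_triang|]; lra.
Qed.

Lemma rder_K (r : R) : Rabs r < R' -> rder K r (J r).
Proof.
intros Hr.
assert (CK : forall u t, Rabs u < R' -> ccont (fun t => F (z0 + RtoC u * cis t) * cis (- t))%C t).
{ intros u t Hu; apply ccont_mult; [apply ccont_circle_comp; [apply HFc | assumption]|].
  eapply rder_ccont, rder_cis_opp. }
split; simpl.
- rewrite (RInt_ext _ (fun t => Derive (fun u => Re (F (z0 + RtoC u * cis t) * cis (- t))%C) r)).
  2:{ intros t _; symmetry; apply is_derive_unique; exact (proj1 (rder_radial r t Hr)). }
  apply is_derive_RInt_param.
  + eapply filter_imp; [|apply near_lt_abs, Hr]; intros u Hu t _.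
    eexists; exact (proj1 (rder_radial u t Hu)).
  + intros t _; apply continuity_2d_pt_ext_loc with (fun u v => Re (f (z0 + RtoC u * cis v)%C)).
    * destruct (near_lt_abs r Hr) as [d Hd]; exists d; intros u v Hu Hv.
      symmetry; apply is_derive_unique; exact (proj1 (rder_radial u v (Hd u Hu))).
    * intros e.
      destruct (cont2_circle f z0 r t) with (eps := pos e) as [d [D B]].
      { apply Hf; rewrite Cmod_circle; assumption. }
      { apply cond_pos. }
      exists (mkposreal d D); intros u v Hu Hv.
      eapply Rle_lt_trans; [|apply (B u v Hu Hv)]; apply (re_le_Cmod (_ - _)).
  + eapply filter_imp; [|apply near_lt_abs, Hr]; intros u Hu.
    apply (cex_cont (fun t => F (z0 + RtoC u * cis t) * cis (- t))%C); intros t _; apply CK, Hu.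
- rewrite (RInt_ext _ (fun t => Derive (fun u => Im (F (z0 + RtoC u * cis t) * cis (- t))%C) r)).
  2:{ intros t _; symmetry; apply is_derive_unique; exact (proj2 (rder_radial r t Hr)). }
  apply is_derive_RInt_param.
  + eapply filter_imp; [|apply near_lt_abs, Hr]; intros u Hu t _.
    eexists; exact (proj2 (rder_radial u t Hu)).
  + intros t _; apply continuity_2d_pt_ext_loc with (fun u v => Im (f (z0 + RtoC u * cis v)%C)).
    * destruct (near_lt_abs r Hr) as [d Hd]; exists d; intros u v Hu Hv.
      symmetry; apply is_derive_unique; exact (proj2 (rder_radial u v (Hd u Hu))).
    * intros e.
      destruct (cont2_circle f z0 r t) with (eps := pos e) as [d [D B]].
      { apply Hf; rewrite Cmod_circle; assumption. }
      { apply cond_pos. }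
      exists (mkposreal d D); intros u v Hu Hv.
      eapply Rle_lt_trans; [|apply (B u v Hu Hv)]; apply (im_le_Cmod (_ - _)).
  + eapply filter_imp; [|apply near_lt_abs, Hr]; intros u Hu.
    apply (cex_cont (fun t => F (z0 + RtoC u * cis t) * cis (- t))%C); intros t _; apply CK, Hu.
Qed.

(** With [J r] the integral of [f] over the circle of radius [r] in the angle [t], and [K r]
    that of [F cis(-t)], differentiation under the integral gives [K' = J] and integration by
    parts gives [K r = r J r], so that [J] is constant in [r]. *)
Lemma mean_value_primitive (r : R) : 0 < r < R' ->
  cint (fun t => f (z0 + RtoC r * cis t)%C) 0 (2 * PI) = (RtoC (2 * PI) * f z0)%C.
Proof.
intros Hr; change (J r = RtoC (2 * PI) * f z0)%C.
assert (J0 : J 0 = (RtoC (2 * PI) * f z0)%C).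
{ unfold J; transitivity (cint (fun _ => f z0) 0 (2 * PI)).
  - apply cint_ext; intros t _; f_equal; ring.
  - rewrite cint_const; do 2 f_equal; ring. }
rewrite <- J0; apply injective_projections.
- apply (radial_constant (fun u => Re (K u)) (fun u => Re (J u)) R' r Hr).
  + intros u Hu; apply (rder_K u Hu).
  + intros u Hu; rewrite circle_by_parts by assumption; simpl; unfold Re; ring.
- apply (radial_constant (fun u => Im (K u)) (fun u => Im (J u)) R' r Hr).
  + intros u Hu; apply (rder_K u Hu).
  + intros u Hu; rewrite circle_by_parts by assumption; simpl; unfold Im; ring.
Qed.

End MeanValue.

(** * Cauchy's formulas and limits of holomorphic functions *)

Definition near (a R x : R) : Prop := Rabs (x - a) < R.
Definition sq (z0 : C) (R : R) : C -> Prop := dom (near (Re z0) R) (near (Im z0) R).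

Lemma oint_near (a R : R) : oint (near a R).
Proof.
split.
- intros x Hx; unfold near in *; exists (R - Rabs (x - a)); split; [lra|]; intros y Hy.
  replace (y - a) with ((y - x) + (x - a)) by ring; eapply Rle_lt_trans; [apply Rabs_triang|]; lra.
- intros x y z Hx Hz Hxyz; unfold near in *.
  apply Rabs_def2 in Hx; apply Rabs_def2 in Hz; apply Rabs_def1; lra.
Qed.

Lemma disc_sq (z0 z : C) (R : R) : Cmod (z - z0) < R -> sq z0 R z.
Proof.
intros H; split; unfold near.
- eapply Rle_lt_trans; [apply (re_le_Cmod (z - z0)) | assumption].
- eapply Rle_lt_trans; [apply (im_le_Cmod (z - z0)) | assumption].
Qed.

Lemma sq_disc (z0 z : C) (R : R) : sq z0 R z -> Cmod (z - z0) < 2 * R.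
Proof.
intros [H1 H2]; unfold near in *; eapply Rle_lt_trans; [apply Cmod_le_Re_Im|].
change (Rabs (Re z - Re z0) + Rabs (Im z - Im z0) < 2 * R); lra.
Qed.

Lemma sq_center (z0 : C) (R : R) : 0 < R -> sq z0 R z0.
Proof. intros H; apply disc_sq; replace (z0 - z0)%C with (RtoC 0) by ring; rewrite Cmod_0; assumption. Qed.

Lemma dom_open (P Q : R -> Prop) (z : C) : oint P -> oint Q -> dom P Q z ->
  exists d, 0 < d /\ forall w, sq z d w -> dom P Q w.
Proof.
intros [OP _] [OQ _] [HP HQ].
destruct (OP _ HP) as [d1 [D1 B1]]; destruct (OQ _ HQ) as [d2 [D2 B2]].
exists (Rmin d1 d2); split; [apply Rmin_pos; assumption|].
intros w [W1 W2]; unfold near in *; pose proof (Rmin_l d1 d2); pose proof (Rmin_r d1 d2).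
split; [apply B1 | apply B2]; lra.
Qed.

Lemma sq_open (z0 z : C) (R : R) : sq z0 R z -> exists d, 0 < d /\ forall w, sq z d w -> sq z0 R w.
Proof. apply dom_open; apply oint_near. Qed.

Lemma rcont_dom (f : C -> C) (P Q : R -> Prop) (a b c d : R) : oint P -> oint Q ->
  (forall z, dom P Q z -> ccontz f z) -> P a -> P b -> Q c -> Q d -> rcont f a b c d.
Proof.
intros [_ OP] [_ OQ] H Ha Hb Hc Hd x y Hx Hy; apply H; split; simpl;
[apply (OP a x b) | apply (OQ c y d)]; assumption.
Qed.

Lemma rects_vanish_hol (f : C -> C) (P Q : R -> Prop) (p : C) : oint P -> oint Q ->
  (forall z, dom P Q z -> ccontz f z) -> (forall z, dom P Q z -> z <> p -> hol f z) ->
  rects_vanish f P Q.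
Proof.
intros OP OQ HC HH a b c d Hab Hcd Ha Hb Hc Hd.
apply goursat_except with p; try assumption.
- apply (rcont_dom f P Q); assumption.
- intros x y Hx Hy N; apply HH; [|assumption]; split; simpl;
  [apply (proj2 OP a x b) | apply (proj2 OQ c y d)]; assumption.
Qed.

Lemma mean_value (f : C -> C) (z0 p : C) (r R : R) : 0 < r < R ->
  (forall z, sq z0 R z -> ccontz f z) -> (forall z, sq z0 R z -> z <> p -> hol f z) ->
  cint (fun t => f (z0 + RtoC r * cis t)%C) 0 (2 * PI) = (RtoC (2 * PI) * f z0)%C.
Proof.
intros Hr HC HH.
destruct (primitive_exists f (near (Re z0) R) (near (Im z0) R)) as [F HF];
 try apply oint_near; try assumption.
{ apply rects_vanish_hol with p; try apply oint_near; assumption. }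
apply (mean_value_primitive F f z0 R); try assumption; intros z Hz.
- apply HF, disc_sq, Hz.
- apply HC, disc_sq, Hz.
Qed.

Lemma ccontz_local (f g : C -> C) (z : C) (d : R) : 0 < d ->
  (forall w, Cmod (w - z) < d -> f w = g w) -> ccontz f z -> ccontz g z.
Proof.
intros D E H eps He.
destruct (H eps He) as [d1 [D1 H1]].
exists (Rmin d d1); split; [apply Rmin_pos; assumption|].
intros w Hw; pose proof (Rmin_l d d1); pose proof (Rmin_r d d1).
rewrite <- !E; [apply H1; lra | | lra].
replace (z - z)%C with (RtoC 0) by ring; rewrite Cmod_0; assumption.
Qed.

Lemma hol_local (f g : C -> C) (z : C) (d : R) : 0 < d ->
  (forall w, Cmod (w - z) < d -> f w = g w) -> hol f z -> hol g z.
Proof. intros D E [l H]; exists l; eapply is_cderiv_local; eassumption. Qed.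

Lemma Cminus_neq_0 (z w : C) : z <> w -> (z - w)%C <> 0.
Proof. intros N E; apply N; rewrite <- (Cplus_0_l w), <- E; ring. Qed.

(** Dividing out a zero at [a] within holomorphic functions: the value at [a] is the one that
    makes the quotient continuous, hence holomorphic ([slope_hol]). *)
Definition slope (f : C -> C) (a z : C) : C :=
  if excluded_middle_informative (z = a) then cder f a else ((f z - f a) / (z - a))%C.

Lemma slope_neq (f : C -> C) (a z : C) : z <> a -> slope f a z = ((f z - f a) / (z - a))%C.
Proof. intros N; unfold slope; destruct (excluded_middle_informative (z = a)); [contradiction | reflexivity]. Qed.

Lemma slope_at (f : C -> C) (a : C) : slope f a a = cder f a.
Proof. unfold slope; destruct (excluded_middle_informative (a = a)); [reflexivity | contradiction]. Qed.

Lemma slope_mult (f : C -> C) (a z : C) : (slope f a z * (z - a))%C = (f z - f a)%C.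
Proof.
destruct (classic (z = a)) as [-> | N]; [ring|].
rewrite slope_neq by assumption; field; apply Cminus_neq_0, N.
Qed.

Lemma slope_hol_off (f : C -> C) (a z : C) : z <> a -> hol f z -> hol (slope f a) z.
Proof.
intros N H.
apply (hol_local (fun w => (f w - f a) / (w - a))%C _ z (Cmod (z - a))).
- apply Cmod_gt_0, Cminus_neq_0, N.
- intros w Hw; rewrite slope_neq; [reflexivity|]; intros ->; rewrite Cmod_minus_sym in Hw; lra.
- apply (hol_div (fun w => f w - f a)%C (fun w => w - a)%C).
  + apply Cminus_neq_0, N.
  + apply hol_minus; [assumption | apply hol_const].
  + apply hol_sub_const.
Qed.

Lemma slope_ccontz (f : C -> C) (a z : C) : hol f a -> ccontz f z -> ccontz (slope f a) z.
Proof.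
intros Ha Hz; destruct (classic (z = a)) as [-> | N].
- apply cder_correct in Ha; apply is_cderiv_quot in Ha; destruct Ha as [q [E [Q Hq]]].
  apply ccontz_ext with q; [|assumption].
  intros w; destruct (classic (w = a)) as [-> | N]; [rewrite slope_at; assumption|].
  rewrite slope_neq by assumption; rewrite (Hq w); field; apply Cminus_neq_0, N.
- apply (ccontz_local (fun w => (f w - f a) * / (w - a))%C _ z (Cmod (z - a))).
  + apply Cmod_gt_0, Cminus_neq_0, N.
  + intros w Hw; rewrite slope_neq; [reflexivity|]; intros ->; rewrite Cmod_minus_sym in Hw; lra.
  + apply ccontz_mult.
    * apply (ccontz_plus f (fun _ => - f a)%C); [assumption | apply ccontz_const].
    * apply (ccontz_inv (fun w => w - a)%C); [apply Cminus_neq_0, N|].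
      apply (ccontz_plus (fun w => w) (fun _ => - a)%C); [apply ccontz_id | apply ccontz_const].
Qed.

Lemma two_PI_pos : 0 < 2 * PI.
Proof. pose proof PI_RGT_0; lra. Qed.

Lemma cint_cis_opp : cint (fun t => cis (- t)) 0 (2 * PI) = 0.
Proof.
rewrite (cint_FTC (fun t => Ci * cis (- t))%C).
- unfold cis; rewrite cos_neg, sin_neg, cos_2PI, sin_2PI, Ropp_0, sin_0, cos_0; ring.
- intros t _.
  assert (K : rder (fun t => Ci * cis (- t))%C t (0 * cis (- t) + Ci * (- (Ci * cis (- t))))).
  { apply (rder_mult (fun _ => Ci) (fun t => cis (- t))); [apply rder_const | apply rder_cis_opp]. }
  replace (0 * cis (- t) + Ci * (- (Ci * cis (- t))))%C with (cis (- t)) in K; [exact K|].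
  transitivity ((- (Ci * Ci)) * cis (- t))%C; [|ring].
  replace (- (Ci * Ci))%C with (RtoC 1) by (Ceq; ring); ring.
- intros t _; eapply rder_ccont, rder_cis_opp.
Qed.

Lemma RtoC_neq_0 (r : R) : r <> 0 -> RtoC r <> 0.
Proof. intros N E; apply N; injection E; auto. Qed.

Lemma circle_ccont (f : C -> C) (z0 : C) (r R t : R) : 0 < r < R ->
  (forall z, sq z0 R z -> ccontz f z) -> ccont (fun t => f (z0 + RtoC r * cis t)%C) t.
Proof.
intros Hr H; apply (ccontz_path f (fun t => z0 + RtoC r * cis t)%C); [|apply ccont_circle_t].
apply H, disc_sq; rewrite Cmod_circle, Rabs_right by lra; lra.
Qed.

(** The mean value property of the difference quotient at [z0], whose central value is
    the derivative; the constant [f z0] integrates to zero against [cis (- t)]. *)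
Lemma cauchy_derivative (f : C -> C) (z0 : C) (r R : R) : 0 < r < R ->
  (forall z, sq z0 R z -> hol f z) ->
  (RtoC (2 * PI * r) * cder f z0)%C = cint (fun t => f (z0 + RtoC r * cis t) * cis (- t))%C 0 (2 * PI).
Proof.
intros Hr H.
assert (HC : forall z, sq z0 R z -> ccontz f z) by (intros; apply hol_ccontz; auto).
assert (H0 : hol f z0) by (apply H, sq_center; lra).
assert (E := mean_value (slope f z0) z0 z0 r R Hr).
rewrite slope_at in E.
rewrite RtoC_mult; transitivity (RtoC r * (RtoC (2 * PI) * cder f z0))%C; [ring|].
rewrite <- E.
2:{ intros z Hz; apply slope_ccontz; auto. }
2:{ intros z Hz N; apply slope_hol_off; auto. }
rewrite <- cint_scal.
2:{ apply cex_cont; intros t _; apply circle_ccont with R; [assumption|];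
    intros; apply slope_ccontz; auto. }
rewrite (cint_ext _ (fun t => f (z0 + RtoC r * cis t) * cis (- t) - f z0 * cis (- t))%C).
- rewrite cint_minus, cint_scal, cint_cis_opp.
  + ring.
  + apply cex_cont; intros; eapply rder_ccont, rder_cis_opp.
  + apply cex_cont; intros t _; apply ccont_mult; [apply circle_ccont with R; assumption|].
    eapply rder_ccont, rder_cis_opp.
  + apply cex_scal, cex_cont; intros; eapply rder_ccont, rder_cis_opp.
- intros t _.
  assert (Nr : RtoC r <> 0) by (apply RtoC_neq_0; lra).
  rewrite slope_neq.
  2:{ intros K; apply (Cmult_neq_0 (RtoC r) (cis t) Nr (cis_neq_0 t)).
      transitivity (z0 + RtoC r * cis t - z0)%C; [ring | rewrite K; ring]. }
  replace (z0 + RtoC r * cis t - z0)%C with (RtoC r * cis t)%C by ring.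
  replace (cis (- t)) with (/ cis t)%C.
  + field; split; [apply cis_neq_0 | assumption].
  + rewrite <- (Cmult_1_r (/ cis t)), <- (cis_opp t); field; apply cis_neq_0.
Qed.

Lemma circle_cint_bound (g : R -> C) (M : R) :
  (forall t, ccont g t) -> (forall t, Cmod (g t) <= M) -> Cmod (cint g 0 (2 * PI)) <= M * (2 * PI).
Proof.
intros Hc H; pose proof two_PI_pos.
eapply Rle_trans; [apply (cint_bound_const g M); [lra | | intros; apply H]|].
- apply cex_cont; intros; apply Hc.
- right; ring.
Qed.

Lemma cauchy_estimate (f : C -> C) (z0 : C) (r R M : R) : 0 < r < R ->
  (forall z, sq z0 R z -> hol f z) -> (forall z, Cmod (z - z0) = r -> Cmod (f z) <= M) ->
  Cmod (cder f z0) <= M / r.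
Proof.
intros Hr H HM.
assert (B : Cmod (RtoC (2 * PI * r) * cder f z0) <= M * (2 * PI)).
{ rewrite (cauchy_derivative f z0 r R Hr H).
  apply circle_cint_bound; intros t.
  - apply ccont_mult; [apply circle_ccont with R; [assumption | intros; apply hol_ccontz; auto]|].
    eapply rder_ccont, rder_cis_opp.
  - rewrite Cmod_mult, Cmod_cis, Rmult_1_r; apply HM; rewrite Cmod_circle, Rabs_right; lra. }
pose proof two_PI_pos as P.
rewrite Cmod_mult, Cmod_R, Rabs_right in B by (apply Rle_ge, Rlt_le, Rmult_lt_0_compat; lra).
apply Rmult_le_reg_l with (2 * PI * r); [apply Rmult_lt_0_compat; lra|].
eapply Rle_trans; [exact B|]; right; field; lra.
Qed.

Lemma lipschitz_path (g g' : R -> C) (a b L : R) : a <= b ->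
  (forall t, a <= t <= b -> rder g t (g' t)) -> (forall t, a <= t <= b -> Cmod (g' t) <= L) ->
  Cmod (g b - g a) <= 2 * L * (b - a).
Proof.
intros Hab D B.
assert (Rr : forall h h' : R -> R, (forall t, a <= t <= b -> is_derive h t (h' t)) ->
  (forall t, a <= t <= b -> Rabs (h' t) <= L) -> Rabs (h b - h a) <= L * (b - a)).
{ intros h h' Hd Hb.
  destruct (MVT_gen h a b h') as [c [Hc E]].
  - rewrite Rmin_left, Rmax_right by lra; intros; apply Hd; lra.
  - rewrite Rmin_left, Rmax_right by lra; intros.
    apply derivable_continuous_pt, ex_derive_Reals_0; eexists; apply Hd; lra.
  - rewrite Rmin_left, Rmax_right in Hc by lra.
    rewrite E, Rabs_mult, (Rabs_right (b - a)) by lra.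
    apply Rmult_le_compat_r; [lra | apply Hb; lra]. }
assert (R1 := Rr (fun t => Re (g t)) _ (fun t Ht => proj1 (D t Ht))
   (fun t Ht => Rle_trans _ _ _ (re_le_Cmod _) (B t Ht))).
assert (R2 := Rr (fun t => Im (g t)) _ (fun t Ht => proj2 (D t Ht))
   (fun t Ht => Rle_trans _ _ _ (im_le_Cmod _) (B t Ht))).
eapply Rle_trans; [apply Cmod_le_Re_Im|].
change (Rabs (Re (g b) - Re (g a)) + Rabs (Im (g b) - Im (g a)) <= 2 * L * (b - a)); lra.
Qed.

Lemma lipschitz_segment (f : C -> C) (z w : C) (L : R) :
  (forall t, 0 <= t <= 1 -> hol f (w + RtoC t * (z - w))%C) ->
  (forall t, 0 <= t <= 1 -> Cmod (cder f (w + RtoC t * (z - w))) <= L) ->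
  Cmod (f z - f w) <= 2 * L * Cmod (z - w).
Proof.
intros H HL.
set (g := fun t => (w + RtoC t * (z - w))%C).
assert (K : forall t, rder g t (z - w)%C).
{ intros t.
  assert (K : rder g t (0 + (1 * (z - w) + RtoC t * 0))).
  { apply (rder_plus (fun _ => w)); [apply rder_const|].
    apply (rder_mult (fun t => RtoC t) (fun _ => z - w)%C); [|apply rder_const].
    apply (rder_RtoC (fun u => u)), (is_derive_id (K := R_AbsRing)). }
  replace (0 + (1 * (z - w) + RtoC t * 0))%C with (z - w)%C in K by ring; exact K. }
assert (B := lipschitz_path (fun t => f (g t)) (fun t => cder f (g t) * (z - w))%C 0 1 (L * Cmod (z - w))).
cbv beta in B; replace (g 1) with z in B by (unfold g; ring); replace (g 0) with w in B by (unfold g; ring).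
eapply Rle_trans; [apply B; [lra | |] | right; ring].
- intros t Ht; apply (rder_path f g); [apply cder_correct, H, Ht | apply K].
- intros t Ht; rewrite Cmod_mult; apply Rmult_le_compat_r; [apply Cmod_ge_0 | apply HL, Ht].
Qed.

Lemma seg_in_disc (z0 z w : C) (r t : R) : 0 <= t <= 1 -> Cmod (z - z0) < r -> Cmod (w - z0) < r ->
  Cmod (w + RtoC t * (z - w) - z0) < r.
Proof.
intros Ht Hz Hw.
replace (w + RtoC t * (z - w) - z0)%C with (RtoC (1 - t) * (w - z0) + RtoC t * (z - z0))%C
  by (rewrite RtoC_minus; ring).
eapply Rle_lt_trans; [apply Cmod_triangle|].
rewrite !Cmod_mult, !Cmod_R, !Rabs_right by lra.
destruct (Req_dec t 0) as [-> | N]; [lra|].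
assert (t * Cmod (z - z0) < t * r) by (apply Rmult_lt_compat_l; lra).
assert ((1 - t) * Cmod (w - z0) <= (1 - t) * r) by (apply Rmult_le_compat_l; lra).
lra.
Qed.

(** Cauchy's formula expresses [f'] through [f] on a circle of fixed radius; this
    makes [f'] Lipschitz, whence a quadratic Taylor bound for [f] that may be
    integrated over the circle. *)
Lemma hol_cder (f : C -> C) (z0 : C) (R : R) : 0 < R ->
  (forall z, sq z0 R z -> hol f z) -> hol (cder f) z0.
Proof.
intros HR H.
destruct (hol_ccontz f z0 (H z0 (sq_center z0 R HR)) 1 ltac:(lra)) as [d [D B]].
set (M := Cmod (f z0) + 1).
assert (HM : forall z, Cmod (z - z0) < d -> Cmod (f z) <= M).
{ intros z Hz; specialize (B z Hz).
  pose proof (Cmod_triangle_rev (f z) (f z0)); unfold M; lra. }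
assert (M0 : 0 < M) by (unfold M; pose proof (Cmod_ge_0 (f z0)); lra).
(* Circles of radius up to [2 rho] about points within [3 rho] of [z0] stay in the region
   where [f] is holomorphic and bounded by [M]. *)
set (rho := Rmin R d / 8).
assert (R0 : 0 < rho) by (unfold rho; pose proof (Rmin_pos R d HR D); lra).
assert (R1 : 8 * rho <= R) by (unfold rho; pose proof (Rmin_l R d); lra).
assert (R2 : 8 * rho <= d) by (unfold rho; pose proof (Rmin_r R d); lra).
assert (Sub : forall z w, Cmod (z - z0) < 3 * rho -> sq z (2 * rho) w -> sq z0 R w).
{ intros z w Hz Hw; apply disc_sq.
  replace (w - z0)%C with ((w - z) + (z - z0))%C by ring.
  apply sq_disc in Hw; eapply Rle_lt_trans; [apply Cmod_triangle|]; lra. }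
assert (HH : forall z, Cmod (z - z0) < 3 * rho -> forall w, sq z (2 * rho) w -> hol f w).
{ intros z Hz w Hw; eapply H, Sub; eassumption. }
assert (Hd : forall z, Cmod (z - z0) < 3 * rho -> hol f z).
{ intros z Hz; apply (HH z Hz), sq_center; lra. }
assert (A : forall z, Cmod (z - z0) < 3 * rho -> Cmod (cder f z) <= M / rho).
{ intros z Hz; apply cauchy_estimate with (2 * rho); [lra | apply HH, Hz|].
  intros w Hw; apply HM.
  replace (w - z0)%C with ((w - z) + (z - z0))%C by ring.
  eapply Rle_lt_trans; [apply Cmod_triangle|]; lra. }
assert (LB : forall z w, Cmod (z - z0) < 3 * rho -> Cmod (w - z0) < 3 * rho ->
  Cmod (f z - f w) <= 2 * (M / rho) * Cmod (z - w)).
{ intros z w Hz Hw; apply lipschitz_segment; intros t Ht; [apply Hd | apply A];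
  apply seg_in_disc; assumption. }
set (L2 := 2 * (M / rho) / rho).
assert (L20 : 0 < L2).
{ assert (0 < M / rho) by (apply Rdiv_lt_0_compat; assumption).
  unfold L2; apply Rdiv_lt_0_compat; [lra | assumption]. }
assert (CF : forall z, Cmod (z - z0) < 2 * rho ->
  cder f z = (RtoC (/ (2 * PI * rho)) * cint (fun t => f (z + RtoC rho * cis t) * cis (- t)) 0 (2 * PI))%C).
{ intros z Hz; rewrite <- (cauchy_derivative f z rho (2 * rho)); [|lra | apply HH; lra].
  pose proof two_PI_pos.
  assert (2 * PI * rho <> 0) by (apply Rmult_integral_contrapositive_currified; lra).
  rewrite RtoC_inv by assumption; field; apply RtoC_neq_0; assumption. }
assert (XC : forall g z, (forall w, Cmod (w - z0) < 3 * rho -> ccontz g w) -> Cmod (z - z0) < 2 * rho ->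
   forall t, ccont (fun t => g (z + RtoC rho * cis t) * cis (- t))%C t).
{ intros g z Hg Hz t; apply ccont_mult; [|eapply rder_ccont, rder_cis_opp].
  apply (ccontz_path g (fun t => z + RtoC rho * cis t)%C); [|apply ccont_circle_t].
  apply Hg.
  replace (z + RtoC rho * cis t - z0)%C with ((z + RtoC rho * cis t - z) + (z - z0))%C by ring.
  eapply Rle_lt_trans; [apply Cmod_triangle|]; rewrite Cmod_circle, Rabs_right; lra. }
assert (CS : forall z t, Cmod (z - z0) < 2 * rho -> Cmod (z + RtoC rho * cis t - z0) < 3 * rho).
{ intros z t Hz; replace (z + RtoC rho * cis t - z0)%C with ((z + RtoC rho * cis t - z) + (z - z0))%C by ring.
  eapply Rle_lt_trans; [apply Cmod_triangle|]; rewrite Cmod_circle, Rabs_right; lra. }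
assert (AV : forall g K, (forall t, ccont g t) -> (forall t, Cmod (g t) <= K) ->
   Cmod (RtoC (/ (2 * PI * rho)) * cint g 0 (2 * PI)) <= K / rho).
{ intros g K Hg HK; pose proof two_PI_pos as TP.
  assert (P2 : 0 < 2 * PI * rho) by (apply Rmult_lt_0_compat; lra).
  rewrite Cmod_mult, Cmod_R, Rabs_right by (apply Rle_ge, Rlt_le, Rinv_0_lt_compat, P2).
  apply Rmult_le_reg_l with (2 * PI * rho); [assumption|].
  rewrite <- Rmult_assoc, Rinv_r, Rmult_1_l by lra.
  eapply Rle_trans; [apply circle_cint_bound; eassumption|]; right; field; lra. }
assert (CFc : forall w, Cmod (w - z0) < 3 * rho -> ccontz f w) by (intros; apply hol_ccontz; auto).
assert (LD : forall z w, Cmod (z - z0) < 2 * rho -> Cmod (w - z0) < 2 * rho ->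
  Cmod (cder f z - cder f w) <= L2 * Cmod (z - w)).
{ intros z w Hz Hw.
  rewrite (CF z Hz), (CF w Hw).
  match goal with |- Cmod ?u <= _ => replace u with (RtoC (/ (2 * PI * rho)) *
    cint (fun t => f (z + RtoC rho * cis t) * cis (- t) - f (w + RtoC rho * cis t) * cis (- t)) 0 (2 * PI))%C end.
  2:{ rewrite cint_minus; [ring | |]; apply cex_cont; intros t _; apply XC; assumption. }
  replace (L2 * Cmod (z - w)) with ((2 * (M / rho) * Cmod (z - w)) / rho) by (unfold L2; field; lra).
  apply AV; intros t.
  - apply ccont_minus; apply XC; assumption.
  - replace (f (z + RtoC rho * cis t) * cis (- t) - f (w + RtoC rho * cis t) * cis (- t))%C with
     ((f (z + RtoC rho * cis t) - f (w + RtoC rho * cis t)) * cis (- t))%C by ring.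
    rewrite Cmod_mult, Cmod_cis, Rmult_1_r.
    eapply Rle_trans; [apply LB; apply CS; assumption|].
    right; f_equal; f_equal; ring. }
assert (TL : forall z w, Cmod (z - z0) < 2 * rho -> Cmod (w - z0) < 2 * rho ->
  Cmod (f w - f z - cder f z * (w - z)) <= 2 * (L2 * Cmod (w - z)) * Cmod (w - z)).
{ intros z w Hz Hw.
  replace (f w - f z - cder f z * (w - z))%C with
    ((f w - cder f z * w) - (f z - cder f z * z))%C by ring.
  assert (DD : forall u, Cmod (u - z0) < 2 * rho ->
     is_cderiv (fun u => f u - cder f z * u)%C u (cder f u - cder f z * 1)%C).
  { intros u Hu; apply (is_cderiv_minus f (fun u => cder f z * u)%C).
    - apply cder_correct, Hd; lra.
    - apply is_cderiv_scal, is_cderiv_id. }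
  apply (lipschitz_segment (fun u => f u - cder f z * u)%C w z); intros t Ht.
  - eexists; apply DD, seg_in_disc; assumption.
  - rewrite (cder_eq _ _ _ (DD _ (seg_in_disc z0 w z (2 * rho) t Ht Hw Hz))).
    rewrite Cmult_1_r; eapply Rle_trans; [apply LD; [apply seg_in_disc|]; assumption|].
    apply Rmult_le_compat_l; [lra|].
    replace (z + RtoC t * (w - z) - z)%C with (RtoC t * (w - z))%C by ring.
    rewrite Cmod_mult, Cmod_R, Rabs_right by lra.
    pose proof (Cmod_ge_0 (w - z)); nra. }
(* Cauchy's formula differentiated under the integral sign. *)
set (l := (RtoC (/ (2 * PI * rho)) * cint (fun t => cder f (z0 + RtoC rho * cis t) * cis (- t)) 0 (2 * PI))%C).
assert (Cz0 : Cmod (z0 - z0) < rho) by (replace (z0 - z0)%C with (RtoC 0) by ring; rewrite Cmod_0; assumption).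
assert (CD : forall w, Cmod (w - z0) < 2 * rho -> ccontz (cder f) w).
{ intros w Hw e He.
  exists (Rmin (2 * rho - Cmod (w - z0)) (e / L2)); split.
  - apply Rmin_pos; [lra | apply Rdiv_lt_0_compat; assumption].
  - intros u Hu.
    pose proof (Rmin_l (2 * rho - Cmod (w - z0)) (e / L2)).
    pose proof (Rmin_r (2 * rho - Cmod (w - z0)) (e / L2)).
    eapply Rle_lt_trans; [apply LD; [|assumption]|].
    + replace (u - z0)%C with ((u - w) + (w - z0))%C by ring.
      eapply Rle_lt_trans; [apply Cmod_triangle|]; lra.
    + apply Rlt_le_trans with (L2 * (e / L2)); [apply Rmult_lt_compat_l; lra | right; field; lra]. }
exists l; intros e He.
exists (Rmin (rho / 2) (e * rho / (2 * L2))); split.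
{ apply Rmin_pos; [lra | apply Rdiv_lt_0_compat; [apply Rmult_lt_0_compat; assumption | lra]]. }
intros w Hw.
pose proof (Rmin_l (rho / 2) (e * rho / (2 * L2))) as W1.
pose proof (Rmin_r (rho / 2) (e * rho / (2 * L2))) as W2.
assert (XD : forall t, ccont (fun t => cder f (z0 + RtoC rho * cis t) * cis (- t))%C t).
{ intros t; apply ccont_mult; [|eapply rder_ccont, rder_cis_opp].
  apply (ccontz_path (cder f) (fun t => z0 + RtoC rho * cis t)%C); [|apply ccont_circle_t].
  apply CD; rewrite Cmod_circle, Rabs_right; lra. }
rewrite (CF w), (CF z0) by lra.
match goal with |- Cmod ?u <= _ => replace u with (RtoC (/ (2 * PI * rho)) *
    cint (fun t => (f (w + RtoC rho * cis t) * cis (- t) - f (z0 + RtoC rho * cis t) * cis (- t))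
       - (w - z0) * (cder f (z0 + RtoC rho * cis t) * cis (- t))) 0 (2 * PI))%C end.
2:{ rewrite !cint_minus, cint_scal.
    - unfold l; ring.
    - apply cex_cont; intros t _; apply XD.
    - apply cex_cont; intros t _; apply XC; [assumption | lra].
    - apply cex_cont; intros t _; apply XC; [assumption | lra].
    - apply cex_minus; apply cex_cont; intros t _; apply XC; try assumption; lra.
    - apply cex_scal, cex_cont; intros t _; apply XD. }
apply Rle_trans with ((2 * (L2 * Cmod (w - z0)) * Cmod (w - z0)) / rho).
- apply AV; intros t.
  + apply ccont_minus; [apply ccont_minus; apply XC; try assumption; lra|].
    apply ccont_mult; [apply ccont_const | apply XD].
  + set (zt := (z0 + RtoC rho * cis t)%C); set (wt := (w + RtoC rho * cis t)%C).
    replace (f wt * cis (- t) - f zt * cis (- t) - (w - z0) * (cder f zt * cis (- t)))%C with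
     ((f wt - f zt - cder f zt * (wt - zt)) * cis (- t))%C by (unfold wt, zt; ring).
    rewrite Cmod_mult, Cmod_cis, Rmult_1_r.
    replace (w - z0)%C with (wt - zt)%C by (unfold wt, zt; ring).
    assert (Q : Cmod (zt - z0) = rho) by (unfold zt; rewrite Cmod_circle, Rabs_right; lra).
    apply TL; [lra|].
    replace (wt - z0)%C with ((w - z0) + (zt - z0))%C by (unfold wt, zt; ring).
    eapply Rle_lt_trans; [apply Cmod_triangle|]; lra.
- pose proof (Cmod_ge_0 (w - z0)) as P0.
  replace (2 * (L2 * Cmod (w - z0)) * Cmod (w - z0) / rho) with
    ((2 * L2 / rho * Cmod (w - z0)) * Cmod (w - z0)) by (field; lra).
  apply Rmult_le_compat_r; [assumption|].
  apply Rle_trans with (2 * L2 / rho * (e * rho / (2 * L2))); [|right; field; lra].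
  apply Rmult_le_compat_l; [|lra].
  apply Rlt_le, Rdiv_lt_0_compat; lra.
Qed.

(** A continuous function with vanishing rectangle integrals is the derivative of its
    primitive, and derivatives are holomorphic. *)
Lemma morera (f : C -> C) (P Q : R -> Prop) : oint P -> oint Q ->
  (forall z, dom P Q z -> ccontz f z) -> rects_vanish f P Q ->
  forall z, dom P Q z -> hol f z.
Proof.
intros OP OQ HC HR z Hz.
destruct (primitive_exists f P Q OP OQ HC HR) as [F HF].
destruct (dom_open P Q z OP OQ Hz) as [d [D Hd]].
apply hol_local with (f := cder F) (d := d); [assumption | |].
- intros w Hw; apply cder_eq, HF, Hd, disc_sq, Hw.
- apply hol_cder with d; [assumption|]; intros w Hw; eexists; apply HF, Hd, Hw.
Qed.

(** Goursat's theorem tolerates one point of mere continuity; Morera's criterion then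
    makes that point an ordinary one. *)
Lemma removable (f : C -> C) (P Q : R -> Prop) (p : C) : oint P -> oint Q ->
  (forall z, dom P Q z -> ccontz f z) -> (forall z, dom P Q z -> z <> p -> hol f z) ->
  forall z, dom P Q z -> hol f z.
Proof.
intros OP OQ HC HH; apply morera; try assumption.
apply rects_vanish_hol with p; assumption.
Qed.

Lemma slope_hol (f : C -> C) (a z : C) (d : R) : 0 < d ->
  (forall w, sq a d w -> hol f w) -> hol f z -> hol (slope f a) z.
Proof.
intros D H Hz; destruct (classic (z = a)) as [-> | N]; [|apply slope_hol_off; assumption].
apply (removable (slope f a) (near (Re a) d) (near (Im a) d) a); try apply oint_near.
- intros w Hw; apply slope_ccontz; [assumption | apply hol_ccontz, H, Hw].
- intros w Hw N; apply slope_hol_off; [assumption | apply H, Hw].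
- apply (sq_center a d D).
Qed.

Lemma uniform_limit_ccontz (fn : nat -> C -> C) (f : C -> C) (z0 : C) (R : R) : 0 < R ->
  (forall n z, sq z0 R z -> ccontz (fn n) z) ->
  (forall e, 0 < e -> exists N, forall n z, (N <= n)%nat -> sq z0 R z -> Cmod (fn n z - f z) <= e) ->
  forall z, sq z0 R z -> ccontz f z.
Proof.
intros HR HC HU z Hz e He.
destruct (HU (e / 4) ltac:(lra)) as [N HN].
destruct (HC N z Hz (e / 4) ltac:(lra)) as [d [D B]].
destruct (sq_open z0 z R Hz) as [d' [D' B']].
exists (Rmin d d'); split; [apply Rmin_pos; assumption|].
intros w Hw; pose proof (Rmin_l d d'); pose proof (Rmin_r d d').
assert (Hw' : sq z0 R w) by (apply B', disc_sq; lra).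
replace (f w - f z)%C with ((fn N w - fn N z) - (fn N w - f w) + (fn N z - f z))%C by ring.
eapply Rle_lt_trans; [apply Cmod_triangle|].
pose proof (Cmod_triangle_minus (fn N w - fn N z) (fn N w - f w)).
specialize (B w ltac:(lra)).
pose proof (HN N w (le_n N) Hw'); pose proof (HN N z (le_n N) Hz); lra.
Qed.

(** Vanishing of rectangle integrals is stable under uniform limits, and by Morera's
    criterion it characterises holomorphy among continuous functions. *)
Lemma uniform_limit_hol (fn : nat -> C -> C) (f : C -> C) (z0 : C) (R : R) : 0 < R ->
  (forall n z, sq z0 R z -> hol (fn n) z) ->
  (forall e, 0 < e -> exists N, forall n z, (N <= n)%nat -> sq z0 R z -> Cmod (fn n z - f z) <= e) ->
  forall z, sq z0 R z -> hol f z.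
Proof.
intros HR HH HU.
assert (HCn : forall n z, sq z0 R z -> ccontz (fn n) z) by (intros; apply hol_ccontz; auto).
assert (HC := uniform_limit_ccontz fn f z0 R HR HCn HU).
apply (morera f (near (Re z0) R) (near (Im z0) R)); try apply oint_near; [exact HC|].
intros a b c d Hab Hcd Ha Hb Hc Hd.
apply Cmod_eq_0, Rle_antisym; [|apply Cmod_ge_0].
apply Rle_plus_epsilon; intros e He; rewrite Rplus_0_l.
set (L := (b - a) + (d - c)).
assert (HL : 0 <= L) by (unfold L; lra).
destruct (HU (e / (2 * L + 1)) ltac:(apply Rdiv_lt_0_compat; lra)) as [N HN].
assert (Sub : forall x y, a <= x <= b -> c <= y <= d -> sq z0 R (x, y)).
{ intros x y Hx Hy; split; simpl; [apply (proj2 (oint_near (Re z0) R) a x b) |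
   apply (proj2 (oint_near (Im z0) R) c y d)]; assumption. }
assert (E0 : rect (fn N) a b c d = 0).
{ apply goursat; try assumption; intros; apply HH, Sub; assumption. }
assert (E1 : rect (fun z => fn N z - f z)%C a b c d = (- rect f a b c d)%C).
{ rewrite rect_minus, E0; try assumption; [ring | |]; intros x y Hx Hy; auto. }
rewrite <- Cmod_opp, <- E1.
eapply Rle_trans; [apply (rect_bound _ (e / (2 * L + 1))); try assumption|].
- intros x y Hx Hy; apply (ccontz_plus (fn N) (fun z => - f z)%C); [auto|].
  apply ccontz_ext with (fun z => (- (1)) * f z)%C; [intros; ring|].
  apply ccontz_mult; [apply ccontz_const | auto].
- intros x y Hx Hy; apply HN; auto.
- fold L; apply Rle_trans with (e / (2 * L + 1) * (2 * L + 1)); [|right; field; lra].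
  assert (0 < e / (2 * L + 1)) by (apply Rdiv_lt_0_compat; lra); nra.
Qed.

(** Cauchy's estimate for the difference. *)
Lemma uniform_limit_cder (fn : nat -> C -> C) (f : C -> C) (z0 : C) (R : R) : 0 < R ->
  (forall n z, sq z0 R z -> hol (fn n) z) ->
  (forall e, 0 < e -> exists N, forall n z, (N <= n)%nat -> sq z0 R z -> Cmod (fn n z - f z) <= e) ->
  forall e, 0 < e -> exists N, forall n, (N <= n)%nat -> Cmod (cder (fn n) z0 - cder f z0) <= e.
Proof.
intros HR HH HU e He.
assert (Hf := uniform_limit_hol fn f z0 R HR HH HU).
destruct (HU (e * (R / 2)) ltac:(apply Rmult_lt_0_compat; lra)) as [N HN].
exists N; intros n Hn.
assert (Z := sq_center z0 R HR).
rewrite <- (cder_eq (fun z => fn n z - f z)%C z0 (cder (fn n) z0 - cder f z0)%C).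
2:{ apply is_cderiv_minus; apply cder_correct; auto. }
replace e with (e * (R / 2) / (R / 2)) by (field; lra).
apply cauchy_estimate with R; [lra | |].
- intros z Hz; apply hol_minus; auto.
- intros z Hz; apply HN; [assumption | apply disc_sq; lra].
Qed.

(** ** Series *)

Fixpoint csum (u : nat -> C) (n : nat) : C :=
  match n with O => RtoC 0 | S m => (csum u m + u m)%C end.

(** Convergence along a filter in the modulus, common to sequences and to real variables
    tending to infinity. The weak inequality lets estimates be used as they come. *)
Definition tends {T : Type} (F : (T -> Prop) -> Prop) (f : T -> C) (l : C) : Prop :=
  forall e, 0 < e -> F (fun u => Cmod (f u - l) <= e).

Definition clim : (nat -> C) -> C -> Prop := tends eventually.

Section Limits.
Context {T : Type} {F : (T -> Prop) -> Prop} {FF : ProperFilter F}.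

Lemma tends_unique (f : T -> C) (a b : C) : tends F f a -> tends F f b -> a = b.
Proof.
intros Ha Hb; apply NNPP; intros N.
assert (P : 0 < Cmod (a - b)) by (apply Cmod_gt_0, Cminus_neq_0, N).
assert (P3 : 0 < Cmod (a - b) / 3) by lra.
destruct (filter_ex _ (filter_and _ _ (Ha _ P3) (Hb _ P3))) as [u [H1 H2]].
assert (T0 := Cmod_triangle_minus (f u - b) (f u - a)).
replace (f u - b - (f u - a))%C with (a - b)%C in T0 by ring; lra.
Qed.

Lemma tends_ext_near (f g : T -> C) (l : C) : F (fun u => f u = g u) -> tends F f l -> tends F g l.
Proof.
intros E H e He; generalize (filter_and _ _ E (H e He)); apply filter_imp.
intros u [<- Hu]; exact Hu.
Qed.

Lemma tends_ext (f g : T -> C) (l : C) : (forall u, f u = g u) -> tends F f l -> tends F g l.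
Proof. intros E; apply tends_ext_near, filter_forall, E. Qed.

Lemma tends_const (c : C) : tends F (fun _ => c) c.
Proof.
intros e He; apply filter_forall; intros _.
replace (c - c)%C with (RtoC 0) by ring; rewrite Cmod_0; lra.
Qed.

Lemma tends_plus (f g : T -> C) (a b : C) :
  tends F f a -> tends F g b -> tends F (fun u => f u + g u)%C (a + b)%C.
Proof.
intros A B e He; assert (P : 0 < e / 2) by lra.
generalize (filter_and _ _ (A _ P) (B _ P)).
apply filter_imp; intros u [H1 H2].
replace (f u + g u - (a + b))%C with ((f u - a) + (g u - b))%C by ring.
eapply Rle_trans; [apply Cmod_triangle|]; lra.
Qed.

Lemma tends_mult (f g : T -> C) (a b : C) :
  tends F f a -> tends F g b -> tends F (fun u => f u * g u)%C (a * b)%C.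
Proof.
intros A B e He.
pose proof (Cmod_ge_0 a); pose proof (Cmod_ge_0 b).
assert (P1 : 0 < e / (2 * (1 + Cmod b))) by (apply Rdiv_lt_0_compat; lra).
assert (P2 : 0 < e / (2 * (1 + Cmod a))) by (apply Rdiv_lt_0_compat; lra).
generalize (filter_and _ _ (A _ (Rmin_pos _ _ Rlt_0_1 P1)) (B _ P2)).
apply filter_imp; intros t [H1 H2].
pose proof (Rmin_l 1 (e / (2 * (1 + Cmod b)))); pose proof (Rmin_r 1 (e / (2 * (1 + Cmod b)))).
replace (f t * g t - a * b)%C with ((f t - a) * (g t - b) + (a * (g t - b) + (f t - a) * b))%C by ring.
eapply Rle_trans; [apply Cmod_triangle|].
eapply Rle_trans; [apply Rplus_le_compat_l, Cmod_triangle|].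
rewrite !Cmod_mult.
set (u := Cmod (f t - a)) in *; set (v := Cmod (g t - b)) in *.
assert (U : 0 <= u) by apply Cmod_ge_0; assert (V : 0 <= v) by apply Cmod_ge_0.
assert (E1 : u * (1 + Cmod b) <= e / 2).
{ apply Rle_trans with (e / (2 * (1 + Cmod b)) * (1 + Cmod b)); [apply Rmult_le_compat_r; lra | right; field; lra]. }
assert (E2 : v * (1 + Cmod a) <= e / 2).
{ apply Rle_trans with (e / (2 * (1 + Cmod a)) * (1 + Cmod a)); [apply Rmult_le_compat_r; lra | right; field; lra]. }
assert (u <= 1) by lra.
nra.
Qed.

Lemma tends_scal (c : C) (f : T -> C) (l : C) : tends F f l -> tends F (fun u => c * f u)%C (c * l)%C.
Proof. intros A; apply tends_mult; [apply tends_const | exact A]. Qed.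

Lemma tends_cont (g : C -> C) (f : T -> C) (l : C) :
  ccontz g l -> tends F f l -> tends F (fun u => g (f u)) (g l).
Proof.
intros Hg Hf e He; destruct (Hg e He) as [d [Dd Hd]].
assert (P : 0 < d / 2) by lra.
generalize (Hf _ P); apply filter_imp; intros u Hu; left; apply Hd; lra.
Qed.

End Limits.

Definition cser (u : nat -> C) : C :=
  (Series (fun n => Re (u n)), Series (fun n => Im (u n))).

Lemma csum_components (u : nat -> C) (n : nat) :
  csum u (S n) = (sum_n (fun k => Re (u k)) n, sum_n (fun k => Im (u k)) n).
Proof.
induction n as [|n IH].
- rewrite !sum_O; simpl; Ceq; unfold Re, Im; ring.
- change (csum u (S (S n))) with (csum u (S n) + u (S n))%C; rewrite IH, !sum_Sn; reflexivity.
Qed.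

Lemma real_tail_bound (a m : nat -> R) (N : nat) : (forall n, Rabs (a n) <= m n) -> ex_series m ->
  Rabs (Series a - sum_n a N) <= Series (fun n => m (S N + n)%nat).
Proof.
intros H Hm.
assert (Ha : ex_series (fun n => Rabs (a n))) by (apply (ex_series_le (V := R_CompleteNormedModule) _ m); [|assumption];
  intros n; unfold norm; simpl; unfold abs; simpl; rewrite Rabs_Rabsolu; apply H).
assert (Ea := ex_series_Rabs a Ha).
assert (Hm' : ex_series (fun n => m (S N + n)%nat)) by (apply (ex_series_incr_n m (S N)), Hm).
rewrite (Series_incr_n a (S N)) by (lia || assumption).
rewrite sum_n_Reals; simpl pred.
replace (sum_f_R0 a N + Series (fun k => a (S N + k)%nat) - sum_f_R0 a N) with
  (Series (fun k => a (S N + k)%nat)) by ring.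
eapply Rle_trans; [apply Series_Rabs|].
- apply (ex_series_incr_n (fun n => Rabs (a n)) (S N)), Ha.
- apply Series_le; [|assumption]; intros n; split; [apply Rabs_pos | apply H].
Qed.

Lemma Series_tail_0 (m : nat -> R) : ex_series m -> forall e, 0 < e ->
  exists N, forall n, (N <= n)%nat -> Rabs (Series (fun k => m (S n + k)%nat)) <= e.
Proof.
intros Hm e He.
destruct (Series_correct m Hm (fun y => Rabs (y - Series m) < e)) as [N HN].
{ exists (mkposreal e He); intros y Hy; exact Hy. }
exists N; intros n Hn; specialize (HN n Hn).
rewrite (Series_incr_n m (S n)) in HN by (lia || assumption).
rewrite sum_n_Reals in HN; simpl pred in HN.
replace (sum_f_R0 m n - (sum_f_R0 m n + Series (fun k => m (S n + k)%nat))) with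
  (- Series (fun k => m (S n + k)%nat)) in HN by ring.
rewrite Rabs_Ropp in HN; lra.
Qed.

Lemma cser_tail (u : nat -> C) (m : nat -> R) (N : nat) : (forall n, Cmod (u n) <= m n) -> ex_series m ->
  Cmod (csum u (S N) - cser u) <= 2 * Series (fun n => m (S N + n)%nat).
Proof.
intros H Hm; rewrite csum_components; eapply Rle_trans; [apply Cmod_le_Re_Im|].
change (Rabs (sum_n (fun k => Re (u k)) N - Series (fun k => Re (u k))) +
  Rabs (sum_n (fun k => Im (u k)) N - Series (fun k => Im (u k))) <= 2 * Series (fun n => m (S N + n)%nat)).
assert (B1 := real_tail_bound (fun n => Re (u n)) m N
  (fun n => Rle_trans _ _ _ (re_le_Cmod _) (H n)) Hm).
assert (B2 := real_tail_bound (fun n => Im (u n)) m N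
  (fun n => Rle_trans _ _ _ (im_le_Cmod _) (H n)) Hm).
rewrite Rabs_minus_sym in B1, B2; lra.
Qed.

Lemma cser_clim (u : nat -> C) (m : nat -> R) : (forall n, Cmod (u n) <= m n) -> ex_series m ->
  clim (csum u) (cser u).
Proof.
intros H Hm e He; destruct (Series_tail_0 m Hm (e / 2) ltac:(lra)) as [N HN].
exists (S N); intros [|n] Hn; [lia|].
eapply Rle_trans; [apply cser_tail; eassumption|].
specialize (HN n ltac:(lia)); pose proof (Rle_abs (Series (fun k => m (S n + k)%nat))); lra.
Qed.

Lemma cser_bound (u : nat -> C) (m : nat -> R) : (forall n, Cmod (u n) <= m n) -> ex_series m ->
  Cmod (cser u) <= 2 * Series m.
Proof.
intros H Hm; eapply Rle_trans; [apply Cmod_le_Re_Im|]; unfold cser; simpl.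
assert (forall a : nat -> R, (forall n, Rabs (a n) <= m n) -> Rabs (Series a) <= Series m).
{ intros a Ha; eapply Rle_trans; [apply Series_Rabs|].
  - apply (ex_series_le (V := R_CompleteNormedModule) _ m); [|assumption].
    intros n; unfold norm; simpl; unfold abs; simpl; rewrite Rabs_Rabsolu; apply Ha.
  - apply Series_le; [|assumption]; intros n; split; [apply Rabs_pos | apply Ha]. }
assert (B1 := H0 (fun n => Re (u n)) (fun n => Rle_trans _ _ _ (re_le_Cmod _) (H n))).
assert (B2 := H0 (fun n => Im (u n)) (fun n => Rle_trans _ _ _ (im_le_Cmod _) (H n))).
lra.
Qed.

Lemma hol_csum (u : nat -> C -> C) (n : nat) (z : C) :
  (forall k, hol (u k) z) -> hol (fun w => csum (fun k => u k w) n) z.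
Proof.
intros H; induction n as [|n IH]; simpl; [apply hol_const | apply hol_plus; auto].
Qed.

(** Weierstrass's test, with uniformity made explicit. *)
Lemma Mtest_uniform (u : nat -> C -> C) (m : nat -> R) (D : C -> Prop) :
  (forall n z, D z -> Cmod (u n z) <= m n) -> ex_series m ->
  forall e, 0 < e -> exists N, forall n z, (N <= n)%nat -> D z ->
    Cmod (csum (fun k => u k z) n - cser (fun k => u k z)) <= e.
Proof.
intros H Hm e He; destruct (Series_tail_0 m Hm (e / 2) ltac:(lra)) as [N HN].
exists (S N); intros [|n] z Hn Hz; [lia|].
eapply Rle_trans; [apply (cser_tail _ m); auto|].
specialize (HN n ltac:(lia)); pose proof (Rle_abs (Series (fun k => m (S n + k)%nat))); lra.
Qed.

Lemma Mtest_hol (u : nat -> C -> C) (m : nat -> R) (z0 : C) (R : R) : 0 < R ->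
  (forall n z, sq z0 R z -> hol (u n) z) ->
  (forall n z, sq z0 R z -> Cmod (u n z) <= m n) -> ex_series m ->
  forall z, sq z0 R z -> hol (fun z => cser (fun n => u n z)) z.
Proof.
intros HR HH HM Hm.
apply uniform_limit_hol with (fun n z => csum (fun k => u k z) n); [assumption | |].
- intros n z Hz; apply hol_csum; auto.
- apply Mtest_uniform with m; assumption.
Qed.

(** * The identity theorem *)

Lemma hol_pow (f : C -> C) (n : nat) (z : C) : hol f z -> hol (fun w => f w ^ n)%C z.
Proof.
intros H; induction n as [|n IH]; simpl; [apply hol_const | apply (hol_mult f); assumption].
Qed.

Lemma Cpow_neq_0 (z : C) (n : nat) : z <> 0 -> (z ^ n)%C <> 0.
Proof.
intros N; induction n as [|n IH]; simpl.
- apply C1_nz.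
- apply Cmult_neq_0; assumption.
Qed.

(** Dividing by [(z - a)^N] does no harm where [D] vanishes. Applying the mean value
    property to Cauchy's kernel at [b] then gives [|D b| <= C (|b - a| / r)^N] for every [N]. *)
Lemma vanish_disc (D : C -> C) (a b : C) (r0 R : R) : 0 < r0 ->
  (forall z, sq a R z -> hol D z) -> (forall z, Cmod (z - a) < r0 -> D z = 0) ->
  Cmod (b - a) < R -> D b = 0.
Proof.
intros Hr0 HD Hz Hb.
destruct (classic (b = a)) as [-> | Nba].
{ apply Hz; replace (a - a)%C with (RtoC 0) by ring; rewrite Cmod_0; assumption. }
set (q := Cmod (b - a)) in *.
assert (Q0 : 0 < q) by (apply Cmod_gt_0, Cminus_neq_0, Nba).
set (r := (q + R) / 2).
assert (Hr : q < r < R) by (unfold r; lra).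
set (A := RInt (fun t => Cmod (D (a + RtoC r * cis t)%C)) 0 (2 * PI)).
assert (HDc : forall t, ccont (fun t => D (a + RtoC r * cis t)%C) t).
{ intros t; apply (circle_ccont D a r R); [lra|]; intros; apply hol_ccontz; auto. }
assert (Nc : forall t, (a + RtoC r * cis t)%C <> b).
{ intros t E; assert (K := Cmod_circle a r t); rewrite E in K; fold q in K.
  rewrite Rabs_right in K; lra. }
(* Cauchy's kernel [(z - a) / (z - b)] on the circle. Its integral is [2 PI], but a bound
   from below suffices: the real part is at least [1/2] since [|b - a| < r]. *)
set (w := fun t => ((RtoC r * cis t) / (a + RtoC r * cis t - b))%C).
assert (Wc : forall t, ccont w t).
{ intros t; unfold w.
  apply (rder_ccont _ t (cder (fun z => (z - a) / (z - b))%C (a + RtoC r * cis t) * (RtoC r * (Ci * cis t)))%C).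
  apply rder_ext with (fun t => (fun z => (z - a) / (z - b))%C (a + RtoC r * cis t)%C).
  { intros u; simpl; f_equal; ring. }
  apply (rder_path (fun z => (z - a) / (z - b))%C (fun t => a + RtoC r * cis t)%C); [|apply rder_circle_t].
  apply cder_correct, hol_div.
  - apply Cminus_neq_0, Nc.
  - apply hol_sub_const.
  - apply hol_sub_const. }
set (kap := cint w 0 (2 * PI)).
pose proof two_PI_pos as TP.
assert (Wlow : forall t, / 2 <= Re (w t)).
{ intros t.
  assert (E : (w t - 1)%C = (w t * ((b - a) / (RtoC r * cis t)))%C).
  { unfold w; field; repeat split;
    first [apply cis_neq_0 | apply RtoC_neq_0; lra | apply Cminus_neq_0, Nc]. }
  assert (L : Cmod (w t - 1) <= Cmod (w t)).
  { rewrite E, Cmod_mult, Cmod_div, Cmod_mult, Cmod_cis, Cmod_R, Rabs_right, Rmult_1_r; try lra.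
    - fold q; pose proof (Cmod_ge_0 (w t)).
      assert (q / r <= 1) by (apply Rmult_le_reg_r with r; [lra | unfold Rdiv; rewrite Rmult_assoc, Rinv_l; lra]).
      nra.
    - apply Cmult_neq_0; [apply RtoC_neq_0; lra | apply cis_neq_0]. }
  assert (L2 : Cmod (w t - 1) ^ 2 <= Cmod (w t) ^ 2) by (apply pow_incr; split; [apply Cmod_ge_0 | assumption]).
  rewrite !Cmod2_alt in L2.
  replace (Re (w t - 1)) with (Re (w t) - 1) in L2 by reflexivity.
  replace (Im (w t - 1)) with (Im (w t)) in L2 by (unfold Im; simpl; ring).
  lra. }
assert (KP : PI <= Cmod kap).
{ eapply Rle_trans; [|apply re_le_Cmod]; eapply Rle_trans; [|apply Rle_abs].
  unfold kap, cint; simpl.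
  apply Rle_trans with (RInt (fun _ => / 2) 0 (2 * PI)).
  { rewrite RInt_const; unfold scal; simpl; unfold mult; simpl; right; field. }
  apply RInt_le; [lra | apply ex_RInt_const | apply (cex_cont w); intros; apply Wc | intros; apply Wlow]. }
assert (Wup : forall t, Cmod (w t) <= r / (r - q)).
{ intros t; unfold w; rewrite Cmod_div, Cmod_mult, Cmod_cis, Cmod_R, Rabs_right by (lra || apply Cminus_neq_0, Nc).
  rewrite Rmult_1_r.
  assert (L : r - q <= Cmod (a + RtoC r * cis t - b)).
  { pose proof (Cmod_triangle_rev (a + RtoC r * cis t - a) (b - a)) as T.
    rewrite Cmod_circle, Rabs_right in T by lra; fold q in T.
    replace (a + RtoC r * cis t - a - (b - a))%C with (a + RtoC r * cis t - b)%C in T by ring; lra. }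
  unfold Rdiv; apply Rmult_le_compat_l; [lra|]; apply Rinv_le_contravar; lra. }
assert (Main : forall N, Cmod (D b) * PI <= (r / (r - q) * A) * (q / r) ^ N).
{ intros N.
  (* At [a] itself [g] vanishes like [D], whatever value division by zero has. *)
  set (g := fun z => (D z * / (z - a) ^ N)%C).
  assert (Hg : forall z, sq a R z -> hol g z).
  { intros z Hz'; destruct (classic (z = a)) as [-> | Nz].
    - apply hol_local with (f := fun _ => RtoC 0) (d := r0); [assumption | | apply hol_const].
      intros u Hu; unfold g; rewrite Hz by assumption; ring.
    - apply (hol_div D (fun z => (z - a) ^ N)%C); [apply Cpow_neq_0, Cminus_neq_0, Nz | auto|].
      apply (hol_pow (fun z => z - a)%C), hol_sub_const. }
  assert (Hsb : sq a R b) by (apply disc_sq; assumption).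
  destruct (sq_open a b R Hsb) as [d [Dd Bd]].
  assert (E := mean_value (fun z => (z - a) * slope g b z)%C a a r R ltac:(lra)).
  assert (Hs : forall z, sq a R z -> hol (fun z => (z - a) * slope g b z)%C z).
  { intros z Hz'; apply hol_mult.
    - apply hol_sub_const.
    - apply (slope_hol g b z d); auto. }
  specialize (E ltac:(intros; apply hol_ccontz; auto) ltac:(intros; auto)).
  replace (RtoC (2 * PI) * ((a - a) * slope g b a))%C with (RtoC 0) in E by ring.
  assert (Gc : forall t, ccont (fun t => g (a + RtoC r * cis t)%C) t).
  { intros t; apply (circle_ccont g a r R); [lra|]; intros; apply hol_ccontz; auto. }
  rewrite (cint_ext _ (fun t => w t * g (a + RtoC r * cis t) - g b * w t)%C) in E.
  2:{ intros t _; rewrite slope_neq by apply Nc; unfold w; field; apply Cminus_neq_0, Nc. }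
  rewrite cint_minus, cint_scal in E.
  2:{ apply cex_cont; intros; apply Wc. }
  2:{ apply cex_cont; intros; apply ccont_mult; [apply Wc | apply Gc]. }
  2:{ apply cex_scal, cex_cont; intros; apply Wc. }
  fold kap in E.
  assert (E2 : (g b * kap)%C = cint (fun t => w t * g (a + RtoC r * cis t))%C 0 (2 * PI)).
  { transitivity (cint (fun t => w t * g (a + RtoC r * cis t))%C 0 (2 * PI) -
      (cint (fun t => w t * g (a + RtoC r * cis t))%C 0 (2 * PI) - g b * kap))%C; [ring | rewrite E; ring]. }
  assert (Pr : 0 < r ^ N) by (apply pow_lt; lra).
  assert (Pq : 0 < q ^ N) by (apply pow_lt; lra).
  assert (B : Cmod (g b * kap) <= r / (r - q) * / r ^ N * A).
  { rewrite E2; unfold A.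
    change (r / (r - q) * / r ^ N * RInt (fun t => Cmod (D (a + RtoC r * cis t)%C)) 0 (2 * PI)) with
      (scal (V := R_NormedModule) (r / (r - q) * / r ^ N) (RInt (fun t => Cmod (D (a + RtoC r * cis t)%C)) 0 (2 * PI))).
    assert (XD : ex_RInt (fun t => Cmod (D (a + RtoC r * cis t)%C)) 0 (2 * PI)).
    { apply (ex_RInt_continuous (V := R_CompleteNormedModule)); intros t _; apply ccont_Cmod, HDc. }
    rewrite <- (RInt_scal (V := R_CompleteNormedModule)) by assumption.
    apply cint_bound; [lra | | apply (ex_RInt_scal (V := R_NormedModule)); assumption |].
    - apply cex_cont; intros; apply ccont_mult; [apply Wc | apply Gc].
    - intros t _; unfold g; rewrite !Cmod_mult, Cmod_inv, Cmod_pow, Cmod_circle, Rabs_right; try lra.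
      + unfold scal; simpl; unfold mult; simpl.
        rewrite (Rmult_comm (Cmod (D _))), <- Rmult_assoc.
        apply Rmult_le_compat_r; [apply Cmod_ge_0|].
        apply Rmult_le_compat_r; [apply Rlt_le, Rinv_0_lt_compat, Pr | apply Wup].
      + apply Cpow_neq_0.
        replace (a + RtoC r * cis t - a)%C with (RtoC r * cis t)%C by ring.
        apply Cmult_neq_0; [apply RtoC_neq_0; lra | apply cis_neq_0]. }
  assert (Eg : Cmod (g b) = Cmod (D b) / q ^ N).
  { unfold g; rewrite Cmod_mult, Cmod_inv, Cmod_pow; [reflexivity | apply Cpow_neq_0, Cminus_neq_0, Nba]. }
  rewrite Cmod_mult, Eg in B.
  replace ((q / r) ^ N) with (q ^ N / r ^ N) by (unfold Rdiv; rewrite Rpow_mult_distr, pow_inv; reflexivity).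
  apply Rmult_le_reg_r with (/ q ^ N); [apply Rinv_0_lt_compat, Pq|].
  replace (r / (r - q) * A * (q ^ N / r ^ N) * / q ^ N) with (r / (r - q) * / r ^ N * A) by (field; lra).
  eapply Rle_trans; [|exact B].
  replace (Cmod (D b) * PI * / q ^ N) with (Cmod (D b) / q ^ N * PI) by (field; lra).
  apply Rmult_le_compat_l; [|assumption].
  apply Rmult_le_pos; [apply Cmod_ge_0 | apply Rlt_le, Rinv_0_lt_compat, Pq]. }
apply Cmod_eq_0, Rle_antisym; [|apply Cmod_ge_0].
pose proof PI_RGT_0 as P0.
assert (A0 : 0 <= r / (r - q) * A).
{ apply Rmult_le_pos; [apply Rlt_le, Rdiv_lt_0_compat; lra|].
  unfold A; apply RInt_ge_0; [lra | | intros; apply Cmod_ge_0].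
  apply (ex_RInt_continuous (V := R_CompleteNormedModule)); intros t _; apply ccont_Cmod, HDc. }
set (K := r / (r - q) * A) in *.
apply Rmult_le_reg_r with PI; [assumption|]; rewrite Rmult_0_l.
apply Rle_plus_epsilon; intros e He; rewrite Rplus_0_l.
destruct (pow_lt_1_zero (q / r)) with (y := e / (K + 1)) as [N HN].
{ assert (0 < r) by lra.
  rewrite Rabs_right by (apply Rle_ge, Rlt_le, Rdiv_lt_0_compat; assumption).
  apply Rmult_lt_reg_r with r; [assumption|].
  replace (q / r * r) with q by (field; lra); lra. }
{ apply Rdiv_lt_0_compat; lra. }
specialize (HN N (le_n N)); specialize (Main N).
assert (P : 0 <= (q / r) ^ N) by (apply pow_le, Rlt_le, Rdiv_lt_0_compat; lra).
rewrite Rabs_right in HN by lra.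
eapply Rle_trans; [exact Main|].
apply Rle_trans with ((K + 1) * (e / (K + 1))); [|right; field; lra].
apply Rmult_le_compat; lra.
Qed.

(** Points of a segment near which [D] vanishes form a set whose supremum cannot
    lie before the end point. *)
Lemma identity_segment (D : C -> C) (a b : C) :
  (forall t, 0 <= t <= 1 -> exists d, 0 < d /\ forall w, sq (a + RtoC t * (b - a)) d w -> hol D w) ->
  (exists r, 0 < r /\ forall z, Cmod (z - a) < r -> D z = 0) -> D b = 0.
Proof.
intros HD [r0 [Hr0 Hz]].
set (ga := fun t => (a + RtoC t * (b - a))%C).
set (E := fun t => 0 <= t <= 1 /\ exists r, 0 < r /\ forall z, Cmod (z - ga t) < r -> D z = 0).
assert (E0 : E 0).
{ split; [lra|]; exists r0; split; [assumption|]; intros z Hz'; apply Hz.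
  unfold ga in Hz'; replace (z - (a + RtoC 0 * (b - a)))%C with (z - a)%C in Hz' by ring; assumption. }
destruct (completeness E) as [T [T1 T2]].
{ exists 1; intros t [Ht _]; lra. }
{ exists 0; exact E0. }
assert (HT : 0 <= T <= 1) by (split; [apply T1, E0 | apply T2; intros t [Ht _]; lra]).
destruct (HD T HT) as [d [Dd Hd]]; fold (ga T) in Hd.
set (L := Cmod (b - a) + 1).
assert (HL : 1 <= L) by (unfold L; pose proof (Cmod_ge_0 (b - a)); lra).
assert (GL : forall s t, Cmod (ga s - ga t) <= L * Rabs (s - t)).
{ intros s t; unfold ga.
  replace (a + RtoC s * (b - a) - (a + RtoC t * (b - a)))%C with (RtoC (s - t) * (b - a))%C
    by (rewrite RtoC_minus; ring).
  rewrite Cmod_mult, Cmod_R, Rmult_comm; apply Rmult_le_compat_r; [apply Rabs_pos | unfold L; lra]. }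
(* Points of the segment within [del] in parameter are at distance at most [d / 8], so that a
   disc on which [D] vanishes spreads over a disc around the supremum [T]. *)
set (del := d / (8 * L)).
assert (Del : 0 < del) by (apply Rdiv_lt_0_compat; lra).
assert (LD : L * del = d / 8) by (unfold del; field; lra).
assert (Et : exists t, E t /\ T - del < t <= T).
{ destruct (classic (exists t, E t /\ T - del < t)) as [[t [Ht Ht']] | N].
  - exists t; split; [assumption|]; split; [assumption | apply T1, Ht].
  - exfalso; assert (T <= T - del); [|lra].
    apply T2; intros t Ht; apply Rnot_lt_le; intros K; apply N; exists t; split; assumption. }
destruct Et as [t [[Ht [r [Hr Hzr]]] HtT]].
assert (V : forall z, Cmod (z - ga T) < d / 4 -> D z = 0).
{ intros z Hz'.
  assert (B : Cmod (ga T - ga t) <= d / 8).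
  { eapply Rle_trans; [apply GL|]; rewrite <- LD; apply Rmult_le_compat_l; [lra|].
    rewrite Rabs_right; lra. }
  apply (vanish_disc D (ga t) z r (d / 2)); try assumption.
  - intros w Hw; apply Hd.
    destruct Hw as [W1 W2]; unfold near in *.
    assert (Rabs (Re (ga T - ga t)) <= d / 8) by (eapply Rle_trans; [apply re_le_Cmod | assumption]).
    assert (Rabs (Im (ga T - ga t)) <= d / 8) by (eapply Rle_trans; [apply im_le_Cmod | assumption]).
    change (Rabs (Re (ga T) - Re (ga t)) <= d / 8) in H.
    change (Rabs (Im (ga T) - Im (ga t)) <= d / 8) in H0.
    rewrite Rabs_minus_sym in H, H0.
    split; unfold near.
    + replace (Re w - Re (ga T)) with ((Re w - Re (ga t)) + (Re (ga t) - Re (ga T))) by ring.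
      eapply Rle_lt_trans; [apply Rabs_triang|]; lra.
    + replace (Im w - Im (ga T)) with ((Im w - Im (ga t)) + (Im (ga t) - Im (ga T))) by ring.
      eapply Rle_lt_trans; [apply Rabs_triang|]; lra.
  - replace (z - ga t)%C with ((z - ga T) + (ga T - ga t))%C by ring.
    eapply Rle_lt_trans; [apply Cmod_triangle|]; lra. }
destruct (Req_dec T 1) as [ET | NT].
- replace b with (ga T) by (unfold ga; rewrite ET; ring).
  apply V; replace (ga T - ga T)%C with (RtoC 0) by ring; rewrite Cmod_0; lra.
- exfalso.
  set (t' := Rmin 1 (T + del)).
  assert (Ht' : T < t' <= 1 /\ t' <= T + del).
  { unfold t'; pose proof (Rmin_l 1 (T + del)); pose proof (Rmin_r 1 (T + del)).
    split; [split|]; try assumption; unfold Rmin; destruct Rle_dec; lra. }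
  assert (E t').
  { split; [lra|]; exists (d / 8); split; [lra|]; intros z Hz'; apply V.
    replace (z - ga T)%C with ((z - ga t') + (ga t' - ga T))%C by ring.
    eapply Rle_lt_trans; [apply Cmod_triangle|].
    assert (Cmod (ga t' - ga T) <= d / 8).
    { eapply Rle_trans; [apply GL|]; rewrite <- LD; apply Rmult_le_compat_l; [lra|].
      rewrite Rabs_right; lra. }
    lra. }
  apply T1 in H; lra.
Qed.

(** * The exponential function and the gradient inequality *)

Lemma Cexp_plus (z w : C) : Cexp (z + w) = (Cexp z * Cexp w)%C.
Proof.
unfold Cexp, Re, Im; Ceq; rewrite exp_plus, ?cos_plus, ?sin_plus; ring.
Qed.

Lemma Cexp_0 : Cexp 0 = 1.
Proof. unfold Cexp, RtoC; simpl; rewrite exp_0, cos_0, sin_0; f_equal; ring. Qed.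

Lemma Cmod_Cexp (z : C) : Cmod (Cexp z) = exp (Re z).
Proof.
replace (Cexp z) with (RtoC (exp (Re z)) * cis (Im z))%C by (unfold Cexp, cis; Ceq; ring).
rewrite Cmod_mult, Cmod_cis, Cmod_R, Rabs_right; [ring | apply Rle_ge, Rlt_le, exp_pos].
Qed.

Lemma Cexp_neq_0 (z : C) : Cexp z <> 0.
Proof. apply Cmod_gt_0; rewrite Cmod_Cexp; apply exp_pos. Qed.

Lemma Cexp_opp (z : C) : Cexp (- z) = (/ Cexp z)%C.
Proof.
assert (E : (Cexp (- z) * Cexp z)%C = 1) by (rewrite <- Cexp_plus, <- Cexp_0; f_equal; ring).
rewrite <- (Cmult_1_r (/ Cexp z)), <- E; field; apply Cexp_neq_0.
Qed.

Lemma derivable_pt_lim_linear (f : R -> R) (x l : R) : derivable_pt_lim f x l ->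
  forall e, 0 < e -> exists d, 0 < d /\ forall h, Rabs h < d -> Rabs (f (x + h) - f x - l * h) <= e * Rabs h.
Proof.
intros H e He; destruct (H e He) as [d Hd]; exists d; split; [apply cond_pos|].
intros h Hh; destruct (Req_dec h 0) as [-> | N].
- rewrite Rplus_0_r, Rmult_0_r, Rabs_R0, Rmult_0_r.
  replace (f x - f x - 0) with 0 by ring; rewrite Rabs_R0; lra.
- specialize (Hd h N Hh).
  replace (f (x + h) - f x - l * h) with (((f (x + h) - f x) / h - l) * h) by (field; assumption).
  rewrite Rabs_mult; apply Rmult_le_compat_r; [apply Rabs_pos | lra].
Qed.

Lemma is_cderiv_Cexp_0 : is_cderiv Cexp 0 1.
Proof.
intros e He.
set (e1 := Rmin (e / 8) 1).
assert (E1 : 0 < e1) by (apply Rmin_pos; lra).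
assert (E2 : e1 <= e / 8) by apply Rmin_l.
assert (E3 : e1 <= 1) by apply Rmin_r.
destruct (derivable_pt_lim_linear exp 0 _ (derivable_pt_lim_exp 0) e1 E1) as [d1 [D1 B1]].
destruct (derivable_pt_lim_linear cos 0 _ (derivable_pt_lim_cos 0) e1 E1) as [d2 [D2 B2]].
destruct (derivable_pt_lim_linear sin 0 _ (derivable_pt_lim_sin 0) e1 E1) as [d3 [D3 B3]].
set (d := Rmin (Rmin d1 d2) (Rmin d3 (e1 / 2))).
assert (Dp : 0 < d) by (repeat apply Rmin_pos; lra).
assert (d <= d1 /\ d <= d2 /\ d <= d3 /\ d <= e1 / 2) as [L1 [L2 [L3 L4]]].
{ unfold d; repeat split.
  - eapply Rle_trans; [apply Rmin_l | apply Rmin_l].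
  - eapply Rle_trans; [apply Rmin_l | apply Rmin_r].
  - eapply Rle_trans; [apply Rmin_r | apply Rmin_l].
  - eapply Rle_trans; [apply Rmin_r | apply Rmin_r]. }
exists d; split; [assumption|]; intros [x y] Hw.
replace ((x, y) - 0)%C with ((x, y) : C) in * by (Ceq; ring).
assert (Rx := re_le_Cmod (x, y)); assert (Ry := im_le_Cmod (x, y)); simpl in Rx, Ry.
set (m := Cmod (x, y)) in *.
assert (M0 : 0 <= m) by apply Cmod_ge_0.
specialize (B1 x ltac:(lra)); specialize (B2 y ltac:(lra)); specialize (B3 y ltac:(lra)).
rewrite Rplus_0_l, exp_0, Rmult_1_l in B1.
rewrite Rplus_0_l, cos_0, sin_0 in B2; rewrite Rplus_0_l, cos_0, sin_0 in B3.
replace (cos y - 1 - - 0 * y) with (cos y - 1) in B2 by ring.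
replace (sin y - 0 - 1 * y) with (sin y - y) in B3 by ring.
assert (X1 : Rabs (exp x - 1) <= e1).
{ replace (exp x - 1) with ((exp x - 1 - x) + x) by ring.
  eapply Rle_trans; [apply Rabs_triang|]; pose proof (Rabs_pos x); nra. }
assert (X2 : exp x <= 2) by (apply Rabs_le_between in X1; lra).
assert (X3 := exp_pos x).
replace (Cexp (x, y) - Cexp 0 - 1 * (x, y))%C with
 ((exp x - 1 - x) + exp x * (cos y - 1), exp x * (sin y - y) + (exp x - 1) * y)
 by (rewrite Cexp_0; unfold Cexp; Ceq; ring).
eapply Rle_trans; [apply Cmod_le_Re_Im|]; simpl.
pose proof (Rabs_triang (exp x - 1 - x) (exp x * (cos y - 1))).
pose proof (Rabs_triang (exp x * (sin y - y)) ((exp x - 1) * y)).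
rewrite !Rabs_mult, (Rabs_right (exp x)) in * by lra.
pose proof (Rabs_pos x); pose proof (Rabs_pos y).
assert (e1 * Rabs x <= e1 * m) by (apply Rmult_le_compat_l; lra).
assert (e1 * Rabs y <= e1 * m) by (apply Rmult_le_compat_l; lra).
assert (exp x * Rabs (cos y - 1) <= 2 * (e1 * m)) by (apply Rmult_le_compat; try apply Rabs_pos; lra).
assert (exp x * Rabs (sin y - y) <= 2 * (e1 * m)) by (apply Rmult_le_compat; try apply Rabs_pos; lra).
assert (Rabs (exp x - 1) * Rabs y <= e1 * m) by (apply Rmult_le_compat; try apply Rabs_pos; lra).
assert (e1 * m <= e / 8 * m) by (apply Rmult_le_compat_r; lra).
nra.
Qed.

Lemma is_cderiv_Cexp (z : C) : is_cderiv Cexp z (Cexp z).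
Proof.
apply is_cderiv_ext with (fun w => Cexp z * Cexp (w - z))%C.
{ intros w; rewrite <- Cexp_plus; f_equal; ring. }
assert (K : is_cderiv (fun w => Cexp z * Cexp (w - z))%C z (Cexp z * (1 * (1 - 0)))).
{ apply is_cderiv_scal, (is_cderiv_comp (fun w => w - z)%C Cexp).
  - apply is_cderiv_minus; [apply is_cderiv_id | apply is_cderiv_const].
  - replace (z - z)%C with (RtoC 0) by ring; apply is_cderiv_Cexp_0. }
replace (Cexp z * (1 * (1 - 0)))%C with (Cexp z) in K by ring; exact K.
Qed.

Lemma hol_Cexp (z : C) : hol Cexp z.
Proof. eexists; apply is_cderiv_Cexp. Qed.

Lemma cint_conj (f : R -> C) (a b : R) : cex f a b -> cint (fun t => Cconj (f t)) a b = Cconj (cint f a b).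
Proof.
intros [F1 F2]; Ceq; [reflexivity|].
apply (RInt_opp (fun u => Im (f u))); assumption.
Qed.

Lemma seg_in_dom (P Q : R -> Prop) (z w : C) (t : R) : oint P -> oint Q -> dom P Q z -> dom P Q w ->
  0 <= t <= 1 -> dom P Q (w + RtoC t * (z - w))%C.
Proof.
intros OP OQ [Hz1 Hz2] [Hw1 Hw2] Ht.
assert (K : forall (P : R -> Prop) x y, oint P -> P x -> P y -> P (y + t * (x - y))).
{ intros P' x y OP' Hx Hy; apply (oint_minmax P' x y); try assumption.
  unfold Rmin, Rmax; destruct (Rle_dec x y); nra. }
split; simpl.
- replace (fst w + (t * (fst z + - fst w) - 0 * (snd z + - snd w))) with (fst w + t * (fst z - fst w)) by ring.
  apply K; assumption.
- replace (snd w + (t * (snd z + - snd w) + 0 * (fst z + - fst w))) with (snd w + t * (snd z - snd w)) by ring.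
  apply K; assumption.
Qed.

(** Constancy along segments, by the Lipschitz bound with constant zero. *)
Lemma cderiv_zero_const (f : C -> C) (P Q : R -> Prop) : oint P -> oint Q ->
  (forall z, dom P Q z -> is_cderiv f z 0) -> forall z w, dom P Q z -> dom P Q w -> f z = f w.
Proof.
intros OP OQ H z w Hz Hw.
assert (E : Cmod (f z - f w) <= 2 * 0 * Cmod (z - w)).
{ apply lipschitz_segment; intros t Ht.
  - eexists; apply H, seg_in_dom; assumption.
  - rewrite (cder_eq f _ 0); [rewrite Cmod_0; lra | apply H, seg_in_dom; assumption]. }
pose proof (Cmod_ge_0 (f z - f w)).
assert (Z : (f z - f w)%C = 0) by (apply Cmod_eq_0; nra).
rewrite <- (Cplus_0_l (f w)), <- Z; ring.
Qed.

(** For a holomorphic [f], the function [m - Re f >= 0] has first Fourier coefficient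
    proportional to [f'] on circles, and zeroth coefficient [m - Re f(s0)]; the former
    is at most the latter in modulus. *)
Lemma positive_real_part_gradient (f : C -> C) (s0 : C) (r R m : R) : 0 < r < R ->
  (forall z, sq s0 R z -> hol f z) -> (forall z, sq s0 R z -> Re (f z) <= m) ->
  Cmod (cder f s0) <= 2 / r * (m - Re (f s0)).
Proof.
intros Hr HH Hm.
set (u := fun t => f (s0 + RtoC r * cis t)%C).
assert (Cu : forall t, ccont u t).
{ intros t; apply (circle_ccont f s0 r R); [lra|]; intros; apply hol_ccontz; auto. }
assert (Xu : cex u 0 (2 * PI)) by (apply cex_cont; intros; apply Cu).
assert (Cc : forall t, ccont (fun t => cis (- t)) t) by (intros; eapply rder_ccont, rder_cis_opp).
assert (A : cint u 0 (2 * PI) = (RtoC (2 * PI) * f s0)%C).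
{ apply (mean_value f s0 s0 r R Hr); intros; [apply hol_ccontz|]; auto. }
assert (B : cint (fun t => u t * cis (- t))%C 0 (2 * PI) = (RtoC (2 * PI * r) * cder f s0)%C).
{ symmetry; apply cauchy_derivative with R; assumption. }
assert (Xuc : cex (fun t => u t * cis t)%C 0 (2 * PI)).
{ apply cex_cont; intros; apply ccont_mult; [apply Cu | apply ccont_cis]. }
assert (Z : cint (fun t => u t * cis t)%C 0 (2 * PI) = 0).
{ assert (E := mean_value (fun z => (z - s0) * f z)%C s0 s0 r R Hr).
  assert (Hs : forall z, sq s0 R z -> hol (fun z => (z - s0) * f z)%C z).
  { intros z Hz; apply hol_mult; [apply hol_sub_const | auto]. }
  specialize (E ltac:(intros; apply hol_ccontz; auto) ltac:(intros; auto)).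
  rewrite (cint_ext _ (fun t => RtoC r * (u t * cis t))%C) in E by (intros; unfold u; ring).
  rewrite cint_scal in E by assumption.
  replace (RtoC (2 * PI) * ((s0 - s0) * f s0))%C with (RtoC 0) in E by ring.
  replace (cint (fun t => u t * cis t)%C 0 (2 * PI)) with
    (/ RtoC r * (RtoC r * cint (fun t => u t * cis t) 0 (2 * PI)))%C
    by (field; apply RtoC_neq_0; lra).
  rewrite E; ring. }
set (p := fun t => m - Re (u t)).
assert (Cp : forall t, continuous p t).
{ intros t; apply (continuous_minus (fun _ => m) (fun t => Re (u t))); [apply continuous_const | apply Cu]. }
assert (Pp : forall t, 0 <= p t).
{ intros t; unfold p, u.
  assert (H : sq s0 R (s0 + RtoC r * cis t)%C).
  { apply disc_sq; rewrite Cmod_circle, Rabs_right; lra. }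
  specialize (Hm _ H); lra. }
pose proof two_PI_pos as TP.
assert (I0 : RInt p 0 (2 * PI) = 2 * PI * (m - Re (f s0))).
{ assert (K : Re (cint u 0 (2 * PI)) = 2 * PI * Re (f s0)) by (rewrite A; simpl; unfold Re; ring).
  simpl in K; unfold p.
  rewrite (RInt_minus (fun _ => m) (fun t => Re (u t))); [|apply ex_RInt_const | apply Xu].
  rewrite RInt_const; unfold minus, plus, opp, scal; simpl; unfold mult; simpl.
  unfold Re in *; rewrite K; ring. }
assert (I1 : cint (fun t => RtoC (p t) * cis (- t))%C 0 (2 * PI) = (- (RtoC (PI * r) * cder f s0))%C).
{ rewrite (cint_ext _ (fun t => RtoC m * cis (- t) - (RtoC (/ 2) * (u t * cis (- t)) +
     RtoC (/ 2) * Cconj (u t * cis t)))%C).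
  2:{ intros t _; unfold p, cis; rewrite cos_neg, sin_neg; Ceq; unfold Re; field. }
  assert (X1 : cex (fun t => u t * cis (- t))%C 0 (2 * PI)).
  { apply cex_cont; intros; apply ccont_mult; [apply Cu | apply Cc]. }
  assert (X2 : cex (fun t => Cconj (u t * cis t))%C 0 (2 * PI)).
  { destruct Xuc as [Y1 Y2]; split; [exact Y1|]; apply (ex_RInt_opp (V := R_NormedModule)); exact Y2. }
  rewrite cint_minus, cint_plus, !cint_scal, cint_conj, cint_cis_opp, Z, B; try assumption.
  - replace (2 * PI * r) with (2 * (PI * r)) by ring.
    unfold Cconj; rewrite !RtoC_mult.
    assert (E2 : (RtoC (/ 2) * RtoC 2 = 1)%C) by (rewrite <- RtoC_mult; f_equal; field).
    transitivity (- ((RtoC (/ 2) * RtoC 2) * (RtoC PI * RtoC r * cder f s0)))%C; [Ceq; ring | rewrite E2; ring].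
  - apply cex_cont; intros; apply Cc.
  - apply cex_scal; assumption.
  - apply cex_scal; assumption.
  - apply cex_scal, cex_cont; intros; apply Cc.
  - apply cex_plus; apply cex_scal; assumption. }
assert (I2 : Cmod (cint (fun t => RtoC (p t) * cis (- t))%C 0 (2 * PI)) <= RInt p 0 (2 * PI)).
{ apply cint_bound; [lra | | |].
  - apply cex_cont; intros; apply ccont_mult; [apply ccont_RtoC, Cp | apply Cc].
  - apply (ex_RInt_continuous (V := R_CompleteNormedModule)); intros; apply Cp.
  - intros t _; rewrite Cmod_mult, Cmod_cis, Cmod_R, Rabs_right by (apply Rle_ge, Pp); lra. }
pose proof PI_RGT_0 as PP.
rewrite I1, I0, Cmod_opp, Cmod_mult, Cmod_R, Rabs_right in I2 by (apply Rle_ge, Rlt_le, Rmult_lt_0_compat; lra).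
apply Rmult_le_reg_l with (PI * r); [apply Rmult_lt_0_compat; lra|].
eapply Rle_trans; [exact I2|]; right; field; lra.
Qed.

(** The gradient inequality for a logarithm of [h], which exists as a primitive of
    [h' / h]. *)
Lemma log_derivative_bound (h : C -> C) (s0 : C) (r R M : R) : 0 < r < R -> 0 < M ->
  (forall z, sq s0 R z -> hol h z) -> (forall z, sq s0 R z -> h z <> 0) ->
  (forall z, sq s0 R z -> Cmod (h z) <= M) ->
  Cmod (cder h s0 / h s0) <= 2 / r * (ln M - ln (Cmod (h s0))).
Proof.
intros Hr M0 HH HN HM.
assert (Hq : forall z, sq s0 R z -> hol (fun z => cder h z / h z)%C z).
{ intros z Hz; apply hol_div; auto.
  destruct (sq_open s0 z R Hz) as [d [D B]]; apply hol_cder with d; auto. }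
assert (Hqc : forall z, sq s0 R z -> ccontz (fun z => cder h z / h z)%C z) by (intros; apply hol_ccontz; auto).
destruct (primitive_exists (fun z => cder h z / h z)%C (near (Re s0) R) (near (Im s0) R)) as [f Hf];
 try apply oint_near; try assumption.
{ apply rects_vanish_hol with s0; try apply oint_near; try assumption; intros; auto. }
assert (Z0 : sq s0 R s0) by (apply sq_center; lra).
assert (Cst : forall z, sq s0 R z -> (h z * Cexp (- f z) = h s0 * Cexp (- f s0))%C).
{ intros z Hz.
  apply (cderiv_zero_const (fun z => h z * Cexp (- f z))%C (near (Re s0) R) (near (Im s0) R));
    try apply oint_near; try assumption.
  intros w Hw.
  replace (RtoC 0) with (cder h w * Cexp (- f w) + h w * (Cexp (- f w) * (- (cder h w / h w))))%C
    by (field; apply HN, Hw).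
  apply (is_cderiv_mult h (fun z => Cexp (- f z))); [apply cder_correct; auto|].
  apply (is_cderiv_comp (fun w => - f w)%C Cexp); [apply is_cderiv_opp, Hf, Hw | apply is_cderiv_Cexp]. }
assert (RL : forall z, sq s0 R z -> Re (f z) = ln (Cmod (h z)) - ln (Cmod (h s0)) + Re (f s0)).
{ intros z Hz; assert (E := f_equal Cmod (Cst z Hz)).
  rewrite !Cmod_mult, !Cmod_Cexp in E; simpl in E.
  apply (f_equal ln) in E; rewrite !ln_mult, !ln_exp in E;
   try apply exp_pos; try (apply Cmod_gt_0; auto).
  unfold Re in *; lra. }
rewrite <- (cder_eq f s0 (cder h s0 / h s0)) by (apply Hf, Z0).
eapply Rle_trans; [apply (positive_real_part_gradient f s0 r R (ln M - ln (Cmod (h s0)) + Re (f s0)) Hr)|].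
- intros z Hz; eexists; apply Hf, Hz.
- intros z Hz; rewrite RL by assumption.
  assert (ln (Cmod (h z)) <= ln M); [|lra].
  apply ln_le; [apply Cmod_gt_0; auto | auto].
- right; ring.
Qed.

(** * Powers and the zeta function to the right of the imaginary axis *)

Definition upow (u : R) (s : C) : C := Cexp (- (s * RtoC (ln u))).

Lemma nat_cpow_inv (n : nat) (s : C) : (/ nat_cpow n s)%C = upow (INR n) s.
Proof. unfold nat_cpow, upow; rewrite Cexp_opp; reflexivity. Qed.

Lemma Cmod_upow (u : R) (s : C) : Cmod (upow u s) = Rpower u (- Re s).
Proof.
unfold upow; rewrite Cmod_Cexp; unfold Rpower; f_equal; simpl; unfold Re; ring.
Qed.

Lemma upow_mult (u v : R) (s : C) : 0 < u -> 0 < v -> upow (u * v) s = (upow u s * upow v s)%C.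
Proof.
intros Hu Hv; unfold upow; rewrite ln_mult, <- Cexp_plus, RtoC_plus by assumption; f_equal; ring.
Qed.

Lemma upow_plus (u : R) (s t : C) : upow u (s + t) = (upow u s * upow u t)%C.
Proof. unfold upow; rewrite <- Cexp_plus; f_equal; ring. Qed.

Lemma upow_1 (s : C) : upow 1 s = 1.
Proof. unfold upow; rewrite ln_1, <- Cexp_0; f_equal; ring. Qed.

Lemma Cexp_RtoC (x : R) : Cexp (RtoC x) = RtoC (exp x).
Proof. unfold Cexp, RtoC; simpl; rewrite cos_0, sin_0; f_equal; ring. Qed.

Lemma upow_one (u : R) : 0 < u -> upow u 1 = RtoC (/ u).
Proof.
intros Hu; unfold upow; replace (- (1 * RtoC (ln u)))%C with (RtoC (- ln u)) by (rewrite RtoC_opp; ring).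
rewrite Cexp_RtoC, exp_Ropp, exp_ln by assumption; reflexivity.
Qed.

Lemma is_cderiv_upow (u : R) (s : C) : is_cderiv (upow u) s (upow u s * (- RtoC (ln u)))%C.
Proof.
assert (K : is_cderiv (upow u) s (upow u s * (- (1 * RtoC (ln u) + s * 0)))).
{ apply (is_cderiv_comp (fun s => - (s * RtoC (ln u)))%C Cexp); [|apply is_cderiv_Cexp].
  apply is_cderiv_opp, is_cderiv_mult; [apply is_cderiv_id | apply is_cderiv_const]. }
replace (- RtoC (ln u))%C with (- (1 * RtoC (ln u) + s * 0))%C by ring; exact K.
Qed.

Lemma hol_upow (u : R) (s : C) : hol (upow u) s.
Proof. eexists; apply is_cderiv_upow. Qed.

Lemma rder_upow (u : R) (s : C) : 0 < u -> rder (fun v => upow v s) u (- s * upow u (s + 1))%C.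
Proof.
intros Hu.
assert (K : rder (fun v => upow v s) u (Cexp (- s * RtoC (ln u)) * (0 * RtoC (ln u) + (- s) * RtoC (/ u)))%C).
{ apply rder_ext with (fun v => Cexp (- s * RtoC (ln v)))%C; [intros v; unfold upow; f_equal; ring|].
  apply (rder_path Cexp (fun v => - s * RtoC (ln v))%C); [apply is_cderiv_Cexp|].
  apply (rder_mult (fun _ => - s)%C (fun v => RtoC (ln v))); [apply rder_const|].
  apply rder_RtoC, is_derive_Reals, derivable_pt_lim_ln, Hu. }
rewrite upow_plus, upow_one by assumption.
replace (- s * (upow u s * RtoC (/ u)))%C with
 (Cexp (- s * RtoC (ln u)) * (0 * RtoC (ln u) + (- s) * RtoC (/ u)))%C; [exact K|].
unfold upow; replace (- (s * RtoC (ln u)))%C with (- s * RtoC (ln u))%C by ring; ring.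
Qed.

Lemma ccont_upow (u : R) (s : C) : 0 < u -> ccont (fun v => upow v s) u.
Proof. intros Hu; eapply rder_ccont, rder_upow, Hu. Qed.

Lemma Rpower_le_neg (u v a : R) : 0 < u <= v -> 0 <= a -> Rpower v (- a) <= Rpower u (- a).
Proof.
intros Huv Ha; unfold Rpower.
assert (ln u <= ln v) by (apply ln_le; lra).
assert (- a * ln v <= - a * ln u) by nra.
destruct H0 as [L | E]; [left; apply exp_increasing, L | right; f_equal; exact E].
Qed.

Lemma Rpower_le_exp (u a b : R) : 1 <= u -> a <= b -> Rpower u a <= Rpower u b.
Proof.
intros Hu Hab; unfold Rpower.
assert (0 <= ln u) by (rewrite <- ln_1; apply ln_le; lra).
assert (a * ln u <= b * ln u) by (apply Rmult_le_compat_r; assumption).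
destruct H0 as [L | E]; [left; apply exp_increasing, L | right; f_equal; exact E].
Qed.

Lemma Rpower_pos (u a : R) : 0 < Rpower u a.
Proof. apply exp_pos. Qed.

(** The derivative in the base is [- s v^(- s - 1)], largest in modulus at the left end. *)
Lemma upow_lipschitz (u v : R) (s : C) : 0 < u <= v -> 0 <= Re s ->
  Cmod (upow v s - upow u s) <= 2 * (Cmod s * Rpower u (- (Re s + 1))) * (v - u).
Proof.
intros Huv Hs.
apply (lipschitz_path (fun v => upow v s) (fun t => (- s * upow t (s + 1))%C)); [lra | |].
- intros t Ht; apply rder_upow; lra.
- intros t Ht; rewrite Cmod_mult, Cmod_opp, Cmod_upow.
  apply Rmult_le_compat_l; [apply Cmod_ge_0|].
  replace (Re (s + 1)) with (Re s + 1) by reflexivity.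
  apply Rpower_le_neg; lra.
Qed.

(** ** Series of powers *)

Lemma telescope_series (a : nat -> R) : is_lim_seq a 0 -> is_series (fun n => a n - a (S n)) (a 0%nat).
Proof.
intros H; change (is_lim_seq (sum_n (fun n => a n - a (S n))) (a 0%nat)).
apply (is_lim_seq_ext (fun n => a 0%nat - a (S n))).
- intros n; induction n as [|n IH]; [rewrite sum_O; reflexivity|].
  rewrite sum_Sn, <- IH; unfold plus; simpl; ring.
- replace (Finite (a 0%nat)) with (Rbar_minus (a 0%nat) 0) by (simpl; f_equal; ring).
  apply (is_lim_seq_minus' (fun _ => a 0%nat)); [apply is_lim_seq_const|].
  apply is_lim_seq_incr_1 in H; exact H.
Qed.

Lemma Rpower_lim_0 (d : R) : 0 < d -> is_lim_seq (fun n => Rpower (INR (S n)) (- d)) 0.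
Proof.
intros Hd; apply is_lim_seq_spec; intros e; pose proof (cond_pos e) as He.
destruct (nfloor_ex (Rpower (/ e) (/ d))) as [N HN]; [left; apply exp_pos|].
exists (S N); intros n Hn.
rewrite Rminus_0_r, Rabs_right by (left; apply exp_pos).
assert (P : 0 < INR (S n)) by (apply lt_0_INR; lia).
assert (L : Rpower (/ e) (/ d) < INR (S n)).
{ eapply Rlt_le_trans; [apply HN|]; rewrite <- S_INR; apply le_INR; lia. }
rewrite Rpower_Ropp.
assert (K : / e < Rpower (INR (S n)) d).
{ replace (/ e) with (Rpower (Rpower (/ e) (/ d)) d).
  - apply Rlt_Rpower_l; [assumption|]; split; [apply exp_pos | assumption].
  - rewrite Rpower_mult, Rinv_l, Rpower_1 by (lra || apply Rinv_0_lt_compat, He); reflexivity. }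
rewrite <- (Rinv_inv e); apply Rinv_lt_contravar; [|assumption].
apply Rmult_lt_0_compat; [apply Rinv_0_lt_compat, He | apply exp_pos].
Qed.

(** The mean value theorem for [v^(-d)]; summed over [u], it bounds the series of
    [n^(- d - 1)] by a telescoping one. *)
Lemma power_telescope (d u : R) : 0 < d -> 0 < u ->
  d * Rpower (u + 1) (- (d + 1)) <= Rpower u (- d) - Rpower (u + 1) (- d).
Proof.
intros Hd Hu.
destruct (MVT_gen (fun x => Rpower x (- d)) u (u + 1) (fun x => - d * Rpower x (- d - 1))) as [c [Hc E]].
- rewrite Rmin_left, Rmax_right by lra; intros x Hx; apply is_derive_Reals, derivable_pt_lim_power; lra.
- rewrite Rmin_left, Rmax_right by lra; intros x Hx.
  apply derivable_continuous_pt; eexists; apply derivable_pt_lim_power; lra.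
- rewrite Rmin_left, Rmax_right in Hc by lra.
  replace (Rpower u (- d) - Rpower (u + 1) (- d)) with (d * Rpower c (- d - 1)).
  + apply Rmult_le_compat_l; [lra|].
    replace (- d - 1) with (- (d + 1)) by ring; apply Rpower_le_neg; lra.
  + replace (u + 1 - u) with 1 in E by ring; lra.
Qed.

Lemma Series_nonneg (a : nat -> R) : (forall n, 0 <= a n) -> ex_series a -> 0 <= Series a.
Proof.
intros H Ha.
assert (E : Series (fun n => Rabs (a n)) = Series a).
{ apply Series_ext; intros n; apply Rabs_right, Rle_ge, H. }
rewrite <- E; eapply Rle_trans; [apply Rabs_pos | apply Series_Rabs].
eapply ex_series_ext; [|exact Ha]; intros n; symmetry; apply Rabs_right, Rle_ge, H.
Qed.

(** Term [n] is [(n + 1)^(-a)]; this scale of convergent series serves as majorant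
    throughout. *)
Definition zser (a : R) (n : nat) : R := Rpower (INR (S n)) (- a).

Lemma ex_zser (a : R) : 1 < a -> ex_series (zser a).
Proof.
intros Ha; apply ex_series_incr_1.
apply (ex_series_le (V := R_CompleteNormedModule) _
  (fun n => / (a - 1) * (Rpower (INR (S n)) (- (a - 1)) - Rpower (INR (S (S n))) (- (a - 1))))).
- intros n; unfold norm; simpl; unfold abs; simpl; unfold zser.
  rewrite Rabs_right by (left; apply exp_pos).
  assert (P : 0 < INR (S n)) by (apply lt_0_INR; lia).
  pose proof (power_telescope (a - 1) (INR (S n)) ltac:(lra) P) as K.
  replace (a - 1 + 1) with a in K by ring; rewrite <- S_INR in K.
  apply Rmult_le_reg_l with (a - 1); [lra|].
  rewrite <- Rmult_assoc, Rinv_r, Rmult_1_l by lra; exact K.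
- apply (ex_series_scal (V := R_NormedModule)); eexists.
  apply (telescope_series (fun n => Rpower (INR (S n)) (- (a - 1)))), Rpower_lim_0; lra.
Qed.

Lemma zser_pos (a : R) (n : nat) : 0 < zser a n.
Proof. apply exp_pos. Qed.

Lemma zser_mono (a b : R) (n : nat) : a <= b -> zser b n <= zser a n.
Proof.
intros H; apply Rpower_le_exp; [|lra].
rewrite S_INR; pose proof (pos_INR n); lra.
Qed.

Lemma INR_S_ge_1 (n : nat) : 1 <= INR (S n).
Proof. rewrite S_INR; pose proof (pos_INR n); lra. Qed.

(** ** The sum defining [(s - 1) zeta s] for positive real part *)

(** The entire function [(e^z - 1) / z]. *)
Definition expm1_div : C -> C := slope Cexp 0.

Lemma hol_expm1_div (z : C) : hol expm1_div z.
Proof. apply slope_hol with 1; [lra | |]; intros; apply hol_Cexp. Qed.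

Lemma expm1_div_0 : expm1_div 0 = 1.
Proof.
unfold expm1_div; rewrite slope_at; apply cder_eq; exact is_cderiv_Cexp_0.
Qed.

Lemma expm1_div_mult (z : C) : (expm1_div z * z)%C = (Cexp z - 1)%C.
Proof.
transitivity (expm1_div z * (z - 0))%C; [f_equal; ring|].
unfold expm1_div; rewrite slope_mult, Cexp_0; reflexivity.
Qed.

(** The integral of [v^(-s)] over [[u, w]], written so as to make sense at [s = 1]. *)
Definition upow_int (u w : R) (s : C) : C :=
  (upow u (s - 1) * (RtoC (ln (w / u)) * expm1_div ((1 - s) * RtoC (ln (w / u)))))%C.

Lemma upow_int_mult (u w : R) (s : C) : 0 < u -> 0 < w ->
  ((1 - s) * upow_int u w s)%C = (upow w (s - 1) - upow u (s - 1))%C.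
Proof.
intros Hu Hw; unfold upow_int.
set (L := RtoC (ln (w / u))).
transitivity (upow u (s - 1) * (expm1_div ((1 - s) * L) * ((1 - s) * L)))%C; [ring|].
rewrite expm1_div_mult.
assert (E : upow w (s - 1) = (upow u (s - 1) * Cexp ((1 - s) * L))%C).
{ unfold upow, L; rewrite <- Cexp_plus, ln_div, RtoC_minus by assumption; f_equal; ring. }
rewrite E; ring.
Qed.

Lemma upow_int_correct (u w : R) (s : C) : 0 < u <= w -> cint (fun v => upow v s) u w = upow_int u w s.
Proof.
intros Huw.
destruct (classic (s = 1)) as [-> | N].
- rewrite (cint_FTC (fun v => RtoC (ln v))).
  + unfold upow_int; replace (1 - 1)%C with (RtoC 0) by ring; rewrite Cmult_0_l, expm1_div_0.
    replace (upow u 0) with (RtoC 1) by (unfold upow; rewrite <- Cexp_0; f_equal; ring).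
    rewrite ln_div, RtoC_minus by lra; ring.
  + rewrite Rmin_left, Rmax_right by lra; intros t Ht; rewrite upow_one by lra.
    apply rder_RtoC, is_derive_Reals, derivable_pt_lim_ln; lra.
  + rewrite Rmin_left, Rmax_right by lra; intros t Ht; apply ccont_upow; lra.
- assert (N1 : (1 - s)%C <> 0) by (apply Cminus_neq_0; auto).
  rewrite (cint_FTC (fun v => / (1 - s) * upow v (s - 1))%C).
  + transitivity (/ (1 - s) * ((1 - s) * upow_int u w s))%C; [|field; assumption].
    rewrite upow_int_mult by lra; ring.
  + rewrite Rmin_left, Rmax_right by lra; intros t Ht.
    assert (K : rder (fun v => / (1 - s) * upow v (s - 1))%C t
      (0 * upow t (s - 1) + / (1 - s) * (- (s - 1) * upow t (s - 1 + 1)))%C).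
    { apply (rder_mult (fun _ => / (1 - s))%C (fun v => upow v (s - 1))); [apply rder_const|].
      apply rder_upow; lra. }
    replace (s - 1 + 1)%C with s in K by ring.
    replace (0 * upow t (s - 1) + / (1 - s) * (- (s - 1) * upow t s))%C with (upow t s) in K
      by (field; assumption); exact K.
  + rewrite Rmin_left, Rmax_right by lra; intros t Ht; apply ccont_upow; lra.
Qed.

Lemma hol_upow_int (u w : R) (s : C) : hol (upow_int u w) s.
Proof.
unfold upow_int; apply hol_mult.
- apply (hol_comp (fun s => s - 1)%C (upow u)); [|apply hol_upow].
  apply hol_sub_const.
- apply (hol_mult (fun _ => RtoC (ln (w / u)))); [apply hol_const|].
  apply (hol_comp (fun s => (1 - s) * RtoC (ln (w / u)))%C expm1_div); [|apply hol_expm1_div].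
  apply (hol_mult (fun s => 1 - s)%C); [|apply hol_const].
  apply hol_minus; [apply hol_const | apply hol_id].
Qed.

(** The difference between [(n+1)^(-s)] and the integral of [v^(-s)] over
    [[n + 1, n + 2]]. It is [O(|s| n^(- Re s - 1))], summable for [Re s > 0]. *)
Definition zterm (n : nat) (s : C) : C :=
  (upow (INR (S n)) s - upow_int (INR (S n)) (INR (S (S n))) s)%C.

Lemma zterm_bound (n : nat) (s : C) : 0 <= Re s -> Cmod (zterm n s) <= 2 * Cmod s * zser (Re s + 1) n.
Proof.
intros Hs; unfold zterm, zser.
set (u := INR (S n)); assert (Hu : 1 <= u) by apply INR_S_ge_1.
assert (Eu : INR (S (S n)) = u + 1) by (unfold u; rewrite (S_INR (S n)); reflexivity).
rewrite Eu, <- upow_int_correct by lra.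
assert (E : (upow u s - cint (fun v => upow v s) u (u + 1) = cint (fun v => upow u s - upow v s) u (u + 1))%C).
{ rewrite cint_minus, cint_const.
  - replace (u + 1 - u) with 1 by ring; ring.
  - apply cex_cont; intros; apply ccont_const.
  - apply cex_cont_le; [lra|]; intros; apply ccont_upow; lra. }
rewrite E.
eapply Rle_trans; [apply (cint_bound_const _ (2 * Cmod s * Rpower u (- (Re s + 1)))); [lra | |]|].
- apply cex_cont_le; [lra|]; intros; apply ccont_minus; [apply ccont_const | apply ccont_upow; lra].
- intros t Ht; rewrite Cmod_minus_sym.
  eapply Rle_trans; [apply upow_lipschitz; lra|].
  pose proof (Cmod_ge_0 s); pose proof (Rpower_pos u (- (Re s + 1))).
  assert (0 <= 2 * (Cmod s * Rpower u (- (Re s + 1)))) by nra.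
  nra.
- right; ring.
Qed.

Lemma hol_zterm (n : nat) (s : C) : hol (zterm n) s.
Proof. apply hol_minus; [apply hol_upow | apply hol_upow_int]. Qed.

(** The function [(s - 1) zeta s] without reference to [zeta]: the integrals subtracted in
    [zterm] add up to [1 / (s - 1)]. *)
Definition Hzeta (s : C) : C := (1 + (s - 1) * cser (fun n => zterm n s))%C.

Lemma sq_Re (z0 z : C) (r : R) : sq z0 r z -> Re z0 - r < Re z < Re z0 + r.
Proof. intros [H _]; unfold near in H; apply Rabs_def2 in H; lra. Qed.

Lemma sq_Im (z0 z : C) (r : R) : sq z0 r z -> Im z0 - r < Im z < Im z0 + r.
Proof. intros [_ H]; unfold near in H; apply Rabs_def2 in H; lra. Qed.

Lemma sq_Cmod (z0 z : C) (r : R) : sq z0 r z -> Cmod z <= Cmod z0 + 2 * r.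
Proof.
intros H; apply sq_disc in H.
pose proof (Cmod_triangle_rev z z0); lra.
Qed.

Lemma hol_Hzeta (s : C) : 0 < Re s -> hol Hzeta s.
Proof.
intros Hs; unfold Hzeta; apply (hol_plus (fun _ => RtoC 1)); [apply hol_const|].
apply (hol_mult (fun s => s - 1)%C); [apply hol_sub_const|].
apply (Mtest_hol zterm (fun n => 2 * (Cmod s + Re s) * zser (Re s / 2 + 1) n) s (Re s / 2)).
- lra.
- intros; apply hol_zterm.
- intros n z Hz; pose proof (sq_Re _ _ _ Hz); pose proof (sq_Cmod _ _ _ Hz).
  eapply Rle_trans; [apply zterm_bound; lra|].
  pose proof (Cmod_ge_0 z); pose proof (zser_pos (Re z + 1) n).
  apply Rmult_le_compat; try lra.
  apply zser_mono; lra.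
- apply (ex_series_scal (V := R_NormedModule)), ex_zser; lra.
- apply sq_center; lra.
Qed.

Lemma Hzeta_bound : exists K, 0 < K /\ forall s, 1 / 2 <= Re s -> Cmod (Hzeta s) <= K * (1 + Cmod s) ^ 2.
Proof.
set (S0 := Series (zser (3 / 2))).
assert (X : ex_series (zser (3 / 2))) by (apply ex_zser; lra).
assert (P : 0 <= S0).
{ apply Series_nonneg; [intros; left; apply zser_pos | assumption]. }
exists (1 + 4 * S0); split; [lra|]; intros s Hs.
unfold Hzeta; eapply Rle_trans; [apply Cmod_triangle|].
rewrite Cmod_1, Cmod_mult.
assert (B : Cmod (cser (fun n => zterm n s)) <= 2 * (2 * Cmod s * S0)).
{ unfold S0; rewrite <- Series_scal_l.
  apply cser_bound; [|apply (ex_series_scal (V := R_NormedModule)), X].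
  intros n; eapply Rle_trans; [apply zterm_bound; lra|].
  pose proof (Cmod_ge_0 s).
  apply Rmult_le_compat_l; [lra | apply zser_mono; lra]. }
pose proof (Cmod_triangle_minus s 1) as T; rewrite Cmod_1 in T.
pose proof (Cmod_ge_0 s); pose proof (Cmod_ge_0 (s - 1)); pose proof (Cmod_ge_0 (cser (fun n => zterm n s))).
assert (Cmod (s - 1) * Cmod (cser (fun n => zterm n s)) <= (Cmod s + 1) * (2 * (2 * Cmod s * S0))).
{ apply Rmult_le_compat; assumption. }
assert (0 <= Cmod s * S0) by (apply Rmult_le_pos; assumption).
nra.
Qed.

Lemma clim_majorant (a : nat -> C) (l : C) (e : nat -> R) :
  (forall n, Cmod (a n - l) <= e n) -> is_lim_seq e 0 -> clim a l.
Proof.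
intros H He eps Heps; apply is_lim_seq_spec in He; destruct (He (mkposreal eps Heps)) as [N HN].
exists N; intros n Hn; specialize (HN n Hn); simpl in HN; rewrite Rminus_0_r in HN.
eapply Rle_trans; [apply H|]; pose proof (Rle_abs (e n)); lra.
Qed.

Lemma sum_n_csum (a : nat -> C) (n : nat) : sum_n (G := C_NormedModule) a n = csum a (S n).
Proof.
induction n as [|n IH].
- rewrite sum_O; simpl; ring.
- rewrite sum_Sn, IH; reflexivity.
Qed.

Lemma is_series_clim (a : nat -> C) (l : C) : is_series (V := C_NormedModule) a l -> clim (csum a) l.
Proof.
intros H e He.
assert (B : locally (T := C_UniformSpace) l (fun z => Cmod (z - l) <= e)).
{ exists (mkposreal (e / 2) ltac:(lra)); intros z [Hz1 Hz2].
  change (Rabs (Re z - Re l) < e / 2) in Hz1; change (Rabs (Im z - Im l) < e / 2) in Hz2.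
  eapply Rle_trans; [apply Cmod_le_Re_Im|].
  change (Rabs (Re z - Re l) + Rabs (Im z - Im l) <= e); lra. }
destruct (H _ B) as [N HN].
exists (S N); intros [|n] Hn; [lia|]; rewrite <- sum_n_csum; apply HN; lia.
Qed.

(** The integrals in [zterm] form a telescoping sum of values of [v^(1 - s)] over [1 - s]. *)
Lemma zeta_partial_sum (s : C) (N : nat) : s <> 1 ->
  csum (fun n => zterm n s) N =
  (csum (fun n => / nat_cpow (S n) s) N - / (1 - s) * (upow (INR (S N)) (s - 1) - 1))%C.
Proof.
intros Ns; assert (N1 : (1 - s)%C <> 0) by (apply Cminus_neq_0; auto).
induction N as [|N IH].
- simpl; rewrite upow_1; ring.
- change (csum (fun n => zterm n s) (S N)) with (csum (fun n => zterm n s) N + zterm N s)%C.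
  change (csum (fun n => / nat_cpow (S n) s)%C (S N)) with
    (csum (fun n => / nat_cpow (S n) s) N + / nat_cpow (S N) s)%C.
  rewrite IH, nat_cpow_inv; unfold zterm.
  assert (E := upow_int_mult (INR (S N)) (INR (S (S N))) s
   ltac:(pose proof (INR_S_ge_1 N); lra) ltac:(pose proof (INR_S_ge_1 (S N)); lra)).
  set (J := upow_int (INR (S N)) (INR (S (S N))) s) in *.
  replace J with (/ (1 - s) * ((1 - s) * J))%C at 1 by (field; assumption).
  rewrite E; ring.
Qed.

Lemma Hzeta_right (zeta : C -> C) (s : C) : is_riemann_zeta zeta -> 1 < Re s ->
  Hzeta s = ((s - 1) * zeta s)%C.
Proof.
intros [HZ _] Hs.
assert (Ns : s <> 1) by (intros ->; simpl in Hs; lra).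
assert (N1 : (1 - s)%C <> 0) by (apply Cminus_neq_0; auto).
assert (L1 : clim (csum (fun n => zterm n s)) (cser (fun n => zterm n s))).
{ apply cser_clim with (fun n => 2 * Cmod s * zser (Re s + 1) n).
  - intros n; apply zterm_bound; lra.
  - apply (ex_series_scal (V := R_NormedModule)), ex_zser; lra. }
assert (L2 : clim (csum (fun n => zterm n s)) (zeta s + - / (1 - s) * (0 + - (1)))%C).
{ apply tends_ext with (fun N => csum (fun n => / nat_cpow (S n) s) N +
    - / (1 - s) * (upow (INR (S N)) (s - 1) + - (1)))%C.
  { intros n; rewrite zeta_partial_sum by assumption; ring. }
  apply tends_plus; [apply is_series_clim, HZ, Hs|].
  apply tends_scal, tends_plus; [|apply tends_const].
  apply clim_majorant with (fun n => Rpower (INR (S n)) (- (Re s - 1))).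
  - intros n; replace (upow (INR (S n)) (s - 1) - 0)%C with (upow (INR (S n)) (s - 1)) by ring.
    rewrite Cmod_upow; right; reflexivity.
  - apply Rpower_lim_0; lra. }
unfold Hzeta; rewrite (tends_unique _ _ _ L1 L2); field; assumption.
Qed.

Lemma is_derive_hol (f : C -> C) (z : C) :
  ex_derive (K := C_AbsRing) (V := C_NormedModule) f z -> hol f z.
Proof.
intros [l [_ H]]; exists l; intros e He.
specialize (H z (fun P HP => HP)).
destruct (H (mkposreal e He)) as [d Hd].
exists d; split; [apply cond_pos|]; intros w Hw.
specialize (Hd w).
assert (B : ball (M := C_UniformSpace) z d w).
{ split; [change (Rabs (Re w - Re z) < d) | change (Rabs (Im w - Im z) < d)].
  - eapply Rle_lt_trans; [apply (re_le_Cmod (w - z)) | assumption].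
  - eapply Rle_lt_trans; [apply (im_le_Cmod (w - z)) | assumption]. }
assert (B' : ball (M := AbsRing_UniformSpace C_AbsRing) z d w) by exact Hw.
specialize (Hd B').
change (Cmod ((f w - f z) - (w - z) * l)%C <= e * Cmod (w - z)%C) in Hd.
replace (f w - f z - l * (w - z))%C with ((f w - f z) - (w - z) * l)%C by ring; exact Hd.
Qed.

(** Both sides are holomorphic for positive real part except at [1]; the points
    off the real axis are reached horizontally from the right, the real ones
    vertically from there. *)
Lemma Hzeta_eq (zeta : C -> C) (s : C) : is_riemann_zeta zeta -> 0 < Re s -> s <> 1 ->
  Hzeta s = ((s - 1) * zeta s)%C.
Proof.
intros HZ Hs Ns.
set (D := fun z => (Hzeta z - (z - 1) * zeta z)%C).
assert (HD : forall z, 0 < Re z -> z <> 1 -> hol D z).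
{ intros z Hz Nz; apply hol_minus; [apply hol_Hzeta, Hz|].
  apply hol_mult; [apply hol_sub_const|].
  apply is_derive_hol, HZ, Nz. }
assert (Zr : forall z, 1 < Re z -> D z = 0).
{ intros z Hz; unfold D; rewrite (Hzeta_right zeta z HZ Hz); ring. }
assert (Off : forall z, 0 < Re z -> Im z <> 0 -> D z = 0).
{ intros z Hz Iz; apply (identity_segment D (2, Im z)).
  - intros t Ht; set (p := ((2, Im z) + RtoC t * (z - (2, Im z)))%C).
    assert (Ep : Re p = 2 + t * (Re z - 2)) by (unfold p; simpl; unfold Re, Im; simpl; ring).
    assert (Ei : Im p = Im z) by (unfold p; simpl; unfold Re, Im; simpl; ring).
    assert (Pp : 0 < Re p) by (rewrite Ep; nra).
    exists (Rmin (Re p) (Rabs (Im z))); split.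
    + apply Rmin_pos; [assumption | apply Rabs_pos_lt, Iz].
    + intros w Hw; pose proof (Rmin_l (Re p) (Rabs (Im z))); pose proof (Rmin_r (Re p) (Rabs (Im z))).
      pose proof (sq_Re _ _ _ Hw); apply HD; [lra|].
      intros ->; destruct Hw as [_ Hw]; unfold near in Hw; rewrite Ei in Hw.
      change (Im 1) with 0 in Hw.
      replace (0 - Im z) with (- Im z) in Hw by ring; rewrite Rabs_Ropp in Hw; lra.
  - exists 1; split; [lra|]; intros w Hw; apply Zr.
    apply disc_sq, sq_Re in Hw; change (Re (2, Im z)) with 2 in Hw; lra. }
assert (E : D s = 0).
{ destruct (Req_dec (Im s) 0) as [Is | Is]; [|apply Off; assumption].
  apply (identity_segment D (s + Ci)%C).
  - intros t Ht; set (p := (s + Ci + RtoC t * (s - (s + Ci)))%C).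
    assert (Ep : Re p = Re s) by (unfold p; simpl; unfold Re, Im; simpl; ring).
    assert (N1 : Re s - 1 <> 0).
    { intros K; apply Ns; destruct s as [a b]; simpl in *; unfold Re, Im in *; simpl in *.
      subst b; replace a with 1 by lra; reflexivity. }
    exists (Rmin (Re s) (Rabs (Re s - 1))); split; [apply Rmin_pos; [assumption | apply Rabs_pos_lt, N1]|].
    intros w Hw; pose proof (Rmin_l (Re s) (Rabs (Re s - 1))); pose proof (Rmin_r (Re s) (Rabs (Re s - 1))).
    pose proof (sq_Re _ _ _ Hw); apply HD; [lra|].
    intros ->; destruct Hw as [Hw _]; unfold near in Hw; rewrite Ep in Hw.
    change (Re 1) with 1 in Hw; rewrite Rabs_minus_sym in Hw; lra.
  - exists (Rmin (Re s) 1); split; [apply Rmin_pos; lra|]; intros w Hw.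
    apply disc_sq in Hw; pose proof (sq_Re _ _ _ Hw); pose proof (sq_Im _ _ _ Hw).
    pose proof (Rmin_l (Re s) 1); pose proof (Rmin_r (Re s) 1).
    assert (A1 : Re (s + Ci) = Re s) by (simpl; unfold Re; ring).
    assert (A2 : Im (s + Ci) = 1) by (unfold Im in *; simpl; rewrite Is; ring).
    apply Off; lra. }
unfold D in E; rewrite <- (Cplus_0_l ((s - 1) * zeta s)), <- E; ring.
Qed.

Lemma Hzeta_1 : Hzeta 1 = 1.
Proof. unfold Hzeta; ring. Qed.

(** * Primes and the Euler product *)

Definition isprime (n : nat) : bool := if prime_dec (Z.of_nat n) then true else false.

Lemma isprime_spec (n : nat) : isprime n = true <-> prime (Z.of_nat n).
Proof. unfold isprime; destruct (prime_dec (Z.of_nat n)); split; intros; auto; discriminate. Qed.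

Lemma isprime_ge_2 (n : nat) : isprime n = true -> (2 <= n)%nat.
Proof. intros H; apply isprime_spec in H; destruct H; lia. Qed.

Lemma divide_Z (a b : nat) : Nat.divide a b <-> (Z.of_nat a | Z.of_nat b)%Z.
Proof.
split.
- intros [c ->]; exists (Z.of_nat c); lia.
- intros [c Hc]; destruct (Nat.eq_dec a 0) as [-> | N].
  + exists 0%nat; lia.
  + exists (Z.to_nat c); nia.
Qed.

Lemma prime_factor_exists (n : nat) : (2 <= n)%nat -> exists q, isprime q = true /\ Nat.divide q n.
Proof.
induction n as [n IH] using lt_wf_ind; intros Hn.
destruct (isprime n) eqn:E; [exists n; split; [assumption | exists 1%nat; lia]|].
assert (Np : ~ prime (Z.of_nat n)) by (rewrite <- isprime_spec; congruence).
destruct (not_prime_divide (Z.of_nat n) ltac:(lia) Np) as [m [Hm Dm]].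
destruct (IH (Z.to_nat m)) as [q [Q1 Q2]]; try lia.
exists q; split; [assumption|].
eapply Nat.divide_trans; [exact Q2|]; apply divide_Z; rewrite Z2Nat.id by lia; assumption.
Qed.

Lemma prime_divides_mult (q p m : nat) : isprime q = true -> isprime p = true ->
  Nat.divide q (p * m) -> q = p \/ Nat.divide q m.
Proof.
intros Hq Hp H; apply isprime_spec in Hq; apply isprime_spec in Hp.
apply divide_Z in H; rewrite Nat2Z.inj_mul in H.
apply prime_mult in H; [|assumption]; destruct H as [H | H].
- left; apply prime_div_prime in H; try assumption; lia.
- right; apply divide_Z, H.
Qed.

Definition rough (k n : nat) : Prop := forall q, isprime q = true -> (q <= k)%nat -> ~ Nat.divide q n.

(** The terms of the zeta series at the integers without prime factors up to [k]. *)
Definition sieved (k : nat) (s : C) (n : nat) : C :=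
  if excluded_middle_informative (rough k (S n)) then upow (INR (S n)) s else 0.

Lemma sieved_in (k n : nat) (s : C) : rough k (S n) -> sieved k s n = upow (INR (S n)) s.
Proof. unfold sieved; destruct excluded_middle_informative; tauto. Qed.

Lemma sieved_out (k n : nat) (s : C) : ~ rough k (S n) -> sieved k s n = 0.
Proof. unfold sieved; destruct excluded_middle_informative; tauto. Qed.

Lemma sieved_bound (k n : nat) (s : C) (a : R) : a <= Re s -> Cmod (sieved k s n) <= zser a n.
Proof.
intros H; unfold sieved; destruct excluded_middle_informative.
- rewrite Cmod_upow; apply (zser_mono a (Re s) n H).
- rewrite Cmod_0; left; apply zser_pos.
Qed.

Lemma rough_S_prime (k n : nat) : isprime (S k) = true ->
  (rough (S k) n <-> rough k n /\ ~ Nat.divide (S k) n).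
Proof.
intros Hp; split.
- intros H; split; [intros q Q L; apply H; [assumption | lia] | apply H; [assumption | lia]].
- intros [H1 H2] q Q L; destruct (Nat.eq_dec q (S k)) as [-> | N]; [assumption | apply H1; [assumption | lia]].
Qed.

Lemma rough_S_composite (k n : nat) : isprime (S k) = false -> (rough (S k) n <-> rough k n).
Proof.
intros Hp; split; intros H q Q L; [apply H; [assumption | lia]|].
apply H; [assumption|]; destruct (Nat.eq_dec q (S k)) as [-> | N]; [congruence | lia].
Qed.

Lemma rough_mult (k m : nat) : isprime (S k) = true -> (rough k (S k * m) <-> rough k m).
Proof.
intros Hp; split; intros H q Q L D; apply (H q Q L).
- apply Nat.divide_mul_r, D.
- destruct (prime_divides_mult q (S k) m Q Hp D) as [-> | D']; [lia | assumption].
Qed.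

(** Among the integers up to [N] without prime factors up to [k], the multiples of the
    prime [p = k + 1] are [p] times those up to [N / p]. *)
Lemma sieve_step (k N : nat) (s : C) : isprime (S k) = true ->
  csum (sieved (S k) s) N =
  (csum (sieved k s) N - upow (INR (S k)) s * csum (sieved k s) (N / S k))%C.
Proof.
intros Hp; pose proof (isprime_ge_2 _ Hp) as P2.
induction N as [|N IH].
- rewrite Nat.Div0.div_0_l; simpl; ring.
- change (csum (sieved (S k) s) (S N)) with (csum (sieved (S k) s) N + sieved (S k) s N)%C.
  change (csum (sieved k s) (S N)) with (csum (sieved k s) N + sieved k s N)%C.
  rewrite IH.
  destruct (classic (Nat.divide (S k) (S N))) as [[m Hm] | Nd].
  + destruct m as [|m]; [lia|].
    assert (E1 : (S N / S k = S m)%nat) by (rewrite Hm; apply Nat.div_mul; lia).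
    assert (E2 : (N / S k = m)%nat).
    { symmetry; apply (Nat.div_unique N (S k) m k); nia. }
    rewrite E1, E2.
    change (csum (sieved k s) (S m)) with (csum (sieved k s) m + sieved k s m)%C.
    assert (E3 : sieved (S k) s N = 0).
    { apply sieved_out; rewrite rough_S_prime by assumption; intros [_ H]; apply H; exists (S m); assumption. }
    assert (E4 : sieved k s N = (upow (INR (S k)) s * sieved k s m)%C).
    { assert (R0 : rough k (S N) <-> rough k (S m)).
      { rewrite Hm, Nat.mul_comm; apply rough_mult, Hp. }
      destruct (classic (rough k (S m))) as [Rm | Rm].
      - rewrite !sieved_in by tauto.
        rewrite Hm, mult_INR, upow_mult by (apply lt_0_INR; lia); ring.
      - rewrite !sieved_out by tauto; ring. }
    rewrite E3, E4; ring.
  + assert (E1 : (S N / S k = N / S k)%nat).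
    { symmetry; apply (Nat.div_unique (S N) (S k) (N / S k) (S (N mod S k))).
      - pose proof (Nat.mod_upper_bound N (S k) ltac:(lia)) as U.
        destruct (Nat.eq_dec (S (N mod S k)) (S k)) as [E | E]; [|lia].
        exfalso; apply Nd; exists (S (N / S k)).
        pose proof (Nat.div_mod_eq N (S k)); nia.
      - pose proof (Nat.div_mod_eq N (S k)); lia. }
    assert (E2 : sieved (S k) s N = sieved k s N).
    { assert (R0 := rough_S_prime k (S N) Hp).
      destruct (classic (rough k (S N))) as [Rm | Rm].
      - rewrite !sieved_in by tauto; reflexivity.
      - rewrite !sieved_out by tauto; reflexivity. }
    rewrite E1, E2; ring.
Qed.

Lemma clim_div (a : nat -> C) (l : C) (p : nat) : (0 < p)%nat -> clim a l -> clim (fun n => a (n / p)%nat) l.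
Proof.
intros Hp A e He; destruct (A e He) as [N H]; exists (N * p)%nat; intros n Hn; apply H.
apply Nat.div_le_lower_bound; lia.
Qed.

Definition sieved_sum (k : nat) (s : C) : C := cser (sieved k s).

Lemma sieved_clim (k : nat) (s : C) : 1 < Re s -> clim (csum (sieved k s)) (sieved_sum k s).
Proof.
intros Hs; apply cser_clim with (zser (Re s)).
- intros n; apply sieved_bound; lra.
- apply ex_zser, Hs.
Qed.

Fixpoint cprod (u : nat -> C) (n : nat) : C :=
  match n with O => RtoC 1 | S m => (cprod u m * u m)%C end.

(** The value [0] off the primes makes the Euler factor there equal to [1], so that products
    and sums over primes are products and sums over all indices. *)
Definition ppow (s : C) (n : nat) : C := if isprime n then upow (INR n) s else 0.
Definition eulerN (N : nat) (s : C) : C := cprod (fun n => / (1 - ppow s n))%C (S N).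

Lemma Rpower_2_half : Rpower 2 (- (1 / 2)) <= 3 / 4.
Proof.
rewrite Rpower_Ropp.
assert (E : Rpower 2 (1 / 2) = sqrt 2).
{ replace (1 / 2) with (/ 2) by field; apply Rpower_sqrt; lra. }
rewrite E.
assert (4 / 3 <= sqrt 2).
{ rewrite <- (sqrt_square (4 / 3)) by lra; apply sqrt_le_1; lra. }
apply Rle_trans with (/ (4 / 3)); [apply Rinv_le_contravar; lra | lra].
Qed.

(** The bound [2^(-1/2) <= 3/4] keeps every Euler factor uniformly away from its pole. *)
Lemma ppow_small (s : C) (n : nat) : 1 / 2 <= Re s -> Cmod (ppow s n) <= 3 / 4.
Proof.
intros Hs; unfold ppow; destruct (isprime n) eqn:E; [|rewrite Cmod_0; lra].
apply isprime_ge_2, le_INR in E; simpl in E.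
rewrite Cmod_upow; eapply Rle_trans; [|apply Rpower_2_half].
eapply Rle_trans; [apply (Rpower_le_exp (INR n) _ (- (1 / 2))); lra|].
apply Rpower_le_neg; lra.
Qed.

Lemma ppow_bound (s : C) (a : R) (n : nat) : 0 <= a <= Re s -> Cmod (ppow s n) <= zser a n * Rpower 2 a.
Proof.
intros Ha; unfold ppow; destruct (isprime n) eqn:E.
- apply isprime_ge_2 in E; rewrite Cmod_upow; unfold zser.
  assert (E1 : 2 <= INR n) by (apply le_INR in E; exact E).
  eapply Rle_trans; [apply (Rpower_le_exp (INR n) _ (- a)); lra|].
  replace (Rpower (INR n) (- a)) with (Rpower (2 * INR n) (- a) * Rpower 2 a).
  + apply Rmult_le_compat_r; [left; apply exp_pos|].
    apply Rpower_le_neg; rewrite ?S_INR; lra.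
  + rewrite <- Rpower_mult_distr, (Rmult_comm (Rpower 2 (- a))), Rmult_assoc, <- Rpower_plus by lra.
    rewrite Rplus_opp_l, Rpower_O by lra; ring.
- rewrite Cmod_0; apply Rmult_le_pos; left; apply exp_pos.
Qed.

Lemma one_minus_neq_0 (w : C) : Cmod w < 1 -> (1 - w)%C <> 0.
Proof.
intros H; apply Cminus_neq_0; intros <-; rewrite Cmod_1 in H; lra.
Qed.

Lemma ppow_1_neq (s : C) (n : nat) : 1 / 2 <= Re s -> (1 - ppow s n)%C <> 0.
Proof. intros H; apply one_minus_neq_0; pose proof (ppow_small s n H); lra. Qed.

Lemma sieved_0 (zeta : C -> C) (s : C) : is_riemann_zeta zeta -> 1 < Re s -> sieved_sum 0 s = zeta s.
Proof.
intros [HZ _] Hs; apply (tends_unique (csum (sieved 0 s))); [apply sieved_clim, Hs|].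
apply tends_ext with (csum (fun n => / nat_cpow (S n) s)%C).
- intros n; induction n as [|n IH]; [reflexivity|].
  cbn [csum]; rewrite IH, nat_cpow_inv, sieved_in; [reflexivity|].
  intros q Q L; apply isprime_ge_2 in Q; lia.
- apply is_series_clim, HZ, Hs.
Qed.

Lemma sieved_sum_S (k : nat) (s : C) : 1 < Re s ->
  sieved_sum (S k) s = (sieved_sum k s * (1 - ppow s (S k)))%C.
Proof.
intros Hs; apply (tends_unique (csum (sieved (S k) s))); [apply sieved_clim, Hs|].
unfold ppow; destruct (isprime (S k)) eqn:E.
- apply tends_ext with (fun N => csum (sieved k s) N + (- upow (INR (S k)) s) * csum (sieved k s) (N / S k))%C.
  { intros N; rewrite sieve_step by assumption; ring. }
  replace (sieved_sum k s * (1 - upow (INR (S k)) s))%C with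
    (sieved_sum k s + (- upow (INR (S k)) s) * sieved_sum k s)%C by ring.
  apply tends_plus; [apply sieved_clim, Hs|].
  apply tends_scal, (clim_div (csum (sieved k s))); [lia | apply sieved_clim, Hs].
- replace (sieved_sum k s * (1 - 0))%C with (sieved_sum k s) by ring.
  apply tends_ext with (csum (sieved k s)); [|apply sieved_clim, Hs].
  intros n; induction n as [|n IH]; [reflexivity|].
  cbn [csum]; rewrite IH; f_equal.
  assert (R0 := rough_S_composite k (S n) E).
  destruct (classic (rough k (S n))) as [Rm | Rm].
  + rewrite !sieved_in by tauto; reflexivity.
  + rewrite !sieved_out by tauto; reflexivity.
Qed.

(** Removing the multiples of each prime in turn: the sum over integers free of prime
    factors up to [N] is [zeta] times the inverse of the Euler product. *)
Lemma zeta_euler (zeta : C -> C) (N : nat) (s : C) : is_riemann_zeta zeta -> 1 < Re s ->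
  zeta s = (eulerN N s * sieved_sum N s)%C.
Proof.
intros HZ Hs; rewrite <- (sieved_0 zeta s HZ Hs); unfold eulerN.
induction N as [|N IH].
- simpl; unfold ppow; change (isprime 0) with false; simpl; field.
- rewrite IH, sieved_sum_S by assumption.
  change (cprod (fun n => / (1 - ppow s n))%C (S (S N))) with
    (cprod (fun n => / (1 - ppow s n))%C (S N) * / (1 - ppow s (S N)))%C.
  field; apply ppow_1_neq; lra.
Qed.

(** The sieved sum starts with the term [1] of the integer [1]; every further term belongs to
    an integer beyond the sieving bound. *)
Lemma sieved_sum_near_1 (N : nat) (s : C) (a : R) : 1 < a <= Re s ->
  Cmod (1 - sieved_sum (S N) s) <= 2 * Series (fun n => zser a (S N + n)).
Proof.
intros Ha.
replace (RtoC 1) with (csum (sieved (S N) s) (S N)).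
- apply (cser_tail (sieved (S N) s) (zser a) N); [|apply ex_zser; lra].
  intros n; apply sieved_bound; lra.
- assert (K : forall m, (m <= N)%nat -> csum (sieved (S N) s) (S m) = 1).
  { induction m as [|m IH]; intros Hm.
    - cbn [csum]; rewrite sieved_in; [rewrite upow_1; ring|].
      intros q Q _ Hq; apply isprime_ge_2 in Q; apply Nat.divide_pos_le in Hq; lia.
    - change (csum (sieved (S N) s) (S (S m))) with (csum (sieved (S N) s) (S m) + sieved (S N) s (S m))%C.
      rewrite (IH ltac:(lia)), sieved_out; [ring|].
      intros H; destruct (prime_factor_exists (S (S m)) ltac:(lia)) as [q [Q1 Q2]].
      apply (H q Q1); [apply Nat.divide_pos_le in Q2; lia | assumption]. }
  apply K; lia.
Qed.

Lemma sieved_sum_uniform (a : R) : 1 < a -> forall e, 0 < e ->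
  exists N0, forall N s, (N0 <= N)%nat -> a <= Re s -> Cmod (1 - sieved_sum N s) <= e.
Proof.
intros Ha e He; destruct (Series_tail_0 (zser a) (ex_zser a Ha) (e / 2) ltac:(lra)) as [N0 H].
exists (S N0); intros [|N] s HN Hs; [lia|].
eapply Rle_trans; [apply sieved_sum_near_1 with (a := a); lra|].
specialize (H N ltac:(lia)); pose proof (Rle_abs (Series (fun k => zser a (S N + k)))); lra.
Qed.

Lemma zeta_upper (zeta : C -> C) (a : R) (s : C) : is_riemann_zeta zeta -> 1 < a <= Re s ->
  Cmod (zeta s) <= 2 * Series (zser a).
Proof.
intros HZ Ha; rewrite <- (sieved_0 zeta s HZ) by lra.
apply cser_bound; [|apply ex_zser; lra]; intros n; apply sieved_bound; lra.
Qed.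

(** By [zeta_euler] the error is [eulerN (1 - sieved_sum)]. The product stays bounded because
    [zeta] is bounded and the sieved sum is close to [1]. *)
Lemma eulerN_uniform (zeta : C -> C) (a : R) : is_riemann_zeta zeta -> 1 < a -> forall e, 0 < e ->
  exists N0, forall N s, (N0 <= N)%nat -> a <= Re s -> Cmod (eulerN N s - zeta s) <= e.
Proof.
intros HZ Ha e He.
set (M := 2 * Series (zser a)).
assert (HM : 0 <= M).
{ unfold M; assert (0 <= Series (zser a)); [|lra].
  apply Series_nonneg; [intros; left; apply zser_pos | apply ex_zser, Ha]. }
set (e1 := Rmin (1 / 2) (e / (2 * M + 1))).
assert (E1 : 0 < e1) by (apply Rmin_pos; [lra | apply Rdiv_lt_0_compat; lra]).
destruct (sieved_sum_uniform a Ha e1 E1) as [N0 H].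
exists N0; intros N s HN Hs; specialize (H N s HN Hs).
pose proof (Rmin_l (1 / 2) (e / (2 * M + 1))) as L1; fold e1 in L1.
pose proof (Rmin_r (1 / 2) (e / (2 * M + 1))) as L2; fold e1 in L2.
set (l := sieved_sum N s) in *; set (P := eulerN N s).
assert (E := zeta_euler zeta N s HZ ltac:(lra)); fold l in E; fold P in E.
assert (Z := zeta_upper zeta a s HZ ltac:(lra)); fold M in Z.
assert (Ll : 1 / 2 <= Cmod l).
{ pose proof (Cmod_triangle_rev 1 l) as T; rewrite Cmod_1 in T; lra. }
assert (PB : Cmod P <= 2 * M).
{ rewrite E, Cmod_mult in Z; pose proof (Cmod_ge_0 P); nra. }
rewrite E; replace (P - P * l)%C with (P * (1 - l))%C by ring; rewrite Cmod_mult.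
apply Rle_trans with ((2 * M + 1) * (e / (2 * M + 1))); [|right; field; lra].
apply Rmult_le_compat; try apply Cmod_ge_0; lra.
Qed.

(** ** Comparison of the product with the exponential of a sum *)

(** The inverse of the genus-one primary factor of Weierstrass: the Euler factor with
    the linear term of its logarithm removed, hence [1 + O(w^2)]. *)
Definition gfac (w : C) : C := (Cexp (- w) / (1 - w))%C.

Lemma exp_le_3_of_le_1 (x : R) : x <= 1 -> exp x <= 3.
Proof.
intros H; apply Rle_trans with (exp 1); [|apply exp_le_3].
destruct H as [L | ->]; [left; apply exp_increasing, L | right; reflexivity].
Qed.

Lemma seg_0 (w : C) (t : R) : 0 <= t <= 1 -> Cmod (0 + RtoC t * (w - 0)) <= Cmod w.
Proof.
intros Ht; replace (0 + RtoC t * (w - 0))%C with (RtoC t * w)%C by ring.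
rewrite Cmod_mult, Cmod_R, Rabs_right by lra; pose proof (Cmod_ge_0 w); nra.
Qed.

(** The derivative of [e^w (1 - w)] is [- w e^w], of modulus at most [3 |w|]. *)
Lemma inv_gfac_bound (w : C) : Cmod w <= 3 / 4 -> Cmod (Cexp w * (1 - w) - 1) <= 6 * Cmod w ^ 2.
Proof.
intros Hw.
assert (D : forall z, is_cderiv (fun z => Cexp z * (1 - z))%C z (- (z * Cexp z))%C).
{ intros z.
  assert (K : is_cderiv (fun z => Cexp z * (1 - z))%C z (Cexp z * (1 - z) + Cexp z * (0 - 1))%C).
  { apply is_cderiv_mult; [apply is_cderiv_Cexp|].
    apply is_cderiv_minus; [apply is_cderiv_const | apply is_cderiv_id]. }
  replace (Cexp z * (1 - z) + Cexp z * (0 - 1))%C with (- (z * Cexp z))%C in K by ring; exact K. }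
assert (B := lipschitz_segment (fun z => Cexp z * (1 - z))%C w 0 (3 * Cmod w)).
cbv beta in B; replace (Cexp 0 * (1 - 0))%C with (RtoC 1) in B by (rewrite Cexp_0; ring).
replace (w - 0)%C with w in B by ring.
eapply Rle_trans; [apply B | right; ring].
- intros; eexists; apply D.
- intros t Ht; rewrite (cder_eq _ _ _ (D _)).
  pose proof (seg_0 w t Ht) as S0; replace (w - 0)%C with w in S0 by ring.
  set (z := (0 + RtoC t * w)%C) in *.
  rewrite Cmod_opp, Cmod_mult, Cmod_Cexp, Rmult_comm.
  apply Rmult_le_compat; [left; apply exp_pos | apply Cmod_ge_0 | | assumption].
  apply exp_le_3_of_le_1; pose proof (re_le_Cmod z); pose proof (Rle_abs (Re z)); lra.
Qed.

Lemma gfac_bound (w : C) : Cmod w <= 3 / 4 -> Cmod (gfac w - 1) <= 96 * Cmod w ^ 2.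
Proof.
intros Hw.
assert (D : forall z, Cmod z <= 3 / 4 -> is_cderiv gfac z (z * Cexp (- z) / ((1 - z) * (1 - z)))%C).
{ intros z Hz; assert (N : (1 - z)%C <> 0) by (apply one_minus_neq_0; lra).
  assert (K : is_cderiv gfac z ((Cexp (- z) * (- (1))) * / (1 - z) +
    Cexp (- z) * (- (0 - 1) / ((1 - z) * (1 - z))))%C).
  { apply (is_cderiv_mult (fun z => Cexp (- z)) (fun z => / (1 - z))%C).
    - apply (is_cderiv_comp (fun z => - z)%C Cexp); [apply is_cderiv_opp, is_cderiv_id | apply is_cderiv_Cexp].
    - apply (is_cderiv_inv (fun z => 1 - z)%C); [assumption|].
      apply is_cderiv_minus; [apply is_cderiv_const | apply is_cderiv_id]. }
  replace ((Cexp (- z) * (- (1))) * / (1 - z) + Cexp (- z) * (- (0 - 1) / ((1 - z) * (1 - z))))%C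
   with (z * Cexp (- z) / ((1 - z) * (1 - z)))%C in K by (field; assumption); exact K. }
assert (B := lipschitz_segment gfac w 0 (48 * Cmod w)).
replace (gfac 0) with (RtoC 1) in B.
2:{ unfold gfac; replace (- (0))%C with (RtoC 0) by ring; rewrite Cexp_0; field. }
replace (w - 0)%C with w in B by ring.
assert (S1 : forall t, 0 <= t <= 1 -> Cmod (0 + RtoC t * w) <= Cmod w).
{ intros t Ht; pose proof (seg_0 w t Ht) as S0; replace (w - 0)%C with w in S0 by ring; exact S0. }
eapply Rle_trans; [apply B | right; ring].
- intros t Ht; eexists; apply D; specialize (S1 t Ht); lra.
- intros t Ht; specialize (S1 t Ht); set (z := (0 + RtoC t * w)%C) in *.
  rewrite (cder_eq _ _ _ (D z ltac:(lra))).
  assert (N : (1 - z)%C <> 0) by (apply one_minus_neq_0; lra).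
  rewrite Cmod_div, !Cmod_mult, Cmod_Cexp by (apply Cmult_neq_0; assumption).
  assert (Q : 1 / 4 <= Cmod (1 - z)).
  { pose proof (Cmod_triangle_rev 1 z) as T; rewrite Cmod_1 in T; lra. }
  assert (Ex : exp (Re (- z)) <= 3).
  { apply exp_le_3_of_le_1; pose proof (re_le_Cmod (- z)) as T; rewrite Cmod_opp in T.
    pose proof (Rle_abs (Re (- z))); lra. }
  replace (48 * Cmod w) with ((Cmod w * 3) * 16) by ring.
  unfold Rdiv; apply Rmult_le_compat.
  + apply Rmult_le_pos; [apply Cmod_ge_0 | left; apply exp_pos].
  + left; apply Rinv_0_lt_compat; nra.
  + apply Rmult_le_compat; [apply Cmod_ge_0 | left; apply exp_pos | |]; assumption.
  + replace 16 with (/ (/ 16)) by field; apply Rinv_le_contravar; nra.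
Qed.

Definition Gprod (N : nat) (s : C) : C := cprod (fun n => gfac (ppow s n)) (S N).
Definition psum (N : nat) (s : C) : C := csum (ppow s) (S N).

Lemma eulerN_split (N : nat) (s : C) : 1 / 2 <= Re s -> eulerN N s = (Cexp (psum N s) * Gprod N s)%C.
Proof.
intros Hs; unfold eulerN, psum, Gprod; induction (S N) as [|n IH]; simpl.
- rewrite Cexp_0; ring.
- rewrite IH, Cexp_plus; unfold gfac; rewrite Cexp_opp; field.
  split; [apply Cexp_neq_0 | apply ppow_1_neq, Hs].
Qed.

(** From [1 + b <= e^b]. *)
Lemma cprod_bound (u : nat -> C) (b : nat -> R) (n : nat) : (forall k, 0 <= b k) -> ex_series b ->
  (forall k, Cmod (u k) <= 1 + b k) -> Cmod (cprod u n) <= exp (Series b).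
Proof.
intros Hb Xb Hu.
assert (K : Cmod (cprod u n) <= exp (match n with O => 0 | S m => sum_n b m end)).
{ induction n as [|n IH]; simpl.
  - rewrite Cmod_1, exp_0; lra.
  - rewrite Cmod_mult.
    replace (sum_n b n) with ((match n with O => 0 | S m => sum_n b m end) + b n).
    + rewrite exp_plus; apply Rmult_le_compat; try apply Cmod_ge_0; [assumption|].
      eapply Rle_trans; [apply Hu | apply exp_ineq1_le].
    + destruct n; [rewrite sum_O; ring | rewrite sum_Sn; reflexivity]. }
eapply Rle_trans; [exact K|].
assert (L : match n with O => 0 | S m => sum_n b m end <= Series b).
{ destruct n as [|m]; [apply Series_nonneg; assumption|].
  rewrite (Series_incr_n b (S m)) by (lia || assumption); rewrite <- sum_n_Reals; simpl pred.
  assert (0 <= Series (fun k => b (S m + k)%nat)); [|lra].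
  apply Series_nonneg; [intros; apply Hb | apply (ex_series_incr_n b (S m)), Xb]. }
destruct L as [L | ->]; [left; apply exp_increasing, L | right; reflexivity].
Qed.

Lemma cprod_inv (u v : nat -> C) (n : nat) : (forall k, (u k * v k)%C = 1) -> (cprod u n * cprod v n)%C = 1.
Proof.
intros H; induction n as [|n IH]; simpl; [ring|].
transitivity ((cprod u n * cprod v n) * (u n * v n))%C; [ring | rewrite IH, H; ring].
Qed.

Lemma zser_mult (a b : R) (n : nat) : zser a n * zser b n = zser (a + b) n.
Proof. unfold zser; rewrite <- Rpower_plus; f_equal; ring. Qed.

Lemma ppow_sq_bound (s : C) (a : R) (n : nat) : 0 <= a <= Re s ->
  Cmod (ppow s n) ^ 2 <= Rpower 2 (2 * a) * zser (2 * a) n.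
Proof.
intros Ha; pose proof (ppow_bound s a n Ha) as B.
replace (Rpower 2 (2 * a) * zser (2 * a) n) with ((zser a n * Rpower 2 a) ^ 2).
- apply pow_incr; split; [apply Cmod_ge_0 | assumption].
- replace (2 * a) with (a + a) by ring; rewrite <- zser_mult, Rpower_plus; ring.
Qed.

Definition sqmaj (K a : R) (n : nat) : R := K * (Rpower 2 (2 * a) * zser (2 * a) n).

Lemma sqmaj_pos (K a : R) (n : nat) : 0 <= K -> 0 <= sqmaj K a n.
Proof.
intros H; unfold sqmaj; apply Rmult_le_pos; [assumption|].
apply Rmult_le_pos; left; [apply exp_pos | apply zser_pos].
Qed.

Lemma ex_sqmaj (K a : R) : 1 / 2 < a -> ex_series (sqmaj K a).
Proof.
intros H; unfold sqmaj; apply (ex_series_scal (V := R_NormedModule)), (ex_series_scal (V := R_NormedModule)).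
apply ex_zser; lra.
Qed.

Lemma Gprod_upper (a : R) (N : nat) (s : C) : 1 / 2 < a <= Re s ->
  Cmod (Gprod N s) <= exp (Series (sqmaj 96 a)).
Proof.
intros Ha; apply cprod_bound.
- intros; apply sqmaj_pos; lra.
- apply ex_sqmaj; lra.
- intros k; replace (gfac (ppow s k)) with (1 + (gfac (ppow s k) - 1))%C by ring.
  eapply Rle_trans; [apply Cmod_triangle|]; rewrite Cmod_1; apply Rplus_le_compat_l.
  eapply Rle_trans; [apply gfac_bound, ppow_small; lra|].
  apply Rmult_le_compat_l; [lra | apply ppow_sq_bound; lra].
Qed.

(** The inverse of the product is a product of the same kind, to which the upper bound
    applies. *)
Lemma Gprod_lower (a : R) (N : nat) (s : C) : 1 / 2 < a <= Re s ->
  exp (- Series (sqmaj 6 a)) <= Cmod (Gprod N s).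
Proof.
intros Ha.
set (v := fun n => (Cexp (ppow s n) * (1 - ppow s n))%C).
assert (E : (Gprod N s * cprod v (S N))%C = 1).
{ apply cprod_inv; intros k; unfold gfac, v; rewrite Cexp_opp; field.
  split; first [apply Cexp_neq_0 | apply ppow_1_neq; lra]. }
assert (B : Cmod (cprod v (S N)) <= exp (Series (sqmaj 6 a))).
{ apply cprod_bound.
  - intros; apply sqmaj_pos; lra.
  - apply ex_sqmaj; lra.
  - intros k; replace (v k) with (1 + (v k - 1))%C by ring.
    eapply Rle_trans; [apply Cmod_triangle|]; rewrite Cmod_1; apply Rplus_le_compat_l.
    eapply Rle_trans; [apply inv_gfac_bound, ppow_small; lra|].
    apply Rmult_le_compat_l; [lra | apply ppow_sq_bound; lra]. }
apply (f_equal Cmod) in E; rewrite Cmod_mult, Cmod_1 in E.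
rewrite exp_Ropp; apply Rmult_le_reg_r with (exp (Series (sqmaj 6 a))); [apply exp_pos|].
rewrite Rinv_l by (apply Rgt_not_eq, exp_pos).
rewrite <- E; apply Rmult_le_compat_l; [apply Cmod_ge_0 | assumption].
Qed.

(** ** Lower bounds and non-vanishing *)

Lemma Re_csum (u : nat -> C) (n : nat) :
  Re (csum u n) = match n with O => 0 | S m => sum_n (fun k => Re (u k)) m end.
Proof. destruct n; [reflexivity | rewrite csum_components; reflexivity]. Qed.

(** On the line of real part [2] the sum of [p^(-s)] is bounded, and so is its exponential
    from below; the other factors of [zeta] are bounded below by [Gprod_lower]. *)
Lemma zeta_lower_2 (zeta : C -> C) : is_riemann_zeta zeta ->
  exists c, 0 < c /\ forall s, Re s = 2 -> c <= Cmod (zeta s).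
Proof.
intros HZ.
set (c := exp (- Series (sqmaj 6 1)) * exp (- (2 * Series (fun n => zser 2 n * Rpower 2 2)))).
assert (X : ex_series (fun n => zser 2 n * Rpower 2 2)).
{ apply ex_series_ext with (fun n => Rpower 2 2 * zser 2 n); [intros; apply Rmult_comm|].
  apply (ex_series_scal (V := R_NormedModule)), ex_zser; lra. }
assert (Hc : 0 < c) by (apply Rmult_lt_0_compat; apply exp_pos).
exists (c / 2); split; [lra|]; intros s Hs.
destruct (sieved_sum_uniform 2 ltac:(lra) (1 / 2) ltac:(lra)) as [N H].
specialize (H N s (le_n N) ltac:(lra)).
rewrite (zeta_euler zeta N s HZ) by lra; rewrite Cmod_mult, eulerN_split, Cmod_mult, Cmod_Cexp by lra.
pose proof (Gprod_lower 1 N s ltac:(lra)) as G.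
assert (L : 1 / 2 <= Cmod (sieved_sum N s)).
{ pose proof (Cmod_triangle_rev 1 (sieved_sum N s)) as T; rewrite Cmod_1 in T; lra. }
assert (P : exp (- (2 * Series (fun n => zser 2 n * Rpower 2 2))) <= exp (Re (psum N s))).
{ assert (B : - (2 * Series (fun n => zser 2 n * Rpower 2 2)) <= Re (psum N s)).
  { assert (T1 := cser_tail (ppow s) (fun n => zser 2 n * Rpower 2 2) N (fun n => ppow_bound s 2 n ltac:(lra)) X).
    pose proof X as X0.
    unfold psum; rewrite Re_csum.
    assert (K : forall m, Rabs (sum_n (fun k => Re (ppow s k)) m) <= sum_n (fun n => zser 2 n * Rpower 2 2) m).
    { induction m as [|m IH].
      - rewrite !sum_O; eapply Rle_trans; [apply re_le_Cmod | apply ppow_bound; lra].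
      - rewrite !sum_Sn; eapply Rle_trans; [apply Rabs_triang|]; apply Rplus_le_compat; [assumption|].
        eapply Rle_trans; [apply re_le_Cmod | apply ppow_bound; lra]. }
    specialize (K N).
    assert (M0 : forall n, 0 <= zser 2 n * Rpower 2 2) by (intros; apply Rmult_le_pos; left; apply exp_pos).
    assert (SM : sum_n (fun n => zser 2 n * Rpower 2 2) N <= Series (fun n => zser 2 n * Rpower 2 2)).
    { rewrite (Series_incr_n (fun n => zser 2 n * Rpower 2 2) (S N)) by (lia || assumption); rewrite <- sum_n_Reals; simpl pred.
      assert (0 <= Series (fun k => zser 2 (S N + k)%nat * Rpower 2 2)); [|lra].
      apply Series_nonneg; [intros; apply M0 |].
      apply (ex_series_incr_n (fun n => zser 2 n * Rpower 2 2) (S N)), X. }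
    assert (0 <= Series (fun n => zser 2 n * Rpower 2 2)) by (apply Series_nonneg; assumption).
    apply Rabs_le_between in K; lra. }
  destruct B as [B | ->]; [left; apply exp_increasing, B | right; reflexivity]. }
unfold c; unfold Rdiv; apply Rmult_le_compat.
- left; apply Rmult_lt_0_compat; apply exp_pos.
- lra.
- rewrite Rmult_comm; apply Rmult_le_compat; try assumption; left; apply exp_pos.
- lra.
Qed.

Lemma Re_ppow (a t : R) (n : nat) : Re (ppow (a, t) n) = if isprime n then Rpower (INR n) (- a) * cos (t * ln (INR n)) else 0.
Proof.
unfold ppow; destruct (isprime n); [|reflexivity].
unfold upow, Cexp, Rpower; simpl; unfold Re, Im; simpl.
f_equal; [f_equal; ring|].
rewrite <- cos_neg; f_equal; ring.
Qed.

(** By [3 + 4 cos x + cos 2x = 2 (1 + cos x)^2 >= 0], the real parts of the sums of [p^(-s)]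
    at the three points have a nonnegative combination. The remaining factors of [zeta] are
    bounded below, uniformly since their exponents [2 Re s] stay above [2]. *)
Lemma zeta_341 (zeta : C -> C) : is_riemann_zeta zeta -> exists c, 0 < c /\ forall a t, 1 < a ->
  c <= Cmod (zeta (a, 0)) ^ 3 * Cmod (zeta (a, t)) ^ 4 * Cmod (zeta (a, 2 * t)).
Proof.
intros HZ.
set (g := exp (- Series (sqmaj 6 1))).
assert (G0 : 0 < g) by apply exp_pos.
exists ((g / 2) ^ 8); split; [apply pow_lt; lra|]; intros a t Ha.
destruct (sieved_sum_uniform a Ha (1 / 2) ltac:(lra)) as [N H].
assert (K : forall t, g / 2 * exp (Re (psum N (a, t))) <= Cmod (zeta (a, t))).
{ intros u; specialize (H N (a, u) (le_n N) ltac:(simpl; lra)).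
  rewrite (zeta_euler zeta N (a, u) HZ) by (simpl; lra).
  rewrite Cmod_mult, eulerN_split, Cmod_mult, Cmod_Cexp by (simpl; lra).
  pose proof (Gprod_lower 1 N (a, u) ltac:(simpl; lra)) as G; fold g in G.
  assert (L : 1 / 2 <= Cmod (sieved_sum N (a, u))).
  { pose proof (Cmod_triangle_rev 1 (sieved_sum N (a, u))) as T; rewrite Cmod_1 in T; lra. }
  replace (g / 2 * exp (Re (psum N (a, u)))) with ((exp (Re (psum N (a, u))) * g) * (1 / 2)) by field.
  pose proof (exp_pos (Re (psum N (a, u)))).
  apply Rmult_le_compat; try lra; [nra|].
  apply Rmult_le_compat_l; lra. }
assert (Pos : 0 <= 3 * Re (psum N (a, 0)) + 4 * Re (psum N (a, t)) + Re (psum N (a, 2 * t))).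
{ unfold psum; rewrite !Re_csum.
  induction N as [|m IH] in |- *.
  - rewrite !sum_O, !Re_ppow; change (isprime 0) with false; simpl; lra.
  - rewrite !sum_Sn; unfold plus; simpl.
    assert (0 <= 3 * Re (ppow (a, 0) (S m)) + 4 * Re (ppow (a, t) (S m)) + Re (ppow (a, 2 * t) (S m))); [|lra].
    rewrite !Re_ppow; destruct (isprime (S m)); [|lra].
    rewrite Rmult_0_l, cos_0, Rmult_assoc, cos_2a_cos.
    set (x := cos (t * ln (INR (S m)))).
    pose proof (Rpower_pos (INR (S m)) (- a)).
    replace (3 * (Rpower (INR (S m)) (- a) * 1) + 4 * (Rpower (INR (S m)) (- a) * x) +
      Rpower (INR (S m)) (- a) * (2 * x * x - 1)) with (Rpower (INR (S m)) (- a) * (2 * (1 + x) ^ 2)) by ring.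
    apply Rmult_le_pos; [lra|]; pose proof (pow2_ge_0 (1 + x)); lra. }
set (p0 := Re (psum N (a, 0))) in *; set (p1 := Re (psum N (a, t))) in *; set (p2 := Re (psum N (a, 2 * t))) in *.
assert (K0 := K 0); assert (K1 := K t); assert (K2 := K (2 * t)); fold p0 p1 p2 in K0, K1, K2.
assert (E1 : forall x, 0 < g / 2 * exp x) by (intros; apply Rmult_lt_0_compat; [lra | apply exp_pos]).
apply Rle_trans with ((g / 2 * exp p0) ^ 3 * (g / 2 * exp p1) ^ 4 * (g / 2 * exp p2)).
- replace ((g / 2 * exp p0) ^ 3 * (g / 2 * exp p1) ^ 4 * (g / 2 * exp p2)) with
   ((g / 2) ^ 8 * exp (3 * p0 + 4 * p1 + p2)).
  + rewrite <- (Rmult_1_r ((g / 2) ^ 8)) at 1; apply Rmult_le_compat_l; [apply pow_le; lra|].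
    rewrite <- exp_0 at 1; destruct Pos as [L | <-]; [left; apply exp_increasing, L | right; reflexivity].
  + replace (3 * p0 + 4 * p1 + p2) with (p0 + p0 + p0 + (p1 + p1 + p1 + p1) + p2) by ring.
    rewrite !exp_plus; ring.
- pose proof (E1 p0); pose proof (E1 p1); pose proof (E1 p2).
  apply Rmult_le_compat; [| lra | | assumption].
  + apply Rmult_le_pos; apply pow_le; lra.
  + apply Rmult_le_compat; try (apply pow_le; lra); apply pow_incr; lra.
Qed.

Lemma Hzeta_neq_0_right (zeta : C -> C) (s : C) : is_riemann_zeta zeta -> 1 < Re s -> Hzeta s <> 0.
Proof.
intros HZ Hs; rewrite (Hzeta_right zeta s HZ Hs).
apply Cmult_neq_0; [apply Cminus_neq_0; intros ->; simpl in Hs; lra|].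
destruct (sieved_sum_uniform (Re s) Hs (1 / 2) ltac:(lra)) as [N H].
specialize (H N s (le_n N) ltac:(lra)).
rewrite (zeta_euler zeta N s HZ Hs), eulerN_split by lra.
apply Cmult_neq_0; [apply Cmult_neq_0; [apply Cexp_neq_0|]|].
- apply Cmod_gt_0; eapply Rlt_le_trans; [|apply (Gprod_lower (Re s)); lra]; apply exp_pos.
- intros E; rewrite E in H; replace (1 - 0)%C with (RtoC 1) in H by ring; rewrite Cmod_1 in H; lra.
Qed.

(** A zero at [1 + it] would enter the product of [zeta_341] to the fourth power and
    overcome the third power of the pole at [1], making the product tend to [0]. *)
Lemma Hzeta_neq_0_line (zeta : C -> C) (t : R) : is_riemann_zeta zeta -> Hzeta (1, t) <> 0.
Proof.
intros HZ E0.
destruct (Req_dec t 0) as [-> | Nt].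
{ change (1, 0) with (RtoC 1) in E0; rewrite Hzeta_1 in E0; injection E0; lra. }
destruct (zeta_341 zeta HZ) as [c [Hc C341]].
destruct (hol_Hzeta (1, t) ltac:(simpl; lra)) as [l Hl].
destruct (Hl 1 ltac:(lra)) as [d [Dd Hd]].
destruct Hzeta_bound as [K [HK BK]].
set (M := K * (5 + 2 * Rabs t) ^ 2).
assert (At : 0 < Rabs t) by (apply Rabs_pos_lt, Nt).
assert (HM : 0 < M) by (apply Rmult_lt_0_compat; [assumption | apply pow_lt; lra]).
assert (BM : forall a u, 1 < a < 2 -> Rabs u <= 2 * Rabs t -> Cmod (Hzeta (a, u)) <= M).
{ intros a u Ha Hu; eapply Rle_trans; [apply BK; simpl; lra|].
  apply Rmult_le_compat_l; [lra|]; apply pow_incr; split; [pose proof (Cmod_ge_0 (a, u)); lra|].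
  pose proof (Cmod_le_Re_Im (a, u)) as T; simpl in T; rewrite (Rabs_right a) in T by lra; lra. }
assert (Main : forall h, 0 < h -> h < d -> h < 1 ->
  c * (Rabs t ^ 4 * Rabs (2 * t)) <= (M ^ 3 * (1 + Cmod l) ^ 4 * M) * h).
{ intros h H1 H2 H3; specialize (C341 (1 + h) t ltac:(lra)).
  assert (HE : forall u, Cmod (Hzeta (1 + h, u)) = Cmod (h, u) * Cmod (zeta (1 + h, u))).
  { intros u; rewrite (Hzeta_right zeta _ HZ) by (simpl; lra); rewrite Cmod_mult; do 2 f_equal; Ceq; ring. }
  assert (Q1 : Cmod (Hzeta (1 + h, t)) <= (1 + Cmod l) * h).
  { assert (Eh : (((1 + h)%R, t) - (1, t))%C = RtoC h) by (Ceq; ring).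
    specialize (Hd (1 + h, t)); rewrite Eh, Cmod_R, Rabs_right, E0 in Hd by lra.
    specialize (Hd H2).
    replace (Hzeta (1 + h, t)) with ((Hzeta ((1 + h)%R, t) - 0 - l * RtoC h) + l * RtoC h)%C by ring.
    eapply Rle_trans; [apply Cmod_triangle|]; rewrite Cmod_mult, Cmod_R, (Rabs_right h) by lra; lra. }
  assert (A0 := HE 0); assert (A1 := HE t); assert (A2 := HE (2 * t)).
  assert (B0 := BM (1 + h) 0 ltac:(lra) ltac:(rewrite Rabs_R0; lra)).
  assert (B2 := BM (1 + h) (2 * t) ltac:(lra) ltac:(rewrite Rabs_mult, (Rabs_right 2); lra)).
  assert (M0 : Cmod (h, 0) = h) by (change (h, 0) with (RtoC h); rewrite Cmod_R, Rabs_right; lra).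
  assert (M1 : Rabs t <= Cmod (h, t)) by (apply (im_le_Cmod (h, t))).
  assert (M2 : Rabs (2 * t) <= Cmod (h, 2 * t)) by (apply (im_le_Cmod (h, 2 * t))).
  set (z0 := Cmod (zeta (1 + h, 0))) in *; set (z1 := Cmod (zeta (1 + h, t))) in *;
  set (z2 := Cmod (zeta (1 + h, 2 * t))) in *.
  assert (0 <= z0) by apply Cmod_ge_0; assert (0 <= z1) by apply Cmod_ge_0; assert (0 <= z2) by apply Cmod_ge_0.
  rewrite M0 in A0.
  assert (L0 : h * z0 <= M) by lra.
  assert (L1 : Rabs t * z1 <= (1 + Cmod l) * h) by (eapply Rle_trans; [apply Rmult_le_compat_r; [assumption | exact M1] | lra]).
  assert (L2 : Rabs (2 * t) * z2 <= M) by (eapply Rle_trans; [apply Rmult_le_compat_r; [assumption | exact M2] | lra]).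
  pose proof (Cmod_ge_0 l) as Pl; pose proof (Rabs_pos (2 * t)).
  assert (Prod : (h * z0) ^ 3 * (Rabs t * z1) ^ 4 * (Rabs (2 * t) * z2) <= M ^ 3 * ((1 + Cmod l) * h) ^ 4 * M).
  { assert (0 <= h * z0) by (apply Rmult_le_pos; lra).
    assert (0 <= Rabs t * z1) by (apply Rmult_le_pos; lra).
    assert (0 <= Rabs (2 * t) * z2) by (apply Rmult_le_pos; lra).
    apply Rmult_le_compat; try lra.
    - apply Rmult_le_pos; apply pow_le; lra.
    - apply Rmult_le_compat; try (apply pow_le; lra); apply pow_incr; lra. }
  apply Rmult_le_reg_l with (h ^ 3); [apply pow_lt; lra|].
  replace (h ^ 3 * (M ^ 3 * (1 + Cmod l) ^ 4 * M * h)) with (M ^ 3 * ((1 + Cmod l) * h) ^ 4 * M) by ring.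
  eapply Rle_trans; [|exact Prod].
  replace ((h * z0) ^ 3 * (Rabs t * z1) ^ 4 * (Rabs (2 * t) * z2)) with
    (h ^ 3 * ((z0 ^ 3 * z1 ^ 4 * z2) * (Rabs t ^ 4 * Rabs (2 * t)))) by ring.
  apply Rmult_le_compat_l; [apply pow_le; lra|].
  apply Rmult_le_compat_r; [|exact C341].
  apply Rmult_le_pos; [apply pow_le; lra | apply Rabs_pos]. }
set (X := c * (Rabs t ^ 4 * Rabs (2 * t))) in *.
set (Y := M ^ 3 * (1 + Cmod l) ^ 4 * M) in *.
assert (HX : 0 < X).
{ apply Rmult_lt_0_compat; [assumption|]; apply Rmult_lt_0_compat; [apply pow_lt, At | apply Rabs_pos_lt; lra]. }
assert (HY : 0 < Y).
{ pose proof (Cmod_ge_0 l); unfold Y; apply Rmult_lt_0_compat; [|assumption].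
  apply Rmult_lt_0_compat; apply pow_lt; lra. }
set (h := Rmin (Rmin d 1) (X / Y) / 2).
assert (Hxy : 0 < X / Y) by (apply Rdiv_lt_0_compat; assumption).
assert (0 < Rmin (Rmin d 1) (X / Y)) by (repeat apply Rmin_pos; lra).
pose proof (Rmin_l (Rmin d 1) (X / Y)); pose proof (Rmin_r (Rmin d 1) (X / Y)).
pose proof (Rmin_l d 1); pose proof (Rmin_r d 1).
specialize (Main h ltac:(unfold h; lra) ltac:(unfold h; lra) ltac:(unfold h; lra)).
assert (Y * h < Y * (X / Y)) by (apply Rmult_lt_compat_l; [assumption | unfold h; lra]).
replace (Y * (X / Y)) with X in H4 by (field; lra); lra.
Qed.

Lemma Hzeta_neq_0 (zeta : C -> C) (s : C) : is_riemann_zeta zeta -> riemann_hypothesis zeta ->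
  1 / 2 < Re s -> Hzeta s <> 0.
Proof.
intros HZ RH Hs; destruct (Rtotal_order (Re s) 1) as [L | [E | G]].
- assert (Ns : s <> 1) by (intros ->; simpl in L; lra).
  rewrite (Hzeta_eq zeta s HZ) by (lra || assumption).
  apply Cmult_neq_0; [apply Cminus_neq_0, Ns|].
  intros Z; assert (K := RH s ltac:(lra) Z); lra.
- destruct s as [a t]; simpl in E; subst a; apply (Hzeta_neq_0_line zeta t HZ).
- apply (Hzeta_neq_0_right zeta s HZ G).
Qed.

(** * The logarithmic derivative of zeta *)

Definition plog (n : nat) : R := if isprime n then ln (INR n) else 0.

(** The contribution of the proper powers of the prime [n] to [- zeta' / zeta]. *)
Definition bterm (n : nat) (s : C) : C := (RtoC (plog n) * (ppow s n * ppow s n / (1 - ppow s n)))%C.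
Definition Bsum (s : C) : C := cser (fun n => bterm n s).
(** The continuation to [Re s > 1/2] of the sum of [log p p^(-s)] over all primes, minus its
    polar part [1 / (s - 1)] (see [prime_series]). *)
Definition Efun (s : C) : C := (- (cder Hzeta s / Hzeta s) - Bsum s)%C.

Lemma plog_nonneg (n : nat) : 0 <= plog n.
Proof.
unfold plog; destruct (isprime n) eqn:E; [|lra].
apply isprime_ge_2, le_INR in E; simpl in E; rewrite <- ln_1; apply ln_le; lra.
Qed.

Lemma ln_le_Rpower (u d : R) : 0 < d -> ln u <= / d * Rpower u d.
Proof.
intros Hd; apply Rmult_le_reg_l with d; [assumption|].
rewrite <- Rmult_assoc, Rinv_r, Rmult_1_l by lra.
unfold Rpower; pose proof (exp_ineq1_le (d * ln u)); lra.
Qed.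

Lemma shift_power (u b : R) : 2 <= u -> 0 <= b -> Rpower u (- b) <= Rpower 2 b * Rpower (u + 1) (- b).
Proof.
intros Hu Hb.
replace (Rpower u (- b)) with (Rpower 2 b * Rpower (2 * u) (- b)).
- apply Rmult_le_compat_l; [left; apply exp_pos | apply Rpower_le_neg; lra].
- rewrite <- Rpower_mult_distr, <- Rmult_assoc, <- Rpower_plus by lra.
  rewrite Rplus_opp_r, Rpower_O by lra; ring.
Qed.

(** The logarithmic weight costs an arbitrarily small power. Passing from [n] to the
    index shift in [zser] costs the factor [2^(b - d)]. *)
Lemma plog_power_bound (n : nat) (b d : R) : 0 < d -> d <= b -> isprime n = true ->
  ln (INR n) * Rpower (INR n) (- b) <= / d * Rpower 2 (b - d) * zser (b - d) n.
Proof.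
intros Hd Hb Hp; apply isprime_ge_2, le_INR in Hp; simpl in Hp.
apply Rle_trans with ((/ d * Rpower (INR n) d) * Rpower (INR n) (- b)).
- apply Rmult_le_compat_r; [left; apply exp_pos | apply ln_le_Rpower, Hd].
- rewrite Rmult_assoc, <- Rpower_plus, Rmult_assoc.
  apply Rmult_le_compat_l; [left; apply Rinv_0_lt_compat, Hd|].
  replace (d + - b) with (- (b - d)) by ring; unfold zser; rewrite S_INR.
  apply shift_power; lra.
Qed.

Lemma bterm_bound (n : nat) (s : C) (a : R) : 1 / 2 < a <= Re s ->
  Cmod (bterm n s) <= 4 * (/ (a - 1 / 2) * Rpower 2 (a + 1 / 2)) * zser (a + 1 / 2) n.
Proof.
intros Ha; unfold bterm.
assert (N := ppow_1_neq s n ltac:(lra)).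
assert (Q : 1 / 4 <= Cmod (1 - ppow s n)).
{ pose proof (Cmod_triangle_rev 1 (ppow s n)) as T; rewrite Cmod_1 in T.
  pose proof (ppow_small s n ltac:(lra)); lra. }
rewrite Cmod_mult, Cmod_div, Cmod_mult, Cmod_R, Rabs_right by (assumption || apply Rle_ge, plog_nonneg).
assert (QI : / Cmod (1 - ppow s n) <= 4).
{ replace 4 with (/ (1 / 4)) by field; apply Rinv_le_contravar; lra. }
assert (P0 : 0 < / Cmod (1 - ppow s n)) by (apply Rinv_0_lt_compat; lra).
assert (K : plog n * (Cmod (ppow s n) * Cmod (ppow s n)) <= / (a - 1 / 2) * Rpower 2 (a + 1 / 2) * zser (a + 1 / 2) n).
{ unfold plog, ppow; destruct (isprime n) eqn:E.
  - pose proof (plog_power_bound n (2 * a) (a - 1 / 2) ltac:(lra) ltac:(lra) E) as B.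
    replace (2 * a - (a - 1 / 2)) with (a + 1 / 2) in B by lra.
    eapply Rle_trans; [|exact B].
    apply isprime_ge_2, le_INR in E; simpl in E.
    apply Rmult_le_compat_l; [rewrite <- ln_1; apply ln_le; lra|].
    rewrite Cmod_upow, <- Rpower_plus; apply Rpower_le_exp; lra.
  - rewrite Rmult_0_l; apply Rmult_le_pos; [|left; apply zser_pos].
    apply Rmult_le_pos; [left; apply Rinv_0_lt_compat; lra | left; apply exp_pos]. }
assert (0 <= plog n * (Cmod (ppow s n) * Cmod (ppow s n))).
{ apply Rmult_le_pos; [apply plog_nonneg | apply Rmult_le_pos; apply Cmod_ge_0]. }
unfold Rdiv; nra.
Qed.

Lemma hol_ppow (n : nat) (s : C) : hol (fun s => ppow s n) s.
Proof. unfold ppow; destruct (isprime n); [apply hol_upow | apply hol_const]. Qed.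

Lemma hol_bterm (n : nat) (s : C) : 1 / 2 <= Re s -> hol (bterm n) s.
Proof.
intros H; unfold bterm; apply (hol_mult (fun _ => RtoC (plog n))); [apply hol_const|].
apply (hol_div (fun s => ppow s n * ppow s n)%C (fun s => 1 - ppow s n)%C).
- apply ppow_1_neq, H.
- apply hol_mult; apply hol_ppow.
- apply hol_minus; [apply hol_const | apply hol_ppow].
Qed.

Lemma hol_Bsum (s : C) : 1 / 2 < Re s -> hol Bsum s.
Proof.
intros Hs; set (a := (Re s + 1 / 2) / 2).
assert (Ha : 1 / 2 < a < Re s) by (unfold a; lra).
apply (Mtest_hol bterm (fun n => 4 * (/ (a - 1 / 2) * Rpower 2 (a + 1 / 2)) * zser (a + 1 / 2) n) s (Re s - a)).
- lra.
- intros n z Hz; apply sq_Re in Hz; apply hol_bterm; lra.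
- intros n z Hz; apply sq_Re in Hz; apply bterm_bound; lra.
- apply (ex_series_scal (V := R_NormedModule)), ex_zser; lra.
- apply sq_center; lra.
Qed.

Lemma Bsum_bound (a : R) : 1 / 2 < a -> exists K, 0 <= K /\ forall s, a <= Re s -> Cmod (Bsum s) <= K.
Proof.
intros Ha.
set (m := fun n => 4 * (/ (a - 1 / 2) * Rpower 2 (a + 1 / 2)) * zser (a + 1 / 2) n).
assert (X : ex_series m) by (apply (ex_series_scal (V := R_NormedModule)), ex_zser; lra).
exists (2 * Series m); split.
- assert (0 <= Series m); [|lra]; apply Series_nonneg; [|assumption].
  intros n; unfold m; apply Rmult_le_pos; [|left; apply zser_pos].
  apply Rmult_le_pos; [lra|]; apply Rmult_le_pos; [left; apply Rinv_0_lt_compat; lra | left; apply exp_pos].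
- intros s Hs; apply cser_bound; [|assumption]; intros n; apply bterm_bound; lra.
Qed.

Lemma hol_cder_Hzeta (s : C) : 0 < Re s -> hol (cder Hzeta) s.
Proof.
intros Hs; apply hol_cder with (Re s); [assumption|].
intros z Hz; apply sq_Re in Hz; apply hol_Hzeta; lra.
Qed.

Lemma hol_Efun (zeta : C -> C) (s : C) : is_riemann_zeta zeta -> riemann_hypothesis zeta ->
  1 / 2 < Re s -> hol Efun s.
Proof.
intros HZ RH Hs; unfold Efun; apply (hol_minus (fun s => - (cder Hzeta s / Hzeta s))%C Bsum).
- apply (hol_opp (fun s => cder Hzeta s / Hzeta s)%C), hol_div.
  + apply (Hzeta_neq_0 zeta); assumption.
  + apply hol_cder_Hzeta; lra.
  + apply hol_Hzeta; lra.
- apply hol_Bsum, Hs.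
Qed.

(** ** The Dirichlet series over primes *)

Lemma is_cderiv_ppow (n : nat) (s : C) : is_cderiv (fun s => ppow s n) s (- (RtoC (plog n) * ppow s n))%C.
Proof.
unfold ppow, plog; destruct (isprime n).
- pose proof (is_cderiv_upow (INR n) s) as K.
  replace (upow (INR n) s * - RtoC (ln (INR n)))%C with (- (RtoC (ln (INR n)) * upow (INR n) s))%C in K by ring.
  exact K.
- replace (- (0 * 0))%C with (RtoC 0) by ring; apply is_cderiv_const.
Qed.

(** Minus the logarithmic derivative of the Euler factor at [n]. *)
Definition lfac (s : C) (n : nat) : C := (RtoC (plog n) * (ppow s n / (1 - ppow s n)))%C.

Lemma is_cderiv_eulerN (N : nat) (s : C) : 1 / 2 <= Re s ->
  is_cderiv (eulerN N) s (- (eulerN N s * csum (lfac s) (S N)))%C.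
Proof.
intros Hs; unfold eulerN; induction (S N) as [|n IH].
- simpl; replace (- (1 * 0))%C with (RtoC 0) by ring; apply is_cderiv_const.
- cbn [cprod csum].
  set (P := cprod (fun n => / (1 - ppow s n))%C n) in *.
  assert (Nz := ppow_1_neq s n Hs).
  assert (K : is_cderiv (fun s => cprod (fun n => / (1 - ppow s n)) n * / (1 - ppow s n))%C s
    (- (P * csum (lfac s) n) * / (1 - ppow s n) +
     P * (- (0 - (- (RtoC (plog n) * ppow s n))) / ((1 - ppow s n) * (1 - ppow s n))))%C).
  { apply (is_cderiv_mult (fun s => cprod (fun n => / (1 - ppow s n))%C n) (fun s => / (1 - ppow s n))%C); [exact IH|].
    apply (is_cderiv_inv (fun s => 1 - ppow s n)%C); [assumption|].
    apply is_cderiv_minus; [apply is_cderiv_const | apply is_cderiv_ppow]. }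
  match type of K with is_cderiv _ _ ?u => match goal with |- is_cderiv _ _ ?v => replace v with u end end; [exact K|].
  unfold lfac; field; assumption.
Qed.

(** The logarithmic derivative of the Euler product converges to that of [zeta], since
    locally uniform limits commute with differentiation; subtracting the prime powers leaves
    the primes, and [(s - 1) zeta] in place of [zeta] accounts for the polar part. *)
Lemma prime_series (zeta : C -> C) (s : C) : is_riemann_zeta zeta -> Re s = 2 ->
  clim (csum (fun n => RtoC (plog n) * ppow s n)%C) (Efun s + / (s - 1))%C.
Proof.
intros HZ Hs.
assert (Ns : (s - 1)%C <> 0) by (apply Cminus_neq_0; intros ->; simpl in Hs; lra).
assert (Zh : forall z : C, z <> 1 -> hol zeta z) by (intros z Hz; apply is_derive_hol, HZ, Hz).
assert (N1 : s <> 1) by (intros ->; simpl in Hs; lra).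
assert (HN := Hzeta_neq_0_right zeta s HZ ltac:(lra)).
assert (HE := Hzeta_right zeta s HZ ltac:(lra)).
assert (Zn : zeta s <> 0) by (intros E; apply HN; rewrite HE, E; ring).
assert (DH : cder Hzeta s = (zeta s + (s - 1) * cder zeta s)%C).
{ apply cder_eq.
  apply is_cderiv_local with (f := fun z => ((z - 1) * zeta z)%C) (d := 1); [lra | |].
  - intros w Hw; apply disc_sq, sq_Re in Hw; symmetry; apply (Hzeta_right zeta w HZ); lra.
  - assert (K : is_cderiv (fun z => (z - 1) * zeta z)%C s ((1 - 0) * zeta s + (s - 1) * cder zeta s)%C).
    { apply (is_cderiv_mult (fun z => z - 1)%C zeta); [|apply cder_correct; auto].
      apply is_cderiv_minus; [apply is_cderiv_id | apply is_cderiv_const]. }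
    replace ((1 - 0) * zeta s)%C with (zeta s) in K by ring; exact K. }
assert (LD : clim (csum (lfac s)) (- (cder zeta s / zeta s))%C).
{ assert (A : clim (fun N => cder (eulerN N) s) (cder zeta s)).
  { intros e He.
    apply (uniform_limit_cder eulerN zeta s (1 / 2)); try lra.
    - intros n z Hz; apply sq_Re in Hz; eexists; apply is_cderiv_eulerN; lra.
    - intros e' He'; destruct (eulerN_uniform zeta (3 / 2) HZ ltac:(lra) e' He') as [N HNN].
      exists N; intros n z Hn Hz; apply sq_Re in Hz; apply HNN; [assumption | lra]. }
  assert (B : clim (fun N => sieved_sum N s) 1).
  { intros e He; destruct (sieved_sum_uniform (3 / 2) ltac:(lra) e He) as [N HNN].
    exists N; intros n Hn; rewrite Cmod_minus_sym; apply HNN; [assumption | lra]. }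
  assert (D : clim (fun N => csum (lfac s) (S N)) (- / zeta s * (1 * cder zeta s))%C).
  { apply tends_ext with (fun N => - / zeta s * (sieved_sum N s * cder (eulerN N) s))%C.
    - intros N; rewrite (cder_eq _ _ _ (is_cderiv_eulerN N s ltac:(lra))).
      transitivity (/ zeta s * (eulerN N s * sieved_sum N s) * csum (lfac s) (S N))%C; [ring|].
      rewrite <- (zeta_euler zeta N s HZ) by lra; field; assumption.
    - apply tends_scal, tends_mult; assumption. }
  replace (- (cder zeta s / zeta s))%C with (- / zeta s * (1 * cder zeta s))%C by (field; assumption).
  intros e He; destruct (D e He) as [N HNN]; exists (S N); intros [|n] Hn; [lia | apply HNN; lia]. }
assert (BB : clim (csum (fun n => bterm n s)) (Bsum s)).
{ apply cser_clim with (fun n => 4 * (/ (2 - 1 / 2) * Rpower 2 (2 + 1 / 2)) * zser (2 + 1 / 2) n).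
  - intros n; apply bterm_bound; lra.
  - apply (ex_series_scal (V := R_NormedModule)), ex_zser; lra. }
replace (Efun s + / (s - 1))%C with (- (cder zeta s / zeta s) + (- (1)) * Bsum s)%C.
- apply tends_ext with (fun n => csum (lfac s) n + (- (1)) * csum (fun n => bterm n s) n)%C.
  + intros n; induction n as [|n IH]; [simpl; ring|].
    cbn [csum]; rewrite <- IH; unfold lfac, bterm; field; apply ppow_1_neq; lra.
  + apply tends_plus; [assumption | apply tends_scal; assumption].
- unfold Efun; rewrite DH, HE; field; auto.
Qed.

(** ** The bound inside the critical strip *)

Lemma is_derive_ln_Cmod (g : R -> C) (t : R) (l : C) : g t <> 0 -> rder g t l ->
  is_derive (fun u => ln (Cmod (g u))) t (Re (l / g t)).
Proof.
intros N [D1 D2].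
assert (P : 0 < Re (g t) * Re (g t) + Im (g t) * Im (g t)).
{ assert (Q := proj1 (Cmod_gt_0 (g t)) N); pose proof (Cmod2_alt (g t)); nra. }
apply is_derive_ext with (fun u => / 2 * ln (Re (g u) * Re (g u) + Im (g u) * Im (g u))).
- intros u; unfold Cmod.
  replace (fst (g u) ^ 2 + snd (g u) ^ 2) with (Re (g u) * Re (g u) + Im (g u) * Im (g u)) by (unfold Re, Im; ring).
  set (x := Re (g u) * Re (g u) + Im (g u) * Im (g u)).
  assert (X : 0 <= x) by (unfold x; nra).
  destruct X as [X | X].
  + rewrite <- Rpower_sqrt by assumption; unfold Rpower; rewrite ln_exp; reflexivity.
  + rewrite <- X, sqrt_0; unfold ln; destruct (Rlt_dec 0 0) as [K | K]; [exfalso; exact (Rlt_irrefl 0 K) | apply Rmult_0_r].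
- evar_last.
  + apply (is_derive_scal (fun u => ln (Re (g u) * Re (g u) + Im (g u) * Im (g u)))).
    apply (is_derive_comp ln (fun u => Re (g u) * Re (g u) + Im (g u) * Im (g u))).
    * apply is_derive_Reals, derivable_pt_lim_ln, P.
    * apply (is_derive_plus (fun u => Re (g u) * Re (g u)) (fun u => Im (g u) * Im (g u)));
      apply (is_derive_mult (K := R_AbsRing)); try eassumption; intros; apply Rmult_comm.
  + unfold scal, plus, mult; simpl; unfold mult, Re, Im in *; simpl; field.
    simpl; nra.
Qed.

Lemma is_derive_exp_lin (k a x : R) :
  is_derive (fun x => exp (k * (x - a))) x (k * exp (k * (x - a))).
Proof.
evar_last.
- apply (is_derive_comp exp (fun x => k * (x - a))); [apply is_derive_Reals, derivable_pt_lim_exp|].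
  apply (is_derive_scal (fun x => x - a)).
  apply (is_derive_minus (fun x => x) (fun _ => a)); [apply (is_derive_id (K := R_AbsRing)) | apply (is_derive_const (V := R_NormedModule))].
- unfold scal, minus, plus, opp, zero, one; simpl; unfold mult; simpl; ring.
Qed.

(** This takes the place of Harnack's inequality: a nonnegative harmonic function satisfies
    the differential inequality along horizontal lines by the gradient estimate. *)
Lemma gronwall_backward (phi phi' : R -> R) (k a b : R) : 0 <= k -> a <= b ->
  (forall x, a <= x <= b -> is_derive phi x (phi' x)) ->
  (forall x, a <= x <= b -> - k * phi x <= phi' x) -> phi a <= phi b * exp (k * (b - a)).
Proof.
intros Hk Hab D B.
destruct (MVT_gen (fun x => phi x * exp (k * (x - a))) a b
  (fun x => phi' x * exp (k * (x - a)) + phi x * (k * exp (k * (x - a))))) as [c [Hc E]].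
- rewrite Rmin_left, Rmax_right by assumption; intros x Hx.
  apply (is_derive_mult (K := R_AbsRing) phi (fun x => exp (k * (x - a)))); [apply D; lra | | intros; apply Rmult_comm].
  apply is_derive_exp_lin.
- rewrite Rmin_left, Rmax_right by assumption; intros x Hx.
  apply derivable_continuous_pt, ex_derive_Reals_0; eexists.
  apply (is_derive_mult (K := R_AbsRing) phi (fun x => exp (k * (x - a)))); [apply D; lra | | intros; apply Rmult_comm].
  apply is_derive_exp_lin.
- rewrite Rmin_left, Rmax_right in Hc by assumption.
  replace (k * (a - a)) with 0 in E by ring; rewrite exp_0, Rmult_1_r in E.
  specialize (B c Hc); pose proof (exp_pos (k * (c - a))) as P.
  assert (0 <= (phi' c * exp (k * (c - a)) + phi c * (k * exp (k * (c - a)))) * (b - a)).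
  { apply Rmult_le_pos; [|lra].
    replace (phi' c * exp (k * (c - a)) + phi c * (k * exp (k * (c - a)))) with
     ((phi' c + k * phi c) * exp (k * (c - a))) by ring.
    apply Rmult_le_pos; lra. }
  lra.
Qed.

(** The function [log M - log |H|] is nonnegative harmonic on squares around the segment
    from [s] to the line of real part [2], if [M] bounds [|H|] there. It is [O(log T)] at the
    right end, hence along the segment, and its gradient at [s] bounds [H' / H]. *)
Lemma Efun_bound (zeta : C -> C) (a : R) : is_riemann_zeta zeta -> riemann_hypothesis zeta ->
  1 / 2 < a -> exists K, 0 < K /\ forall T s, 2 <= T -> a <= Re s <= 2 -> Rabs (Im s) <= T ->
  Cmod (Efun s) <= K * ln T.
Proof.
intros HZ RH Ha0.
destruct Hzeta_bound as [K [HK BK]].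
destruct (zeta_lower_2 zeta HZ) as [c [Hc Lc]].
destruct (Bsum_bound a Ha0) as [KB [HKB BB]].
destruct (Rle_dec a 2) as [Ha2 | Ha2].
2:{ exists 1; split; [lra|]; intros; lra. }
set (R := (a - 1 / 2) / 2).
assert (HR : 0 < R < 1) by (unfold R; lra).
(* The gradient constant for radius [R / 2]; the squares of half-side [R] around points of
   abscissa at least [a] stay to the right of [1/2]. *)
set (k := 2 / (R / 2)).
assert (Hk : 0 < k) by (apply Rdiv_lt_0_compat; lra).
set (L2 := ln 2).
assert (HL2 : 0 < L2) by (unfold L2; rewrite <- ln_1; apply ln_increasing; lra).
set (A0 := Rabs (ln (16 * K) - ln c)).
assert (HA0 : 0 <= A0) by apply Rabs_pos.
set (KK := k * ((2 + A0 / L2) * exp (k * 2)) + KB / L2).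
assert (H0 : 0 <= A0 / L2) by (apply Rmult_le_pos; [assumption | left; apply Rinv_0_lt_compat, HL2]).
assert (H1 : 0 <= KB / L2) by (apply Rmult_le_pos; [assumption | left; apply Rinv_0_lt_compat, HL2]).
assert (H2 : 0 < k * ((2 + A0 / L2) * exp (k * 2))).
{ apply Rmult_lt_0_compat; [assumption|]; apply Rmult_lt_0_compat; [lra | apply exp_pos]. }
exists KK; split; [unfold KK; lra|].
intros T [x t] HT [Hx1 Hx2] Ht; simpl in Hx1, Hx2, Ht.
assert (HLT : L2 <= ln T) by (apply ln_le; lra).
set (M := 16 * K * T ^ 2).
assert (HM : 0 < M) by (unfold M; apply Rmult_lt_0_compat; [lra | apply pow_lt; lra]).
assert (Sub : forall y z, a <= y <= 2 -> sq (y, t) R z -> 1 / 2 < Re z /\ Cmod (Hzeta z) <= M).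
{ intros y z Hy Hz; pose proof (sq_Re _ _ _ Hz) as Z1; pose proof (sq_Cmod _ _ _ Hz) as Z2; simpl in Z1.
  split; [unfold R in *; lra|].
  eapply Rle_trans; [apply BK; unfold R in *; lra|].
  unfold M; replace (16 * K * T ^ 2) with (K * (4 * T) ^ 2) by ring.
  apply Rmult_le_compat_l; [lra|]; apply pow_incr; split; [pose proof (Cmod_ge_0 z); lra|].
  pose proof (Cmod_le_Re_Im (y, t)) as Z3; simpl in Z3; rewrite (Rabs_right y) in Z3 by lra; lra. }
assert (LDB : forall y, a <= y <= 2 ->
  Cmod (cder Hzeta (y, t) / Hzeta (y, t)) <= k * (ln M - ln (Cmod (Hzeta (y, t))))).
{ intros y Hy; apply log_derivative_bound with R; try assumption; try lra.
  - intros z Hz; destruct (Sub y z Hy Hz); apply hol_Hzeta; lra.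
  - intros z Hz; destruct (Sub y z Hy Hz); apply (Hzeta_neq_0 zeta); assumption.
  - intros z Hz; destruct (Sub y z Hy Hz); assumption. }
set (phi := fun y => ln M - ln (Cmod (Hzeta (y, t)))).
assert (G : phi x <= phi 2 * exp (k * (2 - x))).
{ apply gronwall_backward with (fun y => - Re (cder Hzeta (y, t) / Hzeta (y, t))); try lra.
  - intros y Hy; unfold phi.
    evar_last.
    + apply (is_derive_minus (fun _ => ln M) (fun y => ln (Cmod (Hzeta (y, t))))); [apply is_derive_const|].
      apply (is_derive_ln_Cmod (fun y => Hzeta (y, t))).
      * apply (Hzeta_neq_0 zeta); try assumption; simpl; lra.
      * apply rder_hline, cder_correct, hol_Hzeta; simpl; lra.
    + unfold minus, plus, opp, zero; simpl; ring.
  - intros y Hy; specialize (LDB y ltac:(lra)); fold (phi y) in LDB.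
    pose proof (re_le_Cmod (cder Hzeta (y, t) / Hzeta (y, t))) as Q.
    pose proof (Rle_abs (Re (cder Hzeta (y, t) / Hzeta (y, t)))); lra. }
assert (P2 : phi 2 <= (2 + A0 / L2) * ln T).
{ assert (E : phi 2 <= ln M - ln c).
  { unfold phi; assert (ln c <= ln (Cmod (Hzeta (2, t)))); [|lra].
    apply ln_le; [assumption|].
    rewrite (Hzeta_right zeta _ HZ) by (simpl; lra); rewrite Cmod_mult.
    pose proof (Lc (2, t) eq_refl).
    assert (1 <= Cmod ((2, t) - 1)).
    { pose proof (re_le_Cmod ((2, t) - 1)) as Q; simpl in Q; unfold Re in Q; simpl in Q.
      rewrite Rabs_right in Q by lra; lra. }
    pose proof (Cmod_ge_0 (zeta (2, t))); nra. }
  assert (E2 : ln M = ln (16 * K) + 2 * ln T).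
  { unfold M; rewrite ln_mult by (try apply pow_lt; lra); f_equal.
    simpl; rewrite Rmult_1_r, ln_mult by lra; ring. }
  assert (A0 <= A0 / L2 * ln T).
  { rewrite <- (Rmult_1_r A0) at 1; unfold Rdiv; rewrite Rmult_assoc; apply Rmult_le_compat_l; [assumption|].
    apply Rmult_le_reg_l with L2; [assumption|]; rewrite <- Rmult_assoc, Rinv_r; lra. }
  pose proof (Rle_abs (ln (16 * K) - ln c)); fold A0 in H3; lra. }
assert (P0 : 0 <= (2 + A0 / L2) * ln T) by (apply Rmult_le_pos; lra).
assert (G2 : phi x <= (2 + A0 / L2) * ln T * exp (k * 2)).
{ eapply Rle_trans; [exact G|].
  apply Rle_trans with ((2 + A0 / L2) * ln T * exp (k * (2 - x))).
  - apply Rmult_le_compat_r; [left; apply exp_pos | assumption].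
  - apply Rmult_le_compat_l; [assumption|].
    assert (Q : k * (2 - x) < k * 2) by (apply Rmult_lt_compat_l; lra).
    left; apply exp_increasing, Q. }
unfold Efun.
eapply Rle_trans; [apply Cmod_triangle_minus|]; rewrite Cmod_opp.
specialize (LDB x ltac:(lra)); fold (phi x) in LDB.
specialize (BB (x, t) ltac:(simpl; lra)).
assert (KB <= KB / L2 * ln T).
{ rewrite <- (Rmult_1_r KB) at 1; unfold Rdiv; rewrite Rmult_assoc; apply Rmult_le_compat_l; [assumption|].
  apply Rmult_le_reg_l with L2; [assumption|]; rewrite <- Rmult_assoc, Rinv_r; lra. }
assert (k * phi x <= k * ((2 + A0 / L2) * ln T * exp (k * 2))) by (apply Rmult_le_compat_l; lra).
unfold KK.
replace ((k * ((2 + A0 / L2) * exp (k * 2)) + KB / L2) * ln T) with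
 (k * ((2 + A0 / L2) * ln T * exp (k * 2)) + KB / L2 * ln T) by ring.
lra.
Qed.

(** * Perron's formula *)

(** The kernel [y^z / z] of Perron's formula with [y = e^L]. *)
Definition kern (L : R) (z : C) : C := (Cexp (z * RtoC L) / z)%C.
Definition perron (c L T : R) : C := vint (kern L) c (- T) T.

Lemma hol_Cexp_scal (L : R) (z : C) : hol (fun z => Cexp (z * RtoC L)) z.
Proof.
apply (hol_comp (fun z => z * RtoC L)%C Cexp); [|apply hol_Cexp].
apply hol_mult; [apply hol_id | apply hol_const].
Qed.

Lemma hol_kern (L : R) (z : C) : z <> 0 -> hol (kern L) z.
Proof. intros N; apply hol_div; [assumption | apply hol_Cexp_scal | apply hol_id]. Qed.

Lemma pair_neq_0 (x y : R) : x <> 0 \/ y <> 0 -> ((x, y) : C) <> 0.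
Proof. intros H E; injection E; intros; tauto. Qed.

Lemma Cmod_kern (L x y : R) : ((x, y) : C) <> 0 -> Cmod (kern L (x, y)) = exp (x * L) / Cmod (x, y).
Proof.
intros N; unfold kern; rewrite Cmod_div, Cmod_Cexp by assumption; do 2 f_equal; simpl; unfold Re; simpl; ring.
Qed.

Lemma hint_kern_bound (L a b y T : R) : L <> 0 -> 0 < T -> Rabs y = T -> a <= b ->
  Cmod (hint (kern L) a b y) <= (exp (a * L) + exp (b * L)) / (T * Rabs L).
Proof.
intros HL HT Hy Hab.
assert (Ny : y <> 0) by (intros ->; rewrite Rabs_R0 in Hy; lra).
assert (IG : RInt (fun x => exp (x * L) / T) a b = (exp (b * L) - exp (a * L)) / (T * L)).
{ apply is_RInt_unique.
  evar_last.
  - apply (is_RInt_derive (fun x => exp (x * L) / (T * L)) (fun x => exp (x * L) / T)).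
    + intros x _; auto_derive; [trivial | field; split; lra].
    + intros x _; apply (ex_derive_continuous (V := R_NormedModule)); auto_derive; trivial.
  - unfold minus, plus, opp; simpl; field; split; lra. }
eapply Rle_trans.
- apply (cint_bound _ (fun x => exp (x * L) / T)); [assumption | | |].
  + apply cex_cont_le; [assumption|]; intros x _; apply ccont_hline, hol_ccontz, hol_kern, pair_neq_0; tauto.
  + apply (ex_RInt_continuous (V := R_CompleteNormedModule)); intros x _.
    apply (ex_derive_continuous (V := R_NormedModule)); auto_derive; trivial.
  + intros x _; rewrite Cmod_kern by (apply pair_neq_0; tauto).
    apply Rmult_le_compat_l; [left; apply exp_pos|].
    apply Rinv_le_contravar; [assumption|]; rewrite <- Hy; apply (im_le_Cmod (x, y)).
- rewrite IG.
  pose proof (exp_pos (a * L)); pose proof (exp_pos (b * L)).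
  assert (P : 0 < Rabs L) by (apply Rabs_pos_lt, HL).
  assert (PT : 0 < / (T * Rabs L)) by (apply Rinv_0_lt_compat, Rmult_lt_0_compat; assumption).
  destruct (Rle_dec 0 L) as [Q | Q].
  + rewrite (Rabs_right L) in * by lra; unfold Rdiv; nra.
  + rewrite (Rabs_left L) in * by lra.
    replace ((exp (b * L) - exp (a * L)) / (T * L)) with ((exp (a * L) - exp (b * L)) / (T * - L)) by (field; lra).
    unfold Rdiv; nra.
Qed.

Lemma vint_kern_bound (L x T : R) : x <> 0 -> 0 < T ->
  Cmod (vint (kern L) x (- T) T) <= exp (x * L) / Rabs x * (2 * T).
Proof.
intros Hx HT; unfold vint.
replace (2 * T) with (T - - T) by ring.
apply cint_bound_const; [lra | |].
- apply cex_cont_le; [lra|]; intros y _; apply ccont_vline, hol_ccontz, hol_kern, pair_neq_0; tauto.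
- intros y _; rewrite Cmod_kern by (apply pair_neq_0; tauto).
  apply Rmult_le_compat_l; [left; apply exp_pos|].
  apply Rinv_le_contravar; [apply Rabs_pos_lt, Hx | apply (re_le_Cmod (x, y))].
Qed.

Lemma Cmod_Ci_mult (z : C) : Cmod (Ci * z) = Cmod z.
Proof. rewrite Cmod_mult, Cmod_Ci; ring. Qed.

(** For [L < 0] the kernel decays to the right, where it has no pole. *)
Lemma perron_neg (c L T : R) : 0 < c -> 0 < T -> L < 0 ->
  Cmod (perron c L T) <= 4 * exp (c * L) / (T * Rabs L).
Proof.
intros Hc HT HL; apply Rle_plus_epsilon; intros e He.
assert (P : 0 < exp (c * L)) by apply exp_pos.
(* Far enough to the right for the opposite vertical side to contribute at most [e]. *)
set (X := c + 2 * T * exp (c * L) / e).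
assert (HX : c < X).
{ unfold X; assert (0 < 2 * T * exp (c * L) / e); [|lra].
  apply Rdiv_lt_0_compat; [|assumption]; apply Rmult_lt_0_compat; lra. }
assert (G : rect (kern L) c X (- T) T = 0).
{ apply goursat; [lra | lra|]; intros x y Hx Hy; apply hol_kern, pair_neq_0; left; lra. }
unfold rect in G.
assert (E : (Ci * perron c L T)%C = (hint (kern L) c X (- T) - hint (kern L) c X T + Ci * vint (kern L) X (- T) T)%C).
{ unfold perron.
  transitivity (hint (kern L) c X (- T) - hint (kern L) c X T + Ci * vint (kern L) X (- T) T -
    (hint (kern L) c X (- T) - hint (kern L) c X T + Ci * (vint (kern L) X (- T) T - vint (kern L) c (- T) T)))%C.
  - ring.
  - rewrite G; ring. }
rewrite <- Cmod_Ci_mult, E.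
eapply Rle_trans; [apply Cmod_triangle|]; rewrite Cmod_Ci_mult.
apply Rplus_le_compat.
- eapply Rle_trans; [apply Cmod_triangle_minus|].
  assert (B1 := hint_kern_bound L c X (- T) T ltac:(lra) HT ltac:(rewrite Rabs_Ropp, Rabs_right; lra) ltac:(lra)).
  assert (B2 := hint_kern_bound L c X T T ltac:(lra) HT ltac:(rewrite Rabs_right; lra) ltac:(lra)).
  assert (Q : exp (X * L) <= exp (c * L)) by (left; apply exp_increasing; nra).
  assert (PL : 0 < Rabs L) by (apply Rabs_pos_lt; lra).
  assert (PI' : 0 < / (T * Rabs L)) by (apply Rinv_0_lt_compat, Rmult_lt_0_compat; assumption).
  unfold Rdiv in *; nra.
- eapply Rle_trans; [apply vint_kern_bound; lra|].
  rewrite Rabs_right by lra.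
  assert (Q : exp (X * L) <= exp (c * L)) by (left; apply exp_increasing; nra).
  assert (QX : 2 * T * exp (c * L) <= e * X).
  { unfold X; rewrite Rmult_plus_distr_l.
    replace (e * (2 * T * exp (c * L) / e)) with (2 * T * exp (c * L)) by (field; lra).
    pose proof (Rmult_lt_0_compat e c He Hc); lra. }
  apply Rmult_le_reg_l with X; [lra|].
  replace (X * (exp (X * L) / X * (2 * T))) with (exp (X * L) * (2 * T)) by (field; lra).
  apply Rle_trans with (exp (c * L) * (2 * T)); [apply Rmult_le_compat_r; lra | lra].
Qed.

Lemma atan_sum (x y : R) : 0 < x -> 0 < y -> atan (x / y) + atan (y / x) = PI / 2.
Proof.
intros Hx Hy.
replace (y / x) with (/ (x / y)) by (field; lra).
rewrite atan_inv by (apply Rdiv_lt_0_compat; assumption); ring.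
Qed.

Lemma is_derive_atan_div (k x : R) : k <> 0 -> is_derive (fun x => atan (x / k)) x (k / (x * x + k * k)).
Proof.
intros Hk; evar_last.
- apply (is_derive_comp atan (fun x => x / k)).
  + apply is_derive_Reals, derivable_pt_lim_atan.
  + apply (is_derive_scal_l (V := R_NormedModule) (fun x => x) x one (/ k)), (is_derive_id (K := R_AbsRing)).
- unfold scal, one; simpl; unfold mult, Rsqr; simpl; field.
  split; [|assumption]; nra.
Qed.

(** The four sides contribute arctangents that add up to four right angles. *)
Lemma residue_rect (X c T : R) : 0 < X -> 0 < c -> 0 < T ->
  rect (fun z => / z)%C (- X) c (- T) T = (RtoC (2 * PI) * Ci)%C.
Proof.
intros HX Hc HT; unfold rect.
assert (H1 : (hint (fun z => / z)%C (- X) c (- T) - hint (fun z => / z)%C (- X) c T)%C =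
   (RtoC (2 * (atan (c / T) + atan (X / T))) * Ci)%C).
{ unfold hint; rewrite <- cint_minus.
  - rewrite (cint_FTC (fun x => RtoC (2 * atan (x / T)) * Ci)%C).
    + replace (- X / T) with (- (X / T)) by (field; lra); rewrite atan_opp; Ceq; ring.
    + intros x _.
      assert (K : rder (fun x => RtoC (2 * atan (x / T)) * Ci)%C x
        (RtoC (2 * (T / (x * x + T * T))) * Ci + RtoC (2 * atan (x / T)) * 0)%C).
      { apply (rder_mult (fun x => RtoC (2 * atan (x / T))) (fun _ => Ci)); [|apply rder_const].
        apply rder_RtoC, (is_derive_scal (fun x => atan (x / T))), is_derive_atan_div; lra. }
      match type of K with rder _ _ ?u => match goal with |- rder _ _ ?v => replace v with u end end; [exact K|].
      unfold Cinv; Ceq; field; nra.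
    + intros x _; apply ccont_minus; apply ccont_hline, (ccontz_inv (fun z => z)), ccontz_id; apply pair_neq_0; right; lra.
  - apply cex_hline; intros x _; apply (ccontz_inv (fun z => z)), ccontz_id; apply pair_neq_0; right; lra.
  - apply cex_hline; intros x _; apply (ccontz_inv (fun z => z)), ccontz_id; apply pair_neq_0; right; lra. }
assert (H2 : forall x, 0 < x -> (vint (fun z => / z)%C x (- T) T - vint (fun z => / z)%C (- x) (- T) T)%C =
   RtoC (4 * atan (T / x))).
{ intros x Hx; unfold vint; rewrite <- cint_minus.
  - rewrite (cint_FTC (fun y => RtoC (2 * atan (y / x)))%C).
    + replace (- T / x) with (- (T / x)) by (field; lra); rewrite atan_opp; Ceq; ring.
    + intros y _.
      assert (K : rder (fun y => RtoC (2 * atan (y / x)))%C y (RtoC (2 * (x / (y * y + x * x))))).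
      { apply rder_RtoC, (is_derive_scal (fun y => atan (y / x))), is_derive_atan_div; lra. }
      match type of K with rder _ _ ?u => match goal with |- rder _ _ ?v => replace v with u end end; [exact K|].
      unfold Cinv; Ceq; field; nra.
    + intros y _; apply ccont_minus; apply ccont_vline, (ccontz_inv (fun z => z)), ccontz_id; apply pair_neq_0; left; lra.
  - apply cex_vline; intros y _; apply (ccontz_inv (fun z => z)), ccontz_id; apply pair_neq_0; left; lra.
  - apply cex_vline; intros y _; apply (ccontz_inv (fun z => z)), ccontz_id; apply pair_neq_0; left; lra. }
assert (H3 : forall x, 0 < x -> (vint (fun z => / z)%C x (- T) T + vint (fun z => / z)%C (- x) (- T) T)%C = 0).
{ intros x Hx; unfold vint; rewrite <- cint_plus.
  - rewrite (cint_FTC (fun y => RtoC (- ln (y * y + x * x)) * Ci)%C).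
    + replace (- T * - T) with (T * T) by ring; ring.
    + intros y _.
      assert (K : rder (fun y => RtoC (- ln (y * y + x * x)) * Ci)%C y
        (RtoC (- (2 * y / (y * y + x * x))) * Ci + RtoC (- ln (y * y + x * x)) * 0)%C).
      { apply (rder_mult (fun y => RtoC (- ln (y * y + x * x))) (fun _ => Ci)); [|apply rder_const].
        apply rder_RtoC; auto_derive; [nra | field; nra]. }
      match type of K with rder _ _ ?u => match goal with |- rder _ _ ?v => replace v with u end end; [exact K|].
      unfold Cinv; Ceq; field; nra.
    + intros y _; apply ccont_plus; apply ccont_vline, (ccontz_inv (fun z => z)), ccontz_id; apply pair_neq_0; left; lra.
  - apply cex_vline; intros y _; apply (ccontz_inv (fun z => z)), ccontz_id; apply pair_neq_0; left; lra.
  - apply cex_vline; intros y _; apply (ccontz_inv (fun z => z)), ccontz_id; apply pair_neq_0; left; lra. }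
rewrite H1.
set (vc := vint (fun z => / z)%C c (- T) T) in *.
set (vX := vint (fun z => / z)%C (- X) (- T) T) in *.
assert (Ec : vc = RtoC (2 * atan (T / c))).
{ pose proof (H2 c Hc) as A; pose proof (H3 c Hc) as B; fold vc in A, B.
  set (w := vint (fun z => / z)%C (- c) (- T) T) in *.
  transitivity (RtoC (/ 2) * ((vc - w) + (vc + w)))%C.
  - transitivity ((RtoC (/ 2) + RtoC (/ 2)) * vc)%C; [|ring].
    rewrite <- RtoC_plus; replace (/ 2 + / 2) with 1 by field; ring.
  - rewrite A, B; Ceq; field. }
assert (EX : vX = RtoC (- (2 * atan (T / X)))).
{ pose proof (H2 X HX) as A; pose proof (H3 X HX) as B; fold vX in A, B.
  set (w := vint (fun z => / z)%C X (- T) T) in *.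
  transitivity (RtoC (/ 2) * ((w + vX) - (w - vX)))%C.
  - transitivity ((RtoC (/ 2) + RtoC (/ 2)) * vX)%C; [|ring].
    rewrite <- RtoC_plus; replace (/ 2 + / 2) with 1 by field; ring.
  - rewrite A, B; Ceq; field. }
rewrite Ec, EX.
pose proof (atan_sum c T Hc HT); pose proof (atan_sum X T HX HT).
Ceq; [ring|]; nra.
Qed.

(** Shifting the line of integration to the left picks up the residue at the
    origin; the entire part of the kernel contributes nothing. *)
Lemma perron_pos (c L T : R) : 0 < c -> 0 < T -> 0 < L ->
  Cmod (perron c L T - RtoC (2 * PI)) <= 4 * exp (c * L) / (T * Rabs L).
Proof.
intros Hc HT HL; apply Rle_plus_epsilon; intros e He.
(* Far enough to the left for the opposite vertical side to contribute at most [e]. *)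
set (X := 1 + 2 * T / e).
assert (HX : 1 < X).
{ unfold X; assert (0 < 2 * T / e); [|lra]; apply Rdiv_lt_0_compat; lra. }
set (sl := slope (fun z => Cexp (z * RtoC L)) 0).
assert (Hsl : forall z, hol sl z).
{ intros z; apply slope_hol with 1; [lra | |]; intros; apply hol_Cexp_scal. }
assert (Esl : forall z : C, z <> 0 -> kern L z = (sl z + / z)%C).
{ intros z Nz; unfold sl; rewrite slope_neq by assumption; unfold kern.
  replace (0 * RtoC L)%C with (RtoC 0) by ring; rewrite Cexp_0; field; assumption. }
assert (G : rect sl (- X) c (- T) T = 0) by (apply goursat; [lra | lra | intros; apply Hsl]).
assert (RR := residue_rect X c T ltac:(lra) Hc HT).
assert (Hh : forall y, y <> 0 -> hint (kern L) (- X) c y = (hint sl (- X) c y + hint (fun z => / z)%C (- X) c y)%C).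
{ intros y Hy; unfold hint; rewrite <- cint_plus.
  - apply cint_ext; intros x _; apply Esl, pair_neq_0; tauto.
  - apply cex_hline; intros x _; apply hol_ccontz, Hsl.
  - apply cex_hline; intros x _; apply (ccontz_inv (fun z => z)), ccontz_id; apply pair_neq_0; tauto. }
assert (Hv : forall x, x <> 0 -> vint (kern L) x (- T) T = (vint sl x (- T) T + vint (fun z => / z)%C x (- T) T)%C).
{ intros x Hx; unfold vint; rewrite <- cint_plus.
  - apply cint_ext; intros y _; apply Esl, pair_neq_0; tauto.
  - apply cex_vline; intros y _; apply hol_ccontz, Hsl.
  - apply cex_vline; intros y _; apply (ccontz_inv (fun z => z)), ccontz_id; apply pair_neq_0; tauto. }
assert (K : rect (kern L) (- X) c (- T) T = (RtoC (2 * PI) * Ci)%C).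
{ rewrite <- RR; transitivity (rect sl (- X) c (- T) T + rect (fun z => / z)%C (- X) c (- T) T)%C; [|rewrite G; ring].
  unfold rect; rewrite !Hh, !Hv by lra; ring. }
unfold rect in K.
assert (E : (Ci * (perron c L T - RtoC (2 * PI)))%C =
  (- (hint (kern L) (- X) c (- T) - hint (kern L) (- X) c T) + Ci * vint (kern L) (- X) (- T) T)%C).
{ unfold perron.
  transitivity (- (hint (kern L) (- X) c (- T) - hint (kern L) (- X) c T) + Ci * vint (kern L) (- X) (- T) T +
    (hint (kern L) (- X) c (- T) - hint (kern L) (- X) c T + Ci * (vint (kern L) c (- T) T - vint (kern L) (- X) (- T) T)
     - RtoC (2 * PI) * Ci))%C; [ring | rewrite K; ring]. }
rewrite <- Cmod_Ci_mult, E.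
eapply Rle_trans; [apply Cmod_triangle|]; rewrite Cmod_Ci_mult, Cmod_opp.
assert (Q : exp (- X * L) <= exp (c * L)) by (left; apply exp_increasing; nra).
apply Rplus_le_compat.
- eapply Rle_trans; [apply Cmod_triangle_minus|].
  assert (B1 := hint_kern_bound L (- X) c (- T) T ltac:(lra) HT ltac:(rewrite Rabs_Ropp, Rabs_right; lra) ltac:(lra)).
  assert (B2 := hint_kern_bound L (- X) c T T ltac:(lra) HT ltac:(rewrite Rabs_right; lra) ltac:(lra)).
  assert (PL : 0 < Rabs L) by (apply Rabs_pos_lt; lra).
  assert (PI' : 0 < / (T * Rabs L)) by (apply Rinv_0_lt_compat, Rmult_lt_0_compat; assumption).
  unfold Rdiv in *; nra.
- eapply Rle_trans; [apply vint_kern_bound; lra|].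
  rewrite Rabs_left by lra.
  assert (Q1 : exp (- X * L) <= 1) by (rewrite <- exp_0; left; apply exp_increasing; nra).
  assert (QX : 2 * T <= e * X).
  { unfold X; rewrite Rmult_plus_distr_l.
    replace (e * (2 * T / e)) with (2 * T) by (field; lra); lra. }
  apply Rmult_le_reg_l with X; [lra|].
  replace (X * (exp (- X * L) / - - X * (2 * T))) with (exp (- X * L) * (2 * T)) by (field; lra).
  apply Rle_trans with (1 * (2 * T)); [apply Rmult_le_compat_r; lra | lra].
Qed.

Definition step (L : R) : R := if Rlt_dec 0 L then 1 else 0.

(** The truncated Perron formula: the integral detects the sign of [L]. *)
Lemma perron_step (c L T : R) : 0 < c -> 0 < T -> L <> 0 ->
  Cmod (perron c L T - RtoC (2 * PI * step L)) <= 4 * exp (c * L) / (T * Rabs L).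
Proof.
intros Hc HT HL; unfold step; destruct (Rlt_dec 0 L) as [H | H].
- rewrite Rmult_1_r; apply perron_pos; assumption.
- rewrite Rmult_0_r; replace (perron c L T - 0)%C with (perron c L T) by ring; apply perron_neg; lra.
Qed.

(** * The prime number theorem with square-root error *)

Fixpoint theta (n : nat) : R := match n with O => 0 | S m => theta m + plog (S m) end.

Lemma ln_ratio_lower (a b : R) : 0 < a <= b -> (b - a) / b <= ln b - ln a.
Proof.
intros H.
assert (K := exp_ineq1_le (ln a - ln b)).
unfold Rminus at 2 in K; rewrite exp_plus, exp_Ropp, !exp_ln in K by lra.
replace ((b - a) / b) with (1 - a * / b) by (field; lra); lra.
Qed.

(** Placing [X] half-way between integers keeps the truncation error of Perron's formula,
    which is inversely proportional to the gap, under control. *)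
Lemma half_integer_gap (N n : nat) : (1 <= N)%nat -> (1 <= n)%nat ->
  let X := INR N + / 2 in
  / (4 * X) <= Rabs (ln X - ln (INR n)) /\ ((n <= N)%nat -> 0 < ln X - ln (INR n)) /\
  ((N < n)%nat -> ln X - ln (INR n) < 0).
Proof.
intros HN Hn X.
apply le_INR in HN; simpl in HN; assert (Hn' := le_INR _ _ Hn); simpl in Hn'.
assert (HX : 1 < X) by (unfold X; lra).
assert (P4 : / (4 * X) = (/ 4) / X) by (field; lra).
destruct (le_lt_dec n N) as [L | L].
- apply le_INR in L.
  assert (K := ln_ratio_lower (INR n) X ltac:(unfold X; lra)).
  assert (K2 : (/ 4) / X <= (X - INR n) / X).
  { apply Rmult_le_compat_r; [left; apply Rinv_0_lt_compat; lra | unfold X; lra]. }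
  assert (0 < (/ 4) / X) by (apply Rdiv_lt_0_compat; lra).
  repeat split.
  + rewrite Rabs_right by lra; lra.
  + intros; lra.
  + intros L'; apply lt_INR in L'; lra.
- assert (L' := L); apply le_INR in L; rewrite S_INR in L.
  assert (K := ln_ratio_lower X (INR n) ltac:(unfold X; lra)).
  assert (K2 : / (4 * X) <= (INR n - X) / INR n).
  { apply Rmult_le_reg_r with (4 * X * INR n); [apply Rmult_lt_0_compat; lra|].
    replace (/ (4 * X) * (4 * X * INR n)) with (INR n) by (field; lra).
    replace ((INR n - X) / INR n * (4 * X * INR n)) with ((INR n - X) * (4 * X)) by (field; lra).
    assert (X + / 2 <= INR n) by (unfold X; lra).
    nra. }
  assert (0 < / (4 * X)) by (apply Rinv_0_lt_compat; lra).
  repeat split.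
  + rewrite Rabs_left by lra; lra.
  + intros; lia.
  + intros; lra.
Qed.

(** The majorant of [log n n^(-2)] given by [plog_power_bound] with the exponent lowered
    by [1/2]. *)
Definition lmaj (n : nat) : R := / (1 / 2) * Rpower 2 (2 - 1 / 2) * zser (2 - 1 / 2) n.

Lemma lmaj_nonneg (n : nat) : 0 <= lmaj n.
Proof.
unfold lmaj; apply Rmult_le_pos; [|left; apply zser_pos].
apply Rmult_le_pos; [lra | left; apply exp_pos].
Qed.

Lemma ex_lmaj : ex_series lmaj.
Proof. apply (ex_series_scal (V := R_NormedModule)), ex_zser; lra. Qed.

Lemma lmaj_bound (n : nat) : plog n * Rpower (INR n) (- (2)) <= lmaj n.
Proof.
unfold plog; destruct (isprime n) eqn:E.
- apply plog_power_bound; lra || assumption.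
- rewrite Rmult_0_l; apply lmaj_nonneg.
Qed.

Lemma plog_ppow_bound (n : nat) (s : C) : Re s = 2 -> Cmod (RtoC (plog n) * ppow s n) <= lmaj n.
Proof.
intros Hs; rewrite Cmod_mult, Cmod_R, Rabs_right by (apply Rle_ge, plog_nonneg).
eapply Rle_trans; [|apply lmaj_bound].
unfold ppow; destruct (isprime n) eqn:E.
- rewrite Cmod_upow, Hs; lra.
- rewrite Cmod_0, Rmult_0_r; apply Rmult_le_pos; [apply plog_nonneg | left; apply exp_pos].
Qed.

(** The product [n^(-s) e^(l s)] is [e^((l - log n) s)], so that term [n] of the Dirichlet series
    shifts the parameter of the kernel. *)
Lemma ppow_kern (n : nat) (l : R) (s : C) :
  (RtoC (plog n) * ppow s n * kern l s)%C = (RtoC (plog n) * kern (l - ln (INR n)) s)%C.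
Proof.
unfold plog, ppow; destruct (isprime n); [|ring].
unfold kern, upow; rewrite RtoC_minus.
replace (s * (RtoC l - RtoC (ln (INR n))))%C with (- (s * RtoC (ln (INR n))) + s * RtoC l)%C by ring.
rewrite Cexp_plus; unfold Cdiv; ring.
Qed.

Lemma cex_perron (c l T : R) : 0 < c -> 0 < T -> cex (fun t => kern l (c, t)) (- T) T.
Proof.
intros Hc HT; apply cex_vline; intros y _; apply hol_ccontz, hol_kern, pair_neq_0; left; lra.
Qed.

Lemma vint_partial_sum (M : nat) (l T : R) : 0 < T ->
  cex (fun t => csum (fun n => RtoC (plog n) * ppow (2, t) n)%C M * kern l (2, t))%C (- T) T /\
  cint (fun t => csum (fun n => RtoC (plog n) * ppow (2, t) n)%C M * kern l (2, t))%C (- T) T =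
  csum (fun n => RtoC (plog n) * perron 2 (l - ln (INR n)) T)%C M.
Proof.
intros HT; induction M as [|M [IH1 IH2]].
- split.
  + apply cex_cont; intros t _; cbn [csum]; apply ccont_mult; [apply ccont_const|].
    apply ccont_vline, hol_ccontz, hol_kern, pair_neq_0; left; lra.
  + cbn [csum]; rewrite (cint_ext _ (fun _ => RtoC 0)) by (intros; ring); rewrite cint_const; ring.
- assert (E : forall t, (csum (fun n => RtoC (plog n) * ppow (2, t) n)%C (S M) * kern l (2, t))%C =
    (csum (fun n => RtoC (plog n) * ppow (2, t) n) M * kern l (2, t) + RtoC (plog M) * kern (l - ln (INR M)) (2, t))%C).
  { intros t; cbn [csum]; rewrite <- ppow_kern; ring. }
  assert (X : cex (fun t => RtoC (plog M) * kern (l - ln (INR M)) (2, t))%C (- T) T).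
  { apply cex_scal, cex_perron; lra. }
  split.
  + destruct (cex_plus _ _ _ _ IH1 X) as [Y1 Y2]; split;
    [eapply ex_RInt_ext; [|exact Y1] | eapply ex_RInt_ext; [|exact Y2]]; intros t _; cbv beta; rewrite E; reflexivity.
  + rewrite (cint_ext _ _ _ _ (fun t _ => E t)), cint_plus, cint_scal, IH2 by (try assumption; apply cex_perron; lra).
    reflexivity.
Qed.

Lemma csum_theta (M N : nat) (l : R) : (N < M)%nat ->
  (forall n, (1 <= n)%nat -> (n <= N)%nat -> 0 < l - ln (INR n)) ->
  (forall n, (1 <= n)%nat -> (N < n)%nat -> l - ln (INR n) < 0) ->
  csum (fun n => RtoC (plog n) * RtoC (2 * PI * step (l - ln (INR n))))%C M = RtoC (2 * PI * theta N).
Proof.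
intros HM H1 H2.
assert (K : forall m, csum (fun n => RtoC (plog n) * RtoC (2 * PI * step (l - ln (INR n))))%C (S m) =
  RtoC (2 * PI * theta (min m N))).
{ induction m as [|m IH].
  - cbn [csum]; unfold plog; change (isprime 0) with false; rewrite Nat.min_0_l; simpl; rewrite Rmult_0_r; ring.
  - cbn [csum]; cbn [csum] in IH; rewrite IH; unfold step.
    destruct (le_lt_dec (S m) N) as [L | L].
    + specialize (H1 (S m) ltac:(lia) L); destruct (Rlt_dec 0 (l - ln (INR (S m)))) as [_ | Q]; [|lra].
      rewrite !Nat.min_l by lia; cbn [theta]; Ceq; ring.
    + specialize (H2 (S m) ltac:(lia) L); destruct (Rlt_dec 0 (l - ln (INR (S m)))) as [Q | _]; [lra|].
      rewrite !Nat.min_r by lia; Ceq; ring. }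
destruct M as [|M]; [lia|]; rewrite K, Nat.min_r by lia; reflexivity.
Qed.

Lemma Cmod_csum_le (u : nat -> C) (m : nat -> R) (M : nat) : (forall n, 0 <= m n) -> ex_series m ->
  (forall n, Cmod (u n) <= m n) -> Cmod (csum u M) <= Series m.
Proof.
intros H0 Hm H.
assert (K : forall M, Cmod (csum u (S M)) <= sum_n m M).
{ induction M0 as [|n IH].
  - rewrite sum_O; simpl; replace (0 + u 0%nat)%C with (u 0%nat) by ring; apply H.
  - change (csum u (S (S n))) with (csum u (S n) + u (S n))%C; rewrite sum_Sn.
    eapply Rle_trans; [apply Cmod_triangle|]; apply Rplus_le_compat; [assumption | apply H]. }
destruct M as [|M].
- simpl; rewrite Cmod_0; apply Series_nonneg; assumption.
- eapply Rle_trans; [apply K|].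
  rewrite (Series_incr_n m (S M)) by (lia || assumption); rewrite <- sum_n_Reals; simpl pred.
  assert (0 <= Series (fun k => m (S M + k)%nat)); [|lra].
  apply Series_nonneg; [intros; apply H0 | apply (ex_series_incr_n m (S M)), Hm].
Qed.

Lemma csum_minus (u v : nat -> C) (M : nat) : (csum u M - csum v M)%C = csum (fun n => u n - v n)%C M.
Proof. induction M as [|M IH]; cbn [csum]; [ring | rewrite <- IH; ring]. Qed.

(** Each prime [p <= N] contributes its logarithm to the integral of the Dirichlet series
    against the kernel, and the polar part [1 / (s - 1)] contributes [X - 1], by the partial
    fractions [1 / (s (s - 1)) = 1 / (s - 1) - 1 / s]. With height [X^3] and logarithmic gaps
    at least [1 / (4 X)], the errors [X^2 / (X^3 gap)] are bounded. *)
Lemma perron_theta (zeta : C -> C) : is_riemann_zeta zeta -> exists K, 0 < K /\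
  forall N, (1 <= N)%nat -> let X := INR N + / 2 in
  Cmod (vint (fun s => Efun s * kern (ln X) s)%C 2 (- X ^ 3) (X ^ 3) - RtoC (2 * PI * (theta N - X + 1))) <= K.
Proof.
intros HZ.
set (S0 := Series lmaj).
assert (HS0 : 0 <= S0) by (apply Series_nonneg; [apply lmaj_nonneg | apply ex_lmaj]).
exists (16 * S0 + 33); split; [lra|]; intros N HN X.
assert (HX : 3 / 2 <= X) by (unfold X; apply le_INR in HN; simpl in HN; lra).
set (T := X ^ 3); set (l := ln X).
assert (HT : 0 < T) by (apply pow_lt; lra).
assert (Gap : forall n, (1 <= n)%nat -> / (4 * X) <= Rabs (l - ln (INR n)) /\
  ((n <= N)%nat -> 0 < l - ln (INR n)) /\ ((N < n)%nat -> l - ln (INR n) < 0)).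
{ intros n Hn; exact (half_integer_gap N n HN Hn). }
assert (Hl0 : / (4 * X) <= l /\ 0 < l).
{ destruct (Gap 1%nat (le_n 1)) as [G1 [G2 _]]; specialize (G2 HN); change (INR 1) with 1 in G1, G2.
  rewrite ln_1, Rminus_0_r in G1, G2; rewrite Rabs_right in G1 by lra; lra. }
assert (EX : exp l = X) by (apply exp_ln; lra).
assert (EX2 : exp (2 * l) = X ^ 2) by (replace (2 * l) with (l + l) by ring; rewrite exp_plus, EX; ring).
assert (IT : / T = / X * / X * / X) by (unfold T; field; lra).
assert (PB : forall c L, 0 < c -> / (4 * X) <= Rabs L ->
  Cmod (perron c L T - RtoC (2 * PI * step L)) <= 16 * X * / T * exp (c * L)).
{ intros c L Hc HL.
  assert (P4 : 0 < / (4 * X)) by (apply Rinv_0_lt_compat; lra).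
  eapply Rle_trans; [apply perron_step; try assumption|].
  - intros ->; rewrite Rabs_R0 in HL; lra.
  - replace (16 * X * / T * exp (c * L)) with (4 * exp (c * L) * / (T * / (4 * X))) by (field; split; lra).
    apply Rmult_le_compat_l; [pose proof (exp_pos (c * L)); lra|].
    apply Rinv_le_contravar; [apply Rmult_lt_0_compat; assumption | apply Rmult_le_compat_l; lra]. }
assert (kc : forall c L t, 0 < c -> ccont (fun t => kern L (c, t)) t).
{ intros c L t Hc; apply ccont_vline, hol_ccontz, hol_kern, pair_neq_0; left; lra. }
assert (XP := fun c L Hc => cex_perron c L T Hc HT).
assert (Ecx : forall t, ccont (fun t => Efun (2, t)) t).
{ intros t; apply ccont_vline, hol_ccontz; unfold Efun.
  apply (hol_minus (fun s => - (cder Hzeta s / Hzeta s))%C Bsum).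
  - apply (hol_opp (fun s => cder Hzeta s / Hzeta s)%C), hol_div.
    + apply (Hzeta_neq_0_right zeta _ HZ); simpl; lra.
    + apply hol_cder_Hzeta; simpl; lra.
    + apply hol_Hzeta; simpl; lra.
  - apply hol_Bsum; simpl; lra. }
(* The contribution of the polar part, by partial fractions. *)
set (W := (RtoC X * perron 1 l T - perron 2 l T)%C).
assert (EW : cint (fun t => / ((2, t) - 1) * kern l (2, t))%C (- T) T = W).
{ transitivity (cint (fun t => RtoC X * kern l (1, t) - kern l (2, t))%C (- T) T).
  2:{ rewrite cint_minus, cint_scal; [reflexivity | apply XP; lra | apply cex_scal, XP; lra | apply XP; lra]. }
  apply cint_ext; intros t _; unfold kern.
  assert (E1 : ((2, t) - 1)%C = (1, t)) by (Ceq; ring).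
  assert (E2 : ((2, t) : C) = ((1, t) + 1)%C) by (Ceq; ring).
  assert (N1 : ((1, t) : C) <> 0) by (apply pair_neq_0; left; lra).
  assert (N2 : ((2, t) : C) <> 0) by (apply pair_neq_0; left; lra).
  rewrite E1.
  assert (E3 : Cexp ((2, t) * RtoC l) = (Cexp ((1, t) * RtoC l) * RtoC X)%C).
  { rewrite <- EX, <- Cexp_RtoC, <- Cexp_plus; f_equal; Ceq; ring. }
  rewrite E3; rewrite E2 in N2 |- *; field; split; assumption. }
assert (XW : cex (fun t => / ((2, t) - 1) * kern l (2, t))%C (- T) T).
{ apply cex_cont; intros t _; apply ccont_mult; [|apply kc; lra].
  apply (ccont_vline (fun z => / (z - 1))%C), (ccontz_inv (fun z => z - 1)%C).
  - replace ((2, t) - 1)%C with ((1, t) : C) by (Ceq; ring); apply pair_neq_0; left; lra.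
  - apply hol_ccontz, hol_sub_const. }
assert (XE : cex (fun t => Efun (2, t) * kern l (2, t))%C (- T) T).
{ apply cex_cont; intros t _; apply ccont_mult; [apply Ecx | apply kc; lra]. }
destruct (Mtest_uniform (fun n s => RtoC (plog n) * ppow s n)%C lmaj (fun s => Re s = 2)
  (fun n s Hs => plog_ppow_bound n s Hs) ex_lmaj (/ (X ^ 2 * (2 * T)))) as [M0 HM0].
{ apply Rinv_0_lt_compat, Rmult_lt_0_compat; [apply pow_lt|]; lra. }
set (M := max M0 (S N)).
destruct (vint_partial_sum M l T HT) as [XS ES].
set (SM := csum (fun n => RtoC (plog n) * perron 2 (l - ln (INR n)) T)%C M) in *.
assert (R1 : Cmod (vint (fun s => Efun s * kern l s)%C 2 (- T) T - (SM - W)) <= 1).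
{ rewrite <- ES, <- EW; unfold vint.
  rewrite <- cint_minus by assumption.
  rewrite <- cint_minus by (try assumption; apply cex_minus; assumption).
  eapply Rle_trans; [apply (cint_bound_const _ (/ (X ^ 2 * (2 * T)) * X ^ 2)); [lra | |]|].
  - apply cex_minus; [assumption | apply cex_minus; assumption].
  - intros t _.
    assert (EQ : cser (fun n => RtoC (plog n) * ppow (2, t) n)%C = (Efun (2, t) + / ((2, t) - 1))%C).
    { apply (tends_unique (csum (fun n => RtoC (plog n) * ppow (2, t) n)%C)).
      - apply cser_clim with lmaj; [intros; apply plog_ppow_bound; reflexivity | apply ex_lmaj].
      - apply (prime_series zeta); [assumption | reflexivity]. }
    specialize (HM0 M (2, t) ltac:(lia) eq_refl); cbv beta in HM0; rewrite EQ in HM0.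
    set (cs := csum (fun k => RtoC (plog k) * ppow (2, t) k)%C M) in *.
    replace (Efun (2, t) * kern l (2, t) - (cs * kern l (2, t) - / ((2, t) - 1) * kern l (2, t)))%C with
      (- ((cs - (Efun (2, t) + / ((2, t) - 1))) * kern l (2, t)))%C by ring.
    rewrite Cmod_opp, Cmod_mult, Cmod_kern by (apply pair_neq_0; left; lra).
    apply Rmult_le_compat; [apply Cmod_ge_0 | | assumption |].
    + apply Rmult_le_pos; [left; apply exp_pos|]; left; apply Rinv_0_lt_compat, Cmod_gt_0, pair_neq_0; left; lra.
    + rewrite EX2; rewrite <- (Rmult_1_r (X ^ 2)) at 2.
      apply Rmult_le_compat_l; [apply pow_le; lra|].
      rewrite <- Rinv_1; apply Rinv_le_contravar; [lra|].
      pose proof (re_le_Cmod (2, t)) as Q; simpl in Q; rewrite Rabs_right in Q; lra.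
  - right; field; split; lra. }
assert (R2 : Cmod (SM - RtoC (2 * PI * theta N)) <= 16 * S0).
{ rewrite <- (csum_theta M N l).
  2:{ unfold M; lia. }
  2:{ intros n Hn Hn'; apply (Gap n Hn), Hn'. }
  2:{ intros n Hn Hn'; apply (Gap n Hn), Hn'. }
  unfold SM; rewrite csum_minus.
  replace (16 * S0) with (Series (fun n => 16 * lmaj n)) by (unfold S0; apply Series_scal_l).
  apply Cmod_csum_le.
  - intros n; pose proof (lmaj_nonneg n); lra.
  - apply (ex_series_scal (V := R_NormedModule)), ex_lmaj.
  - intros n.
    replace (RtoC (plog n) * perron 2 (l - ln (INR n)) T - RtoC (plog n) * RtoC (2 * PI * step (l - ln (INR n))))%C
      with (RtoC (plog n) * (perron 2 (l - ln (INR n)) T - RtoC (2 * PI * step (l - ln (INR n)))))%C by ring.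
    rewrite Cmod_mult, Cmod_R, Rabs_right by (apply Rle_ge, plog_nonneg).
    destruct (Nat.eq_dec n 0) as [-> | Nn].
    { unfold plog; change (isprime 0) with false; rewrite Rmult_0_l; pose proof (lmaj_nonneg 0); lra. }
    apply Rle_trans with (plog n * (16 * Rpower (INR n) (- (2)))).
    + apply Rmult_le_compat_l; [apply plog_nonneg|].
      eapply Rle_trans; [apply PB; [lra | apply Gap; lia]|].
      right; unfold Rpower.
      replace (2 * (l - ln (INR n))) with (2 * l + - (2) * ln (INR n)) by ring.
      rewrite exp_plus, EX2, IT; field; lra.
    + pose proof (lmaj_bound n); lra. }
assert (Sl : step l = 1) by (unfold step; destruct (Rlt_dec 0 l); [reflexivity | lra]).
assert (R3 : Cmod (W - RtoC (2 * PI * (X - 1))) <= 32).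
{ assert (A1 := PB 1 l ltac:(lra) ltac:(rewrite Rabs_right; lra)).
  assert (A2 := PB 2 l ltac:(lra) ltac:(rewrite Rabs_right; lra)).
  rewrite Sl, Rmult_1_r in A1, A2; rewrite Rmult_1_l, EX in A1; rewrite EX2 in A2.
  unfold W; replace (RtoC X * perron 1 l T - perron 2 l T - RtoC (2 * PI * (X - 1)))%C with
    (RtoC X * (perron 1 l T - RtoC (2 * PI)) - (perron 2 l T - RtoC (2 * PI)))%C by (Ceq; ring).
  eapply Rle_trans; [apply Cmod_triangle_minus|].
  rewrite Cmod_mult, Cmod_R, Rabs_right by lra.
  assert (X * Cmod (perron 1 l T - RtoC (2 * PI)) <= X * (16 * X * / T * X)) by (apply Rmult_le_compat_l; lra).
  assert (X * (16 * X * / T * X) = 16) by (rewrite IT; field; lra).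
  assert (16 * X * / T * X ^ 2 = 16) by (rewrite IT; field; lra).
  lra. }
match goal with |- Cmod ?u <= _ => replace u with
 ((vint (fun s => Efun s * kern l s)%C 2 (- T) T - (SM - W)) + ((SM - RtoC (2 * PI * theta N)) -
   (W - RtoC (2 * PI * (X - 1)))))%C end.
2:{ unfold T, l; replace (RtoC (2 * PI * (theta N - X + 1))) with (RtoC (2 * PI * theta N) - RtoC (2 * PI * (X - 1)))%C
     by (rewrite <- RtoC_minus; f_equal; ring); ring. }
eapply Rle_trans; [apply Cmod_triangle|].
pose proof (Cmod_triangle_minus (SM - RtoC (2 * PI * theta N)) (W - RtoC (2 * PI * (X - 1)))); lra.
Qed.

(** The integral of [1 / (a + |t|)]. *)
Lemma vint_log_bound (f : R -> C) (A a T : R) : 0 < a -> 0 < T -> 0 <= A ->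
  (forall t, ccont f t) -> (forall t, Rabs t <= T -> Cmod (f t) <= A / (a + Rabs t)) ->
  Cmod (cint f (- T) T) <= 2 * A * ln ((a + T) / a).
Proof.
intros Ha HT HA Hc Hb.
assert (X : forall u v, cex f u v) by (intros; apply cex_cont; intros; apply Hc).
rewrite <- (cint_Chasles f (- T) 0 T) by apply X.
eapply Rle_trans; [apply Cmod_triangle|].
assert (B1 : Cmod (cint f (- T) 0) <= A * ln ((a + T) / a)).
{ replace (A * ln ((a + T) / a)) with (RInt (fun t => A / (a - t)) (- T) 0).
  - apply cint_bound; [lra | apply X | |].
    + apply (ex_RInt_continuous (V := R_CompleteNormedModule)); rewrite Rmin_left, Rmax_right by lra; intros t Ht.
      apply (ex_derive_continuous (V := R_NormedModule)); auto_derive; lra.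
    + intros t Ht; specialize (Hb t); rewrite Rabs_left1 in Hb by lra.
      replace (a - t) with (a + - t) by ring; apply Hb; lra.
  - apply is_RInt_unique; evar_last.
    + apply (is_RInt_derive (fun t => - A * ln (a - t)) (fun t => A / (a - t)));
      rewrite Rmin_left, Rmax_right by lra; intros t Ht.
      * auto_derive; [lra | field; lra].
      * apply (ex_derive_continuous (V := R_NormedModule)); auto_derive; lra.
    + unfold minus, plus, opp; simpl; rewrite ln_div by lra.
      rewrite Rminus_0_r; replace (a - - T) with (a + T) by ring; ring. }
assert (B2 : Cmod (cint f 0 T) <= A * ln ((a + T) / a)).
{ replace (A * ln ((a + T) / a)) with (RInt (fun t => A / (a + t)) 0 T).
  - apply cint_bound; [lra | apply X | |].
    + apply (ex_RInt_continuous (V := R_CompleteNormedModule)); rewrite Rmin_left, Rmax_right by lra; intros t Ht.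
      apply (ex_derive_continuous (V := R_NormedModule)); auto_derive; lra.
    + intros t Ht; specialize (Hb t); rewrite Rabs_right in Hb by lra; apply Hb; lra.
  - apply is_RInt_unique; evar_last.
    + apply (is_RInt_derive (fun t => A * ln (a + t)) (fun t => A / (a + t)));
      rewrite Rmin_left, Rmax_right by lra; intros t Ht.
      * auto_derive; [lra | field; lra].
      * apply (ex_derive_continuous (V := R_NormedModule)); auto_derive; lra.
    + unfold minus, plus, opp; simpl; rewrite ln_div by lra.
      rewrite Rplus_0_r; ring. }
lra.
Qed.

(** On the line [Re s = a] the integrand of [perron_theta] is [O(X^a log X / |s|)], and no
    singularity lies between this line and that of real part [2]: the zeros of [zeta] are
    excluded and the pole at [1] was split off. *)
Lemma theta_bound (zeta : C -> C) (b : R) : is_riemann_zeta zeta -> riemann_hypothesis zeta ->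
  1 / 2 < b -> exists K, 0 < K /\ forall N, (1 <= N)%nat -> Rabs (theta N - INR N) <= K * Rpower (INR N) b.
Proof.
intros HZ RH Hb.
(* Any abscissa with [1/2 < a < min b 1]; the gap [b - a] pays for the two logarithms. *)
set (a := (1 / 2 + Rmin b 1) / 2).
assert (Ha : 1 / 2 < a < b /\ a < 1).
{ unfold a; pose proof (Rmin_l b 1); pose proof (Rmin_r b 1).
  assert (1 / 2 < Rmin b 1) by (apply Rmin_glb_lt; lra); lra. }
destruct (Efun_bound zeta a HZ RH ltac:(lra)) as [K1 [HK1 BE]].
destruct (perron_theta zeta HZ) as [K2 [HK2 BP]].
set (d := (b - a) / 2).
assert (Hd : 0 < d) by (unfold d; lra).
set (K3 := 3 * K1 * (4 * / b + 24 * (/ d * / d)) + K2 + 1).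
assert (Ib : 0 < / b) by (apply Rinv_0_lt_compat; lra).
assert (Id : 0 < / d) by (apply Rinv_0_lt_compat; lra).
assert (HK3 : 0 < K3).
{ unfold K3; assert (0 < / d * / d) by (apply Rmult_lt_0_compat; assumption).
  assert (0 < 3 * K1 * (4 * / b + 24 * (/ d * / d))) by (apply Rmult_lt_0_compat; lra); lra. }
exists (K3 * Rpower 2 b); split; [apply Rmult_lt_0_compat; [assumption | apply exp_pos]|].
intros N HN; specialize (BP N HN); cbv zeta in BP.
set (X := INR N + / 2) in *.
assert (HN1 : 1 <= INR N) by (apply le_INR in HN; exact HN).
assert (HX : 3 / 2 <= X) by (unfold X; lra).
set (T := X ^ 3) in *; set (l := ln X) in *.
assert (HT3 : 27 / 8 <= T).
{ unfold T; replace (27 / 8) with ((3 / 2) ^ 3) by field; apply pow_incr; lra. }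
assert (Hl : 0 < l) by (unfold l; rewrite <- ln_1; apply ln_increasing; lra).
assert (LT : ln T = 3 * l).
{ unfold T, l; simpl; rewrite Rmult_1_r, !ln_mult by nra; ring. }
assert (EX : exp l = X) by (apply exp_ln; lra).
set (Phi := fun s => (Efun s * kern l s)%C).
assert (HP : forall x y, a <= x -> hol Phi (x, y)).
{ intros x y Hx; apply hol_mult; [apply (hol_Efun zeta); try assumption; simpl; lra|].
  apply hol_kern, pair_neq_0; left; lra. }
assert (G : rect Phi a 2 (- T) T = 0) by (apply goursat; [lra | lra | intros; apply HP; lra]).
assert (BPhi : forall x y, a <= x <= 2 -> Rabs y <= T ->
  Cmod (Phi (x, y)) <= K1 * ln T * (exp (x * l) / Cmod (x, y))).
{ intros x y Hx Hy; unfold Phi; rewrite Cmod_mult, Cmod_kern by (apply pair_neq_0; left; lra).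
  apply Rmult_le_compat_r.
  - apply Rmult_le_pos; [left; apply exp_pos|]; left; apply Rinv_0_lt_compat, Cmod_gt_0, pair_neq_0; left; lra.
  - apply BE; simpl; lra. }
assert (LT0 : 0 < ln T) by lra.
assert (Bh : forall y, Rabs y = T -> Cmod (hint Phi a 2 y) <= K1 * ln T * 2).
{ intros y Hy; eapply Rle_trans; [apply (cint_bound_const _ (K1 * ln T * 1)); [lra | |]|].
  - apply cex_cont_le; [lra|]; intros; apply ccont_hline, hol_ccontz, HP; lra.
  - intros x Hx; eapply Rle_trans; [apply BPhi; lra|].
    apply Rmult_le_compat_l; [left; apply Rmult_lt_0_compat; assumption|].
    assert (Q : exp (x * l) <= X ^ 2).
    { replace (X ^ 2) with (exp (2 * l)) by (replace (2 * l) with (l + l) by ring; rewrite exp_plus, EX; ring).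
      destruct (Req_dec x 2) as [-> | Nx]; [lra|]; left; apply exp_increasing; nra. }
    assert (Q2 : T <= Cmod (x, y)) by (rewrite <- Hy; apply (im_le_Cmod (x, y))).
    apply Rmult_le_reg_r with (Cmod (x, y)); [lra|].
    replace (exp (x * l) / Cmod (x, y) * Cmod (x, y)) with (exp (x * l)) by (field; lra).
    assert (X ^ 2 <= T) by (unfold T; simpl; nra). lra.
  - assert (0 < K1 * ln T) by (apply Rmult_lt_0_compat; assumption); nra. }
assert (Exa : exp (a * l) = Rpower X a) by reflexivity.
assert (Bv : Cmod (vint Phi a (- T) T) <= 2 * (K1 * ln T * Rpower X a * 2) * ln ((a + T) / a)).
{ apply (vint_log_bound (fun t => Phi (a, t))); try lra.
  - pose proof (Rpower_pos X a).
    apply Rmult_le_pos; [|lra]; left; repeat apply Rmult_lt_0_compat; assumption.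
  - intros t; apply ccont_vline, hol_ccontz, HP; lra.
  - intros t Ht; eapply Rle_trans; [apply BPhi; lra|]; rewrite Exa.
    pose proof (Rpower_pos X a); pose proof (Rabs_pos t).
    assert (Q : (a + Rabs t) / 2 <= Cmod (a, t)).
    { pose proof (re_le_Cmod (a, t)) as Q1; pose proof (im_le_Cmod (a, t)) as Q2; simpl in Q1, Q2.
      rewrite Rabs_right in Q1 by lra; lra. }
    replace (K1 * ln T * Rpower X a * 2 / (a + Rabs t)) with (K1 * ln T * (Rpower X a / ((a + Rabs t) / 2))) by (field; lra).
    apply Rmult_le_compat_l; [left; apply Rmult_lt_0_compat; assumption|].
    apply Rmult_le_compat_l; [lra|]; apply Rinv_le_contravar; lra. }
assert (Llog : ln ((a + T) / a) <= 6 * l).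
{ replace (6 * l) with (ln (T * T)) by (rewrite ln_mult by lra; lra).
  apply ln_le; [apply Rdiv_lt_0_compat; lra|].
  apply Rmult_le_reg_r with a; [lra|].
  replace ((a + T) / a * a) with (a + T) by (field; lra).
  assert (T * T * (1 / 2) <= T * T * a) by (apply Rmult_le_compat_l; nra).
  nra. }
assert (E2 : Cmod (vint Phi 2 (- T) T) <= K1 * ln T * 4 + 2 * (K1 * ln T * Rpower X a * 2) * (6 * l)).
{ unfold rect in G; rewrite <- Cmod_Ci_mult.
  replace (Ci * vint Phi 2 (- T) T)%C with (Ci * vint Phi a (- T) T - (hint Phi a 2 (- T) - hint Phi a 2 T))%C.
  - eapply Rle_trans; [apply Cmod_triangle_minus|]; rewrite Cmod_Ci_mult.
    pose proof (Cmod_triangle_minus (hint Phi a 2 (- T)) (hint Phi a 2 T)).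
    pose proof (Bh (- T) ltac:(rewrite Rabs_Ropp, Rabs_right; lra)); pose proof (Bh T ltac:(rewrite Rabs_right; lra)).
    assert (2 * (K1 * ln T * Rpower X a * 2) * ln ((a + T) / a) <= 2 * (K1 * ln T * Rpower X a * 2) * (6 * l)).
    { apply Rmult_le_compat_l; [|assumption]; pose proof (Rpower_pos X a).
      assert (0 < K1 * ln T * Rpower X a) by (repeat apply Rmult_lt_0_compat; assumption); lra. }
    lra.
  - transitivity (Ci * vint Phi a (- T) T - (hint Phi a 2 (- T) - hint Phi a 2 T) +
      (hint Phi a 2 (- T) - hint Phi a 2 T + Ci * (vint Phi 2 (- T) T - vint Phi a (- T) T)))%C; [rewrite G; ring | ring]. }
rewrite LT in E2.
assert (L1 : l <= / b * Rpower X b) by (apply ln_le_Rpower; lra).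
assert (L2 : l <= / d * Rpower X d) by (apply ln_le_Rpower; lra).
assert (L3 : Rpower X a * (l * l) <= / d * / d * Rpower X b).
{ replace (/ d * / d * Rpower X b) with (Rpower X a * ((/ d * Rpower X d) * (/ d * Rpower X d))).
  - apply Rmult_le_compat_l; [left; apply exp_pos|]; apply Rmult_le_compat; lra.
  - assert (Eb : Rpower X b = Rpower X a * Rpower X d * Rpower X d)
      by (rewrite <- !Rpower_plus; f_equal; unfold d; field).
    rewrite Eb; ring. }
assert (L4 : 1 <= Rpower X b).
{ rewrite <- (Rpower_O X) by lra; apply Rpower_le_exp; lra. }
assert (F : 2 * PI * Rabs (theta N - X + 1) <= 3 * K1 * (4 * / b + 24 * (/ d * / d)) * Rpower X b + K2).
{ pose proof (Cmod_triangle_rev (RtoC (2 * PI * (theta N - X + 1))) (vint Phi 2 (- T) T)) as TR.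
  rewrite Cmod_minus_sym in TR.
  change (vint (fun s => (Efun s * kern l s)%C) 2 (- T) T) with (vint Phi 2 (- T) T) in BP.
  rewrite Cmod_R, Rabs_mult, (Rabs_right (2 * PI)) in TR by (pose proof two_PI_pos; lra).
  assert (K1 * (3 * l) * 4 <= 3 * K1 * (4 * / b) * Rpower X b) by nra.
  assert (2 * (K1 * (3 * l) * Rpower X a * 2) * (6 * l) <= 3 * K1 * (24 * (/ d * / d)) * Rpower X b).
  { replace (2 * (K1 * (3 * l) * Rpower X a * 2) * (6 * l)) with (72 * K1 * (Rpower X a * (l * l))) by ring.
    replace (3 * K1 * (24 * (/ d * / d)) * Rpower X b) with (72 * K1 * (/ d * / d * Rpower X b)) by ring.
    apply Rmult_le_compat_l; lra. }
  lra. }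
assert (P1 : 1 <= 2 * PI) by (pose proof PI2_1; lra).
assert (F2 : Rabs (theta N - X + 1) <= 2 * PI * Rabs (theta N - X + 1)) by (pose proof (Rabs_pos (theta N - X + 1)); nra).
assert (F3 : Rabs (theta N - INR N) <= Rabs (theta N - X + 1) + 1).
{ replace (theta N - INR N) with ((theta N - X + 1) + (- / 2)) by (unfold X; field).
  eapply Rle_trans; [apply Rabs_triang|]; rewrite (Rabs_left (- / 2)) by lra; lra. }
assert (F4 : Rabs (theta N - INR N) <= K3 * Rpower X b) by (unfold K3; nra).
eapply Rle_trans; [exact F4|]; rewrite Rmult_assoc; apply Rmult_le_compat_l; [lra|].
rewrite Rpower_mult_distr by lra; apply Rle_Rpower_l; [lra | unfold X; lra].
Qed.

(** * The exponential integral *)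

Lemma oint_True : oint (fun _ => True).
Proof. split; [intros; exists 1; split; [lra | trivial] | trivial]. Qed.

Lemma oint_gt (a : R) : oint (fun x => a < x).
Proof.
split; [|intros; lra]; intros x Hx; exists (x - a); split; [lra|]; intros y Hy.
apply Rabs_def2 in Hy; lra.
Qed.

Lemma oint_lt (a : R) : oint (fun x => x < a).
Proof.
split; [|intros; lra]; intros x Hx; exists (a - x); split; [lra|]; intros y Hy.
apply Rabs_def2 in Hy; lra.
Qed.

Lemma hol_primitive (f : C -> C) (P Q : R -> Prop) : oint P -> oint Q ->
  (forall z, dom P Q z -> hol f z) -> exists F, forall z, dom P Q z -> is_cderiv F z (f z).
Proof.
intros OP OQ H.
assert (HC : forall z, dom P Q z -> ccontz f z) by (intros; apply hol_ccontz; auto).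
apply primitive_exists; try assumption.
apply rects_vanish_hol with (RtoC 0); auto.
Qed.

Lemma Ein_exists : exists F, forall z, is_cderiv F z (expm1_div (- z)).
Proof.
destruct (hol_primitive (fun z => expm1_div (- z)) (fun _ => True) (fun _ => True)) as [F HF];
 try apply oint_True.
- intros z _; apply (hol_comp (fun z => - z)%C expm1_div); [apply hol_opp, hol_id | apply hol_expm1_div].
- exists F; intros z; apply HF; split; trivial.
Qed.

(** The entire primitive of [(1 - e^(-z)) / z] up to an additive constant, which
    [E1_const] absorbs. *)
Definition Ein : C -> C := proj1_sig (constructive_indefinite_description _ Ein_exists).

Lemma is_cderiv_Ein (z : C) : is_cderiv Ein z (expm1_div (- z)).
Proof. exact (proj2_sig (constructive_indefinite_description _ Ein_exists) z). Qed.

Lemma hol_Ein (z : C) : hol Ein z.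
Proof. eexists; apply is_cderiv_Ein. Qed.

Lemma expm1_div_opp (z : C) : (expm1_div (- z) * z)%C = (1 - Cexp (- z))%C.
Proof.
transitivity (- (expm1_div (- z) * (- z)))%C; [ring | rewrite expm1_div_mult; ring].
Qed.

(** The function [e^(E1 z)] up to a multiplicative constant, in a form that makes sense on
    the cut: both are solutions of [y' = - qE y]. *)
Definition expE (z : C) : C := (Cexp (Ein z) / z)%C.
Definition qE (z : C) : C := (Cexp (- z) / z)%C.

Lemma hol_qE (z : C) : z <> 0 -> hol qE z.
Proof.
intros N; apply hol_div; [assumption | | apply hol_id].
apply (hol_comp (fun z => - z)%C Cexp); [apply hol_opp, hol_id | apply hol_Cexp].
Qed.

Lemma is_cderiv_expE (z : C) : z <> 0 -> is_cderiv expE z (- (qE z * expE z))%C.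
Proof.
intros N.
assert (K : is_cderiv expE z (Cexp (Ein z) * expm1_div (- z) * / z + Cexp (Ein z) * (- (1) / (z * z)))%C).
{ apply (is_cderiv_mult (fun z => Cexp (Ein z)) (fun z => / z)%C).
  - apply (is_cderiv_comp Ein Cexp); [apply is_cderiv_Ein | apply is_cderiv_Cexp].
  - apply (is_cderiv_inv (fun z => z)); [assumption | apply is_cderiv_id]. }
replace (- (qE z * expE z))%C with
 (Cexp (Ein z) * expm1_div (- z) * / z + Cexp (Ein z) * (- (1) / (z * z)))%C; [exact K|].
transitivity (Cexp (Ein z) * ((expm1_div (- z) * z - 1) / (z * z)))%C; [field; assumption|].
rewrite expm1_div_opp; unfold qE, expE; field; assumption.
Qed.

Lemma expE_neq_0 (z : C) : z <> 0 -> expE z <> 0.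
Proof.
intros N; unfold expE, Cdiv; apply Cmult_neq_0; [apply Cexp_neq_0|].
intros E; apply C1_nz; rewrite <- (Cinv_r z N), E; ring.
Qed.

(** Since [expE e^F] has derivative zero for every primitive [F] of [qE]. *)
Lemma expE_primitive (P Q : R -> Prop) : oint P -> oint Q -> (forall z, dom P Q z -> z <> 0) ->
  exists F, (forall z, dom P Q z -> is_cderiv F z (qE z)) /\
  forall z w, dom P Q z -> dom P Q w -> (expE w * Cexp (F w - F z))%C = expE z.
Proof.
intros OP OQ N.
destruct (hol_primitive qE P Q OP OQ) as [F HF]; [intros; apply hol_qE; auto|].
exists F; split; [exact HF|]; intros z w Hz Hw.
assert (E : (expE w * Cexp (F w))%C = (expE z * Cexp (F z))%C).
{ apply (cderiv_zero_const (fun w => expE w * Cexp (F w))%C P Q); try assumption.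
  intros u Hu.
  assert (K : is_cderiv (fun w => expE w * Cexp (F w))%C u (- (qE u * expE u) * Cexp (F u) + expE u * (Cexp (F u) * qE u))%C).
  { apply (is_cderiv_mult expE (fun w => Cexp (F w))); [apply is_cderiv_expE; auto|].
    apply (is_cderiv_comp F Cexp); [auto | apply is_cderiv_Cexp]. }
  replace (- (qE u * expE u) * Cexp (F u) + expE u * (Cexp (F u) * qE u))%C with (RtoC 0) in K by ring; exact K. }
unfold Cminus; rewrite Cexp_plus, Cexp_opp, Cmult_assoc, E; field; apply Cexp_neq_0.
Qed.

(** The ray from [z] to the right lies in the upper, the lower or the right half-plane. *)
Lemma off_cut_domain (z : C) : ~ E1_cut z -> exists P Q, oint P /\ oint Q /\
  (forall w, dom P Q w -> w <> 0) /\ forall u, 0 <= u -> dom P Q (z + RtoC u)%C.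
Proof.
intros H.
assert (Er : forall u, Re (z + RtoC u) = Re z + u) by reflexivity.
assert (Ei : forall u, Im (z + RtoC u) = Im z) by (intros; unfold Im; simpl; ring).
destruct (Rtotal_order (Im z) 0) as [L | [E | G]].
- exists (fun _ => True), (fun y => y < 0); repeat split; try apply oint_True; try apply oint_lt.
  + intros w [_ Hw] ->; simpl in Hw; lra.
  + rewrite Ei; assumption.
- assert (0 < Re z) by (apply Rnot_le_lt; intros K; apply H; split; assumption).
  exists (fun x => 0 < x), (fun _ => True); repeat split; try apply oint_True; try apply oint_gt.
  + intros w [Hw _] ->; simpl in Hw; lra.
  + rewrite Er; lra.
- exists (fun _ => True), (fun y => 0 < y); repeat split; try apply oint_True; try apply oint_gt.
  + intros w [_ Hw] ->; simpl in Hw; lra.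
  + rewrite Ei; lra.
Qed.

Lemma off_cut_distance (z : C) : ~ E1_cut z -> exists m, 0 < m /\ forall u, 0 <= u -> m <= Cmod (z + RtoC u).
Proof.
intros H; destruct (Req_dec (Im z) 0) as [E | N].
- assert (0 < Re z) by (apply Rnot_le_lt; intros K; apply H; split; assumption).
  exists (Re z); split; [assumption|]; intros u Hu.
  eapply Rle_trans; [|apply re_le_Cmod]; eapply Rle_trans; [|apply Rle_abs].
  change (Re z <= Re z + u); lra.
- exists (Rabs (Im z)); split; [apply Rabs_pos_lt, N|]; intros u Hu.
  eapply Rle_trans; [|apply im_le_Cmod]; right; f_equal; unfold Im; simpl; ring.
Qed.

(** The integral defining [E1 z], cut off at [u]. *)
Definition ray (z : C) (u : R) : C := cint (fun t => qE (z + RtoC t)) 0 u.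

Lemma rder_ray_path (z : C) (u : R) : rder (fun u => z + RtoC u)%C u 1.
Proof.
assert (K : rder (fun u => z + RtoC u)%C u (0 + 1)%C).
{ apply (rder_plus (fun _ => z) (fun u => RtoC u)); [apply rder_const|].
  apply (rder_RtoC (fun u => u)), (is_derive_id (K := R_AbsRing)). }
replace (0 + 1)%C with (RtoC 1) in K by ring; exact K.
Qed.

Lemma ccont_ray (z : C) (t : R) : ~ E1_cut z -> 0 <= t -> ccont (fun t => qE (z + RtoC t)) t.
Proof.
intros H Ht; apply (ccontz_path qE (fun t => z + RtoC t)%C); [|eapply rder_ccont, rder_ray_path].
apply hol_ccontz, hol_qE; destruct (off_cut_distance z H) as [m [Hm B]].
apply Cmod_gt_0; specialize (B t Ht); lra.
Qed.

(** Along the ray a primitive of [qE] is available, so that [expE_primitive] compares the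
    values of [expE] at the two ends. *)
Lemma expE_ray (z : C) (u : R) : ~ E1_cut z -> 0 <= u -> (expE (z + RtoC u) * Cexp (ray z u))%C = expE z.
Proof.
intros H Hu.
destruct (off_cut_domain z H) as [P [Q [OP [OQ [N D]]]]].
destruct (expE_primitive P Q OP OQ N) as [F [HF EF]].
assert (E : ray z u = (F (z + RtoC u) - F (z + RtoC 0))%C).
{ apply (cint_FTC (fun t => F (z + RtoC t)%C)); rewrite Rmin_left, Rmax_right by lra; intros t Ht.
  - replace (qE (z + RtoC t)) with (qE (z + RtoC t) * 1)%C by ring.
    apply (rder_path F (fun t => z + RtoC t)%C); [apply HF, D; lra | apply rder_ray_path].
  - apply ccont_ray; [assumption | lra]. }
replace (z + RtoC 0)%C with z in E by ring.
rewrite E; apply EF; [|apply D, Hu].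
replace z with (z + RtoC 0)%C by ring; apply D; lra.
Qed.

(** The integrand is [O(e^(-t))], as the ray keeps a positive distance from [0]. *)
Lemma ray_cauchy (z : C) : ~ E1_cut z -> exists K, 0 < K /\ forall u v, 0 <= u <= v ->
  Cmod (ray z v - ray z u) <= K * exp (- u).
Proof.
intros H; destruct (off_cut_distance z H) as [m [Hm B]].
exists (exp (- Re z) / m); split; [apply Rdiv_lt_0_compat; [apply exp_pos | assumption]|].
intros u v Huv.
assert (X : forall a b, 0 <= a <= b -> cex (fun t => qE (z + RtoC t)) a b).
{ intros a b Hab; apply cex_cont_le; [lra|]; intros t Ht; apply ccont_ray; [assumption | lra]. }
unfold ray; rewrite <- (cint_Chasles _ 0 u v) by (apply X; lra).
replace (cint (fun t => qE (z + RtoC t)) 0 u + cint (fun t => qE (z + RtoC t)) u v -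
  cint (fun t => qE (z + RtoC t)) 0 u)%C with (cint (fun t => qE (z + RtoC t)) u v) by ring.
eapply Rle_trans; [apply (cint_bound _ (fun t => exp (- Re z) / m * exp (- t))); [lra | apply X; lra | |]|].
- apply (ex_RInt_continuous (V := R_CompleteNormedModule)); intros t _.
  apply (ex_derive_continuous (V := R_NormedModule)); auto_derive; trivial.
- intros t Ht; unfold qE.
  assert (N : (z + RtoC t)%C <> 0) by (apply Cmod_gt_0; specialize (B t ltac:(lra)); lra).
  rewrite Cmod_div, Cmod_Cexp by assumption.
  replace (Re (- (z + RtoC t))) with (- Re z + - t) by (simpl; unfold Re; ring).
  rewrite exp_plus.
  replace (exp (- Re z) / m * exp (- t)) with (exp (- Re z) * exp (- t) * / m) by (unfold Rdiv; ring).
  apply Rmult_le_compat_l; [left; apply Rmult_lt_0_compat; apply exp_pos|].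
  apply Rinv_le_contravar; [assumption | apply B; lra].
- rewrite (is_RInt_unique _ _ _ (exp (- Re z) / m * (exp (- u) - exp (- v)))).
  + apply Rmult_le_compat_l; [left; apply Rdiv_lt_0_compat; [apply exp_pos | assumption]|].
    pose proof (exp_pos (- v)); lra.
  + evar_last.
    * apply (is_RInt_derive (fun t => - (exp (- Re z) / m) * exp (- t)) (fun t => exp (- Re z) / m * exp (- t))).
      -- intros t _; auto_derive; [trivial | ring].
      -- intros t _; apply (ex_derive_continuous (V := R_NormedModule)); auto_derive; trivial.
    * unfold minus, plus, opp; simpl; ring.
Qed.

(** A neighbourhood filter of plus infinity, in the form in which thresholds are produced. *)
Definition far (P : R -> Prop) : Prop := exists U, forall u, U <= u -> P u.

Global Instance far_filter : ProperFilter far.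
Proof.
constructor; [intros P [U H]; exists U; apply H; lra|].
constructor.
- exists 0; trivial.
- intros P Q [U H] [V K]; exists (Rmax U V); intros u Hu.
  pose proof (Rmax_l U V); pose proof (Rmax_r U V); split; [apply H | apply K]; lra.
- intros P Q PQ [U H]; exists U; auto.
Qed.

Definition ilim : (R -> C) -> C -> Prop := tends far.

Lemma exp_opp_small (e : R) : 0 < e -> exists U, 0 <= U /\ forall u, U <= u -> exp (- u) <= e.
Proof.
intros He; exists (Rmax 0 (- ln e)); split; [apply Rmax_l|]; intros u Hu.
pose proof (Rmax_r 0 (- ln e)).
rewrite <- (exp_ln e He); destruct (Req_dec (- u) (ln e)) as [-> | N]; [lra|].
left; apply exp_increasing; lra.
Qed.

Lemma cauchy_ilim (f : R -> C) (K : R) : 0 < K ->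
  (forall u v, 0 <= u <= v -> Cmod (f v - f u) <= K * exp (- u)) -> exists l, ilim f l.
Proof.
intros HK H.
assert (R1 : forall g : R -> R, (forall u v, 0 <= u <= v -> Rabs (g v - g u) <= K * exp (- u)) ->
  exists l, forall e, 0 < e -> exists U, forall u, U <= u -> Rabs (g u - l) <= e).
{ intros g Hg.
  assert (L : exists l, filterlim g (Rbar_locally p_infty) (locally (T := R_CompleteSpace) l)).
  { apply (proj1 (filterlim_locally_cauchy (U := R_CompleteSpace) (F := Rbar_locally p_infty) g)).
    intros eps; destruct (exp_opp_small (eps / (2 * K))) as [U [HU B]].
    { apply Rdiv_lt_0_compat; [apply cond_pos | lra]. }
    exists (fun u => U < u); split; [exists U; trivial|].
    assert (C0 : forall u v, U < u -> u <= v -> Rabs (g v - g u) < eps).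
    { intros u v Hu Hv; eapply Rle_lt_trans; [apply Hg; lra|].
      apply Rle_lt_trans with (K * (eps / (2 * K))); [apply Rmult_le_compat_l; [lra | apply B; lra]|].
      replace (K * (eps / (2 * K))) with (eps / 2) by (field; lra); pose proof (cond_pos eps); lra. }
    intros u v Hu Hv; change (Rabs (g v - g u) < eps).
    destruct (Rle_dec u v); [apply C0; lra | rewrite Rabs_minus_sym; apply C0; lra]. }
  destruct L as [l Hl]; exists l; intros e He.
  destruct (proj1 (filterlim_locally g l) Hl (mkposreal e He)) as [U HU].
  exists (U + 1); intros u Hu; left; apply (HU u); lra. }
destruct (R1 (fun u => Re (f u))) as [a Ha].
{ intros u v Huv; eapply Rle_trans; [apply (re_le_Cmod (f v - f u)) | auto]. }
destruct (R1 (fun u => Im (f u))) as [b Hb].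
{ intros u v Huv; eapply Rle_trans; [apply (im_le_Cmod (f v - f u)) | auto]. }
exists (a, b); intros e He.
destruct (Ha (e / 2) ltac:(lra)) as [U1 H1]; destruct (Hb (e / 2) ltac:(lra)) as [U2 H2].
exists (Rmax U1 U2); intros u Hu; pose proof (Rmax_l U1 U2); pose proof (Rmax_r U1 U2).
eapply Rle_trans; [apply Cmod_le_Re_Im|].
change (Rabs (Re (f u) - a) + Rabs (Im (f u) - b) <= e).
specialize (H1 u ltac:(lra)); specialize (H2 u ltac:(lra)); lra.
Qed.

Lemma E1_ray (z l : C) : ~ E1_cut z -> ilim (ray z) l -> Defs.E1 z = l.
Proof.
intros H L; unfold Defs.E1; apply (is_RInt_gen_unique (V := C_R_CompleteNormedModule)).
intros P [eps HP].
destruct (L (eps / 2)) as [U HU]; [pose proof (cond_pos eps); lra|].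
apply Filter_prod with (fun a => a = 0) (fun b => Rmax U 0 < b).
- reflexivity.
- exists (Rmax U 0); trivial.
- intros a b -> Hb; pose proof (Rmax_l U 0); pose proof (Rmax_r U 0).
  exists (ray z b); split.
  + assert (X : cex (fun t => qE (z + RtoC t)) 0 b).
    { apply cex_cont_le; [lra|]; intros t Ht; apply ccont_ray; [assumption | lra]. }
    destruct X as [X1 X2].
    apply (is_RInt_fct_extend_pair (U := R_NormedModule) (V := R_NormedModule)
      (fun u => (Cexp (- (z + RtoC u)) / (z + RtoC u))%C) 0 b
      (RInt (fun t => Re (qE (z + RtoC t)%C)) 0 b) (RInt (fun t => Im (qE (z + RtoC t)%C)) 0 b)).
    * apply (RInt_correct (V := R_CompleteNormedModule) (fun t => Re (qE (z + RtoC t)%C))); exact X1.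
    * apply (RInt_correct (V := R_CompleteNormedModule) (fun t => Im (qE (z + RtoC t)%C))); exact X2.
  + apply HP; specialize (HU b ltac:(lra)); pose proof (cond_pos eps).
    split; [change (Rabs (Re (ray z b) - Re l) < eps) | change (Rabs (Im (ray z b) - Im l) < eps)].
    * eapply Rle_lt_trans; [apply (re_le_Cmod (ray z b - l)) | lra].
    * eapply Rle_lt_trans; [apply (im_le_Cmod (ray z b - l)) | lra].
Qed.

(** The limit exists along the positive axis because [ray] converges there. A vertical
    displacement [y] at abscissa [x] changes a primitive of [qE] by [O(|y| e^(-x))], which yields
    the same limit on all curves along which this is small; horizontal rays and the rays
    through the origin in the right half-plane are such curves. *)
Lemma expE_limit : exists k : C, k <> 0 /\ forall e, 0 < e -> exists U h, 1 <= U /\ 0 < h /\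
  forall x y, U <= x -> Rabs y * exp (- x) <= h -> Cmod (expE (x, y) - k) <= e.
Proof.
assert (C1 : ~ E1_cut 1) by (intros [_ H]; simpl in H; lra).
destruct (ray_cauchy 1 C1) as [K [HK BK]].
destruct (cauchy_ilim (ray 1) K HK BK) as [l Hl].
set (k := (expE 1 * Cexp (- l))%C).
assert (Hk : k <> 0) by (apply Cmult_neq_0; [apply expE_neq_0, C1_nz | apply Cexp_neq_0]).
exists k; split; [assumption|].
assert (L1 : ilim (fun u => expE (1 + RtoC u)) k).
{ apply tends_ext_near with (fun u => expE 1 * Cexp (- ray 1 u))%C.
  - exists 0; intros u Hu; rewrite <- (expE_ray 1 u C1 Hu), Cexp_opp; field; apply Cexp_neq_0.
  - apply tends_mult; [apply tends_const|].
    apply (tends_cont (fun z => Cexp (- z)) (ray 1) l); [|assumption].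
    apply hol_ccontz, (hol_comp (fun z => - z)%C Cexp); [apply hol_opp, hol_id | apply hol_Cexp]. }
destruct (expE_primitive (fun x => 0 < x) (fun _ => True) (oint_gt 0) oint_True) as [F [HF EF]].
{ intros w [Hw _] ->; simpl in Hw; lra. }
intros e He.
set (kk := Cmod k + 1); assert (Hkk : 1 <= kk) by (unfold kk; pose proof (Cmod_ge_0 k); lra).
destruct (L1 (Rmin 1 (e / 4))) as [U1 H1]; [apply Rmin_pos; lra|].
destruct (hol_ccontz Cexp 0 (hol_Cexp 0) (Rmin 1 (e / (4 * kk)))) as [d [Dd Hd]].
{ apply Rmin_pos; [lra | apply Rdiv_lt_0_compat; lra]. }
exists (Rmax 1 (U1 + 1)), (d / 4); repeat split; [apply Rmax_l | lra|]; intros x y Hx Hy.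
pose proof (Rmax_l 1 (U1 + 1)); pose proof (Rmax_r 1 (U1 + 1)).
assert (Ex : expE (x, y) = (expE (1 + RtoC (x - 1)) * Cexp (F (x, 0) - F (x, y)))%C).
{ replace (1 + RtoC (x - 1))%C with ((x, 0) : C) by (Ceq; ring).
  symmetry; apply EF; split; simpl; trivial; lra. }
assert (D : Cmod (F (x, 0) - F (x, y)) <= 2 * exp (- x) * Cmod ((x, 0) - (x, y))).
{ apply lipschitz_segment; intros t Ht.
  - eexists; apply HF; split; [|trivial]; simpl; lra.
  - rewrite (cder_eq F _ (qE ((x, y) + RtoC t * ((x, 0) - (x, y)))%C)).
    2:{ apply HF; split; [|trivial]; simpl; lra. }
    set (w := ((x, y) + RtoC t * ((x, 0) - (x, y)))%C).
    assert (Rw : Re w = x) by (unfold w; simpl; ring).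
    assert (Mw : 1 <= Cmod w).
    { pose proof (re_le_Cmod w) as Q; rewrite Rw, Rabs_right in Q by lra; lra. }
    unfold qE; rewrite Cmod_div, Cmod_Cexp by (apply Cmod_gt_0; lra).
    replace (Re (- w)) with (- x) by (rewrite <- Rw; reflexivity).
    rewrite <- (Rmult_1_r (exp (- x))) at 2; apply Rmult_le_compat_l; [left; apply exp_pos|].
    rewrite <- Rinv_1; apply Rinv_le_contravar; lra. }
assert (Ey : Cmod ((x, 0) - (x, y)) <= Rabs y).
{ eapply Rle_trans; [apply Cmod_ge_components|].
  rewrite Rminus_diag, Rabs_R0, Rminus_0_l, Rabs_Ropp; lra. }
assert (Dl : Cmod (F (x, 0) - F (x, y) - 0) < d).
{ replace (F (x, 0) - F (x, y) - 0)%C with (F (x, 0) - F (x, y))%C by ring.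
  assert (2 * exp (- x) * Cmod ((x, 0) - (x, y)) <= 2 * exp (- x) * Rabs y).
  { apply Rmult_le_compat_l; [pose proof (exp_pos (- x)); lra | assumption]. }
  lra. }
specialize (Hd _ Dl); rewrite Cexp_0 in Hd.
specialize (H1 (x - 1) ltac:(lra)).
rewrite Ex; set (A := expE (1 + RtoC (x - 1))) in *; set (B := Cexp (F (x, 0) - F (x, y))) in *.
pose proof (Rmin_l 1 (e / 4)); pose proof (Rmin_r 1 (e / 4)).
pose proof (Rmin_l 1 (e / (4 * kk))); pose proof (Rmin_r 1 (e / (4 * kk))).
replace (A * B - k)%C with ((A - k) * (B - 1) + ((A - k) + k * (B - 1)))%C by ring.
eapply Rle_trans; [apply Cmod_triangle|].
eapply Rle_trans; [apply Rplus_le_compat_l, Cmod_triangle|].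
rewrite !Cmod_mult.
pose proof (Cmod_ge_0 (A - k)); pose proof (Cmod_ge_0 (B - 1)); pose proof (Cmod_ge_0 k).
assert (H10 : Cmod k * Cmod (B - 1) <= kk * (e / (4 * kk))).
{ apply Rmult_le_compat; try assumption; [unfold kk; lra | lra]. }
replace (kk * (e / (4 * kk))) with (e / 4) in H10 by (field; lra).
nra.
Qed.

Definition E1_const : C := proj1_sig (constructive_indefinite_description _ expE_limit).

Lemma E1_const_neq_0 : E1_const <> 0.
Proof. exact (proj1 (proj2_sig (constructive_indefinite_description _ expE_limit))). Qed.

Lemma E1_const_limit (e : R) : 0 < e -> exists U h, 1 <= U /\ 0 < h /\
  forall x y, U <= x -> Rabs y * exp (- x) <= h -> Cmod (expE (x, y) - E1_const) <= e.
Proof. exact (proj2 (proj2_sig (constructive_indefinite_description _ expE_limit)) e). Qed.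

(** Along the horizontal ray from [z], [expE] tends to [E1_const] while [ray] tends to [E1 z],
    and [expE_ray] relates the two. *)
Lemma exp_E1_off_cut (z : C) : ~ E1_cut z -> Cexp (Defs.E1 z) = (/ E1_const * expE z)%C.
Proof.
intros H.
destruct (ray_cauchy z H) as [K [HK BK]].
destruct (cauchy_ilim (ray z) K HK BK) as [l Hl].
rewrite (E1_ray z l H Hl).
assert (L : ilim (fun u => expE (z + RtoC u)) E1_const).
{ intros e He; destruct (E1_const_limit e He) as [U [h [HU [Hh B]]]].
  destruct (exp_opp_small (h / (1 + Rabs (Im z)))) as [V [HV BV]].
  { apply Rdiv_lt_0_compat; [assumption | pose proof (Rabs_pos (Im z)); lra]. }
  exists (Rmax U V - Re z); intros u Hu.
  pose proof (Rmax_l U V); pose proof (Rmax_r U V).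
  replace (z + RtoC u)%C with ((Re z + u, Im z) : C) by (destruct z; Ceq; ring).
  apply B; [lra|].
  specialize (BV (Re z + u) ltac:(lra)); pose proof (Rabs_pos (Im z)).
  apply Rle_trans with ((1 + Rabs (Im z)) * (h / (1 + Rabs (Im z)))); [|right; field; lra].
  apply Rmult_le_compat; try lra; left; apply exp_pos. }
assert (E : (E1_const * Cexp l)%C = expE z).
{ apply (tends_unique (fun u => expE (z + RtoC u) * Cexp (ray z u))%C).
  - apply tends_mult; [assumption|].
    apply (tends_cont Cexp (ray z) l); [apply hol_ccontz, hol_Cexp | assumption].
  - apply tends_ext_near with (fun _ => expE z); [|apply tends_const].
    exists 0; intros u Hu; symmetry; apply expE_ray; assumption. }
rewrite <- E; field; apply E1_const_neq_0.
Qed.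

(** On the cut the boundary value of [e^(E1 w)] is the value of the right-hand side, which is
    continuous there. *)
Lemma exp_E1_eq (z : C) : z <> 0 -> exp_E1 z = (/ E1_const * expE z)%C.
Proof.
intros N; unfold exp_E1; destruct (E1_cut_dec z) as [H | H]; [|apply exp_E1_off_cut, H].
assert (PF : ProperFilter' (within (fun w : C => ~ E1_cut w) (locally (T := C_UniformSpace) z))).
{ constructor; [|apply within_filter, locally_filter].
  intros [eps He].
  pose proof (cond_pos eps).
  apply (He ((Re z, Im z + eps / 2) : C)).
  - split.
    + change (Rabs (Re z - Re z) < eps); rewrite Rminus_diag, Rabs_R0; assumption.
    + change (Rabs (Im z + eps / 2 - Im z) < eps).
      replace (Im z + eps / 2 - Im z) with (eps / 2) by ring; rewrite Rabs_right; lra.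
  - destruct H as [H _]; intros [K _]; simpl in K; rewrite H in K; lra. }
apply (iota_filterlim_locally (V := C_CompleteNormedModule)
  (F := within (fun w : C => ~ E1_cut w) (locally (T := C_UniformSpace) z))).
assert (Hc : ccontz (fun z => / E1_const * expE z)%C z).
{ apply ccontz_mult; [apply ccontz_const|]; eapply is_cderiv_ccontz, is_cderiv_expE, N. }
intros P [eps HP].
destruct (Hc eps (cond_pos eps)) as [d [Dd Hd]].
unfold filtermap, within.
exists (mkposreal (d / 2) ltac:(lra)); intros w [Hw1 Hw2] Nw.
change (Rabs (Re w - Re z) < d / 2) in Hw1; change (Rabs (Im w - Im z) < d / 2) in Hw2.
rewrite (exp_E1_off_cut w Nw); apply HP.
assert (D : Cmod (w - z) < d).
{ eapply Rle_lt_trans; [apply Cmod_le_Re_Im|].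
  change (Rabs (Re w - Re z) + Rabs (Im w - Im z) < d); lra. }
specialize (Hd w D).
split; [eapply Rle_lt_trans; [apply (re_le_Cmod (/ E1_const * expE w - / E1_const * expE z)) | exact Hd]
      | eapply Rle_lt_trans; [apply (im_le_Cmod (/ E1_const * expE w - / E1_const * expE z)) | exact Hd]].
Qed.

(** * Convergence of the regularised product *)

(** The weight by which [log p] has to be multiplied to give [p^(-s)]; as a function of [x],
    the integrand of the expected value of the sum over primes. *)
Definition phi (s : C) (x : R) : C := (upow x s * RtoC (/ ln x))%C.
(** A primitive of [phi s], regular at [s = 1]: the singularity of the logarithmic
    integral at [s = 1] has been moved to the factor [s - 1] in [regularised_factor]. *)
Definition Jint (s : C) (x : R) : C := (RtoC (ln (ln x)) - Ein ((s - 1) * RtoC (ln x)))%C.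

Lemma ln_pos (x : R) : 1 < x -> 0 < ln x.
Proof. intros H; rewrite <- ln_1; apply ln_increasing; lra. Qed.

Lemma hol_Jint (s : C) (x : R) : hol (fun s => Jint s x) s.
Proof.
unfold Jint; apply hol_minus; [apply hol_const|].
apply (hol_comp (fun s => (s - 1) * RtoC (ln x))%C Ein); [|apply hol_Ein].
apply (hol_mult (fun s => s - 1)%C); [|apply hol_const].
apply hol_sub_const.
Qed.

Lemma hol_phi (s : C) (x : R) : hol (fun s => phi s x) s.
Proof. unfold phi; apply hol_mult; [apply hol_upow | apply hol_const]. Qed.

Lemma rder_Jint (s : C) (x : R) : 1 < x -> rder (Jint s) x (phi s x).
Proof.
intros Hx; pose proof (ln_pos x Hx) as Hl.
assert (D1 : rder (fun x => (s - 1) * RtoC (ln x))%C x ((s - 1) * RtoC (/ x))%C).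
{ assert (K : rder (fun x => (s - 1) * RtoC (ln x))%C x (0 * RtoC (ln x) + (s - 1) * RtoC (/ x))%C).
  { apply (rder_mult (fun _ => s - 1)%C (fun x => RtoC (ln x))); [apply rder_const|].
    apply rder_RtoC, is_derive_Reals, derivable_pt_lim_ln; lra. }
  replace (0 * RtoC (ln x) + (s - 1) * RtoC (/ x))%C with ((s - 1) * RtoC (/ x))%C in K by ring; exact K. }
set (w := ((s - 1) * RtoC (ln x))%C).
assert (K : rder (Jint s) x (RtoC (/ x * / ln x) + (- expm1_div (- w)) * ((s - 1) * RtoC (/ x)))%C).
{ apply (rder_plus (fun x => RtoC (ln (ln x))) (fun x => - Ein ((s - 1) * RtoC (ln x)))%C).
  - apply rder_RtoC; auto_derive; [split; [|split]; lra | field; lra].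
  - apply (rder_path (fun z => - Ein z)%C (fun x => (s - 1) * RtoC (ln x))%C); [|exact D1].
    apply is_cderiv_opp, is_cderiv_Ein. }
replace (phi s x) with (RtoC (/ x * / ln x) + (- expm1_div (- w)) * ((s - 1) * RtoC (/ x)))%C; [exact K|].
assert (Nl : RtoC (ln x) <> 0) by (apply RtoC_neq_0; lra).
assert (E : (expm1_div (- w) * (s - 1))%C = ((1 - Cexp (- w)) * RtoC (/ ln x))%C).
{ rewrite <- (expm1_div_opp w); unfold w; rewrite RtoC_inv by lra; field; assumption. }
transitivity (RtoC (/ x * / ln x) - (expm1_div (- w) * (s - 1)) * RtoC (/ x))%C; [ring|].
rewrite E; unfold phi.
assert (Eu : upow x s = (Cexp (- w) * RtoC (/ x))%C).
{ rewrite <- upow_one by lra; unfold upow, w; rewrite <- Cexp_plus; f_equal; ring. }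
rewrite Eu, RtoC_mult; ring.
Qed.

Lemma rder_phi (s : C) (x : R) : 1 < x ->
  rder (phi s) x (- s * upow x (s + 1) * RtoC (/ ln x) - upow x (s + 1) * RtoC (/ (ln x * ln x)))%C.
Proof.
intros Hx; pose proof (ln_pos x Hx) as Hl.
assert (K : rder (phi s) x (- s * upow x (s + 1) * RtoC (/ ln x) + upow x s * RtoC (- / x / (ln x * ln x)))%C).
{ apply (rder_mult (fun x => upow x s) (fun x => RtoC (/ ln x))); [apply rder_upow; lra|].
  apply rder_RtoC; auto_derive; [split; lra | field; lra]. }
match type of K with rder _ _ ?u => match goal with |- rder _ _ ?v => replace v with u end end; [exact K|].
rewrite upow_plus, upow_one by lra.
replace (- / x / (ln x * ln x)) with (- (/ x * / (ln x * ln x))) by (field; lra).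
rewrite RtoC_opp, RtoC_mult; ring.
Qed.

(** A constant with [|d phi / dx| <= phiK A x^(- Re s - 1)] for [x >= 2] and [|s| <= A]. *)
Definition phiK (A : R) : R := A * / ln 2 + / (ln 2 * ln 2).

Lemma ln2_pos : 0 < ln 2.
Proof. apply ln_pos; lra. Qed.

Lemma phiK_pos (A : R) : 0 <= A -> 0 < phiK A.
Proof.
intros HA; unfold phiK; pose proof ln2_pos.
assert (0 < / ln 2) by (apply Rinv_0_lt_compat; assumption).
assert (0 < / (ln 2 * ln 2)) by (apply Rinv_0_lt_compat, Rmult_lt_0_compat; assumption).
assert (0 <= A * / ln 2) by (apply Rmult_le_pos; lra); lra.
Qed.

Lemma phi_lipschitz (s : C) (A : R) (u v : R) : 2 <= u <= v -> 0 <= Re s -> Cmod s <= A ->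
  Cmod (phi s v - phi s u) <= 2 * (phiK A * Rpower u (- (Re s + 1))) * (v - u).
Proof.
intros Huv Hs HA; pose proof ln2_pos as L2.
eapply (lipschitz_path (phi s)); [lra | intros t Ht; apply rder_phi; lra|].
intros t Ht; cbv beta.
assert (Lt : ln 2 <= ln t) by (apply ln_le; lra).
assert (I1 : 0 < / ln t <= / ln 2) by (split; [apply Rinv_0_lt_compat; lra | apply Rinv_le_contravar; lra]).
assert (I2 : 0 < / (ln t * ln t) <= / (ln 2 * ln 2)).
{ split; [apply Rinv_0_lt_compat; nra | apply Rinv_le_contravar; nra]. }
eapply Rle_trans; [apply Cmod_triangle_minus|].
rewrite !Cmod_mult, Cmod_opp, !Cmod_R, !Rabs_right, Cmod_upow by lra.
replace (Re (s + 1)) with (Re s + 1) by reflexivity.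
assert (P : Rpower t (- (Re s + 1)) <= Rpower u (- (Re s + 1))) by (apply Rpower_le_neg; lra).
pose proof (Rpower_pos t (- (Re s + 1))) as P0; pose proof (Cmod_ge_0 s) as P1.
unfold phiK; rewrite Rmult_plus_distr_r; apply Rplus_le_compat.
- replace (A * / ln 2 * Rpower u (- (Re s + 1))) with (A * Rpower u (- (Re s + 1)) * / ln 2) by ring.
  apply Rmult_le_compat; try lra; [apply Rmult_le_pos; lra | apply Rmult_le_compat; lra].
- rewrite Rmult_comm; apply Rmult_le_compat; lra.
Qed.

Lemma Cmod_phi (s : C) (x : R) : 2 <= x -> Cmod (phi s x) <= / ln 2 * Rpower x (- Re s).
Proof.
intros Hx; pose proof ln2_pos; unfold phi.
assert (Lt : ln 2 <= ln x) by (apply ln_le; lra).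
assert (0 < / ln x <= / ln 2) by (split; [apply Rinv_0_lt_compat; lra | apply Rinv_le_contravar; lra]).
rewrite Cmod_mult, Cmod_upow, Cmod_R, Rabs_right, Rmult_comm by lra.
apply Rmult_le_compat_r; [left; apply exp_pos | lra].
Qed.

(** Comparison of the increment of [Jint s] over a unit interval with its derivative at
    the left end, by the Lipschitz bound for [phi s]. *)
Lemma Jint_step (s : C) (A u : R) : 2 <= u -> 0 <= Re s -> Cmod s <= A ->
  Cmod (Jint s (u + 1) - Jint s u - phi s u) <= 4 * (phiK A * Rpower u (- (Re s + 1))).
Proof.
intros Hu Hs HA.
assert (P0 : 0 < phiK A * Rpower u (- (Re s + 1))).
{ apply Rmult_lt_0_compat; [apply phiK_pos; pose proof (Cmod_ge_0 s); lra | apply exp_pos]. }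
assert (B : Cmod ((Jint s (u + 1) + RtoC (u + 1) * (- phi s u)) - (Jint s u + RtoC u * (- phi s u))) <=
  2 * (2 * (phiK A * Rpower u (- (Re s + 1)))) * (u + 1 - u)).
{ apply (lipschitz_path (fun x => Jint s x + RtoC x * (- phi s u))%C (fun x => phi s x - phi s u)%C); [lra | |].
  - intros t Ht.
    assert (K : rder (fun x => Jint s x + RtoC x * (- phi s u))%C t (phi s t + (1 * (- phi s u) + RtoC t * 0))%C).
    { apply (rder_plus (Jint s)); [apply rder_Jint; lra|].
      apply (rder_mult (fun x => RtoC x) (fun _ => - phi s u)%C); [|apply rder_const].
      apply (rder_RtoC (fun u => u)), (is_derive_id (K := R_AbsRing)). }
    replace (phi s t + (1 * (- phi s u) + RtoC t * 0))%C with (phi s t - phi s u)%C in K by ring; exact K.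
  - intros t Ht; eapply Rle_trans; [apply phi_lipschitz with (A := A); lra|]; nra. }
replace (Jint s (u + 1) - Jint s u - phi s u)%C with
 ((Jint s (u + 1) + RtoC (u + 1) * (- phi s u)) - (Jint s u + RtoC u * (- phi s u)))%C by (rewrite RtoC_plus; ring).
lra.
Qed.

(** Summation by parts of the prime sum against [theta n - n], with the integral and
    the boundary term removed. *)
Definition Ysum (s : C) (N : nat) : C :=
  (psum N s - Jint s (INR N) - RtoC (theta N - INR N) * phi s (INR N))%C.

(** The indices start at [2], as [phi s] is singular at [1]. *)
Definition ystep (n : nat) (s : C) : C := (Ysum s (S (S (S n))) - Ysum s (S (S n)))%C.

Lemma ppow_plog_phi (s : C) (n : nat) : ppow s n = (RtoC (plog n) * phi s (INR n))%C.
Proof.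
unfold ppow, plog, phi; destruct (isprime n) eqn:E; [|ring].
apply isprime_ge_2, le_INR in E; simpl in E.
assert (0 < ln (INR n)) by (apply ln_pos; lra).
transitivity (upow (INR n) s * RtoC (ln (INR n) * / ln (INR n)))%C; [|rewrite RtoC_mult; ring].
rewrite Rinv_r by lra; ring.
Qed.

Lemma ystep_eq (n : nat) (s : C) : let N := S (S n) in
  ystep n s = ((phi s (INR (S N)) - phi s (INR N)) - (Jint s (INR (S N)) - Jint s (INR N) - phi s (INR N))
    - RtoC (theta N - INR N) * (phi s (INR (S N)) - phi s (INR N)))%C.
Proof.
intros N; unfold ystep; fold N; unfold Ysum.
assert (E1 : psum (S N) s = (psum N s + RtoC (plog (S N)) * phi s (INR (S N)))%C).
{ rewrite <- ppow_plog_phi; reflexivity. }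
assert (E2 : theta (S N) - INR (S N) = (theta N - INR N) + (plog (S N) - 1)).
{ rewrite S_INR; change (theta (S N)) with (theta N + plog (S N)); ring. }
rewrite E1, E2, RtoC_plus, (RtoC_minus (plog (S N)) 1); ring.
Qed.

Lemma hol_ystep (n : nat) (s : C) : hol (ystep n) s.
Proof.
assert (HY : forall N, hol (fun s => Ysum s N) s).
{ intros N; unfold Ysum; apply (hol_minus (fun s => psum N s - Jint s (INR N))%C).
  - apply (hol_minus (psum N)); [|apply hol_Jint].
    unfold psum; apply (hol_csum (fun n s => ppow s n)); intros; apply hol_ppow.
  - apply (hol_mult (fun _ => RtoC (theta N - INR N))); [apply hol_const | apply hol_phi]. }
unfold ystep; apply (hol_minus (fun s => Ysum s (S (S (S n)))) (fun s => Ysum s (S (S n)))); apply HY.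
Qed.

Definition ymaj (K A a b : R) (n : nat) : R := (6 + 2 * K) * phiK A * zser (a + 1 - b) n.

(** The step consists of increments of [phi s], of order [n^(- Re s - 1)], of which one
    carries the factor [theta n - n = O(n^b)]. *)
Lemma ystep_bound (K A a b : R) (n : nat) (s : C) : 0 <= K -> 0 <= b < a ->
  (forall N, (1 <= N)%nat -> Rabs (theta N - INR N) <= K * Rpower (INR N) b) ->
  a <= Re s -> Cmod s <= A -> Cmod (ystep n s) <= ymaj K A a b n.
Proof.
intros HK Hab HT Hs HA; rewrite ystep_eq; set (N := S (S n)).
assert (HN : 2 <= INR N).
{ unfold N; rewrite !S_INR; pose proof (pos_INR n); lra. }
assert (EN : INR (S N) = INR N + 1) by apply S_INR.
specialize (HT N ltac:(unfold N; lia)).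
assert (B1 := phi_lipschitz s A (INR N) (INR N + 1) ltac:(lra) ltac:(lra) HA).
assert (B2 := Jint_step s A (INR N) ltac:(lra) ltac:(lra) HA).
replace (INR N + 1 - INR N) with 1 in B1 by ring.
rewrite EN; set (P := phiK A * Rpower (INR N) (- (Re s + 1))) in *.
assert (P0 : 0 < P).
{ apply Rmult_lt_0_compat; [apply phiK_pos; pose proof (Cmod_ge_0 s); lra | apply exp_pos]. }
eapply Rle_trans; [apply Cmod_triangle_minus|].
eapply Rle_trans; [apply Rplus_le_compat_r, Cmod_triangle_minus|].
rewrite Cmod_mult, Cmod_R.
assert (R1 : 1 <= Rpower (INR N) b).
{ rewrite <- (Rpower_O (INR N)) by lra; apply Rpower_le_exp; lra. }
assert (B3 : Rabs (theta N - INR N) * Cmod (phi s (INR N + 1) - phi s (INR N)) <= K * Rpower (INR N) b * (2 * P)).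
{ apply Rmult_le_compat; try apply Rabs_pos; try apply Cmod_ge_0; lra. }
apply Rle_trans with ((6 + 2 * K) * (P * Rpower (INR N) b)).
- assert (P <= P * Rpower (INR N) b) by nra. nra.
- unfold ymaj; rewrite Rmult_assoc; apply Rmult_le_compat_l; [lra|].
  unfold P; rewrite Rmult_assoc; apply Rmult_le_compat_l.
  + left; apply phiK_pos; pose proof (Cmod_ge_0 s); lra.
  + rewrite <- Rpower_plus; unfold zser.
    apply Rle_trans with (Rpower (INR N) (- (a + 1 - b))); [apply Rpower_le_exp; lra|].
    apply Rpower_le_neg; [|lra]; split; [apply lt_0_INR; lia | apply le_INR; unfold N; lia].
Qed.

Lemma Ysum_csum (s : C) (n : nat) : Ysum s (S (S n)) = (Ysum s 2 + csum (fun k => ystep k s) n)%C.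
Proof. induction n as [|n IH]; cbn [csum]; [ring | rewrite Cplus_assoc, <- IH; unfold ystep; ring]. Qed.

Definition gstep (n : nat) (s : C) : C := (Gprod (S n) s - Gprod n s)%C.

(** A step is a bounded product times [gfac - 1 = O(n^(- 2 a))]. *)
Lemma gstep_bound (a : R) (n : nat) (s : C) : 1 / 2 < a <= Re s ->
  Cmod (gstep n s) <= exp (Series (sqmaj 96 a)) * sqmaj 96 a n.
Proof.
intros Ha; unfold gstep.
replace (Gprod (S n) s) with (Gprod n s * gfac (ppow s (S n)))%C by reflexivity.
replace (Gprod n s * gfac (ppow s (S n)) - Gprod n s)%C with (Gprod n s * (gfac (ppow s (S n)) - 1))%C by ring.
rewrite Cmod_mult; apply Rmult_le_compat; try apply Cmod_ge_0; [apply Gprod_upper; assumption|].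
eapply Rle_trans; [apply gfac_bound, ppow_small; lra|].
unfold sqmaj; apply Rmult_le_compat_l; [lra|].
eapply Rle_trans; [apply (ppow_sq_bound s a (S n)); lra|].
apply Rmult_le_compat_l; [left; apply exp_pos|].
apply Rpower_le_neg; [|lra]; split; [apply lt_0_INR; lia | apply le_INR; lia].
Qed.

Lemma hol_Gprod (n : nat) (s : C) : 1 / 2 <= Re s -> hol (Gprod n) s.
Proof.
intros Hs; unfold Gprod; induction (S n) as [|m IH]; cbn [cprod]; [apply hol_const|].
apply (hol_mult (fun s => cprod (fun n => gfac (ppow s n)) m) (fun s => gfac (ppow s m))); [exact IH|].
unfold gfac; apply (hol_div (fun s => Cexp (- ppow s m)) (fun s => 1 - ppow s m)%C).
- apply ppow_1_neq, Hs.
- apply (hol_comp (fun s => - ppow s m)%C Cexp); [apply (hol_opp (fun s => ppow s m)), hol_ppow | apply hol_Cexp].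
- apply hol_minus; [apply hol_const | apply hol_ppow].
Qed.

Lemma Gprod_csum (s : C) (n : nat) : Gprod n s = (Gprod 0 s + csum (fun k => gstep k s) n)%C.
Proof. induction n as [|n IH]; cbn [csum]; [ring | rewrite Cplus_assoc, <- IH; unfold gstep; ring]. Qed.

Definition Ylim (s : C) : C := (Ysum s 2 + cser (fun k => ystep k s))%C.
Definition Glim (s : C) : C := (Gprod 0 s + cser (fun k => gstep k s))%C.

(** The limit of [(s - 1) e^(E1((s-1) log N))] times the product over primes up to [N]. *)
Definition Llim (s : C) : C := (/ E1_const * (Cexp (Ylim s) * Glim s))%C.

(** The exponents satisfy [1/2 < b < a < Re s]: [b] for the error of [theta], [a] for a
    neighbourhood of [s] on which the series is majorised by that of [n^(- (1 + a - b))]. *)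
Lemma Ylim_spec (zeta : C -> C) (s : C) : is_riemann_zeta zeta -> riemann_hypothesis zeta -> 1 / 2 < Re s ->
  hol Ylim s /\ clim (Ysum s) (Ylim s) /\ clim (fun N => RtoC (theta N - INR N) * phi s (INR N))%C 0.
Proof.
intros HZ RH Hs.
set (b := (1 / 2 + (1 / 2 + Re s) / 2) / 2); set (a := (1 / 2 + Re s) / 2).
assert (Hab : 1 / 2 < b /\ b < a /\ a < Re s) by (unfold a, b; lra).
destruct (theta_bound zeta b HZ RH ltac:(lra)) as [K [HK HT]].
set (A := Cmod s + 2 * (Re s - a)).
assert (X : ex_series (ymaj K A a b)) by (apply (ex_series_scal (V := R_NormedModule)), ex_zser; lra).
assert (B : forall n z, sq s (Re s - a) z -> Cmod (ystep n z) <= ymaj K A a b n).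
{ intros n z Hz; pose proof (sq_Re _ _ _ Hz); pose proof (sq_Cmod _ _ _ Hz).
  apply ystep_bound; try assumption; lra. }
assert (Hc : sq s (Re s - a) s) by (apply sq_center; lra).
repeat split.
- unfold Ylim; apply (hol_plus (fun s => Ysum s 2)).
  + unfold Ysum; apply (hol_minus (fun s => psum 2 s - Jint s (INR 2))%C).
    * apply (hol_minus (psum 2)); [|apply hol_Jint].
      unfold psum; apply (hol_csum (fun n s => ppow s n)); intros; apply hol_ppow.
    * apply (hol_mult (fun _ => RtoC (theta 2 - INR 2))); [apply hol_const | apply hol_phi].
  + apply (Mtest_hol ystep (ymaj K A a b) s (Re s - a)); try assumption; [lra | intros; apply hol_ystep].
- intros e He.
  destruct (cser_clim (fun n => ystep n s) (ymaj K A a b) (fun n => B n s Hc) X e He) as [N HN].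
  exists (S (S N)); intros [|[|n]] Hn; try lia.
  rewrite Ysum_csum; unfold Ylim.
  replace (Ysum s 2 + csum (fun k => ystep k s) n - (Ysum s 2 + cser (fun k => ystep k s)))%C with
    (csum (fun k => ystep k s) n - cser (fun k => ystep k s))%C by ring.
  apply HN; lia.
- intros e He.
  assert (L := Rpower_lim_0 (Re s - b) ltac:(lra)).
  pose proof ln2_pos as L2.
  assert (Kp : 0 < K * / ln 2) by (apply Rmult_lt_0_compat; [assumption | apply Rinv_0_lt_compat, L2]).
  apply is_lim_seq_spec in L.
  destruct (L (mkposreal (e / (K * / ln 2)) (Rdiv_lt_0_compat _ _ He Kp))) as [M HM].
  exists (S (S M)); intros [|n] Hn; [lia|].
  specialize (HM n ltac:(lia)); simpl pos in HM; rewrite Rminus_0_r, Rabs_right in HM by (left; apply exp_pos).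
  assert (N2 : 2 <= INR (S n)) by (apply (le_INR 2); lia).
  replace (RtoC (theta (S n) - INR (S n)) * phi s (INR (S n)) - 0)%C with
    (RtoC (theta (S n) - INR (S n)) * phi s (INR (S n)))%C by ring.
  rewrite Cmod_mult, Cmod_R.
  specialize (HT (S n) ltac:(lia)); pose proof (Cmod_phi s (INR (S n)) N2) as PH.
  apply Rle_trans with ((K * Rpower (INR (S n)) b) * (/ ln 2 * Rpower (INR (S n)) (- Re s))).
  + apply Rmult_le_compat; try apply Rabs_pos; try apply Cmod_ge_0; assumption.
  + replace (K * Rpower (INR (S n)) b * (/ ln 2 * Rpower (INR (S n)) (- Re s))) with
     (K * / ln 2 * (Rpower (INR (S n)) b * Rpower (INR (S n)) (- Re s))) by ring.
    rewrite <- Rpower_plus; replace (b + - Re s) with (- (Re s - b)) by ring.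
    apply Rle_trans with (K * / ln 2 * (e / (K * / ln 2))); [apply Rmult_le_compat_l; lra | right; field; split; lra].
Qed.

Lemma Glim_spec (s : C) : 1 / 2 < Re s -> hol Glim s /\ clim (fun N => Gprod N s) (Glim s).
Proof.
intros Hs; set (a := (1 / 2 + Re s) / 2); assert (Ha : 1 / 2 < a < Re s) by (unfold a; lra).
set (m := fun n => exp (Series (sqmaj 96 a)) * sqmaj 96 a n).
assert (X : ex_series m) by (apply (ex_series_scal (V := R_NormedModule)), ex_sqmaj; lra).
assert (B : forall n z, sq s (Re s - a) z -> Cmod (gstep n z) <= m n).
{ intros n z Hz; apply sq_Re in Hz; apply gstep_bound; lra. }
split.
- unfold Glim; apply (hol_plus (Gprod 0)); [apply hol_Gprod; lra|].
  apply (Mtest_hol gstep m s (Re s - a)); try assumption; [lra | | apply sq_center; lra].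
  intros n z Hz; apply sq_Re in Hz; apply (hol_minus (Gprod (S n)) (Gprod n)); apply hol_Gprod; lra.
- apply tends_ext with (fun n => Gprod 0 s + csum (fun k => gstep k s) n)%C.
  { intros n; rewrite <- Gprod_csum; reflexivity. }
  apply tends_plus; [apply tends_const|].
  apply cser_clim with m; [|assumption]; intros n; apply B, sq_center; lra.
Qed.

Lemma Llim_clim (zeta : C -> C) (s : C) : is_riemann_zeta zeta -> riemann_hypothesis zeta -> 1 / 2 < Re s ->
  clim (fun N => / E1_const * (Cexp (- Jint s (INR N)) * eulerN N s))%C (Llim s).
Proof.
intros HZ RH Hs.
destruct (Ylim_spec zeta s HZ RH Hs) as [_ [Y1 Y2]]; destruct (Glim_spec s Hs) as [_ G1].
apply tends_ext with (fun N => / E1_const * (Cexp (Ysum s N + RtoC (theta N - INR N) * phi s (INR N)) * Gprod N s))%C.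
{ intros N; rewrite eulerN_split by lra.
  replace (Ysum s N + RtoC (theta N - INR N) * phi s (INR N))%C with (- Jint s (INR N) + psum N s)%C by (unfold Ysum; ring).
  rewrite Cexp_plus; ring. }
unfold Llim; apply tends_scal, tends_mult; [|assumption].
apply (tends_cont Cexp); [apply hol_ccontz, hol_Cexp|].
replace (Ylim s) with (Ylim s + 0)%C by ring; apply tends_plus; assumption.
Qed.

(** The regularising factor, cleared of its singularity at [s = 1]. *)
Lemma regularised_factor (s : C) (x : R) : 1 < x -> s <> 1 ->
  ((s - 1) * exp_E1 ((s - 1) * RtoC (ln x)))%C = (/ E1_const * Cexp (- Jint s x))%C.
Proof.
intros Hx Ns; pose proof (ln_pos x Hx) as Hl.
assert (N1 : (s - 1)%C <> 0) by (apply Cminus_neq_0, Ns).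
assert (Nl : RtoC (ln x) <> 0) by (apply RtoC_neq_0; lra).
rewrite exp_E1_eq by (apply Cmult_neq_0; assumption); unfold expE, Jint.
replace (- (RtoC (ln (ln x)) - Ein ((s - 1) * RtoC (ln x))))%C with
  (Ein ((s - 1) * RtoC (ln x)) + RtoC (- ln (ln x)))%C by (rewrite RtoC_opp; ring).
rewrite Cexp_plus, Cexp_RtoC, exp_Ropp, exp_ln, RtoC_inv by lra.
field; repeat split; try assumption; apply E1_const_neq_0.
Qed.

Lemma power_exp_small (c h B : R) : 0 < c -> 0 < h -> 0 <= B ->
  exists U, 0 <= U /\ forall l, U <= l -> B * l * exp (- (c * l)) <= h.
Proof.
intros Hc Hh HB.
destruct (exp_opp_small (h / (2 * (B + 1) / c))) as [U [HU HS]].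
{ apply Rdiv_lt_0_compat; [assumption|]; apply Rdiv_lt_0_compat; lra. }
exists (2 * U / c); split.
{ apply Rmult_le_pos; [lra | left; apply Rinv_0_lt_compat, Hc]. }
intros l Hl.
assert (Hl0 : U <= c * l / 2).
{ apply Rmult_le_reg_r with (2 / c); [apply Rdiv_lt_0_compat; lra|].
  replace (c * l / 2 * (2 / c)) with l by (field; lra).
  replace (U * (2 / c)) with (2 * U / c) by (field; lra); assumption. }
assert (L0 : 0 <= l) by nra.
specialize (HS (c * l / 2) Hl0).
assert (E : exp (- (c * l)) = exp (- (c * l / 2)) * exp (- (c * l / 2))) by (rewrite <- exp_plus; f_equal; field).
assert (K : l * exp (- (c * l / 2)) <= 2 / c).
{ pose proof (exp_ineq1_le (c * l / 2)) as Q; pose proof (exp_pos (c * l / 2)).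
  rewrite exp_Ropp; apply Rmult_le_reg_r with (exp (c * l / 2)); [assumption|].
  rewrite Rmult_assoc, Rinv_l, Rmult_1_r by lra.
  apply Rle_trans with (2 / c * (c * l / 2)); [right; field; lra|].
  apply Rmult_le_compat_l; [left; apply Rdiv_lt_0_compat; lra | lra]. }
rewrite E; pose proof (exp_pos (- (c * l / 2))) as P.
replace (B * l * (exp (- (c * l / 2)) * exp (- (c * l / 2)))) with
  ((B * (l * exp (- (c * l / 2)))) * exp (- (c * l / 2))) by ring.
apply Rle_trans with ((2 * (B + 1) / c) * (h / (2 * (B + 1) / c))); [|right; field; lra].
apply Rmult_le_compat; try lra.
- apply Rmult_le_pos; [assumption|]; apply Rmult_le_pos; lra.
- replace (2 * (B + 1) / c) with ((B + 1) * (2 / c)) by (field; lra).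
  apply Rmult_le_compat; try lra; apply Rmult_le_pos; lra.
Qed.

(** The point [(s - 1) log N] moves to infinity on a ray through the origin in the right
    half-plane, where [expE] tends to [E1_const], and the Euler product converges. *)
Lemma Llim_right (zeta : C -> C) (s : C) : is_riemann_zeta zeta -> riemann_hypothesis zeta -> 1 < Re s ->
  Llim s = Hzeta s.
Proof.
intros HZ RH Hs.
assert (Ns : s <> 1) by (intros ->; simpl in Hs; lra).
apply (tends_unique (F := eventually) _ _ _ (Llim_clim zeta s HZ RH ltac:(lra))).
rewrite (Hzeta_right zeta s HZ Hs).
replace ((s - 1) * zeta s)%C with ((s - 1) * ((/ E1_const * E1_const) * zeta s))%C
  by (field; apply E1_const_neq_0).
assert (K : clim (fun N => (s - 1) * ((/ E1_const * expE ((s - 1) * RtoC (ln (INR N)))) * eulerN N s))%C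
   ((s - 1) * ((/ E1_const * E1_const) * zeta s))%C).
{ apply tends_scal, tends_mult.
  - apply tends_scal; intros e He.
    destruct (E1_const_limit e He) as [U [h [HU [Hh B]]]].
    destruct (power_exp_small (Re s - 1) h (Rabs (Im s)) ltac:(lra) Hh (Rabs_pos _)) as [V [HV BV]].
    set (W := Rmax (U / (Re s - 1)) V).
    destruct (nfloor_ex (exp W)) as [M HM]; [left; apply exp_pos|].
    exists (S M); intros N HN.
    assert (HL : W <= ln (INR N)).
    { rewrite <- (ln_exp W); apply ln_le; [apply exp_pos|].
      apply le_INR in HN; rewrite S_INR in HN; lra. }
    pose proof (Rmax_l (U / (Re s - 1)) V) as W1; pose proof (Rmax_r (U / (Re s - 1)) V) as W2; fold W in W1, W2.
    set (l := ln (INR N)) in *.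
    replace ((s - 1) * RtoC l)%C with (((Re s - 1) * l, Im s * l) : C)
      by (destruct s; Ceq; unfold Re, Im; simpl; ring).
    apply B.
    + apply Rle_trans with ((Re s - 1) * (U / (Re s - 1))); [right; field; lra | apply Rmult_le_compat_l; lra].
    + rewrite Rabs_mult, (Rabs_right l) by lra; apply BV; lra.
  - intros e He; destruct (eulerN_uniform zeta (Re s) HZ Hs e He) as [N HN].
    exists N; intros n Hn; apply HN; [assumption | lra]. }
intros e He; destruct (K e He) as [N HN]; exists (S (S N)); intros n Hn; specialize (HN n ltac:(lia)).
assert (N2 : 2 <= INR n) by (apply (le_INR 2); lia).
rewrite Cmult_assoc, <- regularised_factor, exp_E1_eq by
  (first [assumption | lra | apply Cmult_neq_0; [apply Cminus_neq_0, Ns | apply RtoC_neq_0, Rgt_not_eq, ln_pos; lra]]).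
rewrite <- Cmult_assoc; exact HN.
Qed.

Lemma hol_Llim (zeta : C -> C) (s : C) : is_riemann_zeta zeta -> riemann_hypothesis zeta -> 1 / 2 < Re s ->
  hol Llim s.
Proof.
intros HZ RH Hs.
unfold Llim; apply (hol_mult (fun _ => / E1_const)%C); [apply hol_const|].
apply hol_mult; [|apply Glim_spec, Hs].
apply (hol_comp Ylim Cexp); [apply (Ylim_spec zeta s HZ RH Hs) | apply hol_Cexp].
Qed.

(** The identity theorem along the horizontal segment from [2 + i Im s] to [s]. *)
Lemma Llim_eq (zeta : C -> C) (s : C) : is_riemann_zeta zeta -> riemann_hypothesis zeta -> 1 / 2 < Re s ->
  Llim s = Hzeta s.
Proof.
intros HZ RH Hs.
set (D := fun z => (Llim z - Hzeta z)%C).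
assert (E : D s = 0).
{ apply (identity_segment D (2, Im s)).
  - intros t Ht; set (p := ((2, Im s) + RtoC t * (s - (2, Im s)))%C).
    assert (Ep : Re p = 2 + t * (Re s - 2)) by (unfold p; simpl; unfold Re, Im; simpl; ring).
    assert (Pp : 1 / 2 < Re p).
    { rewrite Ep; assert (0 <= t * (Re s - 1 / 2)) by (apply Rmult_le_pos; lra).
      destruct (Req_dec t 1) as [-> | Nt]; lra. }
    exists (Re p - 1 / 2); split; [lra|]; intros w Hw; apply sq_Re in Hw.
    apply hol_minus; [apply (hol_Llim zeta); try assumption; lra | apply hol_Hzeta; lra].
  - exists 1; split; [lra|]; intros z Hz; apply disc_sq, sq_Re in Hz; change (Re (2, Im s)) with 2 in Hz.
    unfold D; rewrite (Llim_right zeta z HZ RH) by lra; ring. }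
unfold D in E; rewrite <- (Cplus_0_l (Hzeta s)), <- E; ring.
Qed.

Lemma euler_product_eulerN (s : C) (x : R) : euler_product s x = eulerN (Z.to_nat (Int_part x)) s.
Proof.
unfold euler_product, primes_upto, eulerN.
set (N := Z.to_nat (Int_part x)).
assert (K : forall n, fold_right Cmult (RtoC 1) (map (fun p : nat => / (1 - / nat_cpow p s))%C
   (filter (fun p : nat => if prime_dec (Z.of_nat p) then true else false) (seq 0 n))) =
   cprod (fun n => / (1 - ppow s n))%C n).
{ induction n as [|n IH]; [reflexivity|].
  rewrite seq_S, filter_app, map_app; cbn [cprod].
  assert (FA : forall (l m : list C), fold_right Cmult (RtoC 1) (l ++ m) =
    (fold_right Cmult (RtoC 1) l * fold_right Cmult (RtoC 1) m)%C).
  { induction l as [|c l IHl]; intros m; simpl; [ring | rewrite IHl; ring]. }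
  rewrite FA, IH; f_equal; simpl.
  unfold ppow, isprime; destruct (prime_dec (Z.of_nat n)); simpl.
  - rewrite nat_cpow_inv; ring.
  - field. }
apply K.
Qed.

(** Between consecutive integers the Euler product is constant and [Jint s] moves by at
    most the supremum of [|phi s|]. *)
Lemma Jint_floor (s : C) (N : nat) (x : R) : (2 <= N)%nat -> 0 <= Re s -> INR N <= x <= INR N + 1 ->
  Cmod (Jint s x - Jint s (INR N)) <= 2 * (/ ln 2 * Rpower (INR N) (- Re s)).
Proof.
intros HN Hs Hx; assert (N2 : 2 <= INR N) by (apply (le_INR 2), HN).
assert (P : 0 < / ln 2 * Rpower (INR N) (- Re s)).
{ apply Rmult_lt_0_compat; [apply Rinv_0_lt_compat, ln2_pos | apply exp_pos]. }
eapply Rle_trans; [apply (lipschitz_path (Jint s) (phi s) (INR N) x (/ ln 2 * Rpower (INR N) (- Re s)))|].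
- lra.
- intros t Ht; apply rder_Jint; lra.
- intros t Ht; eapply Rle_trans; [apply Cmod_phi; lra|].
  apply Rmult_le_compat_l; [left; apply Rinv_0_lt_compat, ln2_pos | apply Rpower_le_neg; lra].
- nra.
Qed.

Theorem theorem1 (zeta : C -> C) (Hzeta : is_riemann_zeta zeta)
  (RH : riemann_hypothesis zeta) (s : C) (Hs : 1 / 2 < Re s)
  (Hs1 : s <> RtoC 1) :
  filterlim
    (fun x : R => (exp_E1 ((s - 1) * RtoC (ln x)) * euler_product s x)%C)
    (Rbar_locally p_infty)
    (locally (T := C_UniformSpace) (zeta s)).
Proof.
assert (N1 : (s - 1)%C <> 0) by (apply Cminus_neq_0, Hs1).
set (F := fun N => (/ E1_const * (Cexp (- Jint s (INR N)) * eulerN N s))%C).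
assert (L0 := Llim_clim zeta s Hzeta RH Hs); fold F in L0.
rewrite (Llim_eq zeta s Hzeta RH Hs), (Hzeta_eq zeta s Hzeta) in L0 by (lra || assumption).
(* The factor by which the value at real [x] differs from that at the integer below. *)
set (dl := fun (N : nat) (x : R) => Cexp (Jint s (INR N) - Jint s x)).
intros P [eps HP].
pose proof (cond_pos eps) as He.
assert (M0 : 0 < Cmod (s - 1)) by (apply Cmod_gt_0, N1).
set (e := eps / 2 * Cmod (s - 1)).
assert (E0 : 0 < e) by (apply Rmult_lt_0_compat; lra).
set (Z := ((s - 1) * zeta s)%C) in *.
set (e2 := Rmin 1 (e / (2 * (1 + Cmod Z)))).
pose proof (Cmod_ge_0 Z) as Z0.
assert (E2 : 0 < e2) by (apply Rmin_pos; [lra | apply Rdiv_lt_0_compat; lra]).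
destruct (L0 (e / 4) ltac:(lra)) as [A HA].
destruct (hol_ccontz Cexp 0 (hol_Cexp 0) e2 E2) as [d [Dd Hd]]; rewrite Cexp_0 in Hd.
assert (LR := Rpower_lim_0 (Re s) ltac:(lra)); apply is_lim_seq_spec in LR.
pose proof ln2_pos as L2.
destruct (LR (mkposreal (d * ln 2 / 4) ltac:(apply Rdiv_lt_0_compat; [apply Rmult_lt_0_compat; assumption | lra]))) as [B HB].
exists (INR (A + B + 3)); intros x Hx; apply HP.
set (N := Z.to_nat (Int_part x)).
assert (HN : INR N <= x <= INR N + 1).
{ destruct (base_Int_part x) as [I1 I2].
  assert (0 <= Int_part x)%Z.
  { apply le_IZR; pose proof (pos_INR (A + B + 3)).
    assert (IZR (-1) < IZR (Int_part x)) by (simpl; lra).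
    apply lt_IZR in H0; apply IZR_le; lia. }
  unfold N; rewrite INR_IZR_INZ, Z2Nat.id by assumption; lra. }
assert (HNA : (A + B + 3 <= N)%nat).
{ assert (A + B + 3 < S N)%nat; [|lia]; apply INR_lt; rewrite S_INR; lra. }
assert (EQ : (exp_E1 ((s - 1) * RtoC (ln x)) * euler_product s x)%C = (/ (s - 1) * (F N * dl N x))%C).
{ assert (X1 : 1 < x) by (pose proof (le_INR 3 _ (Nat.le_trans _ _ _ (Nat.le_add_l 3 (A + B)) HNA)) as Q; simpl in Q; lra).
  transitivity (/ (s - 1) * (((s - 1) * exp_E1 ((s - 1) * RtoC (ln x))) * euler_product s x))%C; [field; assumption|].
  rewrite regularised_factor, euler_product_eulerN by assumption; fold N; f_equal; unfold F, dl.
  replace (- Jint s x)%C with (- Jint s (INR N) + (Jint s (INR N) - Jint s x))%C by ring.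
  rewrite Cexp_plus; ring. }
assert (D1 : Cmod (dl N x - 1) < e2).
{ apply Hd; replace (Jint s (INR N) - Jint s x - 0)%C with (Jint s (INR N) - Jint s x)%C by ring.
  rewrite Cmod_minus_sym.
  eapply Rle_lt_trans; [apply Jint_floor; [lia | lra | assumption]|].
  destruct N as [|n]; [lia|]; specialize (HB n ltac:(lia)); simpl pos in HB.
  rewrite Rminus_0_r, Rabs_right in HB by (left; apply exp_pos).
  apply Rlt_trans with (2 * (/ ln 2 * (d * ln 2 / 4))).
  - apply Rmult_lt_compat_l; [lra|]; apply Rmult_lt_compat_l; [apply Rinv_0_lt_compat, L2 | exact HB].
  - replace (2 * (/ ln 2 * (d * ln 2 / 4))) with (d / 2) by (field; lra); lra. }
specialize (HA N ltac:(lia)).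
assert (D2 : Cmod (F N * dl N x - Z) <= e).
{ pose proof (Rmin_l 1 (e / (2 * (1 + Cmod Z)))) as M1; pose proof (Rmin_r 1 (e / (2 * (1 + Cmod Z)))) as M2.
  fold e2 in M1, M2.
  replace (F N * dl N x - Z)%C with ((F N - Z) * (dl N x - 1) + ((F N - Z) + Z * (dl N x - 1)))%C by ring.
  eapply Rle_trans; [apply Cmod_triangle|].
  eapply Rle_trans; [apply Rplus_le_compat_l, Cmod_triangle|].
  rewrite !Cmod_mult.
  pose proof (Cmod_ge_0 (F N - Z)); pose proof (Cmod_ge_0 (dl N x - 1)).
  assert (Q : Cmod Z * Cmod (dl N x - 1) <= (1 + Cmod Z) * (e / (2 * (1 + Cmod Z)))) by (apply Rmult_le_compat; lra).
  replace ((1 + Cmod Z) * (e / (2 * (1 + Cmod Z)))) with (e / 2) in Q by (field; lra).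
  nra. }
assert (D3 : Cmod (exp_E1 ((s - 1) * RtoC (ln x)) * euler_product s x - zeta s) < eps).
{ rewrite EQ; replace (/ (s - 1) * (F N * dl N x) - zeta s)%C with ((F N * dl N x - Z) / (s - 1))%C
    by (unfold Z; field; assumption).
  rewrite Cmod_div by assumption.
  apply Rle_lt_trans with (e / Cmod (s - 1)).
  - apply Rmult_le_compat_r; [left; apply Rinv_0_lt_compat, M0 | assumption].
  - unfold e; replace (eps / 2 * Cmod (s - 1) / Cmod (s - 1)) with (eps / 2) by (field; lra); lra. }
split; (eapply Rle_lt_trans; [|exact D3]);
[apply (re_le_Cmod (_ - _)) | apply (im_le_Cmod (_ - _))].
Qed.
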